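(* Let $(W,S)$ be an irreducible Fuchsian Coxeter system, $(\Delta,\delta)$ a thick regular Fuchsian building of type $(W,S)$ with base chamber $o$, and $(X_n)_{n\ge0}$ an irreducible isotropic random walk on $\Delta$ with $X_0=o$, bounded range, and $p(x,y)>0$ whenever $\delta(x,y)\in S$. Let $\overline X_n=\delta(o,X_n)$ be the retracted walk on $W$, with Green function $\overline G$, and let $\ell_G(w)=-\log\frac{\overline G(e,w)}{\overline G(e,e)}$ for $w\in W$. Let $\mathbf e_k$ ($k\ge0$) be the last entry times, $\nu$ the stationary probability measure of the Markov chain $(\mathbf W_k)_{k\ge1}$, and $H(\mathbf Y)$ the asymptotic entropy of the process $(\mathbf Y_k)_{k\ge 0}$, all as defined in the context. Then $$\frac{\ell_G(\overline X_n)}{n}\xrightarrow{\;n\to\infty\;}\frac{H(\mathbf Y)}{\mathbb E_\nu[\mathbf e_2-\mathbf e_1]}=:h_G>0\qquad\text{almost surely.}$$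
   Context: Fuchsian Coxeter system: $S=\{s_1,\dots,s_N\}$, $N\ge3$, with integers $k_1,\dots,k_N\ge2$, $\sum_i 1/k_i<N-2$, such that $W$ is generated by $S$ subject to $s_i^2=e$ and $(s_is_{i+1})^{k_i}=e$ (indices cyclic), with no relation between other pairs. $\ell$ is word length, $d(u,v)=\ell(u^{-1}v)$, $\mathcal B_n(u)=\{v\mid d(u,v)\le n\}$. Building: a nonempty set $\Delta$ with $\delta:\Delta\times\Delta\to W$ such that: (B1) $\delta(x,y)=e$ iff $x=y$; (B2) if $\delta(x,y)=w$, $\delta(y,z)=s\in S$, then $\delta(x,z)\in\{w,ws\}$, and $\delta(x,z)=ws$ if $\ell(ws)=\ell(w)+1$; (B3) if $\delta(x,y)=w$, $s\in S$, there is $z$ with $\delta(y,z)=s$, $\delta(x,z)=ws$. Regular: $q_s=|\{y\mid\delta(x,y)=s\}|$ is finite and independent of $x$; thick: $q_s\ge2$ for all $s\in S$. Walks: isotropic means that $p(x,y)$ depends only on $\delta(x,y)$. Bounded range: $L_0$ is the minimal integer such that $p(x,y)>0$ implies $\ell(\delta(x,y))\le L_0$. $\overline X_n$ is a Markov chain on $W$ started at $e$ with $\overline p(u,v)=\sum_{y:\delta(o,y)=v}p(x,y)$ for any $x$ with $\delta(o,x)=u$; $\overline G(u,v)=\sum_{n\ge0}\overline p^{(n)}(u,v)$. Automatic structure and cones: a strongly automatic structure for $(W,S)$ is a finite directed graph $\mathfrak A$ with distinguished vertex $s_*$ and edge labels in $S$ such that no edge ends at $s_*$, every other vertex is reachable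 from $s_*$, the label word of every finite path from $s_*$ is a geodesic (reduced) word in $W$, and mapping a path from $s_*$ to the product of its labels is a bijection from finite paths starting at $s_*$ onto $W$. Let $\gamma_w$ be the path representing $w$. The cone $C(w)$ is the set of $u\in W$ such that $\gamma_w$ is a prefix of $\gamma_u$; the cone type $T(w)$ is the end vertex of $\gamma_w$, identified with the set $w^{-1}C(w)$, which depends only on this vertex. A cone type is recurrent if there is a nontrivial directed path in $\mathfrak A$ from it to itself; $\mathfrak A_R$ is the set of recurrent cone types. Fix such an $\mathfrak A$ (in the paper: obtained from the automaton of cone types of $(W,S)$ by a lexicographic choice), with the properties that any recurrent type can be reached from any other inside $\mathfrak A_R$, and that there is $K\in\mathbb N$ such that all elements of $W\setminus\mathcal B_K(e)$ have recurrent cone type. For $A\subseteq W$ and $L\geq 1$: $\partial_LA=\{u\in A\mid\exists v\in W\setminus A: d(u,v)\le L\}$ and $\mathrm{Int}_LA=A\setminus\partial_LA$. Constant $L_1$: let $\delta_{hyp}$ be a constant such that geodesic triangles in the Cayley graph of $(W,S)$ are $\delta_{hyp}$-thin, and let $\mathrm{div}:\mathbb N_0\to\mathbb R$ be an exponential divergence function: if $\gamma_1,\gamma_2$ are geodesics starting at $u$, $R+r$ is at most both their lengths and $d(\gamma_1(R),\gamma_2(R))\ge\mathrm{div}(0)$, then every path from $\gamma_1(R+r)$ to $\gamma_2(R+r)$ visiting only vertices outside $\mathcal B_{R+r}(u)$ has length at least $\mathrm{div}(r)$. Put $L_1=\max\{\mathrm{div}(0),L_0,\delta_{hyp}\}+1$.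 Coverings: for each $\mathbf T\in\mathfrak A_R$ fix a set $\mathrm{Cov}(\mathbf T)=\{u_1,u_2,\dots\}\subset W$ such that for all $w$ with $T(w)=\mathbf T$: $wu_i\in\mathrm{Int}_{3L_1}C(w)$; $C(wu_i)\subseteq\mathrm{Int}_{L_1}C(w)$; the cones $C(wu_i)$ are pairwise disjoint; $\{T(wu_i)\mid i\ge1\}=\mathfrak A_R$; $C(w)\setminus\bigcup_iC(wu_i)\subset\partial_{3L_1}C(w)\cup\mathcal B_L(w)$ for some constant $L=L(\mathbf T)$; $|\mathrm{Cov}(\mathbf T)\cap\mathcal B_n(e)|$ grows linearly in $n$. Put $\mathrm{Cov}(w)=w\,\mathrm{Cov}(T(w))$, $\mathrm{Cov}_0=\bigcup_{w\in\mathcal B_{K+1}(e)\setminus\mathcal B_K(e)}\mathrm{Cov}(w)$, $\mathrm{Cov}_{n+1}=\bigcup_{w\in\mathrm{Cov}_n}\mathrm{Cov}(w)$. Last entry times: for $k\ge0$, $\mathbf e_k=\inf\{m\mid\exists w\in\mathrm{Cov}_k:\overline X_m\in\mathrm{Int}_{3L_1}C(w),\ \forall n\ge m:\overline X_n\in\mathrm{Int}_{L_1}C(w)\}$ (almost surely finite), and $\mathcal R_k$ is the $w\in\mathrm{Cov}_k$ with $\overline X_{\mathbf e_k}\in C(w)$. For $k\ge1$ let $\mathbf W_k=(T(\mathcal R_k),\mathcal R_{k-1}^{-1}\mathcal R_k,\mathcal R_k^{-1}\overline X_{\mathbf e_k})$. On the set of its attainable values, $(\mathbf W_k)_{k\ge1}$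 is an irreducible positive recurrent time-homogeneous Markov chain; $\nu$ is its stationary probability measure. $\mathbb E_\nu$ is expectation when the law of $\mathbf W_1$ is replaced by $\nu$, i.e. $\mathbb E_\nu[\mathbf e_2-\mathbf e_1]=\sum_{\mathfrak w}\nu(\mathfrak w)\,\mathbb E[\mathbf e_{k+1}-\mathbf e_k\mid\mathbf W_k=\mathfrak w]$ with any $k\ge1$ such that $\mathbb P[\mathbf W_k=\mathfrak w]>0$ (the conditional expectation does not depend on $k$). Entropy $H(\mathbf Y)$: $\mathbf Y_0=\mathcal R_0$ and $\mathbf Y_k=(T(\mathcal R_{k-1}),T(\mathcal R_k),\mathcal R_{k-1}^{-1}\mathcal R_k)$ for $k\ge1$. $H(\mathbf Y)\in[0,\infty]$ is the constant such that $-\frac1n\log\mathbb P[\mathbf Y_0=\mathfrak y_0,\dots,\mathbf Y_n=\mathfrak y_n]\to H(\mathbf Y)$ for almost every realisation $(\mathfrak y_0,\mathfrak y_1,\dots)$ of the process (it exists by the Shannon–McMillan–Breiman theorem). *)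

(* Defs.v *)
From HB Require Import structures.
From mathcomp Require Import all_boot all_order all_algebra finmap.
From mathcomp Require Import monoid.
From mathcomp Require Import all_classical all_reals all_analysis.

Set Implicit Arguments.
Unset Strict Implicit.
Unset Printing Implicit Defensive.

Import Order.TTheory GRing.Theory Num.Theory.
Import numFieldNormedType.Exports.

Local Open Scope classical_set_scope.
Local Open Scope ring_scope.

(* The value 0 is returned when A is empty. *)
Definition least (A : set nat) : nat :=
  xget 0%N [set n | A n /\ forall m, A m -> (n <= m)%N].

Section Coxeter.
Variables (N : nat) (k : 'I_N -> nat) (W : groupType) (s : 'I_N -> W).

Definition word (r : seq 'I_N) : W := (\big[*%g/1%g]_(i <- r) s i)%g.

(* The congruence on words generated by the relators s_i s_i and
   (s_i s_{i+1})^{k_i}; ordS is the cyclic successor. Since the generators are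
   involutions, words without formal inverses suffice. *)
Inductive cox_congr : seq 'I_N -> seq 'I_N -> Prop :=
| cox_refl u : cox_congr u u
| cox_sym u v : cox_congr u v -> cox_congr v u
| cox_trans u v w : cox_congr u v -> cox_congr v w -> cox_congr u w
| cox_square u v i : cox_congr (u ++ [:: i; i] ++ v) (u ++ v)
| cox_rotation u v i :
    cox_congr (u ++ flatten (nseq (k i) [:: i; ordS i]) ++ v) (u ++ v).

Record fuchsian_coxeter_system : Prop := {
  fuchs_rank : (3 <= N)%N;
  fuchs_exp_ge2 : forall i, (2 <= k i)%N;
  fuchs_hyperbolic : \sum_i ((k i)%:R^-1 : rat) < N%:R - 2%:R;
  fuchs_generated : forall w : W, exists r, word r = w;
  fuchs_presented : forall r r', word r = word r' <-> cox_congr r r' }.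

Definition irreducible_coxeter : Prop :=
  ~ exists J : {set 'I_N}, [/\ J != finset.set0, J != [set: 'I_N]%SET &
      forall i j, i \in J -> j \notin J -> commute (s i) (s j)].

Definition len (w : W) : nat :=
  least [set n | exists r, size r = n /\ word r = w].

Definition dist (u v : W) : nat := len (u^-1 * v)%g.

Definition cball (n : nat) (u : W) : set W := [set v | (dist u v <= n)%N].

End Coxeter.

Section CayleyGeometry.
Variables (R : realType) (N : nat) (W : groupType) (s : 'I_N -> W).

Definition bdry (L : R) (A : set W) : set W :=
  [set u | A u /\ exists2 v, ~ A v & (dist s u v)%:R <= L].

Definition inner (L : R) (A : set W) : set W := A `\` bdry L A.

(* g restricted to {0, ..., n} is a geodesic of the Cayley graph. *)
Definition geodesic (n : nat) (g : nat -> W) : Prop :=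
  forall i j, (i <= j <= n)%N -> dist s (g i) (g j) = (j - i)%N.

(* The cyclic symmetry of the hypotheses yields the condition for all three
   sides. *)
Definition thin_triangles (dhyp : R) : Prop :=
  forall (n1 n2 n3 : nat) (g1 g2 g3 : nat -> W),
    geodesic n1 g1 -> geodesic n2 g2 -> geodesic n3 g3 ->
    g1 n1 = g2 0%N -> g2 n2 = g3 0%N -> g3 n3 = g1 0%N ->
    forall i, (i <= n1)%N ->
      (exists2 j, (j <= n2)%N & (dist s (g1 i) (g2 j))%:R <= dhyp) \/
      (exists2 j, (j <= n3)%N & (dist s (g1 i) (g3 j))%:R <= dhyp).

(* The end points of the path c lie on the sphere of radius r1 + r2 around u,
   hence only its intermediate vertices can avoid the closed ball. *)
Definition divergence_function (div : nat -> R) : Prop :=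
  forall (n1 n2 : nat) (g1 g2 : nat -> W) (r1 r2 : nat),
    geodesic n1 g1 -> geodesic n2 g2 -> g1 0%N = g2 0%N ->
    (r1 + r2 <= n1)%N -> (r1 + r2 <= n2)%N ->
    div 0%N <= (dist s (g1 r1) (g2 r1))%:R ->
    forall (m : nat) (c : nat -> W),
      c 0%N = g1 (r1 + r2)%N -> c m = g2 (r1 + r2)%N ->
      (forall j, (j < m)%N -> dist s (c j) (c j.+1) = 1%N) ->
      (forall j, (0 < j < m)%N -> ~ cball s (r1 + r2)%N (g1 0%N) (c j)) ->
      div r2 <= m%:R.

Definition exponential_growth (div : nat -> R) : Prop :=
  exists a c : R, [/\ 1 < a, 0 < c & \forall r \near \oo, c * a ^+ r <= div r].

End CayleyGeometry.

Section Buildings.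
Variables (N : nat) (W : groupType) (s : 'I_N -> W).
Variables (Delta : choiceType) (delta : Delta -> Delta -> W).

Record building : Prop := {
  building_eq : forall x y, delta x y = 1%g <-> x = y;
  building_step : forall x y z i, delta y z = s i ->
    (delta x z = delta x y \/ delta x z = (delta x y * s i)%g) /\
    (len s (delta x y * s i)%g = (len s (delta x y)).+1 ->
     delta x z = (delta x y * s i)%g);
  building_ext : forall x y i,
    exists z, delta y z = s i /\ delta x z = (delta x y * s i)%g }.

Definition regular_building (q : 'I_N -> nat) : Prop :=
  forall i x, ([set y | delta x y = s i] #= `I_(q i))%card.

Definition thick (q : 'I_N -> nat) : Prop := forall i, (2 <= q i)%N.

End Buildings.

Section Chains.
Variables (R : realType) (T : choiceType).

Definition stochastic (p : T -> T -> R) : Prop :=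
  (forall x y, 0 <= p x y) /\
  forall x, (\esum_(y in setT) (p x y)%:E)%E = 1%E.

Fixpoint kpow (p : T -> T -> R) (n : nat) (x y : T) : \bar R :=
  if n is m.+1 then (\esum_(z in setT) ((p x z)%:E * kpow p m z y))%E
  else ((x == y)%:R)%:E.

Definition irreducible_kernel (p : T -> T -> R) : Prop :=
  forall x y, exists n, (0 < kpow p n x y)%E.

Definition green (p : T -> T -> R) (x y : T) : \bar R :=
  (\sum_(0 <= n <oo) kpow p n x y)%E.

Definition markov_chain (d : measure_display) (Omega : measurableType d)
    (P : probability Omega R) (p : T -> T -> R) (o : T)
    (X : nat -> Omega -> T) : Prop :=
  (forall n x, measurable (X n @^-1` [set x])) /\
  forall (n : nat) (x : nat -> T),
    P [set a | forall i, (i <= n)%N -> X i a = x i] =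
    ((x 0%N == o)%:R * \prod_(i < n) p (x i) (x i.+1))%:E.

End Chains.

Section IsotropicWalks.
Variables (R : realType) (N : nat) (W : groupType) (s : 'I_N -> W).
Variables (Delta : choiceType) (delta : Delta -> Delta -> W).
Variable p : Delta -> Delta -> R.

Definition isotropic : Prop :=
  forall x y x' y', delta x y = delta x' y' -> p x y = p x' y'.

Definition range_bound (L : nat) : Prop :=
  forall x y, 0 < p x y -> (len s (delta x y) <= L)%N.

Definition walk_range (L0 : nat) : Prop :=
  range_bound L0 /\ forall L, range_bound L -> (L0 <= L)%N.

(* By isotropy the choice of x with delta o x = u is immaterial. *)
Definition retracted_kernel (o : Delta) (u v : W) : R :=
  let x := xget o [set x | delta o x = u] in
  fine (\esum_(y in [set y | delta o y = v]) (p x y)%:E).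

Definition green_length (o : Delta) (w : W) : R :=
  let G := green (retracted_kernel o) in
  - ln (fine (G 1%g w) / fine (G 1%g 1%g)).

End IsotropicWalks.

Record labelled_graph (N : nat) := LabelledGraph {
  vertex : finType;
  edge : finType;
  src : edge -> vertex;
  tgt : edge -> vertex;
  lab : edge -> 'I_N;
  start : vertex }.

Section Automaton.
Variables (N : nat) (W : groupType) (s : 'I_N -> W) (A : labelled_graph N).

Fixpoint is_path (v : vertex A) (r : seq (edge A)) : bool :=
  if r is e :: r' then (src e == v) && is_path (tgt e) r' else true.

Definition path_end (v : vertex A) (r : seq (edge A)) : vertex A :=
  last v (map (@tgt N A) r).

Definition path_value (r : seq (edge A)) : W := word s (map (@lab N A) r).

Record strongly_automatic : Prop := {
  aut_source : forall e, tgt e != start A;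
  aut_reach : forall v, v != start A ->
    exists r, is_path (start A) r /\ path_end (start A) r = v;
  aut_geodesic : forall r, is_path (start A) r ->
    size r = len s (path_value r);
  aut_bijective :
    set_bij [set r | is_path (start A) r] [set: W] path_value }.

Definition gamma (w : W) : seq (edge A) :=
  xget [::] [set r | is_path (start A) r /\ path_value r = w].

Definition cone (w : W) : set W := [set u | prefix (gamma w) (gamma u)].

Definition cone_type (w : W) : vertex A := path_end (start A) (gamma w).

Definition recurrent (v : vertex A) : Prop :=
  exists r, [/\ r != [::], is_path v r & path_end v r = v].

Definition recurrent_transitive : Prop :=
  forall v v', recurrent v -> recurrent v' ->
    exists r, [/\ is_path v r, path_end v r = v' &
      forall e, e \in r -> recurrent (tgt e)].

Definition recurrent_outside (K : nat) : Prop :=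
  forall w, ~ cball s K 1%g w -> recurrent (cone_type w).

End Automaton.

Section Coverings.
Variables (R : realType) (N : nat) (W : groupType) (s : 'I_N -> W).
Variables (A : labelled_graph N) (L1 : R).

Local Notation C := (cone s A).
Local Notation T := (cone_type s A).

Definition linear_growth (U : set W) : Prop :=
  exists a b : R, 0 < a /\
    \forall n \near \oo,
      a * n%:R <= #|` fset_set (U `&` cball s n 1%g)|%:R <= b * n%:R.

Record covering (t : vertex A) (U : set W) : Prop := {
  cov_inner : forall w u, T w = t -> U u -> inner s (3%:R * L1) (C w) (w * u)%g;
  cov_cone : forall w u, T w = t -> U u -> C (w * u)%g `<=` inner s L1 (C w);
  cov_disjoint : forall w, T w = t -> trivIset U (fun u => C (w * u)%g);
  cov_types : forall w, T w = t ->
    [set T (w * u)%g | u in U] = [set t' | recurrent t'];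
  cov_exhaust : exists L : nat, forall w, T w = t ->
    C w `\` \bigcup_(u in U) C (w * u)%g
      `<=` bdry s (3%:R * L1) (C w) `|` cball s L w;
  cov_linear : linear_growth U }.

Variables (Cov : vertex A -> set W) (K : nat).

Definition covw (w : W) : set W := [set (w * u)%g | u in Cov (T w)].

Fixpoint cov_level (k : nat) : set W :=
  if k is k'.+1 then \bigcup_(w in cov_level k') covw w
  else \bigcup_(w in cball s K.+1 1%g `\` cball s K 1%g) covw w.

(* The quantities below are functions of a trajectory x; the default values
   taken when no entry time exists only matter on a null event. *)
Variable x : nat -> W.

Definition last_entry (k : nat) : nat :=
  least [set m | exists2 w, cov_level k w &
    inner s (3%:R * L1) (C w) (x m) /\
    forall n, (m <= n)%N -> inner s L1 (C w) (x n)].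

Definition entry_cone (k : nat) : W :=
  xget 1%g [set w | cov_level k w /\ C w (x (last_entry k))].

Definition procW (k : nat) : vertex A * W * W :=
  (T (entry_cone k),
   ((entry_cone k.-1)^-1 * entry_cone k)%g,
   ((entry_cone k)^-1 * x (last_entry k))%g).

Definition procY (k : nat) : W + vertex A * vertex A * W :=
  if k is k'.+1 then
    inr (T (entry_cone k'), T (entry_cone k),
         ((entry_cone k')^-1 * entry_cone k)%g)
  else inl (entry_cone 0).

End Coverings.

Section Processes.
Variables (R : realType) (d : measure_display) (Omega : measurableType d).
Variables (P : probability Omega R) (T : choiceType) (Z : nat -> Omega -> T).

Definition attainable : set T :=
  [set t | exists2 k, (1 <= k)%N & (0 < P (Z k @^-1` [set t]))%E].

(* For a time-homogeneous Markov chain the conditional quantities below do not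
   depend on the time chosen here. *)
Definition some_time (t : T) : nat :=
  xget 1%N [set k | (1 <= k)%N /\ (0 < P (Z k @^-1` [set t]))%E].

Definition transition (t t' : T) : \bar R :=
  let k := some_time t in
  (P (Z k @^-1` [set t] `&` Z k.+1 @^-1` [set t']) / P (Z k @^-1` [set t]))%E.

Record stationary_distribution (nu : T -> R) : Prop := {
  stat_ge0 : forall t, 0 <= nu t;
  stat_support : forall t, ~ attainable t -> nu t = 0;
  stat_mass : (\esum_(t in attainable) (nu t)%:E)%E = 1%E;
  stat_invariant : forall t', attainable t' ->
    (nu t')%:E = (\esum_(t in attainable) ((nu t)%:E * transition t t'))%E }.

(* E_nu[e_2 - e_1], computed as the nu-average of the conditional expectations
   of e_{k+1} - e_k given Z_k = t. *)
Definition stationary_increment (nu : T -> R) (e : nat -> Omega -> nat)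
    : \bar R :=
  (\esum_(t in attainable) ((nu t)%:E *
    let k := some_time t in
    (\int[P]_(a in Z k @^-1` [set t]) ((e k.+1 a)%:R - (e k a)%:R)%:E)
      / P (Z k @^-1` [set t])))%E.

Definition path_entropy (H : \bar R) : Prop :=
  {ae P, forall a,
    (- (n%:R^-1 *
        ln (fine (P [set b | forall i, (i <= n)%N -> Z i b = Z i a]))))%:E
      @[n --> \oo] --> H}.

End Processes.

(* Submission.v *)
From HB Require Import structures.
Require Import Defs.
From mathcomp Require Import all_boot all_order all_algebra.
From mathcomp Require Import monoid.
From mathcomp Require Import all_classical all_reals all_analysis.
From mathcomp Require Import measurable_realfun lebesgue_integral.
From mathcomp Require Import zify ring lra.

Set Implicit Arguments.
Unset Strict Implicit.
Unset Printing Implicit Defensive.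

Import Order.TTheory GRing.Theory Num.Theory.
Import numFieldNormedType.Exports.

Local Open Scope classical_set_scope.
Local Open Scope ring_scope.

(** The retraction turns the walk into a Markov chain on W whose step law at u depends only on
    the relative word lengths in the ball of radius L_0 around u, so it is the same at
    corresponding points deep inside cones of the same type. Thickness gives the chain a
    spectral gap, so it is transient with positive speed, and the exponential divergence forces
    it to settle in a cone once it visits a deep subcone infinitely often. The entry cones R_k
    and entry times e_k then form a renewal structure: given R_k and the point of entry, the
    future is the chain conditioned to stay in the cone. Hence the W_k are a Markov chain to
    which an ergodic theorem applies, and e_k / k converges to the mean increment.

     The probability a_k of the first k entry cones is that of R_k alone. At the times when W_k
    equals a fixed state, -log a_k agrees with the Green length of X_(e_k) up to o(k): the Green
    function at the entry point dominates the probability of entering there, and is dominated by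
    P(R_k) up to a constant because from that point the walk may make a bounded detour and enter
    the cone last. These times have positive frequency, and the Green length is Lipschitz, so
    its growth rate is H / E_nu[e_2 - e_1]. The entropy is positive because a detour into a
    sibling cone gives a_(k-1) >= a_k + c P(R_k, W_k = w0), and the expectations of the ratios
    of these probabilities average to the positive frequency of the state w0. *)

(** * Path spaces and measure-theoretic preliminaries *)

(** The entry times look into the future, so the strong Markov property does not apply to them. The
    substitute is a factorisation: the event that a cone is entered for good at time m is an event
    of the path up to m intersected with the event that the shifted path stays in the interior of
    the cone, and the second factor depends only on the cone type and the relative position. All
    later arguments are tied to one state of W_k, given by a type [t], a covering element [u] and a
    path [r], which can be reached from every point along a path of bounded length. This single
    construction yields that all entry times are finite, that the chain returns to a fixed state,
    that the mean increment is finite, and that the Green function can be compared with entry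
    probabilities. The laws of large numbers are one-sided bounds up to an additive constant
    depending on the path; they come from a maximal inequality that tolerates infinite means, and
    finiteness of the mean increment is deduced only afterwards. *)

Section Countable.
Context d (R : realType) (X : measurableType d).
Variables (I : choiceType) (cI : countable [set: I]).

Lemma measurable_exists (F : I -> set X) :
  (forall i, measurable (F i)) -> measurable [set x | exists i, F i x].
Proof.
move=> mF; have -> : [set x | exists i, F i x] = \bigcup_i F i.
  by apply/seteqP; split=> x /= [i]; [exists i|move=> _; exists i].
exact: countable_bigcupT_measurable.
Qed.

Lemma measurable_forall (F : I -> set X) :
  (forall i, measurable (F i)) -> measurable [set x | forall i, F i x].
Proof.
move=> mF; have -> : [set x | forall i, F i x] =
    ~` [set x | exists i, (~` F i) x].
  apply/seteqP; split=> x /= => [h [i]|h i]; first exact.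
  by apply: contrapT => hi; apply: h; exists i.
by apply: measurableC; apply: measurable_exists => i; exact: measurableC.
Qed.

(** The pieces are first numbered by an injection of the countable index type into the natural
    numbers; numbers outside its range give empty pieces. *)
Lemma measure_partition (mu : {measure set X -> \bar R}) (f : X -> I)
    (A : set X) :
  (forall i, measurable (f @^-1` [set i])) -> measurable A ->
  mu A = (\esum_(i in [set: I]) mu (A `&` f @^-1` [set i]))%E.
Proof.
move=> mf mA.
have /countable_injP[g injg] := cI.
pose F k := A `&` [set x | g (f x) = k].
have FE i : F (g i) = A `&` f @^-1` [set i].
  apply/seteqP; split=> x [Ax /= gx]; split => //=; last by rewrite gx.
  by apply: injg gx; rewrite inE.
have F0 k : ~ (g @` [set: I]) k -> F k = set0.
  move=> nk; apply/seteqP; split=> x //= [_ gx]; apply: nk.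
  by exists (f x).
have mF k : measurable (F k).
  have [[i _ <-]|/F0 ->//] := pselect ((g @` [set: I]) k).
  by rewrite FE; exact: measurableI.
have tF : trivIset setT F.
  by move=> i j _ _ [x [[_ /= <-] [_ /= <-]]].
have AE : A = \bigcup_k F k.
  apply/seteqP; split=> [x Ax|x [k _ []]//].
  by exists (g (f x)).
rewrite [in LHS]AE measure_bigcup// nneseries_esum// set_mem_set.
rewrite [LHS](_ : _ = (\esum_(k in g @` [set: I]) mu (F k))%E); last first.
  rewrite [RHS]esum_mkcond esum_mkcond; apply: eq_esum => k _.
  rewrite (@mem_set _ [set: nat])//.
  have [kr|nk] := pselect ((g @` [set: I]) k); first by rewrite mem_set.
  by rewrite memNset// F0// measure0.
rewrite esum_image; first by apply: eq_esum => i _; rewrite FE.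
by move=> i j _ _; apply: injg; rewrite inE.
Qed.

End Countable.

Lemma countable_surj (I : countType) (T : Type) (f : I -> T) :
  (forall t, exists i, f i = t) -> countable [set: T].
Proof.
move=> fs; have -> : [set: T] = f @` [set: I].
  by apply/seteqP; split=> // t _; have [i <-] := fs t; exists i.
exact: sub_countable (card_image_le _ _) (countableP _).
Qed.

Lemma countable_prodT (T U : Type) : countable [set: T] ->
  countable [set: U] -> countable [set: T * U].
Proof. by move=> cT cU; rewrite -setXTT; exact: countableX. Qed.

Lemma countable_seqT (T : Type) :
  countable [set: T] -> countable [set: seq T].
Proof.
move=> cT; pose V n := [set s : seq T | size s = n].
have -> : [set: seq T] = \bigcup_n V n.
  by apply/seteqP; split=> // s _; exists (size s).
apply: bigcup_countable => // n _; elim: n => [|n IH].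
  rewrite (_ : V 0%N = [set [::]])//; apply/seteqP.
  by split=> [[]|s ->].
have -> : V n.+1 = (fun z => z.1 :: z.2) @` ([set: T] `*` V n).
  apply/seteqP; split=> [[|x s]//= [sn]|_ [[x s] [_ /= sn] <-]].
    by exists (x, s).
  by rewrite /V/= sn.
apply: sub_countable (card_image_le _ _) _; exact: countableX.
Qed.

(* The point [t] only serves to make the type of paths pointed. *)
Definition path_from (T : choiceType) (t : T) : Type := nat -> T.

Section PathType.
Variables (T : choiceType) (t : T).

HB.instance Definition _ := gen_eqMixin (path_from t).
HB.instance Definition _ := gen_choiceMixin (path_from t).
HB.instance Definition _ := isPointed.Build (path_from t) (fun=> t).

Definition cyl (n : nat) (x : nat -> T) : set (path_from t) :=
  [set y | forall i, (i <= n)%N -> y i = x i].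

(** The whole space and the empty set are included to make the family stable under intersection, as
    the uniqueness theorem for measures requires. *)
Definition cyls : set (set (path_from t)) :=
  [set A | A = setT \/ A = set0 \/ exists n x, A = cyl n x].

Definition path_space := g_sigma_algebraType cyls.

End PathType.

Definition shift (T : Type) (n : nat) (x : nat -> T) : nat -> T :=
  fun i => x (n + i)%N.

Lemma shiftD (T : Type) m n (x : nat -> T) :
  shift n (shift m x) = shift (m + n) x.
Proof. by apply/funext => i; rewrite /shift addnA. Qed.

Section PathSpace.
Variables (T : choiceType) (t : T) (cT : countable [set: T]).
Local Notation PS := (path_space t).

Lemma measurable_cyl n x : measurable (@cyl T t n x : set PS).
Proof. by apply: sub_sigma_algebra; right; right; exists n, x. Qed.

Lemma cyls_setI : setI_closed (@cyls T t).
Proof.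
move=> A B [->|[->|[n [x ->]]]]; first by rewrite setTI.
  by move=> _; rewrite set0I; right; left.
move=> [->|[->|[m [y ->]]]].
- by rewrite setIT; right; right; exists n, x.
- by rewrite setI0; right; left.
wlog nm : n m x y / (n <= m)%N.
  move=> H; case: (leqP n m) => [|/ltnW]; first exact: H.
  by rewrite setIC; exact: H.
have [xy|xy] := pselect (forall i, (i <= n)%N -> x i = y i).
- right; right; exists m, y; apply/seteqP; split=> z /=; first by case.
  by move=> zy; split=> // i ni; rewrite xy// zy// (leq_trans ni).
- right; left; apply/seteqP; split=> // z [/= zx zy]; apply: xy => i ni.
  by rewrite -zx// zy// (leq_trans ni).
Qed.

Lemma path_measure_unique (R : realType) (m1 m2 : {measure set PS -> \bar R}) :
  (m1 setT < +oo)%E -> m1 setT = m2 setT ->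
  (forall n x, m1 (@cyl T t n x) = m2 (@cyl T t n x)) ->
  forall A, measurable A -> m1 A = m2 A.
Proof.
move=> fin mT m12 A mA.
apply: (@g_sigma_algebra_measure_unique _ R PS (@cyls T t) _ (fun=> setT)) => //.
- by move=> B cB; exact: sub_sigma_algebra.
- by move=> _; left.
- by rewrite bigcup_const//; exists 0%N.
- exact: cyls_setI.
- by move=> B [->|[->|[n [x ->]]]] //; rewrite !measure0.
Qed.

Definition hist n (x : nat -> T) : seq T := mkseq x n.+1.

Lemma hist_eqP n x y :
  hist n x = hist n y <-> forall i, (i <= n)%N -> x i = y i.
Proof.
split=> [h i ni|h].
  have := congr1 (fun s => nth t s i) h.
  by rewrite /hist !nth_mkseq.
by apply/eq_in_map => i; rewrite mem_iota => /andP[_]; rewrite add0n ltnS; exact: h.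
Qed.

Lemma hist_preimage n (h : seq T) : size h = n.+1 ->
  [set x : PS | hist n x = h] = cyl n (nth t h).
Proof.
move=> sh; have hE : h = hist n (nth t h).
  apply: (@eq_from_nth _ t); rewrite ?size_mkseq// sh => i ih.
  by rewrite nth_mkseq.
by rewrite [in LHS]hE; apply/seteqP; split=> x /= /hist_eqP.
Qed.

Lemma measurable_hist n (Q : set (seq T)) : measurable [set x : PS | Q (hist n x)].
Proof.
have -> : [set x : PS | Q (hist n x)] =
    [set x | exists h, (Q h /\ hist n x = h)].
  apply/seteqP; split=> [x /= q|x /= [h [q e]]]; first by exists (hist n x).
  by rewrite e.
apply: measurable_exists; first exact: countable_seqT.
move=> h.
have [Qh|Qh] := pselect (Q h); last first.
  by rewrite (_ : (fun _ => _) = set0)//; apply/seteqP; split=> // x [].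
rewrite (_ : (fun _ => _) = [set x : PS | hist n x = h]); last first.
  by apply/seteqP; split=> x //= [].
have [sh|sh] := eqVneq (size h) n.+1.
  by rewrite hist_preimage//; exact: measurable_cyl.
rewrite (_ : [set x | _] = set0)//; apply/seteqP; split=> // x /= hx.
by move: sh; rewrite -hx size_mkseq eqxx.
Qed.

(** With [T] countable there are only countably many histories up to time n, so such a set is a
    countable union of cylinders. *)
Lemma measurable_coords n (Q : set (nat -> T)) :
  (forall x y, (forall i, (i <= n)%N -> x i = y i) -> Q x -> Q y) ->
  measurable (Q : set PS).
Proof.
move=> QE; have -> : (Q : set PS) = [set x : PS | (Q \o (fun h => nth t h)) (hist n x)].
  apply/seteqP; split=> x /=; apply: QE => i ni; by rewrite nth_mkseq.
exact: measurable_hist.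
Qed.

Lemma measurable_coord n (Q : set T) : measurable [set x : PS | Q (x n)].
Proof. by apply: (@measurable_coords n) => x y /= <-. Qed.

Lemma measurable_to_paths d (X : measurableType d) (f : X -> PS) :
  (forall n a, measurable ((fun x => f x n) @^-1` [set a])) ->
  measurable_fun setT f.
Proof.
move=> mf; apply: (@measurability _ _ _ _ setT f (@cyls T t)) => //.
move=> _ [A [->|[->|[n [x ->]]]] <-]; rewrite setTI ?preimage_setT ?preimage_set0//.
have -> : f @^-1` cyl n x =
    [set a | forall i, ((i <= n)%N -> f a i = x i)] by [].
apply: measurable_forall; first exact: countableP.
move=> i; have [ni|ni] := boolP (i <= n)%N; last first.
  by rewrite (_ : (fun _ => _) = setT)//; apply/seteqP; split.
rewrite (_ : (fun _ => _) = (fun y => f y i) @^-1` [set x i])//.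
by apply/seteqP; split=> y //=; exact.
Qed.

Lemma measurable_shift n : measurable_fun setT (shift n : PS -> PS).
Proof. by apply: measurable_to_paths => i a; exact: (measurable_coord (n + i) [set a]). Qed.

Lemma measurable_shift_preimage n (A : set PS) :
  measurable A -> measurable (shift n @^-1` A : set PS).
Proof. by move=> mA; rewrite -[_ @^-1` _]setTI; apply: measurable_shift. Qed.

End PathSpace.

(** * Word length in Coxeter systems *)

Lemma least_spec (A : set nat) n : A n ->
  A (least A) /\ forall m, A m -> (least A <= m)%N.
Proof.
move=> An; rewrite /least; case: xgetP => [m -> //|/(_ _) nA].
exfalso; have [m [Am minm]] : exists m, A m /\ forall j, A j -> (m <= j)%N.
  elim/ltn_ind: n An => n IH An.
  have [[j Aj jn]|h] := pselect (exists2 j, A j & (j < n)%N); first exact: IH Aj.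
  exists n; split=> // j Aj; rewrite leqNgt; apply/negP => jn; apply: h.
  by exists j.
exact: (nA m).
Qed.

Section CoxeterBasics.
Variables (N : nat) (k : 'I_N -> nat) (W : groupType) (s : 'I_N -> W).
Hypothesis hW : fuchsian_coxeter_system k s.
Local Notation word := (word s).
Local Notation len := (len s).
Local Notation dist := (dist s).
Local Open Scope group_scope.

Lemma word_nil : word [::] = 1. Proof. by rewrite /Defs.word big_nil. Qed.

Lemma word_cons i r : word (i :: r) = s i * word r.
Proof. by rewrite /Defs.word big_cons. Qed.

Lemma word_cat r r' : word (r ++ r') = word r * word r'.
Proof.
by elim: r => [|i r IH] /=; rewrite ?word_nil ?mul1g// !word_cons IH mulgA.
Qed.

Lemma word_seq1 i : word [:: i] = s i.
Proof. by rewrite word_cons word_nil mulg1. Qed.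

Lemma word_rcons r i : word (rcons r i) = word r * s i.
Proof. by rewrite -cats1 word_cat word_seq1. Qed.

Lemma len_spec w : exists2 r, size r = len w & word r = w.
Proof.
have [r rw] := fuchs_generated hW w.
have [[r' [sr' r'w]] _] := @least_spec [set n | exists r, size r = n /\ word r = w]
  (size r) (ex_intro _ r (conj erefl rw)).
by exists r'.
Qed.

Lemma len_word r : (len (word r) <= size r)%N.
Proof.
by have [_] := @least_spec [set n | exists r', size r' = n /\ word r' = word r]
  (size r) (ex_intro _ r (conj erefl erefl)); apply; exists r.
Qed.

(** Both kinds of relators have even length. Parity of word length therefore descends to W, which
    later rules out that multiplying by a generator preserves the length. *)
Lemma cox_parity r r' : cox_congr k r r' -> odd (size r) = odd (size r').
Proof.
elim=> {r r'} [//|//|? ? ? _ -> _ ->//|u v i|u v i]; rewrite !size_cat /= !oddD.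
  by [].
rewrite size_flatten /shape map_nseq sumn_nseq /= oddM /=.
by [].

Qed.

Lemma word_parity r : odd (size r) = odd (len (word r)).
Proof.
have [r' <- /(fuchs_presented hW)] := len_spec (word r).
by move=> /cox_parity.
Qed.

Lemma ss i : s i * s i = 1.
Proof.
rewrite -word_nil -word_seq1 -word_cat; apply/(fuchs_presented hW).
exact: (cox_square k [::] [::] i).
Qed.

Lemma sV i : (s i)^-1 = s i.
Proof. by apply: (mulgI (s i)); rewrite mulgV ss. Qed.

Lemma mulsK i w : w * s i * s i = w.
Proof. by rewrite -mulgA ss mulg1. Qed.

Lemma word_rev r : word (rev r) = (word r)^-1.
Proof.
elim: r => [|i r IH]; first by rewrite /= word_nil invg1.
by rewrite rev_cons word_rcons IH word_cons invgM sV.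
Qed.

Lemma len1 : len 1 = 0%N.
Proof. by apply/eqP; rewrite -leqn0 -word_nil; exact: len_word. Qed.

Lemma len_eq0 w : len w = 0%N -> w = 1.
Proof.
move=> lw; have [r] := len_spec w; rewrite lw => /size0nil -> <-.
exact: word_nil.
Qed.

Lemma lenM u v : (len (u * v) <= len u + len v)%N.
Proof.
have [r <- <-] := len_spec u; have [r' <- <-] := len_spec v.
by rewrite -word_cat -size_cat; exact: len_word.
Qed.

Lemma lenV w : len w^-1 = len w.
Proof.
wlog suff H : w / (len w^-1 <= len w)%N.
  by have := H w^-1; rewrite invgK; have := H w; lia.
have [r <- <-] := len_spec w.
by rewrite -word_rev -(size_rev r); exact: len_word.
Qed.

Lemma len_s i : len (s i) = 1%N.
Proof.
have := len_word [:: i]; rewrite word_seq1 /=.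
by have := word_parity [:: i]; rewrite word_seq1 /=; case: (len _) => [|[]].
Qed.

Lemma odd_lenM u v : odd (len (u * v)) = odd (len u) (+) odd (len v).
Proof.
have [r rs ru] := len_spec u; have [r' rs' ru'] := len_spec v.
by rewrite -rs -rs' -ru -ru' -word_cat -word_parity size_cat oddD.
Qed.

Lemma len_mulS u i : len (u * s i) = (len u).+1 \/ len u = (len (u * s i)).+1.
Proof.
have h1 := lenM u (s i); have h2 := lenM (u * s i) (s i).
have := odd_lenM u (s i); rewrite mulsK in h2; rewrite len_s in h1 h2 *.
lia.
Qed.

Lemma distC u v : dist u v = dist v u.
Proof. by rewrite /Defs.dist -lenV invgM invgK. Qed.

Lemma distxx u : dist u u = 0%N.
Proof. by rewrite /Defs.dist mulVg len1. Qed.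

Lemma dist_triangle v u w : (dist u w <= dist u v + dist v w)%N.
Proof.
by rewrite /Defs.dist; have := lenM (u^-1 * v) (v^-1 * w); rewrite mulgA mulgK.
Qed.

Lemma distM g u v : dist (g * u) (g * v) = dist u v.
Proof. by rewrite /Defs.dist invgM -mulgA mulKg. Qed.

Lemma dist1 u : dist 1 u = len u.
Proof. by rewrite /Defs.dist invg1 mul1g. Qed.

Lemma dist_mul u g : dist u (u * g) = len g.
Proof. by rewrite /Defs.dist mulKg. Qed.

Lemma len_dist u v : (len u <= len v + dist v u)%N.
Proof. by rewrite -!dist1; exact: dist_triangle. Qed.

Lemma dist_eq0 u v : dist u v = 0%N -> u = v.
Proof.
by move=> /len_eq0 h; rewrite -(mulKg u^-1 v) h invgK mulg1.
Qed.

Lemma countable_W : countable [set: W].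
Proof. by apply: (@countable_surj _ _ word) => w; exact: fuchs_generated hW w. Qed.

(** Balls are listed without repetition so that sums over them become finite sums; the bound
    [N.+1 ^ n] on the size is what the decay has to beat in the escape estimate. *)
Fixpoint ball_seq (n : nat) : seq W :=
  if n is m.+1 then
    undup (ball_seq m ++ [seq u * s i | u <- ball_seq m, i <- enum 'I_N])
  else [:: 1].

Lemma mem_ball n w : (w \in ball_seq n) = (len w <= n)%N.
Proof.
elim: n w => [|n IH] w /=.
  rewrite inE leqn0; apply/eqP/eqP => [->|]; [exact: len1|exact: len_eq0].
rewrite mem_undup mem_cat IH; apply/orP/idP => [[/leqW//|]|].
  move=> /allpairsP[[u i] /= [+ _ ->]]; rewrite IH => hu.
  by rewrite (leq_trans (lenM _ _))// len_s addn1.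
rewrite leq_eqVlt ltnS => /orP[/eqP lw|->]; last by left.
right; have [r] := len_spec w; case/lastP: r => [|r i].
  by rewrite lw.
rewrite size_rcons lw word_rcons => -[rn] <-; apply/allpairsP.
by exists (word r, i); rewrite /= mem_enum IH -rn len_word.
Qed.

Lemma ball_seq_uniq n : uniq (ball_seq n).
Proof. by case: n => [|n] //=; exact: undup_uniq. Qed.

Lemma size_ball_seq n : (size (ball_seq n) <= N.+1 ^ n)%N.
Proof.
elim: n => [//|n IH] /=; rewrite (leq_trans (size_undup _))// size_cat.
rewrite size_allpairs size_enum_ord -mulnS (expnSr) leq_mul//.
Qed.

End CoxeterBasics.

(** * A Fuchsian Coxeter group is infinite *)

Section Infinite.
Variables (R : realType) (N : nat) (k : 'I_N -> nat).

Definition cosk (i : 'I_N) : R := cos (pi / (k i)%:R).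

(* The Gram matrix of the reflection representation, with the entry -2 for
   pairs of generators without relation. *)
Definition gram (i j : 'I_N) : R :=
  if i == j then 1 else if j == ordS i then - cosk i
  else if i == ordS j then - cosk j else - 2.

Definition gform (x : 'I_N -> R) (i : 'I_N) : R := \sum_j x j * gram j i.

Definition refl (i : 'I_N) (x : 'I_N -> R) : 'I_N -> R :=
  fun j => x j - (2 * gform x i) *+ (j == i).

Definition act (r : seq 'I_N) (x : 'I_N -> R) := foldr refl x r.

Hypotheses (N3 : (3 <= N)%N) (k2 : forall i, (2 <= k i)%N).

Lemma ordS_neq (i : 'I_N) : ordS i != i.
Proof.
apply/eqP => /(congr1 val) /=; move: i => [i iN] /=.
by have [e|ne] := eqVneq i.+1 N; [rewrite e modnn; lia|rewrite modn_small; lia].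
Qed.

Lemma ordSS_neq (i : 'I_N) : ordS (ordS i) != i.
Proof.
apply/eqP => /(congr1 val) /=; move: i => [i iN] /=.
have [e|ne] := eqVneq i.+1 N.
  by rewrite e modnn modn_small; lia.
rewrite (@modn_small i.+1) ; last lia.
by have [e|ne2] := eqVneq i.+2 N; [rewrite e modnn; lia|rewrite modn_small; lia].
Qed.

Lemma gram_ii i : gram i i = 1. Proof. by rewrite /gram eqxx. Qed.

Lemma gram_ordS i : gram i (ordS i) = - cosk i.
Proof. by rewrite /gram eq_sym (negbTE (ordS_neq i)) eqxx. Qed.

Lemma gramC i j : gram i j = gram j i.
Proof.
rewrite /gram [j == i]eq_sym; case: eqP => // _.
case: (eqVneq j (ordS i)) => [->|//]; case: eqP => // /eqP.
by rewrite eq_sym (negbTE (ordSS_neq i)).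
Qed.

Lemma gform_sub x (a : R) i j :
  gform (fun l => x l - a *+ (l == i)) j = gform x j - a * gram i j.
Proof.
rewrite /gform (eq_bigr (fun l => x l * gram l j - (a *+ (l == i)) * gram l j)).
  rewrite big_split /= sumrN; congr (_ - _).
  rewrite (bigD1 i)//= eqxx big1 ?addr0// => l /negbTE->.
  by rewrite mulr0n mul0r.
by move=> l _; rewrite mulrBl.
Qed.

Lemma gform_refl i x j : gform (refl i x) j = gform x j - 2 * gform x i * gram i j.
Proof. exact: gform_sub. Qed.

Lemma reflK i x : refl i (refl i x) = x.
Proof.
apply/funext => j; rewrite {1}/refl gform_refl gram_ii /refl.
by case: eqP => _; rewrite ?mulr1n ?mulr0n; lra.
Qed.

Lemma act_cat r r' x : act (r ++ r') x = act r (act r' x).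
Proof. by rewrite /act foldr_cat. Qed.

Lemma cosk_ge0 i : 0 <= cosk i.
Proof.
have ki := k2 i; have pi0 := @pi_gt0 R; apply: cos_ge0_pihalf.
have k2R : 2 <= (k i)%:R :> R by rewrite (ler_nat _ 2).
have : 0 <= pi / (k i)%:R :> R by rewrite divr_ge0//; lra.
have : pi / (k i)%:R <= pi / 2 :> R.
  by rewrite ler_pM2l// lef_pV2// posrE; lra.
by move=> *; apply/andP; split; lra.
Qed.

Lemma sink_gt0 i : 0 < sin (pi / (k i)%:R : R).
Proof.
have ki := k2 i; have pi0 := @pi_gt0 R; apply: sin_gt0_pi.
have k2R : 2 <= (k i)%:R :> R by rewrite (ler_nat _ 2).
apply/andP; split; first by rewrite divr_gt0//; lra.
by rewrite ltr_pdivrMr; nra.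
Qed.

(** The product of the two reflections changes only the coordinates i and i+1 and acts there as a
    rotation by twice t = pi / k_i. The coefficients solve the linear recursion for its powers; at n
    = k_i the angle is 2 pi and both corrections vanish. *)
Lemma refl_rotation i n x : let t := pi / (k i)%:R in
  act (flatten (nseq n [:: i; ordS i])) x =
  fun l => x l
    - ((gform x (ordS i) * (cos t - cos (n%:R * (2 * t) + t)) +
        gform x i * (1 - cos (n%:R * (2 * t)))) / sin t ^+ 2) *+ (l == i)
    - ((gform x (ordS i) * (1 - cos (n%:R * (2 * t))) +
        gform x i * (cos t - cos (n%:R * (2 * t) - t))) / sin t ^+ 2)
        *+ (l == ordS i).
Proof.
move=> t; have S0 : sin t != 0 by rewrite gt_eqF// sink_gt0.
elim: n => [|n IH].
  apply/funext => l /=; rewrite mul0r add0r add0r cosN cos0.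
  by rewrite !subrr !mulr0 addr0 mul0r !mul0rn !subr0.
rewrite [nseq _ _]/= [flatten _]/= -/(cat [:: i; ordS i] _) act_cat IH /=.
rewrite -[n.+1]addn1 natrD.
set C := cos (n%:R * (2 * t)); set Z := sin (n%:R * (2 * t)).
have c2 : cos (2 * t) = 2 * cos t ^+ 2 - 1.
  by rewrite mulr_natl cos_mulr2n; lra.
have s2 : sin (2 * t) = 2 * (cos t * sin t).
  by rewrite mulr_natl sin_mulr2n; lra.
have -> : (n%:R + 1%:R) * (2 * t) = n%:R * (2 * t) + 2 * t by ring.
rewrite !(cosD, cosB, sinD) c2 s2 -/C -/Z.
have cS : cos t ^+ 2 = 1 - sin t ^+ 2 by exact: cos2sin2.
have gSi : gram (ordS i) i = - cos t by rewrite gramC gram_ordS.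
have giS : gram i (ordS i) = - cos t by exact: gram_ordS.
apply/funext => l; rewrite /refl !gform_sub.
rewrite gSi giS !gram_ii !cosN !sinN.
set p := gform x i; set q := gform x (ordS i); set c := cos t; set S := sin t.
have SC : S ^+ 2 = 1 - c ^+ 2 by exact: sin2cos2.
(* With [V] the inverse of S^2, the induction step becomes a polynomial identity modulo the
   relations [SC] and [VC]. *)
pose V := (S ^+ 2)^-1; have VE : V * S ^+ 2 = 1.
  by rewrite mulVf// expf_neq0.
have VC : V * c ^+ 2 = V - 1 by rewrite -VE SC; ring.
rewrite -/V; case: (eqVneq l i) => [li|li].
  have -> : (l == ordS i) = false.
    by rewrite li eq_sym; apply/negbTE/ordS_neq.
  rewrite !mulr0n !mulr1n !subr0.
  ring: SC VC.
rewrite !mulr0n !subr0; case: (l == ordS i); rewrite ?mulr0n ?subr0// !mulr1n.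
ring: SC VC.
Qed.

Lemma act_rotation i x : act (flatten (nseq (k i) [:: i; ordS i])) x = x.
Proof.
rewrite refl_rotation; have ki := k2 i.
have -> : (k i)%:R * (2 * (pi / (k i)%:R)) = pi *+ 2 :> R.
  rewrite -mulr_natl; field; rewrite pnatr_eq0; lia.
rewrite cosD cosB cos2pi sin2pi !mul1r !mul0r subr0 addr0.
rewrite !subrr !mulr0 addr0 mul0r.
by apply/funext => j; rewrite !mul0rn !subr0.
Qed.

Lemma act_cox r r' : cox_congr k r r' -> act r = act r'.
Proof.
elim=> {r r'} [//|u v _ ->//|? ? ? _ -> _ ->//|u v i|u v i];
  apply/funext => x; rewrite !act_cat.
  by rewrite /= reflK.
by rewrite act_rotation.
Qed.

Section Vinberg.
Variable x0 : 'I_N -> R.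
Hypotheses (x00 : forall i, 0 < x0 i) (Bx0 : forall i, gform x0 i < 0).

(** Minus the value of the bilinear form at the pair z, x0. *)
Definition psi (z : 'I_N -> R) : R := - \sum_j z j * gform x0 j.

Lemma psi_refl i z : psi (refl i z) = psi z + 2 * gform z i * gform x0 i.
Proof.
rewrite /psi /refl (eq_bigr (fun j => z j * gform x0 j -
  (2 * gform z i) *+ (j == i) * gform x0 j)); last by move=> j _; rewrite mulrBl.
rewrite big_split /= sumrN [X in - (_ - X)](bigD1 i)//= eqxx [X in _ - (_ + X)]big1; last first.
  by move=> j ji; rewrite (negbTE ji) mulr0n mul0r.
by rewrite mulr1n; ring.
Qed.

Lemma psi_sym z : psi z = - \sum_i x0 i * gform z i.
Proof.
rewrite /psi; congr (- _); rewrite /gform.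
under eq_bigr do rewrite big_distrr /=.
rewrite exchange_big /=; apply: eq_bigr => i _; rewrite big_distrr /=.
by apply: eq_bigr => j _; rewrite gramC; ring.
Qed.

(* A maximizer z of psi over the orbit of x0 would satisfy gform z i >= 0 for
   all i, hence psi z <= 0 < psi x0. *)
Lemma psi_no_max r : 0 < psi (act r x0) ->
  exists i, psi (act r x0) < psi (act (i :: r) x0).
Proof.
move=> p0; apply: contrapT => nh.
suff : psi (act r x0) <= 0 by rewrite leNgt p0.
rewrite psi_sym oppr_le0 sumr_ge0// => i _; apply: mulr_ge0; first exact: ltW.
have : ~ psi (act r x0) < psi (act (i :: r) x0) by move=> h; apply: nh; exists i.
rewrite /= psi_refl; have := Bx0 i; nra.
Qed.

Lemma psi_x0 : 0 < psi x0.
Proof.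
have i0 : 'I_N by exists 0%N; lia.
rewrite /psi -sumrN (bigD1 i0)//= ltr_pwDl//.
  by have := x00 i0; have := Bx0 i0; nra.
by apply: sumr_ge0 => i _; have := x00 i; have := Bx0 i; nra.
Qed.

End Vinberg.
End Infinite.

(** * A positive vector with negative image under the Gram matrix *)

Section VinbergVector.
Variable R : realType.

(** The Gram determinant of a hyperbolic triangle is negative. Since a < pi - (b + c), the sum cos a
    + cos b cos c exceeds sin b sin c > 0, and squaring gives the inequality. *)
Lemma triangle_cos (a b c : R) : 0 < a -> 0 < b -> 0 < c -> a <= pi / 2 ->
  b <= pi / 2 -> c <= pi / 2 -> a + b + c < pi ->
  1 < cos a ^+ 2 + cos b ^+ 2 + cos c ^+ 2 + 2 * cos a * cos b * cos c.
Proof.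
move=> a0 b0 c0 ap bp cp abc; have pi0 := @pi_gt0 R.
have : cos (pi - (b + c)) < cos a.
  by rewrite ltr_cos ?in_itv /=; [lra|apply/andP; split; lra|apply/andP; split; lra].
rewrite cosB cospi sinpi mul0r addr0 mulN1r cosD => h.
have sb : 0 < sin b by apply: sin_gt0_pi; apply/andP; split; lra.
have sc : 0 < sin c by apply: sin_gt0_pi; apply/andP; split; lra.
have sb2 := sin2cos2 b; have sc2 := sin2cos2 c.
have h2 : (sin b * sin c) ^+ 2 < (cos a + cos b * cos c) ^+ 2.
  by rewrite ltr_pXn2r// ?nnegrE; nra.
move: h2; rewrite exprMn sb2 sc2; nra.
Qed.

Lemma sum_ord3 (f : 'I_3 -> R) i :
  \sum_j f j = f i + f (ordS i) + f (ordS (ordS i)).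
Proof.
rewrite (bigD1 i)//= (bigD1 (ordS i)) ?ordS_neq//= (bigD1 (ordS (ordS i)))/=.
  rewrite big1 ?addr0 ?addrA// => j.
  by case: i j => [[|[|[|//]]] ?] [[|[|[|//]]] ?].
by rewrite ordS_neq// ordSS_neq.
Qed.

Lemma vinberg3 (k : 'I_3 -> nat) : (forall i, (2 <= k i)%N) ->
  \sum_i ((k i)%:R^-1 : R) < 1 ->
  exists x0 : 'I_3 -> R, (forall i, 0 < x0 i) /\ forall i, gform k x0 i < 0.
Proof.
move=> k2 hk; set c := cosk R k.
(* The row sums of the adjugate of the Gram matrix: applying the Gram matrix to them gives its
   determinant in every coordinate, and this determinant is negative by [triangle_cos]. *)
pose f i := let j := ordS i in let l := ordS j in
  1 - c j ^+ 2 + (c i + c l * c j) + (c l + c i * c j).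
have c0 i : 0 <= c i by exact: cosk_ge0.
have c1 i : c i ^+ 2 < 1.
  have := sink_gt0 R k2 i; have := cos2sin2 (pi / (k i)%:R : R).
  by rewrite -/(cosk R k i) -/c => ->; nra.
have S3 (i : 'I_3) : ordS (ordS (ordS i)) = i.
  by apply/val_inj; case: i => [[|[|[|//]]] ?].
have kR i : 2 <= (k i)%:R :> R by rewrite (ler_nat _ 2).
exists f; split=> i.
  rewrite /f /=; have := c1 (ordS i); have := c0 i; have := c0 (ordS i).
  by have := c0 (ordS (ordS i)); nra.
rewrite /gform (sum_ord3 _ i) gram_ii.
rewrite (@gramC R 3 k isT (ordS i) i) (@gram_ordS R 3 k isT) -/c.
set j := ordS i; set l := ordS j.
have -> : gram R k l i = - c l by rewrite -(@gram_ordS R 3 k isT) S3.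
have -> : f l = 1 - c i ^+ 2 + (c l + c j * c i) + (c j + c l * c i).
  by rewrite /f /= S3.
have -> : f j = 1 - c l ^+ 2 + (c j + c i * c l) + (c i + c j * c l).
  by rewrite /f /= S3.
rewrite /f /= -/j -/l.
have pk m : 0 < pi / (k m)%:R :> R.
  by rewrite divr_gt0 ?pi_gt0//; have := kR m; lra.
have pk2 m : pi / (k m)%:R <= pi / 2 :> R.
  by rewrite ler_pM2l ?pi_gt0// lef_pV2// posrE; have := kR m; lra.
have := triangle_cos (pk i) (pk j) (pk l) (pk2 i) (pk2 j) (pk2 l).
rewrite -/(cosk R k i) -/(cosk R k j) -/(cosk R k l) -/c.
move: hk; rewrite (sum_ord3 _ i) -/j -/l => hk.
have hpi : pi / (k i)%:R + pi / (k j)%:R + pi / (k l)%:R < pi :> R.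
  by rewrite -!mulrDr -[ltRHS]mulr1 ltr_pM2l ?pi_gt0.
by move=> /(_ hpi); nra.
Qed.

(** Row i of the Gram matrix contains the diagonal entry 1, the entry -2 at i+2, which is not a
    neighbour of i once N is at least 4, and otherwise entries that are at most 0. *)
Lemma vinberg4 (N : nat) (k : 'I_N -> nat) : (4 <= N)%N ->
  (forall i, (2 <= k i)%N) -> forall i, gform k (fun=> 1 : R) i < 0.
Proof.
move=> N4 k2 i; have N3 : (3 <= N)%N by lia.
have S2 := ordSS_neq N3 i.
have S3 : ordS (ordS (ordS i)) != i.
  apply/eqP => /(congr1 val) /=; move: i {S2} => [i iN] /=.
  case: (ltngtP i.+1 N) => [h|h|e]; last by rewrite e modnn !modn_small; lia.
    rewrite (modn_small h); case: (ltngtP i.+2 N) => [h'|h'|e'].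
    - rewrite (modn_small h'); case: (ltngtP i.+3 N) => [h''|h''|e''].
      + by rewrite modn_small; lia.
      + lia.
      + by rewrite e'' modnn; lia.
    - lia.
    - by rewrite e' modnn modn_small; lia.
  lia.
rewrite /gform (bigD1 i)//= gram_ii (bigD1 (ordS (ordS i)))//=.
have -> : gram R k (ordS (ordS i)) i = - 2.
  rewrite /gram (negbTE S2) [i == _]eq_sym (negbTE S3).
  by rewrite (inj_eq (@ordS_inj N)) (negbTE (ordS_neq N3 i)).
suff : \sum_(j | (j != i) && (j != ordS (ordS i))) 1 * gram R k j i <= 0 by lra.
rewrite -oppr_ge0 -sumrN; apply: sumr_ge0 => j /andP[ji _].
rewrite /gram (negbTE ji) mul1r; have := cosk_ge0 R k2 i; have := cosk_ge0 R k2 j.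
by case: ifP => _; [|case: ifP => _]; lra.
Qed.

Lemma vinberg_vector (N : nat) (k : 'I_N -> nat) : (3 <= N)%N ->
  (forall i, (2 <= k i)%N) -> \sum_i ((k i)%:R^-1 : rat) < N%:R - 2%:R ->
  exists x0 : 'I_N -> R, (forall i, 0 < x0 i) /\ forall i, gform k x0 i < 0.
Proof.
move=> N3 k2; have [N4 _|N4] := leqP 4 N.
  by exists (fun=> 1); split=> // i; exact: vinberg4.
have e : N = 3%N by lia.
subst N => hk; apply: vinberg3 => //.
move: hk; rewrite -(ltr_rat R) rmorph_sum /= rmorphB /= !ratr_nat => h.
have <- : \sum_i ratr ((k i)%:R^-1) = \sum_i (k i)%:R^-1 :> R.
  by apply: eq_bigr => i _; rewrite fmorphV /= ratr_nat.
lra.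
Qed.

End VinbergVector.

Section InfiniteGroup.
Variables (R : realType) (N : nat) (k : 'I_N -> nat) (W : groupType).
Variables (s : 'I_N -> W) (hW : fuchsian_coxeter_system k s).

(** Otherwise all lengths would be below n, since prefixes of reduced words take every smaller
    length, and W would be finite. Then [psi] would attain a maximum on the orbit of [x0], against
    [psi_no_max]. *)
Lemma len_unbounded n : exists w, len s w = n.
Proof.
have N3 := fuchs_rank hW; have k2 := fuchs_exp_ge2 hW.
have [x0 [x00 Bx0]] := vinberg_vector R N3 k2 (fuchs_hyperbolic hW).
apply: contrapT => nh.
have bnd w : (len s w <= n)%N.
  rewrite leqNgt; apply/negP => nw; apply: nh.
  have [r rs rw] := len_spec hW w; exists (word s (take n r)).
  have h1 := len_word s (take n r); have h2 := len_word s (drop n r).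
  have := lenM hW (word s (take n r)) (word s (drop n r)).
  rewrite -word_cat cat_take_drop rw.
  rewrite size_takel in h1; last lia.
  rewrite size_drop in h2; lia.
pose f w := psi k x0 (act k (xget [::] [set r | word s r = w]) x0).
have fE r : f (word s r) = psi k x0 (act k r x0).
  rewrite /f; set r' := xget _ _.
  have e : word s r' = word s r.
    exact: (@xgetPex _ [::] [set r' | word s r' = word s r] (ex_intro _ r erefl)).
  by rewrite (@act_cox R N k N3 k2 r' r)//; apply/(fuchs_presented hW).
have [w wmax] : exists w, forall v, f v <= f w.
  pose B := ball_seq s n.
  have B0 : B != [::].
    by apply/eqP => e; have := mem_ball hW n 1%g; rewrite -/B e len1.
  have memB v : v \in B by rewrite (mem_ball hW).
  elim: B B0 {memB} (fun v => memB v) => // b B IH _.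
  move: IH => _ memB.
  have [w [wB wm]] : exists w, w \in b :: B /\ forall v, v \in b :: B -> f v <= f w.
    elim: B b {memB} => [|b' B IH] b.
      by exists b; rewrite inE eqxx; split=> // v; rewrite inE => /eqP->.
    have [w [wB wm]] := IH b'; have [le|lt] := lerP (f b) (f w).
      exists w; rewrite inE wB orbT; split=> // v; rewrite inE => /orP[/eqP->//|].
      exact: wm.
    exists b; rewrite inE eqxx; split=> // v; rewrite inE => /orP[/eqP->//|vB].
    by rewrite (le_trans (wm _ vB))// ltW.
  by exists w => v; apply: wm.
have [r rw] := fuchs_generated hW w.
have p0 : 0 < psi k x0 (act k r x0).
  rewrite -fE rw (lt_le_trans (psi_x0 N3 x00 Bx0))//.
  by rewrite -[X in psi _ _ X]/(act k [::] x0) -fE.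
have [i] := psi_no_max N3 x00 Bx0 p0.
by rewrite -!fE ltNge rw wmax.
Qed.

End InfiniteGroup.

(** * Spheres and galleries in regular buildings *)

Section ConstantSums.
Context {R : realType}.
Local Open Scope ereal_scope.

Lemma esum_partition (T U : choiceType) (A : set T) (f : T -> U)
    (a : T -> \bar R) : (forall x, 0 <= a x) ->
  \esum_(x in A) a x =
  \esum_(u in [set: U]) \esum_(x in [set x | A x /\ f x = u]) a x.
Proof.
move=> a0; rewrite esum_esum//.
rewrite (reindex_esum A _ (fun x => (f x, x)))//; split => //=.
- by move=> x y _ _ [].
- by move=> [u x] [/= _ [Ax <-]]; exists x.
Qed.

Lemma esum_exchange (T U : choiceType) (A : set T) (B : set U)
    (a : T -> U -> \bar R) : (forall x y, 0 <= a x y) ->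
  \esum_(x in A) \esum_(y in B) a x y = \esum_(y in B) \esum_(x in A) a x y.
Proof.
move=> a0; rewrite !esum_esum//.
rewrite (reindex_esum (B `*`` (fun=> A)) _ (fun z => (z.2, z.1)))//; split => //=.
- by move=> [x y] [].
- by move=> [? ?] [? ?] _ _ [-> ->].
- by move=> [x y] [/= ? ?]; exists (y, x).
Qed.

Lemma esumZl (T : choiceType) (A : set T) (c : R) (a : T -> \bar R) :
  (0 <= c)%R -> (forall x, 0 <= a x) ->
  \esum_(x in A) (c%:E * a x) = c%:E * (\esum_(x in A) a x).
Proof.
move=> c0 a0; have H (c' : R) (b : T -> \bar R) : (0 < c')%R ->
    (forall x, 0 <= b x) ->
    c'%:E * (\esum_(x in A) b x) <= \esum_(x in A) (c'%:E * b x).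
  move=> c'0 b0; rewrite muleC -lee_pdivlMr//; apply: ge_ereal_sup => _ [F [fF FA] <-].
  rewrite lee_pdivlMr// muleC ge0_mule_fsumr//; apply: esum_ge.
  by exists F.
move: c0; rewrite le_eqVlt => /orP[/eqP<-|c0].
  by rewrite mul0e esum1// => i _; rewrite mul0e.
apply/eqP; rewrite eq_le H// andbT.
have := H c^-1%R (fun x => c%:E * a x).
have ca0 x : 0 <= c%:E * a x by rewrite mule_ge0// lee_fin ltW.
rewrite invr_gt0 => /(_ c0 ca0).
under [X in _ <= X]eq_esum do rewrite muleA -EFinM mulVf ?gt_eqF// mul1e.
by move=> h; rewrite -lee_pdivrMl.
Qed.

Lemma esum_const (T : choiceType) (A : set T) (n : nat) (c : \bar R) : 0 <= c ->
  (A #= `I_n)%card -> \esum_(x in A) c = n%:R%:E * c.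
Proof.
move=> c0 An; rewrite (_ : \esum_(x in A) c = \esum_(i in `I_n) c).
  rewrite esum_fset//.
  rewrite -(@fsbig_ord _ _ _ n (fun=> c)) /= big_const card_ord.
  elim: n {An} => [|n IH]; first by rewrite mul0e.
  by rewrite iterS IH -[in RHS]addn1 natrD EFinD ge0_muleDl ?lee_fin// mul1e addeC.
have /card_set_bijP[e be] := An.
by rewrite (reindex_esum _ _ _ _ be).
Qed.

End ConstantSums.

Section Building.
Variables (R : realType) (N : nat) (k : 'I_N -> nat) (W : groupType).
Variables (s : 'I_N -> W) (hW : fuchsian_coxeter_system k s).
Variables (Delta : choiceType) (delta : Delta -> Delta -> W) (q : 'I_N -> nat).
Hypotheses (hD : building s delta) (hq : regular_building s delta q).
Hypothesis hthick : thick q.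
Local Notation word := (word s).
Local Notation len := (len s).
Local Notation dist := (dist s).

Definition reduced (r : seq 'I_N) := size r = len (word r).

Lemma reduced_rcons r i : reduced (rcons r i) ->
  reduced r /\ len (word r * s i)%g = (len (word r)).+1.
Proof.
rewrite /reduced size_rcons word_rcons => h.
have := len_word s r; have := lenM hW (word r) (s i); rewrite (len_s hW); lia.
Qed.

Lemma reduced_rev r : reduced r -> reduced (rev r).
Proof. by rewrite /reduced (word_rev hW) (lenV hW) size_rev. Qed.

Lemma s_neq1 i : s i <> 1%g.
Proof. by move=> e; have := len_s hW i; rewrite e len1. Qed.

Lemma delta_xx x : delta x x = 1%g.
Proof. exact/(building_eq hD). Qed.

Lemma delta_s_sym y z i : delta y z = s i -> delta z y = s i.
Proof.
move=> yz; have [[e|e] _] := building_step hD z yz; rewrite delta_xx in e.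
  have zy : z = y by apply/(building_eq hD).
  by move: yz; rewrite zy delta_xx => /esym/s_neq1.
by rewrite -(mulsK hW i (delta z y)) -e mul1g.
Qed.

Lemma panel_trans x y z i : delta x y = s i -> delta y z = s i ->
  x = z \/ delta x z = s i.
Proof.
move=> xy yz; have [[e|e] _] := building_step hD x yz; rewrite xy in e.
  by right.
by left; apply/(building_eq hD); rewrite e (ss hW).
Qed.

Lemma ascent_step x y z i : delta y z = s i ->
  len (delta x y * s i)%g = (len (delta x y)).+1 -> delta x z = (delta x y * s i)%g.
Proof. by move=> yz; apply: (building_step hD x yz).2. Qed.

Fixpoint gal (r : seq 'I_N) (x y : Delta) : Prop :=
  if r is i :: r' then exists z, delta x z = s i /\ gal r' z y else x = y.

Lemma gal_rcons r i x y :
  gal (rcons r i) x y <-> exists z, gal r x z /\ delta z y = s i.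
Proof.
elim: r x => [|j r IH] x /=.
  split=> [[z [xz <-]]|[z [-> zy]]]; first by exists x.
  by exists y.
split=> [[z [xz /IH[v [zv vy]]]]|[v [[z [xz zv]] vy]]].
  by exists v; split=> //; exists z.
by exists z; split=> //; apply/IH; exists v.
Qed.

Lemma gal_delta r x y : reduced r -> gal r x y -> delta x y = word r.
Proof.
elim/last_ind: r y => [|r i IH] y; first by move=> _ /= ->; rewrite delta_xx word_nil.
move=> /reduced_rcons[rr asc] /gal_rcons[z [xz zy]].
by rewrite word_rcons -(IH z)// (ascent_step zy) IH.
Qed.

Lemma delta_gal r x y : reduced r -> delta x y = word r -> gal r x y.
Proof.
elim/last_ind: r y => [|r i IH] y.
  by move=> _; rewrite word_nil => /(building_eq hD).
move=> /reduced_rcons[rr asc]; rewrite word_rcons => xy.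
have [z [yz xz]] := building_ext hD x y i.
apply/gal_rcons; exists z; split; last exact: delta_s_sym.
by apply: IH => //; rewrite xz xy (mulsK hW).
Qed.

Lemma gal_rev r x y : gal r x y -> gal (rev r) y x.
Proof.
elim: r x => [|i r IH] x /=; first by move->.
move=> [z [xz /IH zy]]; rewrite rev_cons; apply/gal_rcons.
by exists z; split=> //; exact: delta_s_sym.
Qed.

Lemma len_reduced w : exists2 r, reduced r & word r = w.
Proof. by have [r sr rw] := len_spec hW w; exists r; rewrite // /reduced rw. Qed.

Lemma deltaV x y : delta y x = (delta x y)^-1%g.
Proof.
have [r rr rw] := len_reduced (delta x y).
have /gal_rev g : gal r x y by apply: delta_gal.
by rewrite (gal_delta (reduced_rev rr) g) (word_rev hW) rw.
Qed.

Lemma delta_extend x w : exists y, delta x y = w.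
Proof.
have [r rw] := fuchs_generated hW w; elim/last_ind: r w rw => [|r i IH] w <-.
  by exists x; rewrite delta_xx word_nil.
have [y xy] := IH _ erefl; have [z [_ xz]] := building_ext hD x y i.
by exists z; rewrite xz xy word_rcons.
Qed.

Lemma gal_dist r z x y : gal r x y -> (dist (delta z x) (delta z y) <= size r)%N.
Proof.
elim: r x => [|i r IH] x /=; first by move=> ->; rewrite distxx.
move=> [x' [xx' /IH h]].
have : (dist (delta z x) (delta z x') <= 1)%N.
  have [[->|->] _] := building_step hD z xx'; first by rewrite distxx.
  by rewrite dist_mul (len_s hW).
have := dist_triangle hW (delta z x') (delta z x) (delta z y); lia.
Qed.

Lemma delta_dist z x y : (dist (delta z x) (delta z y) <= len (delta x y))%N.
Proof.
have [r rr rw] := len_reduced (delta x y).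
by rewrite -rw -rr; apply: gal_dist; exact: delta_gal.
Qed.

(** The chamber is the projection of z to the i-panel of x. Two such chambers would be i-adjacent,
    and the step from one to the other ascends, so the second would not be shorter. *)
Lemma descent_unique z x i : len (delta z x) = (len (delta z x * s i)%g).+1 ->
  exists y, [set y | delta x y = s i /\ delta z y = (delta z x * s i)%g] = [set y].
Proof.
move=> lx; have [y [xy zy]] := building_ext hD z x i; exists y.
apply/seteqP; split=> [y' [/= xy' zy']|y' ->//].
have := panel_trans (delta_s_sym xy') xy; case=> [//|y'y].
have := @ascent_step z _ _ _ y'y; rewrite zy' zy (mulsK hW) => /(_ lx) e.
by move: lx; rewrite e; lia.
Qed.

Local Open Scope ereal_scope.

Lemma panel_ascent (c : R) z x i : (0 <= c)%R ->
  len (delta z x * s i)%g = (len (delta z x)).+1 ->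
  \esum_(y in [set y | delta x y = s i /\ delta z y = (delta z x * s i)%g]) c%:E
    = ((q i)%:R * c)%:E /\
  \esum_(y in [set y | delta x y = s i /\ delta z y = delta z x]) c%:E = 0.
Proof.
move=> c0 asc; split.
  rewrite (_ : [set y | _] = [set y | delta x y = s i]); first exact: esum_const.
  by apply/seteqP; split=> [y []//|y /= xy]; split=> //; exact: ascent_step.
rewrite (_ : [set y | _] = set0) ?esum_set0//; apply/seteqP; split=> // y [xy].
by rewrite (ascent_step xy asc) => e; move: asc; rewrite e; lia.
Qed.

Lemma panel_descent (c : R) z x i : (0 <= c)%R ->
  len (delta z x) = (len (delta z x * s i)%g).+1 ->
  \esum_(y in [set y | delta x y = s i /\ delta z y = (delta z x * s i)%g]) c%:E
    = c%:E /\
  \esum_(y in [set y | delta x y = s i /\ delta z y = delta z x]) c%:E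
    = ((q i).-1%:R * c)%:E.
Proof.
move=> c0 dsc; have [y0 Ey0] := descent_unique dsc.
have h1 : \esum_(y in [set y | delta x y = s i /\ delta z y = (delta z x * s i)%g])
  c%:E = c%:E by rewrite Ey0 esum_set1.
split=> //.
have c0E : 0 <= c%:E by rewrite lee_fin.
have := esum_const c0E (hq i x).
rewrite (esumID [set y | delta z y = delta z x])// [X in _ + X](_ : _ = c%:E).
  move=> /(congr1 (fun e => e - c%:E)); rewrite addeK// => ->.
  rewrite -EFinM -EFinB; congr (_%:E).
  have -> : q i = (q i).-1.+1 :> nat by have := hthick i; lia.
  by rewrite -natr1; ring.
rewrite -[RHS]h1; congr esum; apply/seteqP; split=> y [/= xy zy]; split=> //.
  by have [[e|//] _] := building_step hD z xy; exfalso; apply: zy.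
by rewrite /= zy => e; move: dsc; rewrite e; lia.
Qed.

(** Every chamber at distance [w1 s_i] from x has exactly one i-neighbour at distance [w1], so the
    sum fibres over these neighbours. *)
Lemma esum_ascent (Q : Delta -> Prop) (F : Delta -> \bar R) w1 i x :
  (forall y, 0 <= F y) -> len (w1 * s i)%g = (len w1).+1 ->
  \esum_(y in [set y | delta x y = (w1 * s i)%g /\ Q y]) F y =
  \esum_(x1 in [set x1 | delta x x1 = w1])
    \esum_(y in [set y | delta x1 y = s i /\ Q y]) F y.
Proof.
move=> F0 asc; rewrite esum_esum//.
apply: (reindex_esum _ _ snd); split=> /=.
- move=> [x1 y] [/= x01 [x1y zy]]; split=> //.
  by rewrite -x01; apply: ascent_step => //; rewrite x01.
- move=> [x1 y] [x2 y'] /[!inE] /= -[/= x01 [x1y _]] [x02 [x2y _]] e.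
  subst y'; congr (_, _).
  have [//|x12] := panel_trans x1y (delta_s_sym x2y).
  have := @ascent_step x _ _ _ x12; rewrite x01 x02 => /(_ asc) e.
  by move: asc; rewrite -e; lia.
- move=> y [x0y zy]; have [x1 [yx1 x01]] := building_ext hD x y i.
  exists (x1, y) => //=; split; first by rewrite x01 x0y (mulsK hW).
  by split=> //; exact: delta_s_sym.
Qed.

(** Induction on a reduced word of [w], removing its last letter. The i-neighbours of a chamber at
    distance [w1] number q_i, 1, q_i - 1 or 0 over each candidate element, according to whether the
    step by [s i] ascends or descends, and this is read off from the relative lengths. The constant
    [c] is part of the induction so that it can absorb these multiplicities. *)
Lemma delta_count (n : nat) w (c : R) z x z' x' : (0 <= c)%R -> len w = n ->
  (forall g, (len g <= n)%N ->
     (len (delta z x * g)%g + len (delta z' x'))%N =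
     (len (delta z' x' * g)%g + len (delta z x))%N) ->
  forall g,
  \esum_(y in [set y | delta x y = w /\ delta z y = (delta z x * g)%g]) c%:E =
  \esum_(y in [set y | delta x' y = w /\ delta z' y = (delta z' x' * g)%g]) c%:E.
Proof.
elim: n w c z x z' x' => [|n IH] w c z x z' x' c0 lw hloc g.
  have -> : w = 1%g by exact: (len_eq0 hW).
  have E z0 x0 : [set y | delta x0 y = 1%g /\ delta z0 y = (delta z0 x0 * g)%g] =
      if g == 1%g then [set x0] else set0.
    case: eqP => [->|g1]; apply/seteqP; split=> y //=.
    - by move=> [/(building_eq hD)].
    - by move=> ->; rewrite delta_xx mulg1.
    - move=> [/(building_eq hD)->] /esym e; apply: g1.
      by apply: (mulgI (delta z0 y)); rewrite e mulg1.
  by rewrite !E; case: eqP => _; rewrite ?esum_set0// !esum_set1.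
have [r rr rw] := len_reduced w.
case/lastP: r rr rw => [|r i] rr rw.
  by move: rr; rewrite /reduced rw lw.
have [rr' asc] := reduced_rcons rr.
set w1 := word r in asc; have ww1 : w = (w1 * s i)%g by rewrite -rw word_rcons.
have lw1 : len w1 = n by move: asc; rewrite -ww1 lw; lia.
have fib x0 z0 v : \esum_(y in [set y | delta x0 y = w /\ delta z0 y = v]) c%:E =
    \esum_(x1 in [set x1 | delta x0 x1 = w1])
      \esum_(y in [set y | delta x1 y = s i /\ delta z0 y = v]) c%:E.
  rewrite ww1; apply: (@esum_ascent (fun y => delta z0 y = v) (fun=> c%:E)) => //.
rewrite !fib.
pose tau z0 x1 v := \esum_(y in [set y | delta x1 y = s i /\ delta z0 y = v]) c%:E.
have tau0 z0 x1 v : delta z0 x1 <> v -> delta z0 x1 <> (v * s i)%g ->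
    tau z0 x1 v = 0.
  move=> n1 n2; rewrite /tau (_ : [set y | _] = set0) ?esum_set0//.
  apply/seteqP; split=> // y [x1y zy].
  have [[e|e] _] := building_step hD z0 x1y; first by apply: n1; rewrite -e.
  by apply: n2; rewrite -zy e (mulsK hW).
have split2 z0 x0 v : \esum_(x1 in [set x1 | delta x0 x1 = w1]) tau z0 x1 v =
    \esum_(x1 in [set x1 | delta x0 x1 = w1 /\ delta z0 x1 = v]) tau z0 x1 v +
    \esum_(x1 in [set x1 | delta x0 x1 = w1 /\ delta z0 x1 = (v * s i)%g]) tau z0 x1 v.
  have t0 x1 : 0 <= tau z0 x1 v by apply: esum_ge0 => *; rewrite lee_fin.
  rewrite (esumID [set x1 | delta z0 x1 = v])//; congr (_ + _).
  rewrite esum_mkcondr esum_mkcond [RHS]esum_mkcond; apply: eq_esum => x1 _.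
  have [x01|x01] := pselect (delta x0 x1 = w1); last first.
    by rewrite memNset// memNset// => -[].
  rewrite mem_set//; have [zv|zv] := pselect (delta z0 x1 = (v * s i)%g).
    rewrite mem_set ?mem_set//= zv => e.
    by have := len_mulS hW v i; rewrite e; lia.
  rewrite [in RHS]memNset; last by case.
  by case: ifPn => // /set_mem /= zv'; rewrite tau0.
have empty z0 x0 h : (n < len h)%N ->
    [set x1 | delta x0 x1 = w1 /\ delta z0 x1 = (delta z0 x0 * h)%g] = set0.
  move=> nh; apply/seteqP; split=> // x1 [x01 zx1].
  have := delta_dist z0 x0 x1; rewrite zx1 dist_mul x01 lw1; lia.
suff main h v v' : (len h <= n)%N ->
    (v = delta z x * h /\ v' = delta z' x' * h \/
     v = delta z x * h * s i /\ v' = delta z' x' * h * s i)%g ->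
    \esum_(x1 in [set x1 | delta x x1 = w1 /\ delta z x1 = (delta z x * h)%g])
       tau z x1 v =
    \esum_(x1 in [set x1 | delta x' x1 = w1 /\ delta z' x1 = (delta z' x' * h)%g])
       tau z' x1 v'.
  have main' h v v' : 
    (v = delta z x * h /\ v' = delta z' x' * h \/
     v = delta z x * h * s i /\ v' = delta z' x' * h * s i)%g ->
    \esum_(x1 in [set x1 | delta x x1 = w1 /\ delta z x1 = (delta z x * h)%g])
       tau z x1 v =
    \esum_(x1 in [set x1 | delta x' x1 = w1 /\ delta z' x1 = (delta z' x' * h)%g])
       tau z' x1 v'.
    move=> hv; have [nh|nh] := leqP (len h) n; first exact: main.
    by rewrite !empty// !esum_set0.
  rewrite !split2; congr (_ + _); first by apply: main'; left.
  by rewrite -!mulgA; apply: main'; right; rewrite -!mulgA !(ss hW) !mulg1.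
move=> lh hv; have l1 := hloc h (leqW lh).
have l2 : (len (delta z x * h * s i)%g + len (delta z' x') =
           len (delta z' x' * h * s i)%g + len (delta z x))%N.
  by rewrite -!mulgA; apply: hloc; rewrite (leq_trans (lenM hW _ _))// (len_s hW); lia.
have hloc' g0 : (len g0 <= n)%N -> (len (delta z x * g0)%g + len (delta z' x'))%N =
     (len (delta z' x' * g0)%g + len (delta z x))%N by move=> /leqW; exact: hloc.
have key z0 x1 v0 : delta z0 x1 = v0 ->
  (len (v0 * s i)%g = (len v0).+1 ->
     tau z0 x1 (v0 * s i)%g = ((q i)%:R * c)%:E /\ tau z0 x1 v0 = (0 * c)%:E) /\
  (len v0 = (len (v0 * s i)%g).+1 ->
     tau z0 x1 (v0 * s i)%g = (1 * c)%:E /\ tau z0 x1 v0 = ((q i).-1%:R * c)%:E).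
  move=> <-; split=> ha; rewrite /tau ?mul0r ?mul1r.
    exact: panel_ascent.
  exact: panel_descent.
have [asc'|dsc'] := len_mulS hW (delta z x * h)%g i.
- have asc2 : len (delta z' x' * h * s i)%g = (len (delta z' x' * h)%g).+1 by lia.
  case: hv => -[-> ->].
  + transitivity (\esum_(x1 in [set x1 | delta x x1 = w1 /\
      delta z x1 = (delta z x * h)%g]) (0 * c)%:E).
      by apply: eq_esum => x1 [_ e]; have [+ _] := key _ _ _ e => /(_ asc')[].
    rewrite (IH w1 _ z x z' x' _ lw1 hloc')// ?mul0r//.
    by apply: eq_esum => x1 [_ e]; have [+ _] := key _ _ _ e => /(_ asc2)[_ ->]; rewrite mul0r.
  + transitivity (\esum_(x1 in [set x1 | delta x x1 = w1 /\
      delta z x1 = (delta z x * h)%g]) ((q i)%:R * c)%:E).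
      by apply: eq_esum => x1 [_ e]; have [+ _] := key _ _ _ e => /(_ asc')[].
    rewrite (IH w1 _ z x z' x' _ lw1 hloc')// ?mulr_ge0//.
    by apply: eq_esum => x1 [_ e]; have [+ _] := key _ _ _ e => /(_ asc2)[->].
- have dsc2 : len (delta z' x' * h)%g = (len (delta z' x' * h * s i)%g).+1 by lia.
  case: hv => -[-> ->].
  + transitivity (\esum_(x1 in [set x1 | delta x x1 = w1 /\
      delta z x1 = (delta z x * h)%g]) ((q i).-1%:R * c)%:E).
      by apply: eq_esum => x1 [_ e]; have [_] := key _ _ _ e => /(_ dsc')[].
    rewrite (IH w1 _ z x z' x' _ lw1 hloc')// ?mulr_ge0//.
    by apply: eq_esum => x1 [_ e]; have [_] := key _ _ _ e => /(_ dsc2)[_ ->].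
  + transitivity (\esum_(x1 in [set x1 | delta x x1 = w1 /\
      delta z x1 = (delta z x * h)%g]) (1 * c)%:E).
      by apply: eq_esum => x1 [_ e]; have [_] := key _ _ _ e => /(_ dsc')[].
    rewrite (IH w1 _ z x z' x' _ lw1 hloc')// ?mul1r//.
    by apply: eq_esum => x1 [_ e]; have [_] := key _ _ _ e => /(_ dsc2)[->]; rewrite mul1r.
Qed.

End Building.

(** * The retracted kernel *)

Section Kernel.
Variables (R : realType) (N : nat) (k : 'I_N -> nat) (W : groupType).
Variables (s : 'I_N -> W) (hW : fuchsian_coxeter_system k s).
Variables (Delta : choiceType) (delta : Delta -> Delta -> W) (q : 'I_N -> nat).
Hypotheses (hD : building s delta) (hq : regular_building s delta q).
Hypothesis hthick : thick q.
Variables (p : Delta -> Delta -> R) (hp : stochastic p).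
Hypothesis hiso : isotropic delta p.
Variables (L0 : nat) (hL0 : walk_range s delta p L0) (o : Delta).
Hypothesis hpS : forall x y i, delta x y = s i -> 0 < p x y.
Local Notation word := (word s).
Local Notation len := (len s).
Local Notation dist := (dist s).
Local Notation pb := (retracted_kernel delta p o).
Local Open Scope ereal_scope.

Definition step_weight (w : W) : R := p o (xget o [set y | delta o y = w]).

Lemma p_step_weight x y : p x y = step_weight (delta x y).
Proof.
rewrite /step_weight; apply: hiso; apply/esym.
exact: (@xgetPex _ o [set y' | delta o y' = _] (delta_extend hW hD o _)).
Qed.

Lemma p_ge0 x y : (0 <= p x y)%R. Proof. exact: hp.1. Qed.

Lemma pE_ge0 x y : 0 <= (p x y)%:E. Proof. by rewrite lee_fin p_ge0. Qed.
Hint Resolve pE_ge0 p_ge0 : core.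

Lemma step_weight_ge0 w : (0 <= step_weight w)%R. Proof. exact: p_ge0. Qed.

(** The walk retracted from an arbitrary chamber z; by [Ker_pb] it has the retracted kernel whatever
    the centre. *)
Definition Ker (z x : Delta) (v : W) : \bar R :=
  \esum_(y in [set y | delta z y = v]) (p x y)%:E.

(** The chambers y are sorted by w = delta x y. Only w of length at most [L0] carry weight, and for
    each of them [delta_count] compares the numbers of chambers on both sides. *)
Lemma Ker_loc z x z' x' :
  (forall g, (len g <= L0)%N ->
     (len (delta z x * g)%g + len (delta z' x'))%N =
     (len (delta z' x' * g)%g + len (delta z x))%N) ->
  forall g, Ker z x (delta z x * g)%g = Ker z' x' (delta z' x' * g)%g.
Proof.
move=> hloc g; rewrite /Ker (esum_partition _ (delta x))// [RHS](esum_partition _ (delta x'))//.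
apply: eq_esum => w _; have [lw|lw] := leqP (len w) L0.
  have E z0 x0 : \esum_(y in [set y | delta z0 y = (delta z0 x0 * g)%g /\ delta x0 y = w])
      (p x0 y)%:E =
      \esum_(y in [set y | delta x0 y = w /\ delta z0 y = (delta z0 x0 * g)%g]) (step_weight w)%:E.
    rewrite (_ : [set y | _ = w /\ _] = [set y | delta z0 y = (delta z0 x0 * g)%g /\ delta x0 y = w]).
      by apply: eq_esum => y [_ e]; rewrite p_step_weight e.
    by apply/seteqP; split=> y [].
  rewrite !E; apply: (delta_count hW hD hq hthick (step_weight_ge0 w) erefl) => g' g'w.
  by apply: hloc; rewrite (leq_trans g'w).
have E z0 x0 v : \esum_(y in [set y | delta z0 y = v /\ delta x0 y = w]) (p x0 y)%:E = 0.
  apply: esum1 => y [_ e]; congr (_%:E); apply/eqP; rewrite eq_le p_ge0 andbT leNgt.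
  by apply/negP => /hL0.1; rewrite e; lia.
by rewrite !E.
Qed.

Lemma Ker_eq z x z' x' v : delta z x = delta z' x' -> Ker z x v = Ker z' x' v.
Proof.
move=> e; have := @Ker_loc z x z' x' _ ((delta z x)^-1 * v)%g.
by rewrite -e mulgA mulgV mul1g; apply.
Qed.

Lemma Ker_sum z x : \esum_(v in [set: W]) Ker z x v = 1.
Proof.
rewrite -(hp.2 x) [RHS](esum_partition _ (delta z))//.
apply: eq_esum => v _; rewrite /Ker; congr esum.
by apply/seteqP; split=> y //= []//.
Qed.

Lemma Ker_ge0 z x v : 0 <= Ker z x v.
Proof. by apply: esum_ge0 => *; exact: pE_ge0. Qed.

Lemma Ker_pb z x v : Ker z x v = (pb (delta z x) v)%:E.
Proof.
rewrite /retracted_kernel; set x' := xget _ _.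
have e : delta o x' = delta z x.
  exact: (@xgetPex _ o [set y | delta o y = _] (delta_extend hW hD o _)).
rewrite (Ker_eq v (esym e)) fineK// fin_real//.
rewrite (lt_le_trans _ (Ker_ge0 _ _ _))//= (@le_lt_trans _ _ 1)// ?ltry//.
rewrite -(hp.2 x') /Ker esum_mkcond; apply: le_esum => y _.
by case: ifP.
Qed.

Lemma pb_ge0 u v : (0 <= pb u v)%R.
Proof.
have [x <-] := delta_extend hW hD o u.
by rewrite -lee_fin -Ker_pb Ker_ge0.
Qed.

Lemma pb_range u v : (0 < pb u v)%R -> (dist u v <= L0)%N.
Proof.
have [x <-] := delta_extend hW hD o u.
move=> h; rewrite leqNgt; apply/negP => l; suff : Ker o x v = 0.
  by rewrite Ker_pb => -[] e; rewrite e ltxx in h.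
apply: esum1 => y /= yv; congr (_%:E); apply/eqP; rewrite eq_le p_ge0 andbT leNgt.
apply/negP => /hL0.1 h2; have := delta_dist hW hD o x y; rewrite yv; lia.
Qed.

Lemma pb_sum u : \esum_(v in [set: W]) (pb u v)%:E = 1.
Proof.
have [x <-] := delta_extend hW hD o u; rewrite -(Ker_sum o x).
by apply: eq_esum => v _; rewrite Ker_pb.
Qed.

Lemma pb_loc u u' : (forall g, (len g <= L0)%N ->
     (len (u * g)%g + len u')%N = (len (u' * g)%g + len u)%N) ->
  forall g, pb u (u * g)%g = pb u' (u' * g)%g.
Proof.
have [x <-] := delta_extend hW hD o u; have [x' <-] := delta_extend hW hD o u'.
by move=> h g; apply/EFin_inj; rewrite -!Ker_pb; exact: Ker_loc.
Qed.

Lemma pb_ge z x y : (p x y <= pb (delta z x) (delta z y))%R.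
Proof.
rewrite -lee_fin -Ker_pb /Ker; apply: esum_ge; exists [set y]; last by rewrite fsbig_set1.
by split; [exact: finite_set1|move=> _ ->].
Qed.

Lemma eps_ex : exists2 e : R, (0 < e <= 1)%R & forall i, (e <= step_weight (s i))%R.
Proof.
have h i : (0 < step_weight (s i))%R.
  by have [y yi] := delta_extend hW hD o (s i); rewrite -yi -p_step_weight; exact: hpS yi.
suff [e e0 he] : exists2 e : R, (0 < e <= 1)%R &
    forall i, i \in enum 'I_N -> (e <= step_weight (s i))%R.
  by exists e => // i; apply: he; rewrite mem_enum.
elim: (enum 'I_N) => [|i l [e /andP[e0 e1] he]]; first by exists 1%R; rewrite ?ltr01 ?lexx.
exists (Num.min e (step_weight (s i))); first by rewrite lt_min e0 h/= ge_min e1.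
move=> j; rewrite inE => /orP[/eqP->|/he]; first by rewrite ge_min lexx orbT.
by move=> ej; rewrite ge_min ej.
Qed.

Lemma pb_step e u i : (forall i, (e <= step_weight (s i))%R) -> (e <= pb u (u * s i)%g)%R.
Proof.
have [x <-] := delta_extend hW hD o u => he.
have [y [xy oy]] := building_ext hD o x i.
by rewrite -oy (le_trans _ (pb_ge o x y))// p_step_weight xy.
Qed.

Lemma descent_ex u : u <> 1%g -> exists i, len u = (len (u * s i)%g).+1.
Proof.
move=> u1; have [r] := len_reduced hW u; case/lastP: r => [|r i].
  by move=> _; rewrite word_nil => e; exfalso; apply: u1.
move=> /(reduced_rcons hW)[_ h]; rewrite word_rcons => <-; exists i.
by rewrite h (mulsK hW).
Qed.

(** A panel descending towards [o] contains, by thickness, a second chamber over the same element.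
    At 1 there is no descent, whence the exception. *)
Lemma pb_stay e u : (forall i, (e <= step_weight (s i))%R) -> u <> 1%g -> (e <= pb u u)%R.
Proof.
move=> he /descent_ex[i]; have [x <-] := delta_extend hW hD o u => li.
have [_ h] := panel_descent hW hD hq hthick (@ler01 R) li.
have [y [xy oy]] : exists y, delta x y = s i /\ delta o y = delta o x.
  apply: contrapT => nh; move: h; rewrite (_ : [set y | _] = set0).
    rewrite esum_set0 mulr1 => -[] /esym/eqP; rewrite pnatr_eq0 => /eqP h.
    by have := hthick i; lia.
  by apply/seteqP; split=> // y hy; apply: nh; exists y.
by rewrite -[X in pb _ X]oy (le_trans _ (pb_ge o x y))// p_step_weight xy.
Qed.

(** The number of chambers at distance u from any chamber; by [mass_word] the choice of the reduced
    word does not matter. *)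
Definition mass (u : W) : R :=
  (\prod_(i <- xget [::] [set r | reduced s r /\ word r = u]) (q i)%:R)%R.

Lemma esum_word (c : R) x r : (0 <= c)%R -> reduced s r ->
  \esum_(y in [set y | delta x y = word r]) c%:E =
    ((\prod_(i <- r) (q i)%:R)%R * c)%:E.
Proof.
elim/last_ind: r c => [|r i IH] c c0 rr.
  rewrite big_nil mul1r word_nil (_ : [set y | _] = [set x]) ?esum_set1//.
  apply/seteqP; split=> [y /(building_eq hD)->//|y ->].
  by rewrite /= (delta_xx hD).
have [rr' asc] := reduced_rcons hW rr.
rewrite word_rcons -cats1 big_cat big_seq1 /= -mulrA -IH ?mulr_ge0//.
have := @esum_ascent R _ _ _ _ hW _ _ hD (fun=> True) (fun=> c%:E) (word r) i x _ asc.
rewrite (_ : [set y | _ = (_ * _)%g /\ True] = [set y | delta x y = (word r * s i)%g]).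
  move=> -> //; apply: eq_esum => x1 _.
  rewrite (_ : [set y | _ /\ True] = [set y | delta x1 y = s i]).
    by rewrite (esum_const _ (hq i x1))// EFinM.
  by apply/seteqP; split=> y //= [].
by apply/seteqP; split=> y //= [].
Qed.

Lemma mass_word r : reduced s r -> mass (word r) = (\prod_(i <- r) (q i)%:R)%R.
Proof.
move=> rr; rewrite /mass; set r' := xget _ _.
have [rr' e] : reduced s r' /\ word r' = word r.
  exact: (@xgetPex _ [::] [set r' | reduced s r' /\ word r' = word r]
    (ex_intro _ r (conj rr erefl))).
have := esum_word o (@ler01 R) rr'; rewrite e (esum_word o (@ler01 R) rr).
by rewrite !mulr1 => -[].
Qed.

Lemma mass_sum c x u : (0 <= c)%R ->
  \esum_(y in [set y | delta x y = u]) c%:E = (mass u * c)%:E.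
Proof.
by move=> c0; have [r rr <-] := len_reduced hW u; rewrite esum_word// mass_word.
Qed.

Lemma massV u : mass (u^-1)%g = mass u.
Proof.
have [r rr <-] := len_reduced hW u; rewrite -(word_rev hW) !mass_word//.
  by rewrite (perm_big r)// perm_rev.
exact: (reduced_rev hW rr).
Qed.

Lemma mass1 : mass 1%g = 1%R.
Proof. by rewrite -(word_nil s) mass_word ?big_nil// /reduced word_nil len1. Qed.

Lemma mass_asc u i : len (u * s i)%g = (len u).+1 ->
  mass (u * s i)%g = ((q i)%:R * mass u)%R.
Proof.
have [r rr <-] := len_reduced hW u => h; rewrite -word_rcons !mass_word//.
  by rewrite -cats1 big_cat big_seq1 mulrC.
by rewrite /reduced size_rcons word_rcons h rr.
Qed.

Lemma mass_ge1 u : (1 <= mass u)%R.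
Proof.
have [r rr <-] := len_reduced hW u; rewrite mass_word//.
elim: r {rr} => [|i r IH]; rewrite ?big_nil// big_cons.
have : (1 <= (q i)%:R :> R)%R by rewrite ler1n; have := hthick i; lia.
by nra.
Qed.

(** Isotropy turns the column sum into a sum of step weights times the number of x with delta x y =
    w. That number is [mass] of the inverse of w, which equals [mass w]. *)
Lemma p_colsum y : \esum_(x in [set: Delta]) (p x y)%:E = 1.
Proof.
rewrite -(hp.2 y) (esum_partition _ (fun x => delta x y))// [RHS](esum_partition _ (delta y))//.
apply: eq_esum => w _.
transitivity ((mass w * step_weight w)%:E).
  rewrite -massV -(mass_sum y _ (step_weight_ge0 w)).
  rewrite (_ : [set y0 | delta y y0 = (w^-1)%g] = [set x | [set: Delta] x /\ delta x y = w]).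
    by apply: eq_esum => x [_ e]; rewrite p_step_weight e.
  apply/seteqP; split=> [x /= e|x [_ e]] /=.
    by split=> //; rewrite (deltaV hW hD y x) e invgK.
  by rewrite (deltaV hW hD x y) e.
rewrite -(mass_sum y _ (step_weight_ge0 w)).
rewrite (_ : [set y0 | delta y y0 = w] = [set x | [set: Delta] x /\ delta y x = w]).
  by apply: eq_esum => x [_ e]; rewrite p_step_weight e.
by apply/seteqP; split=> x //= [].
Qed.

(** The image under retraction of the invariance of the counting measure on chambers, which is
    [p_colsum]. *)
Lemma mass_invariant v : \esum_(u in [set: W]) (mass u * pb u v)%:E = (mass v)%:E.
Proof.
transitivity (\esum_(x in [set: Delta]) Ker o x v).
  rewrite [RHS](esum_partition _ (delta o)); last by move=> x; exact: Ker_ge0.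
  apply: eq_esum => u _; rewrite -(mass_sum o _ (pb_ge0 u v)).
  rewrite (_ : [set y | delta o y = u] = [set x | [set: Delta] x /\ delta o x = u]).
    by apply: eq_esum => x [_ e]; rewrite Ker_pb e.
  by apply/seteqP; split=> x //= [].
rewrite /Ker esum_exchange//.
transitivity (\esum_(y in [set y | delta o y = v]) (1%R : R)%:E).
  by apply: eq_esum => y _; exact: p_colsum.
by rewrite mass_sum// mulr1.
Qed.

Lemma countable_Delta : countable [set: Delta].
Proof.
have -> : [set: Delta] = \bigcup_(w in [set: W]) [set y | delta o y = w].
  by apply/seteqP; split=> // y _; exists (delta o y).
apply: bigcup_countable => [|w _]; first exact: countable_W hW.
have [r rr <-] := len_reduced hW w; elim/last_ind: r rr => [|r i IH] rr.
  rewrite word_nil (_ : [set y | _] = [set o])//; apply/seteqP.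
  by split=> [y /(building_eq hD)->//|y ->]; rewrite /= (delta_xx hD).
have [rr' asc] := reduced_rcons hW rr.
have -> : [set y | delta o y = word (rcons r i)] =
    \bigcup_(x in [set x | delta o x = word r])
       [set y | delta x y = s i /\ delta o y = word (rcons r i)].
  apply/seteqP; split=> [y /= oy|y [x _ []]//].
  have [x [yx ox]] := building_ext hD o y i; exists x => /=.
    by rewrite ox oy word_rcons (mulsK hW).
  by split=> //; apply: (delta_s_sym hW hD).
apply: bigcup_countable => [|x _]; first exact: IH.
apply: finite_set_countable; apply: (@sub_finite_set _ _ [set y | delta x y = s i]).
  by move=> y [].
by apply/finite_setP; exists (q i); exact: hq.
Qed.

End Kernel.

(** * The Markov property *)

Section LawOn.
Context d1 d2 (R : realType) (X : measurableType d1) (Y : measurableType d2).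
Variables (mu : {measure set X -> \bar R}) (D : set X) (f : X -> Y).
Local Open Scope ereal_scope.

Definition law_on of measurable D & measurable_fun setT f : set Y -> \bar R :=
  fun A => mu (D `&` f @^-1` A).

Hypotheses (mD : measurable D) (mf : measurable_fun setT f).

Let law0 : law_on mD mf set0 = 0.
Proof. by rewrite /law_on preimage_set0 setI0 measure0. Qed.

Let law_ge0 A : 0 <= law_on mD mf A.
Proof. exact: measure_ge0. Qed.

Let law_sigma_additive : semi_sigma_additive (law_on mD mf).
Proof.
have mfi A : measurable A -> measurable (D `&` f @^-1` A).
  by move=> mA; apply: measurableI => //; rewrite -[_ @^-1` _]setTI; exact: mf.
move=> F mF tF mUF; rewrite /law_on preimage_bigcup setI_bigcupr.
apply: measure_semi_sigma_additive.
- by move=> n; exact: mfi.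
- move=> i j _ _ [x [[_ Fi] [_ Fj]]]; apply: (tF i j) => //.
  by exists (f x).
- by rewrite -setI_bigcupr -preimage_bigcup; exact: mfi.
Qed.

HB.instance Definition _ := isMeasure.Build _ _ _ (law_on mD mf)
  law0 law_ge0 law_sigma_additive.

End LawOn.

Section MarkovProperty.
Variables (R : realType) (T : choiceType) (t : T) (cT : countable [set: T]).
Local Notation PS := (path_space t).
Variables (pb : T -> T -> R) (Lam : T -> {measure set PS -> \bar R}).
Hypothesis Lam1 : forall x, Lam x setT = 1%E.
Hypothesis pb0 : forall x y, 0 <= pb x y.
Hypothesis LamE : forall x n (y : nat -> T),
  Lam x (cyl n y) = ((y 0%N == x)%:R * \prod_(i < n) pb (y i) (y i.+1))%:E.
Local Open Scope ereal_scope.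

Lemma Lam_cyl_shift x n h (B : set PS) : measurable B ->
  Lam x (cyl n h `&` shift n @^-1` B) = Lam x (cyl n h) * Lam (h n) B.
Proof.
move=> mB; have c0 : (0 <= (h 0%N == x)%:R * \prod_(i < n) pb (h i) (h i.+1) :> R)%R.
  by rewrite mulr_ge0// prodr_ge0.
pose m1 := law_on (Lam x) (measurable_cyl n h) (measurable_shift cT n).
pose m2 := mscale (NngNum c0) (Lam (h n)).
rewrite LamE -[LHS]/(m1 B) -[RHS]/(m2 B).
apply: (@path_measure_unique T t R m1 m2) => //.
- rewrite /m1 /= /law_on preimage_setT setIT LamE ltry//.
- by rewrite /m1 /m2 /= /law_on /mscale preimage_setT setIT LamE Lam1 mule1.
move=> m w; rewrite /m1 /m2 /= /law_on /mscale /= LamE.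
have [e|ne] := eqVneq (w 0%N) (h n); last first.
  rewrite mul0r mule0 (_ : _ `&` _ = set0) ?measure0//.
  apply/seteqP; split=> // y [/= yh yw]; move: ne.
  by rewrite -(yw 0%N)// -(yh n)// /shift addn0 eqxx.
pose v i := if (i <= n)%N then h i else w (i - n)%N.
have vE i : v (n + i)%N = w i.
  rewrite /v; case: ifP => [h1|_]; last by rewrite addKn.
  have -> : i = 0%N by lia.
  by rewrite addn0 e.
rewrite (_ : _ `&` _ = cyl (n + m) v); last first.
  apply/seteqP; split=> [y [/= yh yw] i inm|y /= yv].
    rewrite /v; case: leqP => ni; first exact: yh.
    have := yw (i - n)%N; rewrite /shift subnKC; last exact: ltnW.
    by apply; lia.
  split=> i ile; first by rewrite yv ?/v ?ile //; lia.
  by rewrite /shift yv ?vE //; lia.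
rewrite LamE mul1r -EFinM; congr (_%:E).
rewrite big_split_ord /= -mulrA; congr (_ * (_ * _))%R.
- apply: eq_bigr => i _; rewrite /v (ltnW (ltn_ord i)).
  by have := ltn_ord i; rewrite /= => ->.
- by apply: eq_bigr => i _; rewrite -addnS !vE.
Qed.

Lemma Lam_markov x n y (F B : set PS) :
  (forall u v, (forall i, (i <= n)%N -> u i = v i) -> F u -> F v) ->
  measurable B ->
  Lam x (F `&` [set z | z n = y] `&` shift n @^-1` B) =
  Lam x (F `&` [set z | z n = y]) * Lam y B.
Proof.
move=> HF mB; pose G := F `&` [set z : PS | z n = y].
have HG (u v : PS) : (forall i, (i <= n)%N -> u i = v i) -> G u -> G v.
  by move=> uv [Fu /= un]; split; [exact: HF Fu|rewrite /= -uv].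
have mG : measurable (G : set PS) by exact: measurable_coords HG.
have mS := measurable_shift_preimage cT n mB.
have mh (h : seq T) : measurable ((hist n : PS -> _) @^-1` [set h]).
  exact: (measurable_hist cT n [set h]).
rewrite -/G (measure_partition (countable_seqT cT) (Lam x) mh (measurableI _ _ mG mS)).
rewrite (measure_partition (countable_seqT cT) (Lam x) mh mG) muleC.
have fy : Lam y B \is a fin_num.
  rewrite ge0_fin_numE// (@le_lt_trans _ _ 1)// ?ltry// -(Lam1 y).
  by apply: le_measure; rewrite ?inE.
rewrite -[Lam y B]fineK// -esumZl ?fine_ge0//.
apply: eq_esum => h _; rewrite fineK//.
have [[u [Gu uh]]|nG] := pselect (exists u : PS, G u /\ hist n u = h).
  have cE : [set z : PS | hist n z = h] = cyl n u.
    rewrite -uh; apply/seteqP; split=> z /= /hist_eqP; exact.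
  have GC : G `&` cyl n u = cyl n u.
    apply/seteqP; split=> [z []//|z zu]; split=> //.
    by apply: HG Gu => i ni; rewrite zu.
  have yE : u n = y by case: Gu.
  rewrite -![hist n @^-1` _]/[set z | hist n z = h] cE GC.
  rewrite setIAC GC Lam_cyl_shift// yE muleC.
by [].
rewrite (_ : G `&` hist n @^-1` [set h] = set0); last first.
  by apply/seteqP; split=> // u [Gu /= uh]; apply: nG; exists u.
rewrite measure0 mule0 (_ : _ `&` _ = set0) ?measure0//.
by apply/seteqP; split=> // u [[Gu _] /= uh]; apply: nG; exists u.
Qed.

Lemma Lam_shift x n (F B : set PS) :
  (forall u v, (forall i, (i <= n)%N -> u i = v i) -> F u -> F v) ->
  measurable B ->
  Lam x (F `&` shift n @^-1` B) =
  \esum_(y in [set: T]) (Lam x (F `&` [set z | z n = y]) * Lam y B).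
Proof.
move=> HF mB; have mF : measurable (F : set PS) by exact: measurable_coords HF.
have mS := measurable_shift_preimage cT n mB.
rewrite (measure_partition cT (Lam x) (f := fun z : PS => z n)); last first.
- exact: measurableI.
- by move=> y; exact: (measurable_coord cT n [set y]).
by apply: eq_esum => y _; rewrite setIAC -Lam_markov.
Qed.

End MarkovProperty.

(** * Laws of the retracted walk *)

Section ChainStep.
Variables (R : realType) (T : choiceType) (t : T) (cT : countable [set: T]).
Local Notation PS := (path_space t).
Variables (p : T -> T -> R) (a : T -> R) (mu : {measure set PS -> \bar R}).
Hypotheses (p0 : forall x y, 0 <= p x y) (a0 : forall x, 0 <= a x).
Hypothesis muE : forall n (y : nat -> T),
  mu (cyl n y) = (a (y 0%N) * \prod_(i < n) p (y i) (y i.+1))%:E.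
Local Open Scope ereal_scope.

Lemma chain_step n x x' (F : set PS) :
  (forall u v, (forall i, (i <= n)%N -> u i = v i) -> F u -> F v) ->
  mu (F `&` [set z | z n = x] `&` [set z | z n.+1 = x']) =
  mu (F `&` [set z | z n = x]) * (p x x')%:E.
Proof.
move=> HF; pose G := F `&` [set z : PS | z n = x].
have HG (u v : PS) : (forall i, (i <= n)%N -> u i = v i) -> G u -> G v.
  by move=> uv [Fu /= un]; split; [exact: HF Fu|rewrite /= -uv].
have mG : measurable (G : set PS) by exact: measurable_coords HG.
have mS : measurable [set z : PS | z n.+1 = x'].
  exact: (measurable_coord cT n.+1 [set x']).
have mh (h : seq T) : measurable ((hist n : PS -> _) @^-1` [set h]).
  exact: (measurable_hist cT n [set h]).
rewrite -/G (measure_partition (countable_seqT cT) mu mh (measurableI _ _ mG mS)).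
rewrite (measure_partition (countable_seqT cT) mu mh mG) muleC -esumZl//.
apply: eq_esum => h _.
have [[u [Gu uh]]|nG] := pselect (exists u : PS, G u /\ hist n u = h); last first.
  rewrite (_ : G `&` hist n @^-1` [set h] = set0); last first.
    by apply/seteqP; split=> // u [Gu /= uh]; apply: nG; exists u.
  rewrite measure0 mule0 (_ : _ `&` _ = set0) ?measure0//.
  by apply/seteqP; split=> // u [[Gu _] /= uh]; apply: nG; exists u.
have cE : [set z : PS | hist n z = h] = cyl n u.
  rewrite -uh; apply/seteqP; split=> z /= /hist_eqP; exact.
have GC : G `&` cyl n u = cyl n u.
  apply/seteqP; split=> [z []//|z zu]; split=> //.
  by apply: HG Gu => i ni; rewrite zu.
have xE : u n = x by case: Gu.
rewrite -![hist n @^-1` _]/[set z | hist n z = h] cE GC setIAC GC.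
pose v i := if (i <= n)%N then u i else x'.
rewrite (_ : _ `&` _ = cyl n.+1 v); last first.
  apply/seteqP; split=> [z [/= zu zx] i|z zv].
    rewrite leq_eqVlt /v => /orP[/eqP->|]; first by rewrite ltnn.
    by rewrite ltnS => ni; rewrite ni zu.
  split=> [i ni|/=]; first by rewrite zv ?/v ?ni// (leq_trans ni).
  by rewrite zv// /v ltnn.
rewrite !muE big_ord_recr /= -EFinM; congr (_%:E).
rewrite /v /= leqnn ltnn -xE mulrA mulrC; congr (_ * (_ * _))%R.
by apply: eq_bigr => i _; rewrite (ltnW (ltn_ord i)) ltn_ord.
Qed.

End ChainStep.

Section BuildingLaws.
Variables (R : realType) (N : nat) (k : 'I_N -> nat) (W : groupType).
Variables (s : 'I_N -> W) (hW : fuchsian_coxeter_system k s).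
Variables (Delta : choiceType) (delta : Delta -> Delta -> W) (q : 'I_N -> nat).
Hypotheses (hD : building s delta) (hq : regular_building s delta q).
Hypothesis hthick : thick q.
Variables (p : Delta -> Delta -> R) (hp : stochastic p).
Hypothesis hiso : isotropic delta p.
Variables (L0 : nat) (hL0 : walk_range s delta p L0) (o : Delta).
Local Notation pb := (retracted_kernel delta p o).
Variables (d : measure_display) (Omega : measurableType d).
Variables (P : probability Omega R) (X : nat -> Omega -> Delta).
Hypothesis hX : markov_chain P p o X.
Local Open Scope ereal_scope.

Let cD := countable_Delta hW hD hq o.
Let cW := countable_W hW.

Definition chamber_path (a : Omega) : path_space o := fun n => X n a.

Lemma measurable_chamber_path : measurable_fun setT chamber_path.
Proof. by apply: measurable_to_paths => n x; exact: hX.1. Qed.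

Definition chamber_law : {measure set (path_space o) -> \bar R} :=
  law_on P measurableT measurable_chamber_path.

Lemma chamber_lawE n (y : nat -> Delta) :
  chamber_law (cyl n y) =
  ((y 0%N == o)%:R * \prod_(i < n) p (y i) (y i.+1))%:E.
Proof. by rewrite /chamber_law /= /law_on setTI -hX.2. Qed.

Lemma chamber_lawT : chamber_law setT = 1.
Proof. by rewrite /chamber_law /= /law_on preimage_setT setIT probability_setT. Qed.

Lemma chamber_law_start (B : set Delta) :
  chamber_law [set y | B (y 0%N)] = (if o \in B then 1 else 0).
Proof.
have mB (C : set Delta) : measurable ([set y | C (y 0%N)] : set (path_space o)).
  exact: (measurable_coord cD 0 C).
have c1 : chamber_law (cyl 0 (fun=> o)) = 1.
  by rewrite chamber_lawE eqxx big_ord0 mul1r.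
have sub (C : set Delta) : o \in C -> chamber_law [set y | C (y 0%N)] = 1.
  move=> oC; apply/eqP; rewrite eq_le -{1}chamber_lawT -c1; apply/andP; split.
    by apply: le_measure; rewrite ?inE//; exact: (mB C).
  apply: le_measure; rewrite ?inE//; first exact: measurable_cyl.
  by move=> y yo /=; rewrite yo//; exact: set_mem.
case: ifPn => [/sub//|oB].
have := sub (~` B); rewrite in_setC oB => /(_ isT).
have cP D : chamber_law D = P (chamber_path @^-1` D).
  by rewrite /chamber_law /= /law_on setTI.
rewrite !cP => h.
have mA : measurable (chamber_path @^-1` [set y | B (y 0%N)]).
  by rewrite -[_ @^-1` _]setTI; exact: measurable_chamber_path.
have := probability_setC P mA.
rewrite -[X in P X]/(chamber_path @^-1` [set y | (~` B) (y 0%N)]) h.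
have fA := fin_num_measure P _ mA.
rewrite -(fineK fA) -EFinB => -[] e.
by congr (_%:E); lra.
Qed.

(** Conditioned on the chamber x at time n, the probability of moving to a chamber over [u n.+1] is
    given by [Ker z x], which depends on x only through delta z x. So the retraction from any
    chamber z is a Markov chain with the same kernel. *)
Lemma chamber_law_delta z n (u : nat -> W) :
  chamber_law [set y | forall i, (i <= n)%N -> delta z (y i) = u i] =
  ((u 0%N == delta z o)%:R * \prod_(i < n) pb (u i) (u i.+1))%:E.
Proof.
pose A n := [set y : path_space o | forall i, (i <= n)%N -> delta z (y i) = u i].
have HA m (y y' : path_space o) : (forall i, (i <= m)%N -> y i = y' i) -> A m y -> A m y'.
  by move=> yy Ay i im; rewrite -yy// Ay.
have mA m : measurable (A m : set (path_space o)).
  exact: (measurable_coords cD (@HA m)).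
rewrite -/(A n); elim: n => [|n IH].
  rewrite big_ord0 mulr1.
  have -> : A 0%N = [set y | [set x | delta z x = u 0%N] (y 0%N)].
    apply/seteqP; split=> y /=; first exact.
    by move=> e i; rewrite leqn0 => /eqP->.
  rewrite chamber_law_start; have [e|ne] := eqVneq (u 0%N) (delta z o).
    by rewrite mem_set//= e.
  by rewrite memNset// => /= e; rewrite e eqxx in ne.
rewrite big_ord_recr /= mulrA EFinM -IH.
have mX m x : measurable [set y : path_space o | y m = x].
  exact: (measurable_coord cD m [set x]).
apply: (etrans (measure_partition cD chamber_law (f := fun y : path_space o => y n) (mX n) (mA n.+1))).
rewrite [X in X * _](measure_partition cD chamber_law (f := fun y : path_space o => y n) (mX n) (mA n)).
rewrite muleC -esumZl//; last exact: (pb_ge0 hW hD hq hthick hp hiso hL0).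
apply: eq_esum => x _.
have [zx|zx] := pselect (delta z x = u n); last first.
  have z0 m : (n <= m)%N ->
      chamber_law (A m `&` (fun y : path_space o => y n) @^-1` [set x]) = 0.
    move=> nm; have -> : A m `&` (fun y : path_space o => y n) @^-1` [set x] = set0.
      by apply/seteqP; split=> // y [/(_ n nm) /= yn yx]; rewrite yx in yn.
    exact: measure0.
  by rewrite (z0 n.+1 (leqnSn n)) (z0 n (leqnn n)) mule0.
rewrite (measure_partition cD chamber_law (f := fun y : path_space o => y n.+1)
  (mX n.+1)); last by apply: measurableI => //; exact: mX.
rewrite -zx -(Ker_pb hW hD hq hthick hp hiso hL0 o z x) /Ker.
have fin : chamber_law (A n `&` [set y | y n = x]) \is a fin_num.
  rewrite ge0_fin_numE// (@le_lt_trans _ _ 1)// ?ltry// -chamber_lawT.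
  by apply: le_measure; rewrite ?inE//; apply: measurableI => //; exact: mX.
rewrite muleC -[X in X * _](fineK fin) -esumZl ?fine_ge0//; last first.
  by move=> y; rewrite lee_fin hp.1.
rewrite [RHS]esum_mkcond; apply: eq_esum => x' _; rewrite fineK//.
case: ifPn => [|zx'].
  move=> /set_mem /= zx'.
  apply: (etrans _ (@chain_step R Delta o cD p (fun y => (y == o)%:R) chamber_law hp.1 chamber_lawE n x x' _ (HA n))).
  congr (chamber_law _); apply/seteqP; split=> y.
      move=> [[/= Ay yx] yx']; split=> //; split=> // i ni.
      by apply: Ay; exact: leqW.
    move=> [[/= Ay yx] yx']; split=> //; split=> // i.
    rewrite leq_eqVlt => /orP[/eqP->|]; first by rewrite yx'.
    by rewrite ltnS; exact: Ay.
transitivity (chamber_law set0); last exact: measure0.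
congr (chamber_law _); apply/seteqP; split=> // y [[/= Ay _] yx'].
by move/negP: zx'; apply; rewrite inE /= -yx' Ay.
Qed.

(** The chain on W started at x is realised on the given probability space: instead of moving the
    starting chamber [o], the same walk is retracted from a chamber z with delta z o = x. *)
Definition origin (x : W) : Delta := xget o [set z | delta z o = x].

Lemma originP x : delta (origin x) o = x.
Proof.
apply: (@xgetPex _ o [set z | delta z o = x]).
have [z oz] := delta_extend hW hD o x^-1%g; exists z.
by rewrite /= (deltaV hW hD) oz invgK.
Qed.

Definition retraction_path (z : Delta) (a : Omega) : path_space (1%g : W) :=
  fun n => delta z (X n a).

Lemma measurable_retraction_path z : measurable_fun setT (retraction_path z).
Proof.
apply: measurable_to_paths => n w.
have -> : (fun a => retraction_path z a n) @^-1` [set w] =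
    [set a | exists x, (delta z x = w /\ X n a = x)].
  apply/seteqP; split=> [a /= e|a /= [x [zx xx]]]; first by exists (X n a).
  by rewrite /retraction_path xx.
apply: measurable_exists => // x.
have [zx|zx] := pselect (delta z x = w).
  by rewrite (_ : (fun _ => _) = X n @^-1` [set x]); [exact: hX.1|
    apply/seteqP; split=> a //= []].
by rewrite (_ : (fun _ => _) = set0)//; apply/seteqP; split=> a //= [].
Qed.

Definition walk_law (z : Delta) : {measure set (path_space (1%g : W)) -> \bar R} :=
  law_on P measurableT (measurable_retraction_path z).

Lemma walk_law_cyl z n (u : nat -> W) :
  walk_law z (cyl n u) = ((u 0%N == delta z o)%:R * \prod_(i < n) pb (u i) (u i.+1))%:E.
Proof. by rewrite -chamber_law_delta. Qed.

Definition Lam (x : W) := walk_law (origin x).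

Lemma LamT x : Lam x setT = 1.
Proof. by rewrite /Lam /walk_law /= /law_on preimage_setT setIT probability_setT. Qed.

Lemma Lam_cyl x n (u : nat -> W) :
  Lam x (cyl n u) = ((u 0%N == x)%:R * \prod_(i < n) pb (u i) (u i.+1))%:E.
Proof. by rewrite /Lam walk_law_cyl originP. Qed.

Lemma walk_lawE z B : measurable B -> walk_law z B = Lam (delta z o) B.
Proof.
apply: path_measure_unique; rewrite ?LamT.
- by rewrite /walk_law /= /law_on preimage_setT setIT probability_setT ltry.
- by rewrite /walk_law /= /law_on preimage_setT setIT probability_setT.
- by move=> n u; rewrite walk_law_cyl Lam_cyl.
Qed.

(* Averaging over the chambers z adjacent to o compares the retractions based
   at z and at o. *)
Lemma base_change i n (U : set W) :
  Lam 1%g [set x | U (x n)] <=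
  (q i)%:R%:E * Lam (s i) [set x | exists2 u, U u & x n = (s i * u)%g].
Proof.
have mB (C : set W) : measurable ([set x | C (x n)] : set (path_space (1%g : W))).
  exact: (measurable_coord cW n C).
pose sU := [set v | exists2 u, U u & v = (s i * u)%g].
have mX x : measurable (X n @^-1` [set x]) by exact: hX.1.
have mZ z (C : set W) : measurable [set a | C (delta z (X n a))].
  have := measurable_retraction_path z; move=> /(_ measurableT _ (mB C)).
  by rewrite setTI.
have -> : Lam 1%g [set x | U (x n)] = walk_law o [set x | U (x n)].
  by rewrite walk_lawE ?(delta_xx hD)//; exact: (mB U).
rewrite -(esum_const _ (hq i o))//.
rewrite [leRHS](_ : _ = \esum_(z in [set z | delta o z = s i])
    \esum_(x in [set: Delta]) P ([set a | sU (delta z (X n a))] `&` X n @^-1` [set x])).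
  rewrite esum_exchange//.
  rewrite {1}/walk_law /= /law_on setTI.
  rewrite (measure_partition cD P mX (mZ o U)).
  apply: le_esum => x _.
  have [ox|ox] := pselect (U (delta o x)); last first.
    rewrite (_ : _ `&` _ = set0) ?measure0; first by apply: esum_ge0.
    by apply/seteqP; split=> // a [/= Ua Xa]; apply: ox; rewrite -Xa.
  have [z [xz xz']] := building_ext hD x o i.
  have oz : delta o z = s i by [].
  have zx : delta z x = (s i * delta o x)%g.
    by rewrite (deltaV hW hD x z) xz' invgM (sV hW) -(deltaV hW hD).
  apply: esum_ge; exists [set z]; first by split=> // y ->.
  rewrite fsbig_set1; apply: le_measure; rewrite ?inE.
  - exact: measurableI.
  - exact: measurableI.
  - by move=> a [/= Ua Xa]; split=> //=; exists (delta o x); rewrite // Xa zx.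
apply: eq_esum => z /= oz.
rewrite -(measure_partition cD P mX (mZ z sU)).
have e : s i = delta z o by rewrite (deltaV hW hD o z) oz (sV hW).
apply: (etrans (congr1 (fun v => Lam v [set x | sU (x n)]) e)).
apply: (etrans (esym (walk_lawE z (mB sU)))).
by rewrite /walk_law /= /law_on setTI.
Qed.

End BuildingLaws.

(** * Cones *)

Section Inner.
Variables (R : realType) (N : nat) (W : groupType) (s : 'I_N -> W).
Local Notation dist := (dist s).
Local Notation inner := (inner s).

Lemma innerP (L : R) (A : set W) u :
  inner L A u <-> A u /\ forall v, (dist u v)%:R <= L -> A v.
Proof.
split=> [[Au nb]|[Au h]].
  by split=> // v uv; apply: contrapT => nv; apply: nb; split=> //; exists v.
by split=> // -[_ [v nv uv]]; exact/nv/h.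
Qed.

Lemma inner_sub (L : R) (A B : set W) : A `<=` B -> inner L A `<=` inner L B.
Proof. by move=> AB u /innerP[Au h]; apply/innerP; split=> [|v /h]; exact: AB. Qed.

Lemma inner_le (L L' : R) (A : set W) : L <= L' -> inner L' A `<=` inner L A.
Proof.
move=> LL u /innerP[Au h]; apply/innerP; split=> // v uv; apply: h.
exact: le_trans LL.
Qed.

Lemma inner_in (L : R) (A : set W) : inner L A `<=` A.
Proof. by move=> u []. Qed.

End Inner.

Section Cones.
Variables (N : nat) (k : 'I_N -> nat) (W : groupType) (s : 'I_N -> W).
Hypothesis hW : fuchsian_coxeter_system k s.
Variables (A : labelled_graph N) (hA : strongly_automatic s A).
Local Notation len := (len s).
Local Notation dist := (dist s).
Local Notation gamma := (gamma s A).
Local Notation C := (cone s A).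
Local Notation T := (cone_type s A).
Local Notation pv := (path_value s (A := A)).
Local Open Scope group_scope.

Lemma gammaP w : is_path (start A) (gamma w) /\ pv (gamma w) = w.
Proof.
have [_ _ /(_ w I) [r rp rw]] := aut_bijective hA.
exact: (@xgetPex _ [::] [set r | is_path (start A) r /\ pv r = w]
  (ex_intro _ r (conj rp rw))).
Qed.

Lemma gamma_pv r : is_path (start A) r -> gamma (pv r) = r.
Proof.
move=> rp; have [gp gv] := gammaP (pv r).
by have [_ inj _] := aut_bijective hA; apply: inj; rewrite ?inE.
Qed.

Lemma size_gamma w : size (gamma w) = len w.
Proof. by have [gp gv] := gammaP w; rewrite (aut_geodesic hA gp) gv. Qed.

Lemma gamma_inj u v : gamma u = gamma v -> u = v.
Proof. by move=> e; rewrite -(gammaP u).2 e (gammaP v).2. Qed.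

Lemma is_path_cat v (r r' : seq (edge A)) :
  is_path v (r ++ r') = is_path v r && is_path (path_end v r) r'.
Proof. by elim: r v => [|e r IH] v //=; rewrite IH andbA. Qed.

Lemma path_end_cat v (r r' : seq (edge A)) :
  path_end v (r ++ r') = path_end (path_end v r) r'.
Proof. by rewrite /path_end map_cat last_cat. Qed.

Lemma pv_cat r r' : pv (r ++ r') = pv r * pv r'.
Proof. by rewrite /path_value map_cat word_cat. Qed.

Lemma coneP w u : C w u ->
  exists r, [/\ is_path (T w) r, u = w * pv r & gamma u = gamma w ++ r].
Proof.
move=> /prefixP[r e]; exists r; split=> //.
  by have := (gammaP u).1; rewrite e is_path_cat => /andP[].
by rewrite -[LHS](gammaP u).2 e pv_cat (gammaP w).2.
Qed.

Lemma gamma_extend w r : is_path (T w) r -> gamma (w * pv r) = gamma w ++ r.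
Proof.
move=> rp; rewrite -{1}(gammaP w).2 -pv_cat gamma_pv// is_path_cat.
by rewrite (gammaP w).1.
Qed.

Lemma cone_extend w r : is_path (T w) r -> C w (w * pv r).
Proof. by move=> rp; rewrite /cone /= gamma_extend// prefix_prefix. Qed.

Lemma type_extend w r : is_path (T w) r -> T (w * pv r) = path_end (T w) r.
Proof. by move=> rp; rewrite /cone_type gamma_extend// path_end_cat. Qed.

Lemma cone_trans w v : C w v -> C v `<=` C w.
Proof. by move=> wv u vu; exact: prefix_trans wv vu. Qed.

Lemma cone_len w u : C w u -> (len w <= len u)%N.
Proof. by rewrite -!size_gamma => /size_prefix. Qed.

Lemma cone_total w w' u : C w u -> C w' u -> (len w <= len w')%N -> C w w'.
Proof.
rewrite /cone /= !prefixE => /eqP e /eqP e' h; apply/eqP.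
have h' : (size (gamma w) <= size (gamma w'))%N by rewrite !size_gamma.
by rewrite -e' take_takel// e.
Qed.

Lemma cone_len_eq w u : C w u -> len w = len u -> w = u.
Proof.
rewrite /cone /= prefixE -!size_gamma => /eqP e h.
by apply: gamma_inj; rewrite -e h take_size.
Qed.

(** The vertex at distance n from 1 on the automaton geodesic of u; it is u itself from n = len u
    on. *)
Definition pre (u : W) (n : nat) : W := pv (take n (gamma u)).

Lemma gamma_pre u n : gamma (pre u n) = take n (gamma u).
Proof.
apply: gamma_pv; have := (gammaP u).1.
by rewrite -{1}(cat_take_drop n (gamma u)) is_path_cat => /andP[].
Qed.

Lemma len_pre u n : (n <= len u)%N -> len (pre u n) = n.
Proof. by rewrite -!size_gamma => h; rewrite gamma_pre size_takel. Qed.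

Lemma cone_pre u n : C (pre u n) u.
Proof. by rewrite /cone /= gamma_pre -{2}(cat_take_drop n (gamma u)) prefix_prefix. Qed.

Lemma pre_len u n : (len u <= n)%N -> pre u n = u.
Proof. by rewrite -size_gamma => h; rewrite /pre take_oversize// (gammaP u).2. Qed.

Lemma cone_preE w u : C w u -> pre u (len w) = w.
Proof.
rewrite /cone /= prefixE -size_gamma => /eqP e.
by apply: gamma_inj; rewrite gamma_pre e.
Qed.

Lemma pre_pre u m n : (m <= n)%N -> pre (pre u n) m = pre u m.
Proof. by move=> mn; rewrite /pre gamma_pre take_takel. Qed.

Lemma pre_step u n : (n < len u)%N -> exists i, pre u n.+1 = pre u n * s i.
Proof.
rewrite -size_gamma => nu; rewrite /pre.
case E : (gamma u) nu => [//|e r] nu; exists (lab (nth e (gamma u) n)).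
rewrite -E; rewrite (take_nth e); last by rewrite E.
by rewrite -cats1 pv_cat /path_value /= word_seq1.
Qed.

Lemma dist_pre u i j : (i <= j <= len u)%N -> dist (pre u i) (pre u j) = (j - i)%N.
Proof.
move=> /andP[ij ju]; apply/eqP; rewrite eqn_leq; apply/andP; split.
  elim: j ij ju => [|j IH]; first by rewrite leqn0 => /eqP->; rewrite distxx.
  rewrite leq_eqVlt => /orP[/eqP->|]; first by rewrite distxx.
  rewrite ltnS => ij ju; have [l e] := pre_step ju.
  have := dist_triangle hW (pre u j) (pre u i) (pre u j.+1).
  rewrite {2}e dist_mul (len_s hW); have := IH ij (ltnW ju); lia.
have := len_dist hW (pre u j) (pre u i); rewrite (len_pre ju) (len_pre (leq_trans ij ju)).
by lia.
Qed.

Lemma geodesic_pre u : geodesic s (len u) (pre u).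
Proof. by move=> i j; exact: dist_pre. Qed.

Lemma len_cone w u : C w u -> len u = (len w + dist w u)%N.
Proof.
move=> wu; have := cone_preE wu; have h := cone_len wu => e.
have := @dist_pre u (len w) (len u); rewrite h leqnn => /(_ isT).
rewrite e pre_len// => ->; lia.
Qed.

Section Translation.
Variables (w w' : W) (tw : T w = T w').

Lemma cone_tr g : C w (w * g) -> C w' (w' * g).
Proof.
move=> /coneP[r [rp /mulgI ge _]].
by rewrite ge; apply: cone_extend; rewrite -tw.
Qed.

Lemma type_tr g : C w (w * g) -> T (w' * g) = T (w * g).
Proof.
move=> /coneP[r [rp /mulgI ge _]].
by rewrite ge !type_extend// -?tw.
Qed.

Lemma len_tr g : C w (w * g) -> (len (w * g) + len w' = len (w' * g) + len w)%N.
Proof.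
move=> h; rewrite (len_cone h) (len_cone (cone_tr h)) !dist_mul; lia.
Qed.

Lemma inner_tr (R : realType) (L : R) g :
  inner s L (C w) (w * g) -> inner s L (C w') (w' * g).
Proof.
move=> /innerP[h hL]; apply/innerP; split; first exact: cone_tr.
move=> v vL; rewrite -(mulKg w'^-1 v) invgK; apply: cone_tr.
apply: hL; have -> : dist (w * g) (w * (w'^-1 * v)) = dist (w' * g) v.
  by rewrite distM -(distM s w') mulgA mulgV mul1g.
exact: vL.
Qed.

End Translation.

Lemma recurrent_child w : recurrent (T w) -> exists i, C w (w * s i) /\ w * s i <> w.
Proof.
move=> [r [r0 rp _]]; case: r r0 rp => [//|e r] _ /= /andP[/eqP se _].
have p1 : is_path (T w) [:: e] by rewrite /= se eqxx.
exists (lab e); have -> : s (lab e) = pv [:: e] by rewrite /path_value /= word_seq1.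
split; first exact: cone_extend.
move=> /(congr1 (fun u => size (gamma u))); rewrite gamma_extend// size_cat addn1; lia.
Qed.

Lemma recurrent_rep (t : vertex A) : recurrent t -> exists w, T w = t.
Proof.
move=> [r [r0 rp rt]]; have t0 : t != start A.
  case/lastP: r r0 rp rt => [//|r e] _ rp.
  by rewrite /path_end map_rcons last_rcons => <-; exact: aut_source hA e.
have [r' [rp' rt']] := aut_reach hA t0; exists (pv r').
by rewrite /cone_type gamma_pv.
Qed.

End Cones.

(** * Spectral gap and exponential decay *)

(** The properties of the retracted chain on which the analysis rests; the building returns only at
    the end. [mass] counts the chambers over an element, and [Q] bounds both its growth along an
    edge and the loss in [iw_base_change]. *)
Record isotropic_walk (R : realType) (N : nat) (W : groupType) (s : 'I_N -> W)
    (pb : W -> W -> R) (mass : W -> R)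
    (Lam : W -> {measure set (path_space (1%g : W)) -> \bar R})
    (L0 : nat) (eps Q : R) : Prop := IsotropicWalk {
  iw_eps : 0 < eps <= 1;
  iw_ge0 : forall u v, 0 <= pb u v;
  iw_range : forall u v, 0 < pb u v -> (dist s u v <= L0)%N;
  iw_sum : forall u, (\esum_(v in [set: W]) (pb u v)%:E = 1)%E;
  iw_loc : forall u u', (forall g, (len s g <= L0)%N ->
     (len s (u * g) + len s u' = len s (u' * g) + len s u)%N) ->
     forall g, pb u (u * g)%g = pb u' (u' * g)%g;
  iw_step : forall u i, eps <= pb u (u * s i)%g;
  iw_stay : forall u, u <> 1%g -> eps <= pb u u;
  iw_mass_ge1 : forall u, 1 <= mass u;
  iw_mass1 : mass 1%g = 1;
  iw_mass_asc : forall u i, len s (u * s i)%g = (len s u).+1 ->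
    2 * mass u <= mass (u * s i)%g <= Q * mass u;
  iw_inv : forall v,
    (\esum_(u in [set: W]) (mass u * pb u v)%:E = (mass v)%:E)%E;
  iw_LamT : forall x, Lam x setT = 1%E;
  iw_cyl : forall x n y,
    Lam x (cyl n y) = ((y 0%N == x)%:R * \prod_(i < n) pb (y i) (y i.+1))%:E;
  iw_base_change : forall i n (U : set W),
    (Lam 1%g [set x | U (x n)] <=
     Q%:E * Lam (s i) [set x | exists2 u, U u & x n = (s i * u)%g])%E }.

(** * Transition probabilities of the chain on W *)

Section Walk.
Variables (R : realType) (N : nat) (k : 'I_N -> nat) (W : groupType).
Variables (s : 'I_N -> W) (hW : fuchsian_coxeter_system k s).
Variables (pb : W -> W -> R) (mass : W -> R).
Local Notation PS := (path_space (1%g : W)).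
Variables (Lam : W -> {measure set PS -> \bar R}) (L0 : nat) (eps Q : R).
Hypothesis hw : isotropic_walk s pb mass Lam L0 eps Q.
Local Notation dist := (dist s).
Local Open Scope ereal_scope.

Let cW := countable_W hW.

Lemma mW n (B : set W) : measurable ([set x | B (x n)] : set PS).
Proof. exact: (measurable_coord cW n B). Qed.

Lemma Lam_le1 x (B : set PS) : measurable B -> Lam x B <= 1.
Proof. by move=> mB; rewrite -(iw_LamT hw x); apply: le_measure; rewrite ?inE. Qed.

Lemma Lam_fin x (B : set PS) : measurable B -> Lam x B \is a fin_num.
Proof.
by move=> mB; rewrite ge0_fin_numE// (@le_lt_trans _ _ 1)// ?ltry// Lam_le1.
Qed.

Lemma LamC x (B : set PS) : measurable B -> Lam x (~` B) = 1 - Lam x B.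
Proof.
move=> mB; have mC := measurableC mB.
rewrite -(iw_LamT hw x) -[X in Lam x X - _](setvU B) measureU ?setICl//.
by rewrite addeK// Lam_fin.
Qed.

Lemma Lam_markov_at x n y (F B : set PS) :
  (forall u v, (forall i, (i <= n)%N -> u i = v i) -> F u -> F v) ->
  measurable B ->
  Lam x (F `&` [set z | z n = y] `&` shift n @^-1` B) =
  Lam x (F `&` [set z | z n = y]) * Lam y B.
Proof. exact: (Lam_markov cW (iw_LamT hw) (iw_ge0 hw) (iw_cyl hw)). Qed.

Lemma Lam_markov_sum x n (F B : set PS) :
  (forall u v, (forall i, (i <= n)%N -> u i = v i) -> F u -> F v) ->
  measurable B ->
  Lam x (F `&` shift n @^-1` B) =
  \esum_(y in [set: W]) (Lam x (F `&` [set z | z n = y]) * Lam y B).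
Proof. exact: (Lam_shift cW (iw_LamT hw) (iw_ge0 hw) (iw_cyl hw)). Qed.

Lemma Lam_start x : Lam x [set z | z 0%N = x] = 1.
Proof.
have -> : [set z : PS | z 0%N = x] = cyl 0 (fun=> x).
  apply/seteqP; split=> z /=; last exact.
  by move=> e i; rewrite leqn0 => /eqP->.
by rewrite (iw_cyl hw) eqxx big_ord0 mul1r.
Qed.

Lemma Lam_null x (S B : set PS) : measurable S -> measurable B ->
  Lam x (~` S) = 0 -> Lam x (S `&` B) = Lam x B.
Proof.
move=> mS mB z0; have mC := measurableC mS; have mI := measurableI _ _ mS mB.
apply/eqP; rewrite eq_le; apply/andP; split.
  by apply: le_measure; rewrite ?inE.
apply: (@le_trans _ _ (Lam x ((S `&` B) `|` ~` S))).
  apply: le_measure; rewrite ?inE//; first exact: measurableU.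
  by move=> z Bz; have [Sz|] := pselect (S z); [left|right].
have h : Lam x ((S `&` B) `|` ~` S) <= Lam x (S `&` B) + Lam x (~` S).
  exact: measureU2.
by rewrite z0 adde0 in h.
Qed.

Lemma Lam_start_I x (B : set PS) : measurable B ->
  Lam x ([set z | z 0%N = x] `&` B) = Lam x B.
Proof.
move=> mB; have m0 := mW 0 [set x]; apply: Lam_null => //.
by rewrite LamC// Lam_start subee.
Qed.

Lemma Lam_step1 x y : Lam x [set z | z 1%N = y] = (pb x y)%:E.
Proof.
rewrite -Lam_start_I; last exact: (mW 1 [set y]).
have -> : [set z : PS | z 0%N = x] `&` [set z | z 1%N = y] =
    cyl 1 (fun i => if i is 0%N then x else y).
  apply/seteqP; split=> z /=; first by move=> [z0 z1] [|[|i]].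
  by move=> h; split; [exact: (h 0%N)|exact: (h 1%N)].
by rewrite (iw_cyl hw) eqxx mul1r big_ord1.
Qed.

Lemma esum_ball (F : W -> \bar R) u n : (forall v, 0 <= F v) ->
  (forall v, (n < dist u v)%N -> F v = 0) ->
  \esum_(v in [set: W]) F v = \sum_(g <- ball_seq s n) F (u * g)%g.
Proof.
move=> F0 Fn.
rewrite (reindex_esum [set: W] [set: W] (fun g => (u * g)%g)); last first.
  split=> //; first by move=> g h _ _; exact: mulgI.
  by move=> v _; exists (u^-1 * v)%g; rewrite // mulgA mulgV mul1g.
rewrite fsbig_seq ?(ball_seq_uniq s n)// -esum_fset ?finite_seq//.
rewrite [RHS]esum_mkcond; apply: eq_esum => g _.
case: ifPn => // gn; rewrite Fn// dist_mul ltnNge -(mem_ball hW).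
by apply/negP => h; move/negP: gn; apply; rewrite inE.
Qed.

Definition step_op (f : W -> R) (u : W) : R :=
  (\sum_(g <- ball_seq s L0) pb u (u * g)%g * f (u * g)%g)%R.

Lemma pb_far u v : (L0 < dist u v)%N -> pb u v = 0%R.
Proof.
move=> uv; apply/eqP; rewrite eq_le (iw_ge0 hw) andbT leNgt; apply/negP.
by move=> /(iw_range hw); lia.
Qed.

Lemma pb_ball_sum u : (\sum_(g <- ball_seq s L0) pb u (u * g)%g = 1)%R.
Proof.
apply: EFin_inj; rewrite -sumEFin -(iw_sum hw u).
rewrite (@esum_ball (fun v => (pb u v)%:E) u L0)// => v.
  by rewrite lee_fin (iw_ge0 hw).
by move=> /pb_far->.
Qed.

Lemma step_opE f u : (forall v, 0 <= f v)%R ->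
  (step_op f u)%:E = \esum_(v in [set: W]) (pb u v * f v)%:E.
Proof.
move=> f0; rewrite (@esum_ball (fun v => (pb u v * f v)%:E) u L0) => [|v|v].
- by rewrite sumEFin.
- by rewrite lee_fin mulr_ge0 ?(iw_ge0 hw).
- by move=> /pb_far->; rewrite mul0r.
Qed.

Definition trans (n : nat) (u v : W) : R := fine (Lam u [set z | z n = v]).

Lemma transE n u v : (trans n u v)%:E = Lam u [set z | z n = v].
Proof. by rewrite fineK// Lam_fin//; exact: (mW n [set v]). Qed.

Lemma trans_ge0 n u v : (0 <= trans n u v)%R.
Proof. by rewrite fine_ge0. Qed.

Lemma trans0 u v : trans 0 u v = (v == u)%:R.
Proof.
apply: EFin_inj; rewrite transE; have [->|ne] := eqVneq v u; first exact: Lam_start.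
apply/eqP; rewrite mulr0n eq_le measure_ge0 andbT.
apply: (@le_trans _ _ (Lam u (~` [set z | z 0%N = u]))).
  apply: le_measure; rewrite ?inE; first exact: (mW 0 [set v]).
    by apply: measurableC; exact: (mW 0 [set u]).
  by move=> z /= -> /eqP; rewrite (negbTE ne).
by rewrite LamC ?Lam_start ?subee//; exact: (mW 0 [set u]).
Qed.

Lemma transS n u v : trans n.+1 u v = step_op (trans n ^~ v) u.
Proof.
apply: EFin_inj; rewrite step_opE; last by move=> ?; exact: trans_ge0.
rewrite transE.
have -> : [set z : PS | z n.+1 = v] = setT `&` shift 1 @^-1` [set z : PS | z n = v].
  by rewrite setTI.
rewrite Lam_markov_sum//; last exact: (mW n [set v]).
by apply: eq_esum => y _; rewrite setTI Lam_step1 -transE -EFinM.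
Qed.

Lemma transD m n u v w : (trans m u v * trans n v w <= trans (m + n) u w)%R.
Proof.
rewrite -lee_fin EFinM !transE.
have mw := mW n [set w].
have h : Lam u (setT `&` [set z | z m = v] `&` shift m @^-1` [set z | z n = w]) =
   Lam u (setT `&` [set z | z m = v]) * Lam v [set z | z n = w].
  exact: Lam_markov_at.
rewrite setTI in h; rewrite -h; apply: le_measure; rewrite ?inE.
- by apply: measurableI; [exact: (mW m [set v])|exact: measurable_shift_preimage].
- exact: (mW (m + n) [set w]).
- by move=> z [].
Qed.

Lemma trans1 u v : trans 1 u v = pb u v.
Proof. by apply: EFin_inj; rewrite transE Lam_step1. Qed.

(** The variance is at least the contribution of the two atoms i and j, and x^2 + y^2 >= (x - y)^2 /
    2. *)
Lemma variance_bound (I : eqType) (r : seq I) (a f : I -> R) (i j : I) (e : R) :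
  uniq r -> i \in r -> j \in r -> i != j ->
  (forall l, 0 <= a l)%R -> (\sum_(l <- r) a l = 1)%R ->
  (0 <= e)%R -> (e <= a i)%R -> (e <= a j)%R ->
  ((\sum_(l <- r) a l * f l) ^+ 2 + e / 2 * (f i - f j) ^+ 2 <=
   \sum_(l <- r) a l * f l ^+ 2)%R.
Proof.
move=> ur ir jr ij a0 a1 e0 ei ej; set m := (\sum_(l <- r) a l * f l)%R.
have h : (\sum_(l <- r) a l * (f l - m) ^+ 2 = \sum_(l <- r) a l * f l ^+ 2 - m ^+ 2)%R.
  rewrite (eq_bigr (fun l => a l * f l ^+ 2 - 2 * m * (a l * f l) + m ^+ 2 * a l)%R).
    rewrite !big_split /= sumrN -!big_distrr /= a1 -/m; ring.
  by move=> l _; ring.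
have h2 : (a i * (f i - m) ^+ 2 + a j * (f j - m) ^+ 2 <=
    \sum_(l <- r) a l * (f l - m) ^+ 2)%R.
  rewrite (bigD1_seq i)//=.
  rewrite -big_filter (bigD1_seq j) ?filter_uniq ?mem_filter ?jr ?andbT ?(eq_sym j)//=.
  rewrite lerD2l lerDl sumr_ge0// => l _.
  by rewrite mulr_ge0// sqr_ge0.
rewrite -lerBrDl -h (le_trans _ h2)//.
set x := (f i - m)%R in h2 *; set y := (f j - m)%R in h2 *.
have -> : (f i - f j = x - y)%R by rewrite /x /y; ring.
have : (e * x ^+ 2 <= a i * x ^+ 2)%R by rewrite ler_wpM2r// sqr_ge0.
have : (e * y ^+ 2 <= a j * y ^+ 2)%R by rewrite ler_wpM2r// sqr_ge0.
have : (0 <= e * (x + y) ^+ 2)%R by rewrite mulr_ge0// sqr_ge0.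
nra.
Qed.

End Walk.

Section Spectral.
Variables (R : realType) (N : nat) (k : 'I_N -> nat) (W : groupType).
Variables (s : 'I_N -> W) (hW : fuchsian_coxeter_system k s).
Variables (pb : W -> W -> R) (mass : W -> R).
Local Notation PS := (path_space (1%g : W)).
Variables (Lam : W -> {measure set PS -> \bar R}) (L0 : nat) (eps Q : R).
Hypothesis hw : isotropic_walk s pb mass Lam L0 eps Q.
Variables (A : labelled_graph N) (hA : strongly_automatic s A).
Variables (K : nat) (hK : recurrent_outside s A K).
Local Notation len := (len s).
Local Notation C := (cone s A).
Local Notation T := (cone_type s A).
Local Open Scope ereal_scope.

Let cW := countable_W hW.
Let eps0 : (0 < eps)%R. Proof. by case/andP: (iw_eps hw). Qed.
Let mass0 u : (0 < mass u)%R.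
Proof. exact: lt_le_trans (iw_mass_ge1 hw u). Qed.
Let mass_ge0 u : (0 <= mass u)%R. Proof. exact: ltW. Qed.
Let pb_ge0 u v : (0 <= pb u v)%R. Proof. exact: (iw_ge0 hw). Qed.
Hint Resolve mass0 mass_ge0 pb_ge0 : core.

(** The parent of z in the spanning tree of the Cayley graph formed by the automaton geodesics; it
    is a tree edge that carries the Dirichlet energy below. *)
Definition par (z : W) : W := pre s A z (len z).-1.

Lemma par_spec z : z <> 1%g ->
  len z = (len (par z)).+1 /\ exists i, z = (par z * s i)%g.
Proof.
move=> z1; have lz : (0 < len z)%N.
  by rewrite lt0n; apply/eqP => /(len_eq0 hW).
have h : ((len z).-1 < len z)%N by lia.
split; first by rewrite /par (len_pre hA); lia.
have [i e] := pre_step hA h; exists i; rewrite /par -e prednK//.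
by rewrite (pre_len hA).
Qed.

Lemma par_cone u i : C u (u * s i)%g -> (u * s i)%g <> u -> par (u * s i)%g = u.
Proof.
move=> ci ne; have := len_cone hW hA ci; rewrite dist_mul (len_s hW) => lu.
by rewrite /par lu addn1 /= (cone_preE hA ci).
Qed.

Lemma L0_gt0 : (1 <= L0)%N.
Proof.
have [i] : exists i : 'I_N, True.
  by have := fuchs_rank hW => N3; exists (Ordinal (leq_trans (isT : 0 < 3)%N N3)).
have := iw_range hw (lt_le_trans eps0 (iw_step hw 1%g i)).
by rewrite dist_mul (len_s hW).
Qed.

Definition norm2 (f : W -> R) : \bar R :=
  \esum_(u in [set: W]) (mass u * f u ^+ 2)%:E.

Definition energy (f : W -> R) : \bar R :=
  \esum_(z in [set z | z <> 1%g]) (mass z * (f z - f (par z)) ^+ 2)%:E.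

Lemma norm2_ge0 f u : 0 <= (mass u * f u ^+ 2)%:E.
Proof. by rewrite lee_fin mulr_ge0 ?sqr_ge0. Qed.

Lemma energy_ge0 f z : 0 <= (mass z * (f z - f (par z)) ^+ 2)%:E.
Proof. by rewrite lee_fin mulr_ge0 ?sqr_ge0. Qed.
Hint Resolve norm2_ge0 energy_ge0 : core.

(** The loss in Jensen's inequality is a variance. At z different from 1, both z and its parent are
    reached in one step with probability at least eps, so [variance_bound] yields the energy of the
    tree edge. The summation uses the invariance of [mass]. *)
Lemma contraction f :
  norm2 (step_op s pb L0 f) + (eps / 2)%:E * energy f <= norm2 f.
Proof.
have e2 : (0 <= eps / 2)%R by rewrite divr_ge0// ltW.
rewrite /energy esum_mkcond -esumZl//; last by move=> z; case: ifP.
rewrite -esumD//; last by move=> z _; rewrite mule_ge0 ?lee_fin//; case: ifP.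
apply: (@le_trans _ _ (\esum_(z in [set: W])
    \esum_(v in [set: W]) (mass z * pb z v * f v ^+ 2)%:E)).
  apply: le_esum => z _.
  rewrite (@esum_ball _ _ _ _ _ hW (fun v => (mass z * pb z v * f v ^+ 2)%:E) z L0); last 2 first.
  - by move=> v; rewrite lee_fin mulr_ge0 ?sqr_ge0 ?mulr_ge0.
  - by move=> v /(pb_far hW hw)->; rewrite mulr0 mul0r.
  rewrite sumEFin; set r := ball_seq s L0.
  have [z1|z1] := pselect (z = 1%g).
    rewrite memNset//= mule0 adde0 lee_fin.
    under eq_bigr do rewrite -mulrA.
    rewrite -big_distrr /= ler_wpM2l//.
    set m := step_op _ _ _ _ _.
    suff : (0 <= \sum_(g <- r) pb z (z * g)%g * (f (z * g)%g - m) ^+ 2)%R.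
      rewrite (eq_bigr (fun g => pb z (z * g)%g * f (z * g)%g ^+ 2
        - 2 * m * (pb z (z * g)%g * f (z * g)%g) + m ^+ 2 * pb z (z * g)%g)%R).
        rewrite !big_split /= sumrN -!big_distrr /= (pb_ball_sum hW hw).
        rewrite -/m -/(step_op s pb L0 f z) -/m; lra.
      by move=> g _; ring.
    by apply: sumr_ge0 => g _; rewrite mulr_ge0 ?sqr_ge0 ?(iw_ge0 hw).
  rewrite mem_set// -EFinM -EFinD lee_fin.
  have [_ [i zi]] := par_spec z1.
  have pz : par z = (z * s i)%g by rewrite {2}zi (mulsK hW).
  have h1 : 1%g \in r by rewrite (mem_ball hW) len1.
  have hi : s i \in r by rewrite (mem_ball hW) (len_s hW) L0_gt0.
  have n1 : 1%g != s i by apply/eqP => e; have := len_s hW i; rewrite -e len1.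
  have := @variance_bound R W r (fun g => pb z (z * g)%g) (fun g => f (z * g)%g) 1%g (s i)
    eps (ball_seq_uniq s L0) h1 hi n1 (fun g => iw_ge0 hw _ _) (pb_ball_sum hW hw z)
    (ltW eps0).
  rewrite !mulg1 => /(_ (iw_stay hw z1) (iw_step hw z i)) h.
  rewrite pz (mulrCA (eps / 2)%R) -mulrDr; under eq_bigr do rewrite -mulrA.
  by rewrite -big_distrr /= ler_wpM2l.
rewrite esum_exchange; last first.
  by move=> u v; rewrite lee_fin mulr_ge0 ?sqr_ge0 ?mulr_ge0.
apply: le_esum => v _.
under eq_esum do rewrite mulrC EFinM.
rewrite esumZl ?sqr_ge0// => [|u]; last first.
  by rewrite lee_fin mulr_ge0.
by rewrite (iw_inv hw) -EFinM mulrC.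
Qed.

(** One child per element outside the ball of radius K, along which the mass at least doubles. The
    choice is injective because [par] recovers u. *)
Let phi (u : W) : W :=
  xget u [set v | [/\ len v = (len u).+1, par v = u & (2 * mass u <= mass v)%R]].

Let phiP u : (K < len u)%N ->
  [/\ len (phi u) = (len u).+1, par (phi u) = u & (2 * mass u <= mass (phi u))%R].
Proof.
move=> Ku; have rec : recurrent (T u).
  by apply: hK; rewrite /cball /= dist1; lia.
have [i [ci ne]] := recurrent_child hA rec.
have lu := len_cone hW hA ci; rewrite dist_mul (len_s hW) addn1 in lu.
apply: (@xgetPex _ u [set v | [/\ len v = (len u).+1, par v = u & (2 * mass u <= mass v)%R]]).
exists (u * s i)%g; split=> //; first exact: par_cone.
by have /andP[] := iw_mass_asc hw lu.
Qed.

Let outside (f : W -> R) := \esum_(u in [set u | (K < len u)%N]) (mass u * f u ^+ 2)%:E.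

Let outside_le f : norm2 f < +oo -> outside f <= 6%:E * energy f.
Proof.
move=> fin; have of1 : outside f < +oo.
  apply: le_lt_trans fin; rewrite /outside esum_mkcond.
  by apply: le_esum => u _; case: ifP.
have ofin : outside f \is a fin_num.
  by rewrite ge0_fin_numE//; apply: esum_ge0.
have phi_inj : set_inj [set u | (K < len u)%N] phi.
  move=> u v /[!inE] /= Ku Kv e.
  by have [_ <- _] := phiP Ku; have [_ <- _] := phiP Kv; rewrite e.
have h1 : \esum_(u in [set u | (K < len u)%N])
    (mass (phi u) * (f (phi u) - f u) ^+ 2)%:E <= energy f.
  rewrite (eq_esum (b := fun u => (mass (phi u) * (f (phi u) - f (par (phi u))) ^+ 2)%:E)).
    rewrite -(esum_image _ phi (fun z => (mass z * (f z - f (par z)) ^+ 2)%:E) phi_inj) /energy esum_mkcond [leRHS]esum_mkcond.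
    apply: le_esum => z _; case: ifPn => [/set_mem[u /= Ku <-]|_]; last by case: ifP.
    rewrite mem_set//= => e; have [+ _ _] := phiP Ku.
    by rewrite e len1.
  by move=> u /= Ku; have [_ -> _] := phiP Ku.
have h2 : \esum_(u in [set u | (K < len u)%N])
    (mass (phi u) * f (phi u) ^+ 2)%:E <= outside f.
  rewrite -(esum_image _ phi (fun z => (mass z * f z ^+ 2)%:E) phi_inj).
  rewrite esum_mkcond [leRHS]esum_mkcond.
  apply: le_esum => z _; case: ifPn => [/set_mem[u /= Ku <-]|_]; last by case: ifP.
  by rewrite mem_set//=; have [-> _ _] := phiP Ku; lia.
(* The expression (a - b)^2 + a^2 / 2 is minimal at a = 2b/3, with value b^2 / 3, and the child has
   at least twice the mass. This gives 2/3 here, and 2/3 - 1/2 = 1/6 gives the constant 6. *)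
have h3 : (2 / 3)%:E * outside f <=
    \esum_(u in [set u | (K < len u)%N]) (mass (phi u) * (f (phi u) - f u) ^+ 2)%:E +
    (2^-1)%:E * \esum_(u in [set u | (K < len u)%N]) (mass (phi u) * f (phi u) ^+ 2)%:E.
  rewrite -!esumZl//; try by move=> u; rewrite lee_fin mulr_ge0 ?sqr_ge0.
  rewrite -esumD; last 2 first.
  - by move=> u _; rewrite lee_fin mulr_ge0 ?sqr_ge0.
  - move=> u _; rewrite -EFinM lee_fin mulr_ge0//.
    by apply: mulr_ge0; rewrite ?sqr_ge0.
  apply: le_esum => u /= Ku; rewrite -!EFinM -EFinD lee_fin.
  have [_ _ m2] := phiP Ku; have mu := mass0 u.
  set a := f (phi u); set b := f u; set M := mass (phi u) in m2 *.
  have sq : (0 <= (2 * b - 3 * a) ^+ 2)%R by exact: sqr_ge0.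
  have : (0 <= M * (2 * b - 3 * a) ^+ 2)%R by rewrite mulr_ge0//; lra.
  have : (0 <= (M - 2 * mass u) * b ^+ 2)%R by rewrite mulr_ge0 ?sqr_ge0//; lra.
  nra.
have h4 : (2 / 3)%:E * outside f <= energy f + (2^-1)%:E * outside f.
  apply: (le_trans h3); apply: leeD => //.
  by rewrite lee_pmul2l.
move: h4; have e0 : 0 <= energy f by apply: esum_ge0.
case: (energy f) e0 => [e| |//] e0; last by rewrite mulry gtr0_sg// mul1e leey.
rewrite -(fineK ofin) -!EFinM -EFinD !lee_fin; lra.
Qed.

Lemma energy_le f (e : R) z : energy f = e%:E -> z <> 1%g ->
  ((f z - f (par z)) ^+ 2 <= e)%R.
Proof.
move=> fe z1; rewrite -lee_fin -fe /energy.
apply: (@le_trans _ _ (mass z * (f z - f (par z)) ^+ 2)%:E).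
  by rewrite lee_fin ler_peMl ?sqr_ge0 ?(iw_mass_ge1 hw).
by apply: esum_ge; exists [set z]; [split=> // y ->|rewrite fsbig_set1].
Qed.

(** As masses are at least 1, f changes by at most the square root of e along a tree edge, so f^2 +
    2e at most doubles along each edge, in either direction. *)
Lemma energy_chain f (e : R) u : energy f = e%:E ->
  (f u ^+ 2 + 2 * e <= 2 ^+ len u * (f 1%g ^+ 2 + 2 * e) /\
   f 1%g ^+ 2 + 2 * e <= 2 ^+ len u * (f u ^+ 2 + 2 * e))%R.
Proof.
move=> fe; move: {2}(len u) (erefl (len u)) => n; elim: n u => [|n IH] u lu.
  by rewrite lu (len_eq0 hW lu) expr0 !mul1r.
have u1 : u <> 1%g by move=> e1; rewrite e1 len1 in lu.
have [lp _] := par_spec u1.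
have := IH (par u); have lpn : len (par u) = n by lia.
rewrite lpn lu => /(_ erefl) [h1 h2].
have h := energy_le fe u1.
have p2 : (0 < 2 ^+ n :> R)%R by rewrite exprn_gt0.
have a1 : (f u ^+ 2 <= 2 * f (par u) ^+ 2 + 2 * (f u - f (par u)) ^+ 2)%R.
  by have : (0 <= (f u - 2 * f (par u)) ^+ 2)%R by [exact: sqr_ge0]; nra.
have a2 : (f (par u) ^+ 2 <= 2 * f u ^+ 2 + 2 * (f u - f (par u)) ^+ 2)%R.
  by have : (0 <= (2 * f u - f (par u)) ^+ 2)%R by [exact: sqr_ge0]; nra.
rewrite (exprS 2%R n); split.
  rewrite -mulrA; move: h1; set X := (2 ^+ n * _)%R; lra.
apply: (le_trans h2); rewrite -mulrA mulrCA.
by apply: ler_wpM2l; [exact: ltW|lra].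
Qed.

(** Outside the ball of radius K the doubling of masses is enough. Inside, values are compared along
    the tree, through 1, with the value at one point of length K+1 where the outside estimate
    applies. *)
Lemma energy_bound : exists2 c : R, (1 <= c)%R &
  forall f, norm2 f < +oo -> norm2 f <= c%:E * energy f.
Proof.
have [x1 lx1] := len_unbounded R hW K.+1.
pose M := (\sum_(u <- ball_seq s K) mass u)%R.
have M0 : (0 <= M)%R by apply: sumr_ge0 => u _; exact: ltW.
pose B := (2 ^+ K * 2 ^+ K.+1 * 8 : R)%R.
have B0 : (0 <= B)%R by rewrite !mulr_ge0// exprn_ge0.
exists (6 + M * B)%R; first by have := mulr_ge0 M0 B0; lra.
move=> f fin; have oe := outside_le fin.
have e0 : 0 <= energy f by apply: esum_ge0.
case fe : (energy f) e0 => [e| |//] e0; last first.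
  by rewrite mulry gtr0_sg ?mul1e ?leey//; have := mulr_ge0 M0 B0; lra.
rewrite fe in oe.
rewrite /norm2 (esumID [set u | (K < len u)%N])// setTI -/(outside f).
rewrite -EFinM mulrDl EFinD leeD//.
rewrite setTI (_ : ~` _ = [set` ball_seq s K]); last first.
  apply/seteqP; split=> u /=; rewrite (mem_ball hW); last by lia.
  by move=> h; lia.
have -> : \esum_(u in [set` ball_seq s K]) (mass u * f u ^+ 2)%:E =
    \sum_(u <- ball_seq s K) (mass u * f u ^+ 2)%:E.
  by rewrite fsbig_seq ?(ball_seq_uniq s K)// -esum_fset ?finite_seq.
rewrite sumEFin lee_fin /M -mulrA big_distrl /= big_seq [leRHS]big_seq.
apply: ler_sum => u; rewrite (mem_ball hW) => uK.
rewrite ler_wpM2l//.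
have [hu _] := energy_chain u fe; have [_ hx] := energy_chain x1 fe.
have fx : (f x1 ^+ 2 <= 6 * e)%R.
  rewrite -lee_fin EFinM; apply: le_trans oe.
  apply: (@le_trans _ _ (mass x1 * f x1 ^+ 2)%:E).
    by rewrite lee_fin ler_peMl ?sqr_ge0 ?(iw_mass_ge1 hw).
  apply: esum_ge; exists [set x1]; last by rewrite fsbig_set1.
  by split=> // y ->; rewrite /= lx1.
rewrite lee_fin in e0.
have pK : (2 ^+ len u <= 2 ^+ K :> R)%R by rewrite ler_weXn2l// ler1n.
rewrite lx1 in hx.
have q1 : (0 <= f 1%g ^+ 2 + 2 * e)%R by rewrite addr_ge0 ?sqr_ge0 ?mulr_ge0.
have p0 : (0 < 2 ^+ K :> R)%R by rewrite exprn_gt0.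
have p1 : (0 < 2 ^+ K.+1 :> R)%R by rewrite exprn_gt0.
have c1 : (2 ^+ len u * (f 1%g ^+ 2 + 2 * e) <= 2 ^+ K * (f 1%g ^+ 2 + 2 * e))%R.
  by rewrite ler_wpM2r.
have c2 : (2 ^+ K * (f 1%g ^+ 2 + 2 * e) <= 2 ^+ K * (2 ^+ K.+1 * (8 * e)))%R.
  apply: ler_wpM2l; first exact: ltW.
  apply: (le_trans hx); apply: ler_wpM2l; first exact: ltW.
  lra.
have -> : (B * e = 2 ^+ K * (2 ^+ K.+1 * (8 * e)))%R by rewrite /B; ring.
apply: (@le_trans _ _ (f u ^+ 2 + 2 * e)%R); first lra.
exact: le_trans hu (le_trans c1 c2).
Qed.

Lemma spectral_gap : exists2 rho : R, (0 < rho < 1)%R &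
  forall f, norm2 f < +oo -> norm2 (step_op s pb L0 f) <= rho%:E * norm2 f.
Proof.
have [c c1 hc] := energy_bound; have c0 : (0 < c)%R by lra.
have e1 : (eps <= 1)%R by case/andP: (iw_eps hw).
have ec : (0 < eps / 2 / c <= 2^-1)%R.
  rewrite !divr_gt0//= ler_pdivrMr//; nra.
exists (1 - eps / 2 / c)%R; first by case/andP: ec => *; apply/andP; split; lra.
move=> f fin; have h := contraction f; have h2 := hc f fin.
have nf : norm2 f \is a fin_num by rewrite ge0_fin_numE//; apply: esum_ge0.
have h3 : (eps / 2 / c)%:E * norm2 f <= (eps / 2)%:E * energy f.
  rewrite EFinM -muleA lee_pmul2l ?lte_fin ?divr_gt0//.
  by rewrite lee_pdivrMl.
have h4 : norm2 (step_op s pb L0 f) + (eps / 2 / c)%:E * norm2 f <= norm2 f.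
  by apply: le_trans h; rewrite leeD2l.
rewrite -(fineK nf) -!EFinM in h4 *.
rewrite mulrBl mul1r EFinB leeBrDr//.
Qed.

(** The spectral gap is iterated on the indicator of v, whose squared norm is [mass v]. *)
Lemma trans_decay : exists2 rho : R, (0 < rho < 1)%R &
  forall n u v, (mass u * trans Lam n u v ^+ 2 <= rho ^+ n * mass v)%R.
Proof.
have [rho rho01 h] := spectral_gap; exists rho => // n u v.
have rho0 : (0 < rho)%R by case/andP: rho01.
suff H : norm2 (trans Lam n ^~ v) <= (rho ^+ n * mass v)%:E.
  rewrite -lee_fin; apply: le_trans H; apply: esum_ge; exists [set u] => //.
  by rewrite fsbig_set1.
elim: n => [|n IH].
  rewrite expr0 mul1r /norm2 [leLHS](_ : _ = \esum_(u in [set v]) (mass u)%:E).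
    by rewrite esum_set1// lee_fin ltW.
  rewrite [RHS]esum_mkcond; apply: eq_esum => u' _.
  rewrite (trans0 hW hw); have [<-|ne] := eqVneq v u'.
    by rewrite mem_set// expr1n mulr1.
  by rewrite memNset ?expr0n ?mulr0// => e; rewrite e eqxx in ne.
have -> : trans Lam n.+1 ^~ v = step_op s pb L0 (trans Lam n ^~ v).
  by apply/funext => u'; exact: (transS hW hw).
apply: (le_trans (h _ _)); first exact: le_lt_trans IH (ltry _).
by rewrite exprS -mulrA EFinM lee_pmul2l ?lte_fin.
Qed.

End Spectral.

(** * Transience and the Green function *)

Section Summable.
Variables (R : realType).
Local Open Scope ereal_scope.

Lemma geometric_summable (b : R) : (0 <= b < 1)%R ->
  \sum_(0 <= n <oo) (b ^+ n)%:E < +oo.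
Proof.
case/andP=> b0 b1.
have h n : \sum_(0 <= i < n) (b ^+ i)%:E <= (1 / (1 - b))%:E.
  rewrite sumEFin lee_fin ler_pdivlMr ?subr_gt0//.
  suff -> : ((\sum_(0 <= i < n) b ^+ i) * (1 - b) = 1 - b ^+ n)%R.
    by rewrite gerBl exprn_ge0.
  elim: n => [|n IH]; first by rewrite big_geq// mul0r expr0 subrr.
  by rewrite big_nat_recr//= mulrDl IH exprS; ring.
apply: (@le_lt_trans _ _ (1 / (1 - b))%:E); last exact: ltry.
apply: lime_le; last by apply: nearW => n; exact: h.
by apply: is_cvg_nneseries => n _ _; rewrite lee_fin exprn_ge0.
Qed.

Lemma le_summable (a b : nat -> \bar R) : (forall n, 0 <= a n) ->
  (forall n, a n <= b n) -> \sum_(0 <= n <oo) b n < +oo ->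
  \sum_(0 <= n <oo) a n < +oo.
Proof. by move=> a0 ab; apply: le_lt_trans; apply: lee_nneseries. Qed.

Variables (d : measure_display) (T : measurableType d).
Variable mu : {measure set T -> \bar R}.

Lemma ae_eventually_not (F : nat -> set T) : (forall n, measurable (F n)) ->
  \sum_(0 <= n <oo) mu (F n) < +oo ->
  {ae mu, forall x, exists n, forall m, (n <= m)%N -> ~ F m x}.
Proof.
move=> mF sF; exists (lim_sup_set F); split.
- by apply: bigcapT_measurable => n; apply: bigcup_measurable.
- exact: lim_sup_set_cvg0.
- move=> x /= nx n _; apply: contrapT => h; apply: nx; exists n => m nm Fm.
  by apply: h; exists m.
Qed.

Lemma ae_conj (P Q : T -> Prop) : {ae mu, forall x, P x} ->
  {ae mu, forall x, Q x} -> {ae mu, forall x, P x /\ Q x}.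
Proof. by move=> hP hQ; apply: filterS2 hP hQ => x ? ?; split. Qed.

Lemma ae_forall (I : choiceType) (P : I -> T -> Prop) : countable [set: I] ->
  (forall i, {ae mu, forall x, P i x}) -> {ae mu, forall x, forall i, P i x}.
Proof.
move=> /countable_injP[g gi] hP.
have H : {ae mu, forall x, forall n i, g i = n -> P i x}.
  apply: ae_foralln => n; have [[i gin]|no] := pselect (exists i, g i = n).
    apply: filterS (hP i) => x hx j gj.
    by have -> : j = i by apply: gi; rewrite ?inE// gj gin.
  by apply: aeW => x i gin; case: no; exists i.
by apply: filterS H => x hx i; exact: hx.
Qed.

Lemma ae_measure0 (S : set T) : measurable S -> mu S = 0 ->
  {ae mu, forall x, ~ S x}.
Proof. by move=> mS S0; exists S; split=> // x /= /contrapT. Qed.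

End Summable.

(** * Green function and linear escape *)

Section Escape.
Variables (R : realType) (N : nat) (k : 'I_N -> nat) (W : groupType).
Variables (s : 'I_N -> W) (hW : fuchsian_coxeter_system k s).
Variables (pb : W -> W -> R) (mass : W -> R).
Local Notation PS := (path_space (1%g : W)).
Variables (Lam : W -> {measure set PS -> \bar R}) (L0 : nat) (eps Q : R).
Hypothesis hw : isotropic_walk s pb mass Lam L0 eps Q.
Variables (A : labelled_graph N) (hA : strongly_automatic s A).
Variables (K : nat) (hK : recurrent_outside s A K).
Local Notation len := (len s).
Local Notation dist := (dist s).
Local Open Scope ereal_scope.

Let cW := countable_W hW.
Let eps0 : (0 < eps)%R. Proof. by case/andP: (iw_eps hw). Qed.
Let mass_gt0 u : (0 < mass u)%R.
Proof. exact: lt_le_trans (iw_mass_ge1 hw u). Qed.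

Let Q2 : (2 <= Q)%R.
Proof.
have [w lw] := len_unbounded R hW 1.
have w1 : w <> 1%g by move=> e; rewrite e len1 in lw.
have [lp0 [i wi]] := par_spec hW hw hA w1; have lp := lp0; rewrite {1}wi in lp.
have /andP[h1 h2] := iw_mass_asc hw lp.
have := le_trans h1 h2; rewrite ler_pM2r//.
Qed.

Lemma mass_le v : (mass v <= Q ^+ len v)%R.
Proof.
move: {2}(len v) (erefl (len v)) => n; elim: n v => [|n IH] v lv.
  by rewrite lv (len_eq0 hW lv) (iw_mass1 hw) expr0.
have v1 : v <> 1%g by move=> e1; rewrite e1 len1 in lv.
have [lp [i vi]] := par_spec hW hw hA v1; rewrite lp exprS.
have lp' := lp; rewrite {1}vi in lp'.
have /andP[_ h] := iw_mass_asc hw lp'; rewrite -vi in h.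
by apply: (le_trans h); rewrite ler_pM2l ?IH//; [lia|have := Q2; lra].
Qed.

Lemma trans_geometric u v : exists b c : R, [/\ (0 <= b < 1)%R &
  forall n, (trans Lam n u v <= c * b ^+ n)%R].
Proof.
have [rho /andP[r0 r1] h] := trans_decay hW hw hA hK.
exists (Num.sqrt rho), (Num.sqrt (mass v)); split=> [|n].
  by rewrite sqrtr_ge0 -sqrtr1 ltr_sqrt.
rewrite -(@ler_pXn2r _ 2)// ?nnegrE ?mulr_ge0 ?exprn_ge0 ?sqrtr_ge0 ?(trans_ge0 Lam n u v)//.
rewrite exprMn -exprM mulnC exprM !sqr_sqrtr ?(ltW r0) ?(ltW (mass_gt0 v))// mulrC.
by apply: le_trans (h n u v); rewrite ler_peMl ?sqr_ge0 ?(iw_mass_ge1 hw).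
Qed.

Lemma kpow_trans n u v : kpow pb n u v = (trans Lam n u v)%:E.
Proof.
elim: n u => [|n IH] u /=; first by rewrite (trans0 hW hw) eq_sym.
rewrite (transS hW hw) (step_opE hW hw); last by move=> z; exact: trans_ge0.
by apply: eq_esum => z _; rewrite IH.
Qed.

Lemma green_lt u v : green pb u v < +oo.
Proof.
have [b [c [b01 h]]] := trans_geometric u v.
rewrite /green; have hs : \sum_(0 <= n <oo) (c * b ^+ n)%:E < +oo.
  have c0 : (0 <= c)%R by have := le_trans (trans_ge0 Lam 0 u v) (h 0%N); rewrite expr0 mulr1.
  rewrite (eq_eseriesr (g := fun n => c%:E * (b ^+ n)%:E))//.
  rewrite nneseriesZl//; last by move=> n _; rewrite lee_fin exprn_ge0//; case/andP: b01.
  by rewrite lte_mul_pinfty ?lee_fin// geometric_summable.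
apply: le_summable hs => n; rewrite kpow_trans lee_fin//.
exact: trans_ge0.
Qed.

Definition green_value (v : W) : R := fine (green pb 1%g v).

Lemma green_ge0 u v : 0 <= green pb u v.
Proof. by apply: nneseries_ge0 => n _ _; rewrite kpow_trans lee_fin (trans_ge0). Qed.

Lemma green_valueE v : (green_value v)%:E = \sum_(0 <= n <oo) (trans Lam n 1%g v)%:E.
Proof.
rewrite fineK; first by apply: eq_eseriesr => n _; exact: kpow_trans.
by rewrite ge0_fin_numE ?green_lt ?green_ge0.
Qed.

Lemma green_value_step v i : (eps * green_value v <= green_value (v * s i)%g)%R.
Proof.
rewrite -lee_fin EFinM !green_valueE -nneseriesZl//; last first.
  by move=> n _; rewrite lee_fin (trans_ge0).
rewrite [leRHS](nneseries_split 0 1); try by move=> n _ _; rewrite lee_fin (trans_ge0).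
rewrite add0n -[leLHS]add0e; apply: leeD; first by apply: sume_ge0 => n _; rewrite lee_fin (trans_ge0).
rewrite -(nneseries_addn 1); try by move=> n; rewrite lee_fin (trans_ge0).
apply: lee_nneseries => n _.
  by rewrite -EFinM lee_fin mulr_ge0 ?(trans_ge0)// ltW.
rewrite -EFinM lee_fin; apply: le_trans (transD hW hw n 1 1%g v (v * s i)%g).
by rewrite mulrC ler_wpM2l ?(trans_ge0)// (trans1 hW hw) (iw_step hw).
all: by move=> *; rewrite lee_fin (trans_ge0).
Qed.

Lemma green_value_gt0 v : (0 < green_value v)%R.
Proof.
have [r rv] := fuchs_generated hW v; rewrite -{}rv; elim/last_ind: r => [|r i IH]; last first.
  by rewrite word_rcons; apply: lt_le_trans (green_value_step _ i); rewrite mulr_gt0.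
rewrite word_nil -lte_fin green_valueE; apply: (@lt_le_trans _ _ 1%:E) => //.
apply: le_trans (nneseries_lim_ge 1 _) => [|n _ _]; last by rewrite lee_fin (trans_ge0).
by rewrite big_nat1 (trans0 hW hw) eqxx.
Qed.

Lemma green_value_dist u v : (eps ^+ dist u v * green_value u <= green_value v)%R.
Proof.
move: {2}(dist u v) (erefl (dist u v)) => n; elim: n v => [|n IH] v e.
  by rewrite e (dist_eq0 hW e) expr0 mul1r.
have [r [sr wr]] := len_spec hW (u^-1 * v)%g.
case/lastP: r sr wr => [|r i]; rewrite -/(dist u v) e // size_rcons => -[sr] wr.
have vE : v = (u * word s r * s i)%g by rewrite -mulgA -word_rcons wr mulgA mulgV mul1g.
have dr : (dist u (u * word s r)%g <= n)%N.
  by rewrite dist_mul -sr len_word.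
have dr2 : dist u (u * word s r)%g = n.
  apply/eqP; rewrite eqn_leq dr/=; have := dist_triangle hW (u * word s r)%g u v.
  have -> : dist (u * word s r)%g v = 1%N by rewrite vE dist_mul (len_s hW).
  by rewrite e addn1 ltnS.
rewrite exprS -mulrA vE; apply: le_trans (green_value_step _ i).
by apply: ler_wpM2l; [exact: ltW|rewrite -{1}dr2; exact: IH].
Qed.

Definition green_len (v : W) : R := (- ln (green_value v / green_value 1%g))%R.

Lemma green_len_lip u v : (green_len v <= green_len u - ln eps * (dist u v)%:R)%R.
Proof.
have h := green_value_dist u v; have gu := green_value_gt0 u; have gv := green_value_gt0 v.
have g1 := green_value_gt0 1%g; have ed : (0 < eps ^+ dist u v)%R by rewrite exprn_gt0.
have : (ln (eps ^+ dist u v * green_value u) <= ln (green_value v))%R by rewrite ler_ln ?posrE ?mulr_gt0.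
rewrite /green_len !ln_div ?posrE// lnM ?posrE// lnXn// -mulr_natr; lra.
Qed.

(** There are at most (N+1)^l elements of length at most l, each reached at time n with probability
    at most rho^(n/2) Q^(l/2). When l is a small fraction of n the decay wins. *)
Lemma escape_prob : exists2 b : R, (0 <= b < 1)%R &
  exists2 h, (0 < h)%N & forall n,
  Lam 1%g [set x | (h * len (x n) <= n)%N] <= (b ^+ n)%:E.
Proof.
have [rho /andP[r0 r1] hd] := trans_decay hW hw hA hK.
(* The decay estimate bounds the square of a transition probability, hence the square of N+1 next to
   [Q]. *)
pose c : R := (((N.+1)%:R ^+ 2) * Q)%R.
have c1 : (1 <= c)%R.
  have a1 : (1 <= (N.+1 ^ 2)%:R :> R)%R by rewrite ler1n expn_gt0.
  by rewrite /c -natrX; apply: (le_trans a1); rewrite ler_peMr//; have := Q2; lra.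
have c0 : (0 < c)%R by lra.
(* A fourth root: one square root because probabilities were squared, another because half of the
   decay is spent on absorbing c^l. *)
pose b := Num.sqrt (Num.sqrt rho).
have b2 : (b ^+ 2 = Num.sqrt rho)%R by rewrite sqr_sqrtr ?sqrtr_ge0.
have b4 : (b ^+ 4 = rho)%R by rewrite (exprM b 2 2) b2 sqr_sqrtr ?ltW.
have b0 : (0 <= b)%R by rewrite sqrtr_ge0.
have b1 : (b < 1)%R.
  rewrite ltNge; apply/negP => b1; have := exprn_ege1 4 b1; rewrite b4; lra.
have [h' hh'] : exists h', (c * rho ^+ h' <= 1)%R.
  have := @cvg_expr R rho; rewrite ger0_norm ?ltW// => /(_ r1) cv.
  have /cvgrPdist_lt /(_ c^-1%R) := cv; rewrite invr_gt0 => /(_ c0) [m _ /(_ m (leqnn _))] /=.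
  rewrite sub0r normrN ger0_norm ?exprn_ge0 ?ltW// => hm; exists m.
  by rewrite mulrC -ler_pdivlMr// div1r ltW.
exists b; first by rewrite b0.
(* The factor 2 leaves rho^(n/2) after c^l is absorbed; the added 1 keeps the constant positive. *)
exists (h'.*2.+1) => // n.
set E := [set x | _]; set l := (n %/ h'.*2.+1)%N.
have hE : Lam 1%g E <= \sum_(v <- ball_seq s l) Lam 1%g [set x | x n = v].
  have mE : measurable (E : set PS) by exact: (mW hW n [set v | (h'.*2.+1 * len v <= n)%N]).
  rewrite (measure_partition cW (Lam 1%g) (fun v => measurable_coord cW n [set v]) mE).
  rewrite (esum_ball hW (u := 1%g) (n := l))//; last first.
    move=> v; rewrite dist1 => lv; apply: etrans (measure0 (Lam 1%g)).
    congr (Lam 1%g _); apply/seteqP; split=> // x [Ex xv].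
    move: Ex; rewrite /E/= xv => Ex; have : (len v <= l)%N by rewrite /l leq_divRL// mulnC.
    lia.
  apply: lee_sum => v _; rewrite mul1g; apply: le_measure; rewrite ?inE.
  - by apply: measurableI => //; exact: (mW hW n [set v]).
  - exact: (mW hW n [set v]).
  - by move=> x [].
apply: (le_trans hE).
under eq_bigr do rewrite -(transE hW hw).
rewrite sumEFin lee_fin.
have tb v : v \in ball_seq s l -> (trans Lam n 1%g v * N.+1%:R ^+ l <= b ^+ n)%R.
  rewrite (mem_ball hW) => vl.
  rewrite -(@ler_pXn2r _ 2)// ?nnegrE ?mulr_ge0 ?exprn_ge0 ?(trans_ge0)//.
  have := hd n 1%g v; rewrite (iw_mass1 hw) mul1r => h.
  have mv : (mass v <= Q ^+ l)%R.
    by apply: (le_trans (mass_le v)); rewrite ler_weXn2l//; have := Q2; lra.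
  have h2 : (trans Lam n 1%g v ^+ 2 <= rho ^+ n * Q ^+ l)%R.
    by apply: (le_trans h); rewrite ler_wpM2l// exprn_ge0// ltW.
  rewrite exprMn; apply: (@le_trans _ _ (rho ^+ n * c ^+ l)%R).
    have -> : (c ^+ l = Q ^+ l * (N.+1%:R ^+ l) ^+ 2)%R.
      by rewrite /c exprMn -!exprM mulrC (mulnC 2%N).
    by rewrite mulrA ler_wpM2r// exprn_ge0// exprn_ge0.
  have ln : (h'.*2.+1 * l <= n)%N by rewrite mulnC /l leq_trunc_div.
  have hl : (2 * (h' * l) <= n)%N.
    move: ln; have -> : (h'.*2.+1 * l = l + 2 * (h' * l))%N by rewrite mulSn -mul2n mulnA.
    exact: leq_trans (leq_addl l _).
  clear vl mv h2 h ln; clearbody l.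
  have [m hlE] : exists m, m = (h' * l)%N by eexists.
  rewrite -hlE in hl.
  have -> : (rho ^+ n = rho ^+ (n - m) * (rho ^+ h') ^+ l)%R.
    rewrite -exprM -hlE -exprD subnK//; lia.
  rewrite -mulrA -exprMn (mulrC (rho ^+ h')%R).
  apply: (@le_trans _ _ (rho ^+ (n - m))%R).
    rewrite ler_piMr ?exprn_ge0 ?(ltW r0)// exprn_ile1//.
    by rewrite mulr_ge0 ?exprn_ge0 ?(ltW r0) ?(ltW c0).
  rewrite -b4 -!exprM ler_wiXn2l ?(ltW b1)//; lia.
have sz : ((\sum_(v <- ball_seq s l) trans Lam n 1%g v) * N.+1%:R ^+ l <=
    b ^+ n * N.+1%:R ^+ l)%R.
  rewrite big_distrl /=.
  apply: (@le_trans _ _ (\sum_(v <- ball_seq s l) b ^+ n)%R).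
    by rewrite big_seq [leRHS]big_seq; apply: ler_sum.
  rewrite big_const_seq count_predT iter_addr_0 -[leLHS]mulr_natr.
  by rewrite ler_wpM2l ?exprn_ge0// -natrX ler_nat size_ball_seq.
by rewrite ler_pM2r ?exprn_gt0 ?ltr0n// in sz.
Qed.

Lemma escape : exists2 h, (0 < h)%N &
  {ae Lam 1%g, forall x, exists n, forall m, (n <= m)%N -> (m < h * len (x m))%N}.
Proof.
have [b b01 [h h0 hb]] := escape_prob; exists h => //.
have H : {ae Lam 1%g, forall x, exists n, forall m, (n <= m)%N ->
    ~ [set y : PS | (h * len (y m) <= m)%N] x}.
  apply: (@ae_eventually_not _ _ _ (Lam 1%g) (fun m => [set y : PS | (h * len (y m) <= m)%N])).
    by move=> n; exact: (mW hW n [set v | (h * len v <= n)%N]).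
  by apply: (le_summable _ hb (geometric_summable b01)).
by apply: filterS H => x [n hn]; exists n => m /hn; rewrite ltnNge => /negP.
Qed.

Lemma bounded_steps x0 :
  {ae Lam x0, forall x, forall n, (dist (x n) (x n.+1) <= L0)%N}.
Proof.
apply: ae_foralln => n.
have h u : {ae Lam x0, forall x, x n = u -> (dist u (x n.+1) <= L0)%N}.
  pose S := [set x : PS | x n = u] `&` shift n @^-1` [set x : PS | (L0 < dist u (x 1%N))%N].
  have mB : measurable ([set x : PS | (L0 < dist u (x 1%N))%N]).
    exact: (mW hW 1 [set v | (L0 < dist u v)%N]).
  have H : {ae Lam x0, forall x, ~ S x}.
  apply: ae_measure0.
    by apply: measurableI; [exact: (mW hW n [set u])|exact: measurable_shift_preimage].
    rewrite /S -[X in X `&` _]setTI (Lam_markov_at hW hw)//.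
    suff -> : Lam u [set x | (L0 < dist u (x 1%N))%N] = 0 by rewrite mule0.
    rewrite (measure_partition cW (Lam u) (fun v => measurable_coord cW 1 [set v]) mB).
    apply: esum1 => v _; apply/eqP; rewrite eq_le measure_ge0 andbT.
    have [uv|uv] := boolP (L0 < dist u v)%N; last first.
      rewrite [X in Lam u X](_ : _ = set0) ?measure0//.
      by apply/seteqP; split=> // z /= [+ zv]; rewrite zv; rewrite (negbTE uv).
    apply: (@le_trans _ _ (Lam u [set x | x 1%N = v])).
      apply: le_measure; rewrite ?inE; last by move=> z [].
        by apply: measurableI => //; exact: (mW hW 1 [set v]).
      exact: (mW hW 1 [set v]).
    by rewrite (Lam_step1 hW hw) (pb_far hW hw).
  apply: filterS H => x hx xn; rewrite leqNgt; apply/negP => hd; apply: hx.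
  by split=> //=; rewrite /shift addn1.
have H := ae_forall cW h.
by apply: filterS H => x hx; exact: hx.
Qed.

End Escape.

(** * Convergence to the boundary *)

Section ExpBeats.
Variables (R : realType) (div : nat -> R) (hdivexp : exponential_growth div).

Lemma bernoulli (d : R) n : 0 <= d -> 1 + n%:R * d <= (1 + d) ^+ n.
Proof.
move=> d0; elim: n => [|n IH]; first by rewrite expr0 mul0r addr0.
rewrite exprS; apply: (@le_trans _ _ ((1 + d) * (1 + n%:R * d))).
  have nd : 0 <= n%:R * d by rewrite mulr_ge0.
  rewrite -natr1; nra.
by rewrite ler_wpM2l// addr_ge0.
Qed.

Lemma exp_beats (B : nat) :
  exists r0, forall r, (r0 <= r)%N -> (B * r.+1)%:R < div r.
Proof.
have [a [c [a1 c0 [n0 _ hn]]]] := hdivexp.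
(* With the square root of a, squaring Bernoulli's inequality gives quadratic growth, which beats
   the linear term. *)
pose d := Num.sqrt a - 1.
have sa : 1 < Num.sqrt a by rewrite -sqrtr1 ltr_sqrt//; lra.
have d0 : 0 < d by rewrite subr_gt0.
pose b : R := B%:R * 2 / (c * d ^+ 2).
have cd : 0 < c * d ^+ 2 by rewrite mulr_gt0 ?exprn_gt0.
exists (maxn n0 (Num.Def.truncn b).+2) => r; rewrite geq_max => /andP[nr br].
apply: lt_le_trans (hn r nr); rewrite natrM.
have rb : b < r%:R.
  by apply: (lt_le_trans (truncnS_gt b)); rewrite ler_nat; exact: ltnW.
have r1 : 1 <= r%:R :> R by rewrite ler1n; lia.
have h : (r%:R * d) ^+ 2 <= a ^+ r.
  have -> : a ^+ r = (Num.sqrt a ^+ r) ^+ 2.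
    by rewrite -exprM mulnC exprM sqr_sqrtr//; lra.
  have rd : 0 <= r%:R * d by rewrite mulr_ge0// ltW.
  rewrite ler_pXn2r ?nnegrE ?exprn_ge0 ?sqrtr_ge0//.
  have := @bernoulli d r (ltW d0); rewrite (_ : 1 + d = Num.sqrt a); last by rewrite /d; ring.
  lra.
have h2 : c * (r%:R * d) ^+ 2 <= c * a ^+ r by rewrite ler_pM2l.
apply: lt_le_trans h2; rewrite exprMn.
have h3 : B%:R * 2 < c * d ^+ 2 * r%:R by rewrite [ltRHS]mulrC -ltr_pdivrMr.
have h4 : B%:R * 2 * r%:R < c * d ^+ 2 * r%:R * r%:R by rewrite ltr_pM2r//; lra.
have B0 : 0 <= B%:R :> R by [].
rewrite -natr1; nra.
Qed.

End ExpBeats.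

(** * Divergence of geodesics along a trajectory *)

Section Geometry.
Variables (R : realType) (N : nat) (k : 'I_N -> nat) (W : groupType).
Variables (s : 'I_N -> W) (hW : fuchsian_coxeter_system k s).
Variables (A : labelled_graph N) (hA : strongly_automatic s A).
Variables (div : nat -> R) (hdiv : divergence_function s div).
Variable hdivexp : exponential_growth div.
Local Notation word := (word s).
Local Notation len := (len s).
Local Notation dist := (dist s).
Local Notation C := (cone s A).
Local Notation pre := (pre s A).

Definition adj (u v : W) : bool := dist u v == 1%N.
Definition above (M : nat) (z : W) : bool := (M < len z)%N.

Lemma adj_s u i : adj u (u * s i)%g.
Proof. by rewrite /adj dist_mul (len_s hW). Qed.

Lemma adjC u v : adj u v = adj v u.
Proof. by rewrite /adj (distC hW). Qed.

Lemma word_path M r u : (M + size r < len u)%N -> exists p,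
  [/\ path adj u p, last u p = (u * word r)%g, size p = size r & all (above M) p].
Proof.
elim: r u => [|i r IH] u /= h; first by exists [::]; rewrite word_nil mulg1.
have lu : (M + size r < len (u * s i)%g)%N by have := len_mulS hW u i; lia.
have [p [p1 p2 p3 p4]] := IH _ lu; exists ((u * s i)%g :: p) => /=.
rewrite adj_s p1 p2 p3 p4 word_cons mulgA andbT; split=> //.
by rewrite /above; lia.
Qed.

Lemma dist_path M u v : (M + dist u v < len u)%N -> exists p,
  [/\ path adj u p, last u p = v, size p = dist u v & all (above M) p].
Proof.
have [r] := len_spec hW (u^-1 * v)%g; rewrite -/(dist u v) => <- wr.
by move=> /word_path; rewrite wr mulgA mulgV mul1g.
Qed.

Lemma pre_adj u n : (n < len u)%N -> adj (pre u n) (pre u n.+1).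
Proof. by move=> /(pre_step hA)[i ->]; exact: adj_s. Qed.

Lemma up_path u M : (M <= len u)%N -> exists p,
  [/\ path adj (pre u M) p, last (pre u M) p = u, size p = (len u - M)%N &
   all (above M) p].
Proof.
suff H d : (d <= len u)%N -> exists p, [/\ path adj (pre u (len u - d)) p,
    last (pre u (len u - d)) p = u, size p = d & all (above (len u - d)) p].
  by move=> Mu; have := H _ (leq_subr M (len u)); rewrite subKn.
elim: d => [|d IH] du.
  by exists [::]; rewrite subn0 (pre_len hA).
have [p [p1 p2 p3 p4]] := IH (ltnW du).
have e : (len u - d = (len u - d.+1).+1)%N by lia.
exists (pre u (len u - d) :: p) => /=; rewrite p1 p2 p3 e pre_adj; last by lia.
split=> //; rewrite /above (len_pre hA) ?ltnSn/=; last by lia.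
by apply: sub_all p4 => z; rewrite /above; lia.
Qed.

Lemma down_path u M n : (M < n)%N -> (n <= len u)%N -> exists p,
  [/\ path adj (pre u n) (rcons p (pre u M)), size p = (n - M).-1 &
   all (above M) p].
Proof.
elim: n => // n IH; rewrite ltnS leq_eqVlt => /orP[/eqP<- nu|Mn nu].
  by exists [::]; rewrite /= adjC pre_adj// subSnn.
have [p [p1 p2 p3]] := IH Mn (ltnW nu).
exists (pre u n :: p) => /=; rewrite p1 p2 p3 adjC pre_adj//.
by split=> //; [lia|rewrite /above (len_pre hA) ?Mn//; lia].
Qed.

(** Climbing from level M to u, following p, and descending to level M below v gives a path that
    avoids the ball of radius M between its end points. If the two geodesics are already apart at
    level R0, divergence bounds its length from below. *)
Lemma div_bound u v M R0 p : (R0 <= M < len u)%N -> (M < len v)%N ->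
  path adj u p -> last u p = v -> all (above M) p ->
  div 0%N <= (dist (pre u R0) (pre v R0))%:R ->
  div (M - R0)%N <= (len u - M + size p + (len v - M))%:R.
Proof.
move=> /andP[RM Mu] Mv pu pv pM hd.
have [p1 [a1 a2 a3 a4]] := up_path (ltnW Mu).
have [p2 [b1 b2 b3]] := down_path Mv (leqnn _).
rewrite (pre_len hA)// in b1.
pose q := p1 ++ p ++ rcons p2 (pre v M).
have sq : size q = (len u - M + size p + (len v - M))%N.
  by rewrite /q !size_cat size_rcons a3 b2; lia.
have pq : path adj (pre u M) q by rewrite /q !cat_path a1 a2 pu pv.
have lq : last (pre u M) q = pre v M by rewrite /q !last_cat last_rcons.
have g0 : pre u 0 = pre v 0 by apply: (gamma_inj hA); rewrite !(gamma_pre hA) !take0.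
have MR : (R0 + (M - R0) = M)%N by rewrite subnKC.
have h1 : (R0 + (M - R0) <= len u)%N by rewrite MR ltnW.
have h2 : (R0 + (M - R0) <= len v)%N by rewrite MR ltnW.
rewrite -sq; have H := hdiv (geodesic_pre hW hA (u := u)) (geodesic_pre hW hA (u := v)) g0 h1 h2 hd.
apply: (H (size q) (fun j => nth 1%g (pre u M :: q) j)); rewrite ?MR//.
- by rewrite -lq (last_nth 1%g).
- by move=> j jq; apply/eqP; move/(pathP 1%g): pq => /(_ j jq).
- move=> j /andP[j0 jq].
  have -> : pre u 0 = 1%g by apply: (len_eq0 hW); rewrite (len_pre hA).
  rewrite /cball /= dist1; case: j j0 jq => // j _ /= jq.
  have : nth 1%g q j \in p1 ++ p ++ p2.
    rewrite /q -rcons_cat -rcons_cat nth_rcons.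
    move: jq; rewrite /q -rcons_cat -rcons_cat size_rcons ltnS => jq.
    by rewrite jq mem_nth.
  have al : all (above M) (p1 ++ p ++ p2) by rewrite !all_cat a4 pM b3.
  by move=> /(allP al); rewrite /above ltnNge => /negP.
Qed.

(** Geodesics within D of each other at level R1 are joined there by a path of bounded length
    outside a slightly smaller ball. Being apart at a much lower level would force that path to be
    long. *)
Lemma pre_close (D : nat) : exists r0, forall u v R0 R1,
  (R1 <= len u)%N -> (R1 <= len v)%N -> (R0 + r0 <= R1)%N ->
  (dist (pre u R1) (pre v R1) <= D)%N ->
  (dist (pre u R0) (pre v R0))%:R < div 0%N.
Proof.
have [r1 hr] := exp_beats hdivexp (3 * D + 2).
exists (r1 + D + 1)%N => u v R0 R1 Ru Rv RR hD.
rewrite ltNge; apply/negP => hd.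
pose u1 := pre u R1; pose v1 := pre v R1; pose M := (R1 - D - 1)%N.
have lu : len u1 = R1 by rewrite (len_pre hA).
have lv : len v1 = R1 by rewrite (len_pre hA).
have [p [p1 p2 p3 p4]] : exists p, [/\ path adj u1 p, last u1 p = v1,
    size p = dist u1 v1 & all (above M) p].
  by apply: dist_path; rewrite lu /M -/u1 -/v1 in hD *; lia.
have R01 : (R0 <= R1)%N by lia.
have := @div_bound u1 v1 M R0 p; rewrite lu lv /u1 /v1 !(pre_pre hA)// -/u1 -/v1.
move=> /(_ _ _ p1 p2 p4 hd) h.
have {}h : div (M - R0)%N <= (R1 - M + size p + (R1 - M))%:R by apply: h; lia.
have := hr (M - R0)%N; have MR : (r1 <= M - R0)%N by lia.
move=> /(_ MR) h2; have := lt_le_trans h2 h; rewrite ltr_nat p3.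
have le : (3 * D + 2 <= (3 * D + 2) * (M - R0).+1)%N by rewrite leq_pmulr.
by rewrite -/u1 -/v1 in hD; lia.
Qed.

Section Trajectory.
Variables (L0 h n0 : nat) (x : nat -> W).
Hypothesis h0 : (0 < h)%N.
Hypothesis xs : forall n, (dist (x n) (x n.+1) <= L0)%N.
Hypothesis xl : forall n, (n0 <= n)%N -> (n < h * len (x n))%N.

Lemma steps_path M n d :
  (forall i, (n <= i <= n + d)%N -> (M + L0 < len (x i))%N) ->
  exists p, [/\ path adj (x n) p, last (x n) p = x (n + d)%N,
    (size p <= L0 * d)%N & all (above M) p].
Proof.
elim: d => [|d IH] hx; first by exists [::]; rewrite addn0.
have [|p [p1 p2 p3 p4]] := IH; first by move=> i hi; apply: hx; lia.
have hnd := hx (n + d)%N; have := xs (n + d) => st.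
have [|q [q1 q2 q3 q4]] := @dist_path M (x (n + d)%N) (x (n + d).+1).
  by apply: leq_ltn_trans (hnd _); lia.
exists (p ++ q); rewrite cat_path last_cat size_cat all_cat p1 p2 q1 q2 p4 q4 addnS.
by split=> //; rewrite q3; nia.
Qed.

Lemma len_traj n : (len (x n) <= len (x 0%N) + L0 * n)%N.
Proof.
elim: n => [|n IH]; first by lia.
by have := len_dist hW (x n.+1) (x n); have := xs n; rewrite mulnS; lia.
Qed.

(** By time n the trajectory has left the ball of radius n/h; half of that radius leaves linear room
    above it for the divergence estimate. *)
Definition radius n := (n %/ h)./2.

Lemma len_radius n j : (n0 <= n <= j)%N -> (n %/ h < len (x j))%N.
Proof.
move=> /andP[nn nj]; rewrite ltn_divLR// mulnC.
exact: leq_ltn_trans nj (xl (leq_trans nn nj)).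
Qed.

(** Between times n and 2n the trajectory itself provides a path of length O(n) outside a ball of
    radius about n/h, whereas geodesics apart at half that radius would need exponential length. *)
Lemma doubling_close : exists n1, forall n j, (n1 <= n)%N -> (n <= j <= 2 * n)%N ->
  (dist (pre (x n) (radius n)) (pre (x j) (radius n)))%:R < div 0%N.
Proof.
set c0 := len (x 0%N).
(* Chosen so that [B] times r + 1 is at least the length of the path in [div_bound], using n <= h (2
   L0 + 3)(r + 1). *)
pose B := (2 * c0 + 5 * L0 * (h * (2 * L0 + 3)))%N.
have [r1 hr] := exp_beats hdivexp B.
exists (n0 + h * (2 * (r1 + L0) + 2))%N => n j nn /andP[nj j2].
rewrite ltNge; apply/negP => hd.
set t := (n %/ h)%N.
have nt : (h * t <= n)%N by rewrite mulnC leq_trunc_div.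
have tn : (n < h * t.+1)%N by rewrite mulnC ltn_ceil.
have rt : (2 * (r1 + L0) + 2 <= t)%N.
  by rewrite /t leq_divRL// mulnC; lia.
have re : radius n = t./2 by [].
clearbody t; rewrite re in hd.
have hl i : (n <= i)%N -> (t < len (x i))%N.
  move=> ni; rewrite -(ltn_pmul2l h0).
  by apply: leq_ltn_trans (leq_trans nt ni) (xl _); lia.
pose M := (t - L0)%N; pose r := (M - t./2)%N.
have [|p [p1 p2 p3 p4]] := @steps_path M n (j - n).
  by move=> i /andP[ni _]; have := hl i ni; rewrite /M; lia.
rewrite subnKC// in p2.
have hn := hl n (leqnn n); have hj := hl j nj.
have Mt : (t./2 <= M < len (x n))%N by rewrite /M; lia.
have Mj : (M < len (x j))%N by rewrite /M; lia.
have hb := div_bound Mt Mj p1 p2 p4 hd.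
have rr : (r1 <= r)%N by rewrite /r /M; lia.
have := lt_le_trans (hr r rr) hb; rewrite ltr_nat.
have ln := len_traj n; have lj := len_traj j.
have e1 : (t.+1 <= (2 * L0 + 3) * r.+1)%N.
  have : (t <= 2 * r + 2 * L0 + 1)%N by rewrite /r /M; lia.
  by clearbody r; nia.
have e2 : (n <= h * ((2 * L0 + 3) * r.+1))%N.
  by apply: leq_trans (ltnW tn) _; rewrite leq_mul.
have e3 : (L0 * n <= L0 * (h * ((2 * L0 + 3) * r.+1)))%N by rewrite leq_mul.
have e4 : (L0 * j <= 2 * (L0 * n))%N by rewrite mulnCA leq_mul.
have e5 : (L0 * (j - n) <= L0 * n)%N by rewrite leq_mul//; lia.
have -> : (B * r.+1 = 2 * (c0 * r.+1) + 5 * (L0 * (h * ((2 * L0 + 3) * r.+1))))%N.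
  by rewrite /B; ring.
have e6 : (c0 <= c0 * r.+1)%N by rewrite leq_pmulr.
rewrite -/c0 in ln lj; lia.
Qed.

(** Induction along doublings. The bound 2 div 0 between times 2n and j holds at the larger radius
    belonging to 2n, and [pre_close] improves it to div 0 at the radius of n, so errors do not
    accumulate. *)
Lemma radius_close : exists n1, forall n j, (n1 <= n <= j)%N ->
  (dist (pre (x n) (radius n)) (pre (x j) (radius n)))%:R <= 2 * div 0%N.
Proof.
have [r0 hr] := pre_close (Num.Def.truncn (2 * div 0%N)).+1.
have [n1 hn] := doubling_close.
exists (n1 + n0 + h * (2 * r0 + 2))%N.
suff H m n j : (j - n < m)%N -> (n1 + n0 + h * (2 * r0 + 2) <= n <= j)%N ->
    (dist (pre (x n) (radius n)) (pre (x j) (radius n)))%:R <= 2 * div 0%N.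
  by move=> n j; exact: H (ltnSn _).
elim: m n j => // m IH n j jm nj.
have [n1n n0n nlej] : [/\ (n1 <= n)%N, (n0 <= n)%N & (n <= j)%N] by split; lia.
have hd d : (dist d.1 d.2)%:R < div 0%N -> 0 < div 0%N by apply: le_lt_trans.
have [j2|j2] := leqP j (2 * n).
  have h1 : (dist (pre (x n) (radius n)) (pre (x j) (radius n)))%:R < div 0%N.
    by apply: hn; rewrite ?nlej.
  have d0 := hd (_, _) h1; lra.
have np : (0 < n)%N.
  by apply: leq_trans (_ : 1 <= h * (2 * r0 + 2))%N _; [rewrite muln_gt0 h0; lia|lia].
have h1 : (dist (pre (x n) (radius n)) (pre (x (2 * n)%N) (radius n)))%:R < div 0%N.
  by apply: hn => //; lia.
have h2 : (dist (pre (x (2 * n)%N) (radius (2 * n))) (pre (x j) (radius (2 * n))))%:R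
    <= 2 * div 0%N.
  by apply: IH; lia.
have h3 : (dist (pre (x (2 * n)%N) (radius n)) (pre (x j) (radius n)))%:R < div 0%N.
  have rad i : (radius i <= i %/ h)%N by rewrite /radius; move: (i %/ h)%N => z; lia.
  apply: (hr _ _ _ (radius (2 * n))).
  - by apply: leq_trans (rad _) _; apply: ltnW; apply: len_radius; lia.
  - by apply: leq_trans (rad _) _; apply: ltnW; apply: len_radius; lia.
  - have t0 : (2 * r0 + 2 <= n %/ h)%N by rewrite leq_divRL// mulnC; lia.
    have t2 : (2 * (n %/ h) <= (2 * n) %/ h)%N.
      by rewrite leq_divRL// -mulnA leq_mul// leq_trunc_div.
    rewrite /radius; move: t0 t2; move: (n %/ h)%N (2 * n %/ h)%N => a b; lia.
  - by rewrite -(ler_nat R); apply: (le_trans h2); apply: ltW; exact: truncnS_gt.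
have := dist_triangle hW (pre (x (2 * n)%N) (radius n)) (pre (x n) (radius n)) (pre (x j) (radius n)).
rewrite -(ler_nat R) natrD; lra.
Qed.

(** At a late visit to [C v] the geodesic to x n passes through v below the level [radius n]. By
    [radius_close] all later geodesics are within 2 div 0 of it at that level, which is too close to
    lie outside [C w]. *)
Lemma deep_trap v w :
  (forall z z', C v z -> ~ C w z' -> 2 * div 0%N < (dist z z')%:R) ->
  (forall n, exists2 m, (n <= m)%N & C v (x m)) ->
  exists n, forall m, (n <= m)%N -> C w (x m).
Proof.
move=> vw io; have [n1 hn] := radius_close.
have [n nn vn] := io (n1 + n0 + h * (2 * len v + 2))%N.
exists n => j nj.
have vr : (len v <= radius n)%N.
  have : (2 * len v + 2 <= n %/ h)%N by rewrite leq_divRL// mulnC; lia.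
  by rewrite /radius; move: (n %/ h)%N => z; lia.
have rn : (radius n <= len (x n))%N.
  apply: leq_trans (ltnW (len_radius (n := n) _)); last by lia.
  by rewrite /radius; move: (n %/ h)%N => z; lia.
have vp : C v (pre (x n) (radius n)).
  by apply: (cone_total hA vn (cone_pre hA _ _)); rewrite (len_pre hA).
apply: (cone_trans _ (cone_pre hA (x j) (radius n))); apply: contrapT => nw.
have := vw _ _ vp nw; rewrite ltNge => /negP; apply; apply: hn; lia.
Qed.

End Trajectory.

(** A geodesic from z to z' leaves [B1] across one edge. More than a steps lead to the far end of
    this edge and more than b steps start at its near end; the edge is counted twice, hence the
    -1. *)
Lemma inner_depth (a b : R) (A1 B1 C1 : set W) : A1 `<=` inner s a B1 ->
  B1 `<=` inner s b C1 -> forall z z', A1 z -> ~ C1 z' -> a + b - 1 < (dist z z')%:R.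
Proof.
move=> AB BC z z' Az Cz; have [r] := len_spec hW (z^-1 * z')%g.
rewrite -/(dist z z') => sr wr.
pose f i := (z * word (take i r))%g.
have f0 : B1 (f 0%N) by rewrite /f take0 word_nil mulg1; exact: inner_in (AB _ Az).
have fn : f (size r) = z' by rewrite /f take_size wr mulgA mulgV mul1g.
have fr i : z' = (f i * word (drop i r))%g.
  by rewrite /f -mulgA -word_cat cat_take_drop wr mulgA mulgV mul1g.
have [i [ir Bi nBi]] : exists i, [/\ (i < size r)%N, B1 (f i) & ~ B1 (f i.+1)].
  apply: contrapT => no; apply: Cz; apply: inner_in; apply: BC; rewrite -fn.
  have H i : (i <= size r)%N -> B1 (f i).
    elim: i => // i IH ir; apply: contrapT => nB; apply: no; exists i.
    by split=> //; apply: IH; exact: ltnW.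
  exact: H.
have /innerP[_ ha] := AB _ Az; have /innerP[_ hb] := BC _ Bi.
have h1 : a < i.+1%:R.
  rewrite ltNge; apply/negP => hi; apply: nBi; apply: ha; apply: le_trans hi.
  by rewrite ler_nat /f dist_mul (leq_trans (len_word s _))// size_take; case: ifP; lia.
have h2 : b < (size r - i)%:R.
  rewrite ltNge; apply/negP => hi; apply: Cz; apply: hb; apply: le_trans hi.
  by rewrite ler_nat (fr i) dist_mul (leq_trans (len_word s _))// size_drop.
rewrite -sr -(subnK (ltnW ir)) natrD; rewrite -natr1 in h1; lra.
Qed.

End Geometry.

(** * Staying in a cone *)

(** [su_L1d] makes two nested collars thicker than 2 div 0, and [su_L1r] keeps a single step of the
    walk from leaving the cone when it starts in the interior. *)
Record setup (R : realType) (N : nat) (k : 'I_N -> nat) (W : groupType)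
    (s : 'I_N -> W) (pb : W -> W -> R) (mass : W -> R)
    (Lam : W -> {measure set (path_space (1%g : W)) -> \bar R})
    (L0 : nat) (eps Q : R) (A : labelled_graph N) (K : nat) (div : nat -> R)
    (L1 : R) (Cov : vertex A -> set W) : Prop := Setup {
  su_W : fuchsian_coxeter_system k s;
  su_w : isotropic_walk s pb mass Lam L0 eps Q;
  su_A : strongly_automatic s A;
  su_K : recurrent_outside s A K;
  su_div : divergence_function s div;
  su_exp : exponential_growth div;
  su_L1d : div 0%N + 1 <= L1;
  su_L1r : L0%:R + 1 <= L1;
  su_Cov : forall t, recurrent t -> covering s L1 t (Cov t) }.

Section Traps.
Variables (R : realType) (N : nat) (k : 'I_N -> nat) (W : groupType).
Variables (s : 'I_N -> W) (pb : W -> W -> R) (mass : W -> R).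
Local Notation PS := (path_space (1%g : W)).
Variables (Lam : W -> {measure set PS -> \bar R}) (L0 : nat) (eps Q : R).
Variables (A : labelled_graph N) (K : nat) (div : nat -> R) (L1 : R).
Variables (Cov : vertex A -> set W).
Hypothesis su : setup k s pb mass Lam L0 eps Q K div L1 Cov.
Let hW := su_W su.
Let hw := su_w su.
Let hA := su_A su.
Let cW := countable_W hW.
Local Notation len := (len s).
Local Notation C := (cone s A).
Local Notation T := (cone_type s A).
Local Notation pre := (pre s A).
Local Notation I1 w := (inner s L1 (cone s A w)).
Local Notation I3 w := (inner s (3%:R * L1) (cone s A w)).

Lemma L1_ge2 : 2 <= L1.
Proof.
have := su_L1r su; have := L0_gt0 hW hw; rewrite -(ler_nat R); lra.
Qed.

Lemma I31 w : I3 w `<=` I1 w.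
Proof. by apply: inner_le; have := L1_ge2; lra. Qed.

Lemma I3C w : I3 w `<=` C w. Proof. exact: inner_in. Qed.
Lemma I1C w : I1 w `<=` C w. Proof. exact: inner_in. Qed.

Lemma recurrent_far w : (K < len w)%N -> recurrent (T w).
Proof. by move=> Kw; apply: (su_K su); rewrite /cball /= dist1; lia. Qed.

Lemma recurrent_len w : recurrent (T w) -> (0 < len w)%N.
Proof.
move=> [r [r0 rp re]]; rewrite lt0n; apply/negP => /eqP /(len_eq0 hW) w1.
have g1 : gamma s A 1%g = [::].
  by apply: size0nil; rewrite (size_gamma hA) len1.
move: r0 rp re; rewrite w1 /cone_type g1 /path_end /=.
case/lastP: r => [//|r e] _ _; rewrite map_rcons last_rcons => e1.
by have := aut_source hA e; rewrite e1 eqxx.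
Qed.

(** The predecessor of w on its geodesic is outside [C w] and at distance at most len g + 1 from w
    g. *)
Lemma inner_len w g (a : R) : recurrent (T w) -> inner s a (C w) (w * g)%g ->
  a < (len g).+1%:R.
Proof.
move=> /recurrent_len lw /innerP[_ h]; rewrite ltNge; apply/negP => ha.
have ln : (len (pre w (len w).-1) < len w)%N by rewrite (len_pre hA); lia.
suff /(cone_len hA) : C w (pre w (len w).-1) by lia.
apply: h; apply: le_trans ha; rewrite ler_nat.
apply: leq_trans (dist_triangle hW w _ _) _; rewrite (distC hW) dist_mul.
have := @dist_pre _ _ _ _ hW _ hA w (len w).-1 (len w).
rewrite (pre_len hA (leqnn (len w))) (distC hW) => ->; lia.
Qed.

Lemma cov_mem w u : recurrent (T w) -> Cov (T w) u ->
  [/\ I3 w (w * u)%g, C (w * u)%g `<=` I1 w & recurrent (T (w * u)%g)].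
Proof.
move=> rw uc; have hc := su_Cov su rw; split.
- exact: (cov_inner hc).
- exact: (cov_cone hc).
- have : [set t' | recurrent t'] (T (w * u)%g); last by [].
  by rewrite -(cov_types hc (erefl (T w))); exists u.
Qed.

Lemma cov_len w u : recurrent (T w) -> Cov (T w) u -> (len w < len (w * u)%g)%N.
Proof.
move=> rw uc; have [h1 _ _] := cov_mem rw uc.
have hc := I3C h1; rewrite (len_cone hW hA hc) dist_mul.
suff : (6 < (len u).+1)%N by lia.
by rewrite -(ltr_nat R); have := inner_len rw h1; have := L1_ge2; lra.
Qed.

Lemma cov_type t t' : recurrent t -> recurrent t' ->
  exists2 u, Cov t u & forall w, T w = t -> T (w * u)%g = t'.
Proof.
move=> rt rt'; have [w0 tw0] := recurrent_rep hA rt.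
have : [set t' | recurrent t'] t' by [].
rewrite -(cov_types (su_Cov su rt) tw0) => -[u uc ut]; exists u => // w tw.
rewrite -ut; apply: (type_tr hA); first by rewrite tw0 tw.
by apply: I3C; rewrite -tw0 in rt uc; have [] := cov_mem rt uc.
Qed.

Lemma deep_element t n : recurrent t -> exists g, forall w, T w = t ->
  [/\ I3 w (w * g)%g, C (w * g)%g `<=` I1 w, T (w * g)%g = t & (n < len g)%N].
Proof.
move=> rt; have [u uc ut] := cov_type rt rt.
elim: n => [|n [g hg]].
  exists u => w tw; rewrite -tw in rt uc; have [h1 h2 _] := cov_mem rt uc.
  split=> //; first exact: ut; have := cov_len rt uc.
  by rewrite (len_cone hW hA (I3C h1)) dist_mul; lia.
exists (u * g)%g => w tw; rewrite mulgA.
have tu := ut _ tw; have [h1 h2 h3 h4] := hg _ tu.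
have [k1 k2 _] : [/\ I3 w (w * u)%g, C (w * u)%g `<=` I1 w & recurrent (T (w * u)%g)].
  by rewrite -tw in rt uc; exact: cov_mem.
split=> //.
- by apply: inner_sub h1 => z /k2; exact: I1C.
- by move=> z /h2 /I1C; exact: k2.
- have cw : C w (w * u * g)%g by apply: I1C; apply: k2; exact: I3C.
  have e1 : (len (w * u * g)%g = len w + len (u * g)%g)%N.
    by rewrite (len_cone hW hA cw) -mulgA dist_mul.
  have e2 := len_cone hW hA (I3C h1); rewrite dist_mul in e2.
  have e3 : (len w < len (w * u)%g)%N by apply: cov_len; rewrite tw.
  move: e1 e2 e3 h4; clear; lia.
Qed.

Definition stay (w : W) : set PS := [set x | forall n, I1 w (x n)].
Definition stay_until (w : W) (n : nat) : set PS :=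
  [set x | forall i, (i <= n)%N -> I1 w (x i)].

Lemma measurable_stay w : measurable (stay w : set PS).
Proof.
apply: measurable_forall; first exact: countableP.
by move=> n; exact: (mW hW n (I1 w)).
Qed.

Lemma stay_until_local w n x y : (forall i, (i <= n)%N -> x i = y i) ->
  stay_until w n x -> stay_until w n y.
Proof. by move=> xy h i ni; have := h i ni; rewrite xy. Qed.

Lemma measurable_stay_until w n : measurable (stay_until w n : set PS).
Proof. exact: (measurable_coords cW (@stay_until_local w n)). Qed.

Local Open Scope ereal_scope.

Section Translation.
Variables (w w' : W) (tw : T w = T w').

Lemma I1_tr g : I1 w (w * g)%g <-> I1 w' (w' * g)%g.
Proof. split; first exact: (inner_tr hA tw).
exact: (inner_tr hA (esym tw)). Qed.

(** From a point of the interior one step remains in the cone, and inside cones of equal type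
    lengths change by the same amounts under right multiplication. Locality of the kernel then
    applies. *)
Lemma pb_tr g h : I1 w (w * g)%g -> pb (w * g)%g (w * h)%g = pb (w' * g)%g (w' * h)%g.
Proof.
move=> /innerP[cg near].
have L01 : (L0%:R <= L1)%R by have := su_L1r su; lra.
have H h' : (len h' <= L0)%N -> C w (w * g * h')%g.
  by move=> lh; apply: near; rewrite dist_mul (le_trans _ L01)// ler_nat.
have -> : (w * h = w * g * (g^-1 * h))%g by rewrite mulgA mulgK.
have -> : (w' * h = w' * g * (g^-1 * h))%g by rewrite mulgA mulgK.
apply: (iw_loc hw) => h' /H ch.
have e1 : (len (w * g * h')%g + len w' = len (w' * g * h')%g + len w)%N.
  by move: ch; rewrite -!mulgA; exact: (len_tr hW hA tw).
have e2 := len_tr hW hA tw cg; lia.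
Qed.

Lemma stay_until_tr n g :
  Lam (w * g)%g (stay_until w n) = Lam (w' * g)%g (stay_until w' n).
Proof.
have out v v' m : ~ I1 v (v * v')%g -> Lam (v * v')%g (stay_until v m) = 0.
  move=> nI; rewrite -(Lam_start_I hW hw); last exact: measurable_stay_until.
  apply: etrans (measure0 (Lam (v * v')%g)); congr (Lam _ _).
  by apply/seteqP; split=> // x [/= x0 /(_ 0%N (leq0n m))]; rewrite x0.
elim: n g => [|n IH] g.
  have [h|h] := pselect (I1 w (w * g)%g); last by rewrite !out//; move/I1_tr.
  have h' : I1 w' (w' * g)%g by exact/I1_tr.
  have one v v' : I1 v (v * v')%g -> Lam (v * v')%g (stay_until v 0) = 1.
    move=> Iv; rewrite -(Lam_start hw (v * v')%g).
    rewrite -(Lam_start_I hW hw); last exact: measurable_stay_until.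
    congr (Lam _ _); apply/seteqP; split=> [x []//|x /= x0]; split=> // i.
    by rewrite leqn0 => /eqP->; rewrite x0.
  by rewrite (one _ _ h) (one _ _ h').
have [h|h] := pselect (I1 w (w * g)%g); last by rewrite !out//; move/I1_tr.
have step v v' : I1 v (v * v')%g -> Lam (v * v')%g (stay_until v n.+1) =
    \esum_(h in [set: W]) ((pb (v * v')%g (v * h)%g)%:E *
      Lam (v * h)%g (stay_until v n)).
  move=> Iv; have -> : stay_until v n.+1 =
      stay_until v 0 `&` shift 1 @^-1` stay_until v n.
    apply/seteqP; split=> x.
      by move=> hx; split=> i hi; apply: hx; lia.
    move=> [h0 h1] [|i] hi; first exact: h0.
    by have := h1 i; rewrite /shift; apply.
  have loc0 (a b : nat -> W) : (forall i, (i <= 1)%N -> a i = b i) ->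
      stay_until v 0 a -> stay_until v 0 b.
    by move=> ab; apply: stay_until_local => i; rewrite leqn0 => /eqP->; exact: ab.
  rewrite (Lam_markov_sum hW hw _ loc0 (measurable_stay_until v n)).
  rewrite (reindex_esum [set: W] [set: W] (fun h => (v * h)%g)); last first.
    split=> //; first by move=> a b _ _; exact: mulgI.
    by move=> z _; exists (v^-1 * z)%g; rewrite // mulgA mulgV mul1g.
  apply: eq_esum => z _; congr (_ * _).
  rewrite -(Lam_step1 hW hw) -[LHS](Lam_start_I hW hw); last first.
    by apply: measurableI; [exact: measurable_stay_until|exact: (mW hW 1 [set (v * z)%g])].
  rewrite -[RHS](Lam_start_I hW hw); last exact: (mW hW 1 [set (v * z)%g]).
  congr (Lam _ _); apply/seteqP; split=> x /= [x0]; first by case.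
  move=> x1; split=> //; split=> // i; rewrite leqn0 => /eqP->; by rewrite x0.
rewrite !step//; last exact/I1_tr.
by apply: eq_esum => z _; rewrite IH pb_tr.
Qed.

Lemma stay_limit v y : Lam y (stay_until v n) @[n --> \oo] --> Lam y (stay v).
Proof.
have -> : stay v = \bigcap_n stay_until v n.
  apply/seteqP; split=> [x h n _ i _|x h n]; first exact: h.
  exact: (h n Logic.I n).
apply: nonincreasing_cvg_mu.
- by rewrite (@le_lt_trans _ _ 1)// ?ltry// (Lam_le1 hw)//; exact: measurable_stay_until.
- by move=> n; exact: measurable_stay_until.
- by apply: bigcapT_measurable => n; exact: measurable_stay_until.
- by move=> m n mn; apply/subsetPset => x h i ni; apply: h; exact: leq_trans mn.
Qed.

Lemma stay_tr g : Lam (w * g)%g (stay w) = Lam (w' * g)%g (stay w').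
Proof.
have h1 := @stay_limit w (w * g)%g; have h2 := @stay_limit w' (w' * g)%g.
have e : (fun n => Lam (w * g)%g (stay_until w n)) =
    (fun n => Lam (w' * g)%g (stay_until w' n)).
  by apply/funext => n; exact: stay_until_tr.
rewrite e in h1; exact: cvg_unique h1 h2.
Qed.

Definition relative (v : W) (x : PS) : PS := fun n => (v^-1 * x n)%g.

Lemma measurable_relative v : measurable_fun setT (relative v).
Proof.
apply: measurable_to_paths => n a.
exact: (mW hW n [set z | (v^-1 * z)%g = a]).
Qed.

Lemma measurable_relative_preimage v (B : set PS) : measurable B ->
  measurable (relative v @^-1` B : set PS).
Proof. by move=> mB; rewrite -[_ @^-1` _]setTI; apply: measurable_relative. Qed.

Lemma stay_cyl v y n z : Lam y (stay v `&` relative v @^-1` cyl n z) =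
  if pselect (forall i, (i <= n)%N -> I1 v (v * z i)%g) then
    Lam y (cyl n (fun i => v * z i)%g) * Lam (v * z n)%g (stay v)
  else 0.
Proof.
have e (x : PS) : @cyl W 1%g n z (relative v x) <-> @cyl W 1%g n (fun i => v * z i)%g x.
  split=> h i ni; have := h i ni; rewrite /relative.
    by move=> <-; rewrite mulgA mulgV mul1g.
  by move=> ->; rewrite mulKg.
case: pselect => [Iz|nI]; last first.
  apply: etrans (measure0 (Lam y)); congr (Lam y _); apply/seteqP; split=> // x [sx /e cx].
  by apply: nI => i ni; rewrite -(cx i ni).
rewrite -(Lam_cyl_shift cW (iw_LamT hw) (iw_ge0 hw) (iw_cyl hw)); last exact: measurable_stay.
congr (Lam y _); apply/seteqP; split=> x.
  by move=> [sx /e cx]; split=> // m; exact: sx.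
move=> [cx sx]; split; last exact/e.
move=> m; have [mn|mn] := leqP m n; first by rewrite cx//; exact: Iz.
by have := sx (m - n)%N; rewrite /shift subnKC// ltnW.
Qed.

(** Both restricted laws are determined by cylinders. There each factor is a step from the interior,
    covered by [pb_tr], and the remaining factor is the probability of staying, covered by
    [stay_tr]. *)
Lemma stay_relative g (B : set PS) : measurable B ->
  Lam (w * g)%g (stay w `&` relative w @^-1` B) =
  Lam (w' * g)%g (stay w' `&` relative w' @^-1` B).
Proof.
move=> mB; pose m v := law_on (Lam (v * g)%g) (measurable_stay v) (measurable_relative v).
apply: (@path_measure_unique _ 1%g R [the measure _ _ of m w] [the measure _ _ of m w'] _ _ _ B mB).
- rewrite /= /m /law_on preimage_setT setIT.
  by rewrite (@le_lt_trans _ _ 1)// ?ltry// (Lam_le1 hw)//; exact: measurable_stay.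
- by rewrite /= /m /law_on !preimage_setT !setIT stay_tr.
move=> n z; rewrite /= /m /law_on !stay_cyl.
have Ie : (forall i, (i <= n)%N -> I1 w (w * z i)%g) <->
    (forall i, (i <= n)%N -> I1 w' (w' * z i)%g).
  by split=> h i ni; have := h i ni; rewrite I1_tr.
case: pselect => [Iz|nI]; case: pselect => [Iz'|nI']//; last 2 first.
- by case: nI'; exact/Ie.
- by case: nI; exact/Ie.
rewrite stay_tr; congr (_ * _); rewrite !(iw_cyl hw); congr (_%:E).
congr (_ * _)%R.
  by rewrite !(inj_eq (@mulgI _ _)).
by apply: eq_bigr => i _; rewrite pb_tr//; apply: Iz; exact: ltnW.
Qed.

End Translation.
End Traps.

(** * Trapping configurations *)

Section TrapExistence.
Variables (R : realType) (N : nat) (k : 'I_N -> nat) (W : groupType).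
Variables (s : 'I_N -> W) (pb : W -> W -> R) (mass : W -> R).
Local Notation PS := (path_space (1%g : W)).
Variables (Lam : W -> {measure set PS -> \bar R}) (L0 : nat) (eps Q : R).
Variables (A : labelled_graph N) (K : nat) (div : nat -> R) (L1 : R).
Variables (Cov : vertex A -> set W).
Hypothesis su : setup k s pb mass Lam L0 eps Q K div L1 Cov.
Let hW := su_W su.
Let hw := su_w su.
Let hA := su_A su.
Let cW := countable_W hW.
Local Notation len := (len s).
Local Notation dist := (dist s).
Local Notation C := (cone s A).
Local Notation T := (cone_type s A).
Local Notation pre := (pre s A).
Local Notation I1 w := (inner s L1 (cone s A w)).
Local Notation I3 w := (inner s (3%:R * L1) (cone s A w)).
Local Notation pv := (path_value s (A := A)).

Local Open Scope ereal_scope.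
Let eps0 : (0 < eps)%R. Proof. by case/andP: (iw_eps hw). Qed.

(** A substitute for infinitely many visits that can be transported by left translation, see
    [big_mul]. *)
Definition charged (U : set W) : Prop := exists2 e : R, (0 < e)%R &
  forall n0, exists2 n, (n0 <= n)%N & e%:E <= Lam 1%g [set x | U (x n)].

Lemma big_sub U V : U `<=` V -> charged U -> charged V.
Proof.
move=> UV [e e0 h]; exists e => // n0; have [n nn hn] := h n0; exists n => //.
apply: (le_trans hn); apply: le_measure; rewrite ?inE; [exact: (mW hW n U)|exact: (mW hW n V)|].
by move=> x /=; exact: UV.
Qed.

(** A first step to [s i] has probability at least eps; from there [iw_base_change] compares the
    walk with the translated one at the cost of a factor [Q]. *)
Lemma big_step i U : charged U -> charged [set (s i * u)%g | u in U].
Proof.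
move=> [e e0 h]; pose V := [set (s i * u)%g | u in U].
have hQ n : e%:E <= Lam 1%g [set x | U (x n)] ->
    (0 < Q)%R /\ (e / Q)%:E <= Lam (s i) [set x | V (x n)].
  move=> hn; have := le_trans hn (iw_base_change hw i n U).
  have -> : [set x : PS | exists2 u, U u & x n = (s i * u)%g] = [set x | V (x n)].
    by apply/seteqP; split=> x [u Uu xn]; exists u.
  have mV := mW hW n V.
  rewrite -(fineK (Lam_fin hw (s i) mV)) -EFinM !lee_fin.
  set l := fine _ => hl; have l0 : (0 <= l)%R by rewrite fine_ge0.
  have Q0 : (0 < Q)%R by nra.
  by split=> //; rewrite ler_pdivrMr// mulrC.
have Q0 : (0 < Q)%R by have [n _ /hQ[]] := h 0%N.
exists (eps * (e / Q))%R; first by rewrite mulr_gt0 ?divr_gt0.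
move=> n0; have [n nn /hQ[_ hn]] := h n0; exists n.+1; first exact: leqW.
have mV := mW hW n V.
apply: (@le_trans _ _ (Lam 1%g (setT `&` [set z | z 1%N = s i] `&` shift 1 @^-1` [set x | V (x n)]))).
  rewrite (Lam_markov_at hW hw)// setTI (Lam_step1 hW hw) EFinM.
  apply: lee_pmul => //; rewrite ?lee_fin ?(ltW eps0) ?divr_ge0 ?(ltW e0) ?(ltW Q0)//.
  by have := iw_step hw 1%g i; rewrite mul1g.
apply: le_measure; rewrite ?inE; last by move=> x [_].
- rewrite setTI; apply: measurableI; first exact: (mW hW 1 [set s i]).
  exact: measurable_shift_preimage.
- exact: (mW hW n.+1 V).
Qed.

Lemma big_mul g U : charged U -> charged [set (g * u)%g | u in U].
Proof.
have [r <-] := fuchs_generated hW g => bU; elim: r => [|i r IH].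
  by apply: big_sub bU => u Uu; exists u => //; rewrite word_nil mul1g.
apply: big_sub (big_step i IH) => _ [_ [u Uu <-] <-]; exists u => //.
by rewrite word_cons mulgA.
Qed.

(** At late times the walk is outside the ball of radius K up to a small probability, hence in one
    of finitely many cones based at length K+1. If none were charged, at some late time all these
    probabilities would be below the inverse of their number plus one. *)
Lemma big_sphere : exists2 w, len w = K.+1 & charged (C w).
Proof.
apply: contrapT => no; pose b := ball_seq s K.+1.
pose e : R := ((size b).+1%:R^-1)%R.
have e0 : (0 < e)%R by rewrite invr_gt0.
have [f hf] : exists f : W -> nat, forall w n, len w = K.+1 -> (f w <= n)%N ->
    Lam 1%g [set x | C w (x n)] < e%:E.
  have : forall w, exists n0, forall n, len w = K.+1 -> (n0 <= n)%N ->
      Lam 1%g [set x | C w (x n)] < e%:E.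
    move=> w; apply: contrapT => nw; have lw : len w = K.+1.
      by apply: contrapT => lw; apply: nw; exists 0%N.
    apply: no; exists w => //; exists e => // n0; apply: contrapT => nn; apply: nw.
    by exists n0 => n _ n0n; rewrite ltNge; apply/negP => h; apply: nn; exists n.
  by move=> /choice[f hf]; exists f => w n; exact: hf.
have [c /andP[c0 c1] [h h0 hc]] := escape_prob hW hw hA (su_K su).
have [n2 hn2] : exists n2, forall n, (n2 <= n)%N -> (c ^+ n < e)%R.
  have := @cvg_expr R c; rewrite ger0_norm// => /(_ c1) cv.
  have /cvgrPdist_lt /(_ e e0) [m _ hm] := cv; exists m => n mn.
  by have := hm n mn; rewrite /= sub0r normrN ger0_norm// exprn_ge0.
pose n := (\max_(w <- b) f w + n2 + h * K)%N.
have fn w : w \in b -> (f w <= n)%N.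
  move=> wb; apply: leq_trans (_ : \max_(w <- b) f w <= n)%N; last by rewrite /n; lia.
  by rewrite (bigD1_seq w)//= ?leq_maxl// /b ball_seq_uniq.
pose g (x : PS) := pre (x n) K.+1.
have mg v : measurable (g @^-1` [set v]).
  exact: (mW hW n [set z | pre z K.+1 = v]).
have := measure_partition cW (Lam 1%g) mg measurableT; rewrite (iw_LamT hw).
rewrite (esum_ball hW (u := 1%g) (n := K.+1))//; last first.
  move=> v; rewrite dist1 => lv; apply: etrans (measure0 (Lam 1%g)).
  congr (Lam 1%g _); apply/seteqP; split=> // x [_ /= gx].
  suff : (len v <= K.+1)%N by rewrite leqNgt lv.
  rewrite -gx /g; have [h1|/ltnW h1] := leqP K.+1 (len (x n)).
    by rewrite (len_pre hA).
  by rewrite (pre_len hA).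
rewrite -/b => h1.
have small v : v \in b -> Lam 1%g (setT `&` g @^-1` [set (1 * v)%g]) <= e%:E.
  move=> vb; rewrite setTI mul1g.
  have := vb; rewrite /b (mem_ball hW) leq_eqVlt => /orP[/eqP lv|lv].
    apply/ltW; apply: le_lt_trans (hf v n lv (fn v vb)).
    apply: le_measure; rewrite ?inE//; first exact: (mW hW n (C v)).
    by move=> x /= <-; exact: cone_pre.
  apply: le_trans (_ : (c ^+ n)%:E <= _); last first.
    by rewrite lee_fin ltW// hn2// /n; lia.
  apply: le_trans (hc n); apply: le_measure; rewrite ?inE//.
    exact: (mW hW n [set v | (h * len v <= n)%N]).
  move=> x /= gx; have lx : (len (x n) <= K)%N.
    rewrite leqNgt; apply/negP => lx; move: lv; rewrite -gx /g (len_pre hA)//; lia.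
  by apply: leq_trans (_ : h * K <= n)%N; [rewrite leq_mul|rewrite /n; lia].
have : \sum_(v <- b) Lam 1%g (setT `&` g @^-1` [set (1 * v)%g]) <= \sum_(v <- b) e%:E.
  by rewrite big_seq [leRHS]big_seq; apply: lee_sum.
rewrite -h1 sumEFin lee_fin big_const_seq count_predT iter_addr_0 leNgt => /negP; apply.
rewrite -mulr_natr /e mulrC ltr_pdivrMr// mul1r ltr_nat; exact: ltnSn.
Qed.

(** Suppose staying is null for the charged cone [C w]. A deep subcone [C v2] of the same type is a
    translate of it, hence charged. Infinitely many visits to [C v2] would, by [deep_trap], confine
    the trajectory to [C v0], inside the interior of [C w]. So almost surely there are finitely many
    visits, against the lower bound at arbitrarily late times. *)
Lemma trap_exists : exists w y, recurrent (T w) /\ 0 < Lam y (stay s A L1 w).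
Proof.
have [w lw bw] := big_sphere.
have rw : recurrent (T w) by apply: (recurrent_far su); rewrite lw.
apply: contrapT => no.
have z0 y : Lam y (stay s A L1 w) = 0.
  apply/eqP; rewrite eq_le measure_ge0 andbT leNgt; apply/negP => h.
  by apply: no; exists w, y.
have [g hg] := deep_element su 0 rw.
have [_ a1 a2 _] := hg w erefl; have [_ b1 b2 _] := hg _ a2.
have [_ c1 c2 _] := hg _ b2.
pose v0 := (w * g)%g; pose v2 := (w * g * g * g)%g.
have bv : charged (C v2).
  apply: big_sub (big_mul (v2 * w^-1)%g bw) => _ [u wu <-].
  have [r [rp -> _]] := coneP hA wu.
  rewrite -mulgA mulKg; apply: (cone_extend hA); rewrite c2; exact: rp.
have deep z z' : C v2 z -> ~ C v0 z' -> (2 * div 0%N < (dist z z')%:R)%R.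
  move=> vz vz'; have := inner_depth hW c1 b1 vz vz'; have := su_L1d su; lra.
pose F n : set PS := [set x | C v2 (x n)].
have mF n : measurable (F n) by exact: (mW hW n (C v2)).
pose S : set PS := [set x | forall n, C v0 (x n)].
have mS : measurable S.
  by apply: measurable_forall; [exact: countableP|move=> n; exact: (mW hW n (C v0))].
have S0 m : Lam 1%g (shift m @^-1` S) = 0.
  rewrite -[X in Lam _ X]setTI (Lam_markov_sum hW hw)//.
  apply: esum1 => y _; suff -> : Lam y S = 0 by rewrite mule0.
  apply/eqP; rewrite eq_le measure_ge0 andbT -(z0 y); apply: le_measure; rewrite ?inE//.
    exact: (measurable_stay su).
  by move=> x Sx n; apply: a1.
have aS : {ae Lam 1%g, forall x, forall m, ~ S (shift m x)}.
  apply: ae_foralln => m; apply: ae_measure0; last exact: S0.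
  exact: measurable_shift_preimage.
have [h h0 esc] := escape hW hw hA (su_K su).
have stp := bounded_steps hW hw 1%g.
have notio : {ae Lam 1%g, forall x, ~ lim_sup_set F x}.
  apply: filterS (ae_conj (ae_conj esc stp) aS) => x [[[n0 xl] xs] nS] Fx.
  have [|m hm] := @deep_trap _ _ _ _ _ hW _ hA div (su_div su) (su_exp su) L0 h n0 x h0 xs xl v2 v0 deep.
    by move=> n; have [m /= nm Fm] := Fx n Logic.I; exists m.
  by apply: (nS m) => n; apply: hm; rewrite leq_addr.
have mL : measurable (lim_sup_set F).
  by apply: bigcapT_measurable => n; apply: bigcup_measurable.
have L0' : Lam 1%g (lim_sup_set F) = 0.
  have [B [mB B0 nB]] := notio; apply/eqP; rewrite eq_le measure_ge0 andbT -B0.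
  by apply: le_measure; rewrite ?inE// => x Fx; apply: nB => /=; exact.
have [e e0 he] := bv.
have cv := @lim_sup_set_cvg _ _ _ (Lam 1%g) F mF.
have fin : Lam 1%g (\bigcup_(k0 in [set k0 | (0 <= k0)%N]) F k0) < +oo.
  rewrite (@le_lt_trans _ _ 1)// ?ltry// (Lam_le1 hw)//; exact: bigcup_measurable.
have {}cv := cv fin; rewrite L0' in cv.
have : e%:E <= 0; last by rewrite lee_fin leNgt e0.
rewrite -(cvg_lim _ cv)//; apply: lime_ge; first by apply/cvg_ex; exists 0.
apply: nearW => n; have [m nm hm] := he n; apply: (le_trans hm).
apply: le_measure; rewrite ?inE; [exact: mF|exact: bigcup_measurable|].
by move=> x Fx; exists m.
Qed.

(** This encodes a state [(t, u, pv r)] of the entry chain: a cone of type t, reached by u from a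
    cone of type t, and entered at the end of r. By [trap_first], walking along r makes its end the
    last entry, since every earlier visit to the deep interior is undone; by [trap_stay] the walk
    may remain in the cone from there. *)
Record trap (t : vertex A) (u : W) (r : seq (edge A)) : Prop := Trap {
  trap_rec : recurrent t;
  trap_cov : Cov t u;
  trap_type : forall w, T w = t -> T (w * u)%g = t;
  trap_path : is_path t r;
  trap_I3 : forall w, T w = t -> I3 w (w * pv r)%g;
  trap_first : forall w, T w = t -> forall i, (i < size r)%N ->
    I3 w (w * pv (take i r))%g ->
    exists2 j, (i <= j < size r)%N & ~ I1 w (w * pv (take j r))%g;
  trap_stay : forall w, T w = t -> 0 < Lam (w * pv r)%g (stay s A L1 w) }.

Lemma adj_pb u v : adj s u v -> (eps <= pb u v)%R.
Proof.
move=> /eqP uv; have [r sr wr] := len_spec hW (u^-1 * v)%g.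
rewrite -/(dist u v) uv in sr; case: r sr wr => [//|i [|//]] _; rewrite word_seq1 => e.
have -> : v = (u * s i)%g by rewrite e mulgA mulgV mul1g.
exact: (iw_step hw).
Qed.

Lemma follow_path (c : nat -> W) l : (forall i, (i < l)%N -> adj s (c i) (c i.+1)) ->
  (eps ^+ l)%:E <= Lam (c 0%N) (cyl l c).
Proof.
move=> h; rewrite (iw_cyl hw) eqxx mul1r lee_fin -[X in (eps ^+ X)%R](card_ord l) -prodr_const.
apply: ler_prod => i _; rewrite (ltW eps0)/=; apply: adj_pb; exact: h.
Qed.

Lemma path_take (t : vertex A) r i : is_path t r -> is_path t (take i r).
Proof. by rewrite -{1}(cat_take_drop i r) is_path_cat => /andP[]. Qed.

Lemma pv_step w r i : (i < size r)%N ->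
  adj s (w * pv (take i r))%g (w * pv (take i.+1 r))%g.
Proof.
move=> ir; case: r ir => [//|e r] ir.
rewrite (take_nth e)// -cats1 pv_cat mulgA.
have -> : pv [:: nth e (e :: r) i] = s (lab (nth e (e :: r) i)).
  by rewrite /path_value /= word_seq1.
exact: (adj_s hW).
Qed.

Lemma trap_data : exists t u r, trap t u r.
Proof.
have [w [y [rw ys]]] := trap_exists.
set t := T w in rw.
have Iy : I1 w y.
  apply: contrapT => nI; move: ys; rewrite -(Lam_start_I hW hw y (measurable_stay su w)).
  move=> h; suff z : Lam y ([set z | z 0%N = y] `&` stay s A L1 w) = 0 by rewrite z ltxx in h.
  apply: etrans (measure0 (Lam y)); congr (Lam y _); apply/seteqP; split=> // x [/= x0 sx].
  by apply: nI; rewrite -x0; exact: sx.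
have [r1 [p1 y1 _]] := coneP hA (I1C Iy).
have [u uc ut] := cov_type su rw rw.
have [Iu Cu _] := cov_mem su rw uc; have tu : T (w * u)%g = t by exact: ut.
have [r0 [p0 /mulgI u0 _]] := coneP hA (I3C Iu).
pose rr := r0 ++ r1.
have prr : is_path t rr.
  by rewrite /rr is_path_cat p0/= -(type_extend hA p0) -u0 tu.
(* [P i]: from the i-th vertex, a deep one, the rest of the path stays in the interior. It holds at
   the vertex [w u], whose cone lies in the interior; cutting at the least such i gives
   [trap_first]. *)
pose P i := [/\ (i <= size rr)%N, I3 w (w * pv (take i rr))%g &
  forall j, (i <= j <= size rr)%N -> I1 w (w * pv (take j rr))%g].
have P0 : P (size r0).
  split.
  - by rewrite /rr size_cat leq_addr.
  - by rewrite /rr take_size_cat// -u0.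
  - move=> j /andP[j1 j2]; apply: Cu; rewrite /rr take_cat ltnNge j1/= pv_cat -u0 mulgA.
    by apply: (cone_extend hA); rewrite tu; exact: path_take.
have [Pm minP] := least_spec P0; set i0 := least P in Pm minP.
have [i0r I0 I0'] := Pm.
have szr : size (take i0 rr) = i0 by rewrite size_takel.
exists t, u, (take i0 rr); split=> //.
- exact: path_take.
- by move=> w' tw'; apply: (inner_tr hA (esym tw')).
- move=> w' tw' i; rewrite szr => ii; rewrite take_takel ?(ltnW ii)// => Ii.
  apply: contrapT => no; suff /minP : P i by rewrite leqNgt ii.
  split; first exact: leq_trans (ltnW ii) i0r.
    by apply: (inner_tr hA tw').
  move=> j /andP[ij jr]; have [j0|j0] := leqP i0 j; first by apply: I0'; rewrite j0.
  apply: contrapT => nI; apply: no; exists j; first by rewrite ij.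
  by rewrite take_takel ?(ltnW j0)// => /(inner_tr hA tw').
- move=> w' tw'; rewrite (stay_tr su tw').
  (* From the cut the remaining path leads to a point from which staying in the interior of
     [C (w u)] has positive probability, and that subcone lies in the interior of [C w]. *)
  pose l := (size rr - i0)%N.
  pose c i := (w * pv (take (i0 + i) rr))%g.
  have cl : c l = (w * u * pv r1)%g.
    by rewrite /c /l subnKC// take_size /rr pv_cat -u0 mulgA.
  have c0 : c 0%N = (w * pv (take i0 rr))%g by rewrite /c addn0.
  rewrite -c0.
  have h1 : (eps ^+ l)%:E <= Lam (c 0%N) (cyl l c).
    by apply: follow_path => i il; rewrite /c addnS; apply: pv_step; rewrite /l in il; lia.
  have h2 : 0 < Lam (c l) (stay s A L1 (w * u)%g).
    by rewrite cl (stay_tr su (w' := w)) ?tu// -y1.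
  apply: (@lt_le_trans _ _ (Lam (c 0%N) (cyl l c `&` shift l @^-1` stay s A L1 (w * u)%g))).
    rewrite (Lam_cyl_shift cW (iw_LamT hw) (iw_ge0 hw) (iw_cyl hw)); last exact: (measurable_stay su).
    apply: mule_gt0 => //; apply: lt_le_trans h1; by rewrite lte_fin exprn_gt0.
  apply: le_measure; rewrite ?inE.
  + apply: measurableI; first exact: measurable_cyl.
    by apply: measurable_shift_preimage => //; exact: (measurable_stay su).
  + exact: (measurable_stay su).
  + move=> x [cx sx] n; have [nl|nl] := leqP n l.
      by rewrite (cx n nl); apply: I0'; rewrite /l in nl; lia.
    have := sx (n - l)%N; rewrite /shift subnKC ?(ltnW nl)// => /I1C; exact: Cu.
Qed.

End TrapExistence.

Lemma ae_mono (R : realType) (d : measure_display) (T : measurableType d)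
    (mu : {measure set T -> \bar R}) (P Q : T -> Prop) :
  (forall x, P x -> Q x) -> {ae mu, forall x, P x} -> {ae mu, forall x, Q x}.
Proof. by move=> PQ; apply: filterS. Qed.

(** * Infinitely many visits to the trap *)

Section Hits.
Variables (R : realType) (N : nat) (k : 'I_N -> nat) (W : groupType).
Variables (s : 'I_N -> W) (pb : W -> W -> R) (mass : W -> R).
Local Notation PS := (path_space (1%g : W)).
Variables (Lam : W -> {measure set PS -> \bar R}) (L0 : nat) (eps Q : R).
Variables (A : labelled_graph N) (K : nat) (div : nat -> R) (L1 : R).
Variables (Cov : vertex A -> set W).
Hypothesis su : setup k s pb mass Lam L0 eps Q K div L1 Cov.
Let hW := su_W su.
Let hw := su_w su.
Let hA := su_A su.
Let cW := countable_W hW.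
Local Notation len := (len s).
Local Notation C := (cone s A).
Local Notation T := (cone_type s A).
Local Notation pre := (pre s A).
Local Notation I1 w := (inner s L1 (cone s A w)).
Local Notation I3 w := (inner s (3%:R * L1) (cone s A w)).
Local Notation pv := (path_value s (A := A)).

Variables (t : vertex A) (u : W) (r : seq (edge A)).
Hypothesis tr : trap s Lam L1 Cov t u r.
Local Notation stay := (stay s A L1).
Local Notation cov_level := (cov_level s Cov K).
Local Open Scope ereal_scope.
Let eps0 : (0 < eps)%R. Proof. by case/andP: (iw_eps hw). Qed.

(** The elements whose coverings make up the levels. *)
Definition source w := len w = K.+1 \/ exists n, cov_level n w.

Lemma level_child n w v : cov_level n w -> Cov (T w) v -> cov_level n.+1 (w * v)%g.
Proof. by move=> lw wv; exists w => //; exists v. Qed.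

Lemma level_far n w : cov_level n w -> (K.+1 < len w)%N.
Proof.
elim: n w => [|n IH] w /= [w' hw' [v vc <-]].
  have lw : len w' = K.+1.
    by case: hw'; rewrite /cball /= dist1 => *; lia.
  by rewrite -lw; apply: (cov_len su) => //; apply: (recurrent_far su); rewrite lw.
have lw := IH _ hw'; apply: (ltn_trans lw); apply: (cov_len su) => //.
by apply: (recurrent_far su); exact: ltnW.
Qed.

Lemma source_far w : source w -> (K < len w)%N.
Proof. by case=> [->//|[n /level_far]]; lia. Qed.

Lemma source_child w v : source w -> Cov (T w) v -> exists n, cov_level n (w * v)%g.
Proof.
move=> [lw|[n lw]] wv; last by exists n.+1; exact: level_child.
exists 0%N; exists w; last by exists v.
by rewrite /cball; split; rewrite /= dist1; lia.
Qed.

Lemma deepest_source x : (K < len x)%N -> exists w, [/\ source w, C w x &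
  forall v, Cov (T w) v -> ~ C (w * v)%g x].
Proof.
move=> Kx; suff H m w : (len x - len w < m)%N -> source w -> C w x ->
    exists w, [/\ source w, C w x & forall v, Cov (T w) v -> ~ C (w * v)%g x].
  apply: (H _ (pre x K.+1) (ltnSn _)); last exact: cone_pre.
  by left; rewrite (len_pre hA).
elim: m w => // m IH w lm sw wx.
have [[v vc vx]|no] := pselect (exists2 v, Cov (T w) v & C (w * v)%g x); last first.
  by exists w; split=> // v vc vx; apply: no; exists v.
have lv := cov_len su (recurrent_far su (source_far sw)) vc.
have lx := cone_len hA vx.
by apply: (IH (w * v)%g) => //; [lia|right; exact: source_child].
Qed.

(** The cones whose last entry yields the type t and the increment u. *)
Definition marked w := exists n w2, [/\ cov_level n w2, T w2 = t & w = (w2 * u)%g].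

Lemma marked_type w : marked w -> T w = t.
Proof. by move=> [n [w2 [_ tw ->]]]; exact: trap_type tr _ tw. Qed.

Lemma pre_extend w r' i : is_path (T w) r' -> pre (w * pv r')%g (len w + i) = (w * pv (take i r'))%g.
Proof.
move=> pr; rewrite /Submission.pre (gamma_extend hA pr) take_cat (size_gamma hA) ltnNge leq_addr/=.
by rewrite addKn pv_cat (gammaP hA w).2.
Qed.

(** The exit demanded in the second clause makes the notion insensitive to what precedes the path:
    it cancels every earlier visit to the cone. *)
Definition entrance w (l : nat) (c : nat -> W) : Prop :=
  [/\ c l = (w * pv r)%g, exists2 i, (i < l)%N & ~ I1 w (c i) &
   forall m, (m < l)%N -> I3 w (c m) -> exists2 j, (m <= j < l)%N & ~ I1 w (c j)].

Lemma entrance_local w l c c' : (forall i, (i <= l)%N -> c i = c' i) ->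
  entrance w l c -> entrance w l c'.
Proof.
move=> cc [h1 [i il h2] h3]; split; first by rewrite -cc.
  by exists i => //; rewrite -cc// ltnW.
move=> m ml; rewrite -cc ?(ltnW ml)// => /(h3 m ml)[j /andP[mj jl] nj].
by exists j; [rewrite mj|rewrite -cc// ltnW].
Qed.

(** A deep point x' of [C x] is neither near the boundary of the deepest source cone containing x
    nor in its exceptional ball, so it lies in the cone of a child [w1] of that source. As the
    source was deepest, [w1] lies in [C x]. A child of [w1] of type t and its child by u follow.
    There are finitely many types, so the lengths are bounded. *)
Lemma far_route : exists J, forall x, (K < len x)%N -> exists w l c,
  [/\ marked w /\ (len x < len w)%N, (l <= J)%N, c 0%N = x,
   forall i, (i < l)%N -> adj s (c i) (c i.+1) & entrance w l c].
Proof.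
have [Lf hL] : exists Lf : vertex A -> nat, forall t0, recurrent t0 -> forall w,
    T w = t0 -> C w `\` \bigcup_(v in Cov t0) C (w * v)%g
      `<=` bdry s (3%:R * L1) (C w) `|` cball s (Lf t0) w.
  suff h t0 : exists n, recurrent t0 -> forall w,
      T w = t0 -> C w `\` \bigcup_(v in Cov t0) C (w * v)%g
      `<=` bdry s (3%:R * L1) (C w) `|` cball s n w.
    by have [f hf] := choice h; exists f => t0; exact: hf.
  have [rt|nt] := pselect (recurrent t0); last by exists 0%N.
  by have [L hL] := cov_exhaust (su_Cov su rt); exists L.
have [uf hu] : exists uf : vertex A -> W, forall t0, recurrent t0 ->
    Cov t0 (uf t0) /\ forall w, T w = t0 -> T (w * uf t0)%g = t.
  suff h t0 : exists v, recurrent t0 -> Cov t0 v /\ forall w, T w = t0 -> T (w * v)%g = t.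
    by have [f hf] := choice h; exists f => t0; exact: hf.
  have [rt|nt] := pselect (recurrent t0); last by exists 1%g.
  by have [v v1 v2] := cov_type su rt (trap_rec tr); exists v.
pose Lb := (\max_t0 Lf t0)%N.
have [gf hg] : exists gf : vertex A -> W, forall t0, recurrent t0 -> forall w, T w = t0 ->
    [/\ I3 w (w * gf t0)%g, C (w * gf t0)%g `<=` I1 w, T (w * gf t0)%g = t0 & (Lb < len (gf t0))%N].
  suff h t0 : exists g, recurrent t0 -> forall w, T w = t0 ->
      [/\ I3 w (w * g)%g, C (w * g)%g `<=` I1 w, T (w * g)%g = t0 & (Lb < len g)%N].
    by have [f hf] := choice h; exists f => t0; exact: hf.
  have [rt|nt] := pselect (recurrent t0); last by exists 1%g.
  by have [g hg] := deep_element su Lb rt; exists g.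
exists ((\max_t0 len (gf t0)) + (\max_t0 len (uf t0)) + len u + size r)%N => x Kx.
have rx := recurrent_far su Kx.
have [wb [sb bx nb]] := deepest_source Kx.
have [g1 g2 g3 g4] := hg _ rx x erefl; set x' := (x * gf (T x))%g in g1 g2 g3.
have xx' := I3C g1.
have rb := recurrent_far su (source_far sb).
have [v vc vx'] : exists2 v, Cov (T wb) v & C (wb * v)%g x'.
  apply: contrapT => no.
  have : (bdry s (3%:R * L1) (C wb) `|` cball s (Lf (T wb)) wb) x'.
    apply: (hL _ rb wb erefl); split; first exact: cone_trans bx _ xx'.
    by move=> [v vc vx]; apply: no; exists v.
  have [_ nbd] : I3 wb x' by apply: inner_sub g1; exact: cone_trans bx.
  move=> [//|]; rewrite /cball /= leqNgt => /negP; apply.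
  apply: leq_ltn_trans (_ : Lb < _)%N; first exact: (leq_bigmax (T wb)).
  have := len_cone hW hA (cone_trans bx xx'); have := len_cone hW hA xx'.
  have := cone_len hA bx; rewrite dist_mul; lia.
pose w1 := (wb * v)%g; have [n1 lv1] := source_child sb vc.
have xw1 : (len x < len w1)%N.
  rewrite ltnNge; apply/negP => h; apply: (nb v vc).
  exact: (cone_total hA vx' xx' h).
have cxw1 : C x w1 by exact: (cone_total hA xx' vx' (ltnW xw1)).
have r1 : recurrent (T w1) by apply: (recurrent_far su); lia.
have [u1 t2] := hu _ r1; pose w2 := (w1 * uf (T w1))%g.
have tw2 : T w2 = t by exact: t2.
have [i12 _ r2] := cov_mem su r1 u1; have c12 := I3C i12.
pose w := (w2 * u)%g.
have uc : Cov (T w2) u by rewrite tw2; exact: trap_cov tr.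
have [i2 _ rw] := cov_mem su r2 uc; have c2 := I3C i2.
have mw : marked w by exists n1.+1, w2; split=> //; exact: level_child.
have tw := marked_type mw.
have pr : is_path (T w) r by rewrite tw; exact: trap_path tr.
pose z := (w * pv r)%g.
have cwz : C w z by exact: (cone_extend hA).
have cxw : C x w by apply: cone_trans cxw1 _ _; apply: cone_trans c12 _ _.
have cxz : C x z by exact: cone_trans cxw _ cwz.
have lz : len z = (len w + size r)%N.
  by rewrite -!(size_gamma hA) /z (gamma_extend hA pr) size_cat.
have xw : (len x < len w)%N.
  have := cov_len su r2 uc; have := cov_len su r1 u1; rewrite -/w1 -/w2 -/w; lia.
have ge i : (pre z (len w + i) = w * pv (take i r))%g by exact: pre_extend.
have lenpv : len (pv r) = size r.
  by have := len_cone hW hA cwz; rewrite dist_mul lz; lia.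
exists w, (len z - len x)%N, (fun i => pre z (len x + i)); split=> //.
- have e1 := len_cone hW hA c12; have e2 := len_cone hW hA c2.
  rewrite !dist_mul in e1 e2.
  have e0 := cone_len hA vx'; have ex := len_cone hW hA xx'; rewrite dist_mul in ex.
  have := @leq_bigmax _ (fun t0 => len (gf t0)) (T x).
  have := @leq_bigmax _ (fun t0 => len (uf t0)) (T w1).
  rewrite -/w1 -/w2 -/w in e0 e1 e2 *; lia.
- by rewrite addn0 (cone_preE hA).
- move=> i il; rewrite addnS; apply: (pre_adj hW hA); lia.
- have nI i : (len x + i < len w)%N -> ~ I1 w (pre z (len x + i)).
    by move=> iw /I1C /(cone_len hA); rewrite (len_pre hA); lia.
  split.
  + by rewrite subnKC ?(pre_len hA)//; lia.
  + by exists 0%N; [lia|apply: nI; lia].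
  + move=> m ml Im; have wm : (len w <= len x + m)%N.
      by rewrite leqNgt; apply/negP => h; apply: (nI m h); exact: (I31 su).
    have := Im; rewrite -(subnKC wm) ge => Im'.
    have [|j /andP[j1 j2] nj] := trap_first tr tw _ Im'; first by lia.
    exists (len w + j - len x)%N; first by lia.
    by rewrite subnKC ?ge//; lia.
Qed.

(** A point of the ball of radius K is first taken to 1 and then out to length K+1. This detour
    never meets the cone of w, whose base is longer than K+1. *)
Lemma route : exists J, forall x, exists w l c,
  [/\ marked w, (l <= J)%N, c 0%N = x,
   forall i, (i < l)%N -> adj s (c i) (c i.+1) & entrance w l c].
Proof.
have [J hJ] := far_route; exists (J + K + K.+1)%N => x.
have [Kx|xK] := ltnP K (len x).
  have [w [l [c [[mw _] lJ c0 ca ce]]]] := hJ x Kx.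
  by exists w, l, c; split=> //; lia.
have [y ly] := len_unbounded R hW K.+1.
have [|w [l [c [[mw yw] lJ c0 ca ce]]]] := hJ y; first by rewrite ly.
pose a := len x; pose b := (a + K.+1)%N.
pose c' i := if (i < a)%N then pre x (a - i) else if (i < b)%N then pre y (i - a) else c (i - b)%N.
have p0 z : pre z 0 = 1%g by apply: (len_eq0 hW); rewrite (len_pre hA).
have near i : (i < b)%N -> (len (c' i) <= K.+1)%N.
  move=> ib; rewrite /c' ib; case: ifP => h.
    by rewrite (len_pre hA) /a; lia.
  by rewrite (len_pre hA) ?ly /b; move: h ib; rewrite /b /a; lia.
have nI i : (i < b)%N -> ~ I1 w (c' i).
  move=> /near h /I1C /(cone_len hA); rewrite ly in yw; lia.
have c'b i : c' (b + i)%N = c i.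
  rewrite /c' addKn ifF; last by rewrite /b; lia.
  by rewrite ifF//; lia.
exists w, (b + l)%N, c'; split=> //.
- by rewrite /b /a; lia.
- rewrite /c'; case: ifP => h; first by rewrite subn0 (pre_len hA).
  have a0 : a = 0%N by lia.
  rewrite ifT; last by rewrite /b; lia.
  by rewrite sub0n p0; apply/esym/(len_eq0 hW).
- move=> i il; have [bi|ib] := leqP b i.
    by rewrite -(subnKC bi) -addnS !c'b; apply: ca; lia.
  have [ia|ai] := ltnP i a.
    have -> : c' i = pre x (a - i.+1).+1 by rewrite /c' ia; congr (pre x _); lia.
    have -> : c' i.+1 = pre x (a - i.+1).
      rewrite /c'; case: ifP => // h; have e : a = i.+1 by lia.
      rewrite ifT; last by rewrite /b; lia.
      by rewrite e !subnn !p0.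
    by rewrite (adjC hW); apply: (pre_adj hW hA); rewrite -/a; lia.
  have -> : c' i = pre y (i - a) by rewrite /c' ib ifF//; lia.
  have -> : c' i.+1 = pre y (i - a).+1.
    have [h|h] := ltnP i.+1 b.
      by rewrite /c' ifF ?h; [congr (pre y _); lia|lia].
    have e : i.+1 = (b + 0)%N by lia.
    rewrite e c'b c0 (pre_len hA)// ly; rewrite /b in e; lia.
  by apply: (pre_adj hW hA); rewrite ly /b in ib *; lia.
- have [e1 [i il e2] e3] := ce; split; first by rewrite c'b.
  + by exists (b + i)%N; [lia|rewrite c'b].
  + move=> m ml Im; have [bm|mb] := leqP b m; last first.
      by have := nI m mb; case; exact: (I31 su).
    move: Im; rewrite -(subnKC bm) c'b => /e3[|j /andP[j1 j2] nj]; first lia.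
    by exists (b + j)%N; [lia|rewrite c'b].
Qed.

Definition hit (m : nat) : set PS :=
  [set x | exists w, [/\ marked w, entrance w m x & stay w (shift m x)]].

Lemma hit_shift n m x : hit m (shift n x) -> hit (n + m)%N x.
Proof.
move=> [w [mw [e1 [i im e2] e3] sw]]; exists w; split=> //; last first.
  by rewrite -shiftD.
split=> //; first by exists (n + i)%N; rewrite // ltn_add2l.
move=> m' m'm; have [nm|mn] := leqP n m'.
  rewrite -{1}(subnKC nm) => /(e3 (m' - n)%N)[|j /andP[j1 j2] nj]; first lia.
  by exists (n + j)%N => //; lia.
by exists (n + i)%N => //; lia.
Qed.

Lemma measurable_hit m : measurable (hit m).
Proof.
apply: measurable_exists => // w.
have [mw|nw] := pselect (marked w); last first.
  by rewrite (_ : (fun _ => _) = set0)//; apply/seteqP; split=> // x [].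
rewrite (_ : (fun _ => _) = [set x : PS | entrance w m x] `&` shift m @^-1` stay w).
  apply: measurableI; last first.
    by apply: measurable_shift_preimage => //; exact: (measurable_stay su).
  exact: (measurable_coords cW (@entrance_local w m)).
by apply/seteqP; split=> x [].
Qed.

(** The favourable event is given coordinate by coordinate, so that its truncations at finite times
    are local and the Markov property applies to their complements in [zero_one]. *)
Lemma hit_window : exists2 J, True & exists2 c : R, (0 < c)%R & forall x,
  exists2 G : nat -> set W, c%:E <= Lam x [set y | forall i, G i (y i)] &
    forall y, (forall i, G i (y i)) -> exists2 m, (m <= J)%N & hit m y.
Proof.
have [J hJ] := route; exists J => //.
have [w0 tw0] := recurrent_rep hA (trap_rec tr).
have ms := measurable_stay su w0.
pose sg := fine (Lam (w0 * pv r)%g (stay w0)).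
have sgE : sg%:E = Lam (w0 * pv r)%g (stay w0) by rewrite fineK// (Lam_fin hw).
have sg0 : (0 < sg)%R by rewrite -lte_fin sgE; exact: trap_stay tr _ tw0.
exists (eps ^+ J * sg)%R; first by rewrite mulr_gt0 ?exprn_gt0.
move=> x; have [w [l [c [mw lJ c0 ca ce]]]] := hJ x.
have tw := marked_type mw; have [cl _ _] := ce.
exists (fun i => if (i <= l)%N then [set c i] else I1 w); last first.
  move=> y hy; exists l => //; exists w; split=> //.
    apply: entrance_local ce => i il; have := hy i; by rewrite il.
  move=> n; rewrite /shift; have := hy (l + n)%N; case: ifP => // h.
  have -> : (l + n = l)%N by lia.
  by move=> ->; rewrite cl; apply: (I31 su); exact: trap_I3 tr _ tw.
apply: (@le_trans _ _ (Lam x (cyl l c `&` shift l @^-1` stay w))).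
  rewrite (Lam_cyl_shift cW (iw_LamT hw) (iw_ge0 hw) (iw_cyl hw)); last exact: (measurable_stay su).
  rewrite EFinM; apply: lee_pmul; rewrite ?lee_fin ?exprn_ge0 ?(ltW eps0) ?(ltW sg0)//.
    rewrite -c0; apply: le_trans (follow_path su ca).
    by rewrite lee_fin ler_wiXn2l// ?(ltW eps0)//; case/andP: (iw_eps hw).
  by rewrite cl sgE (stay_tr su (w := w) (w' := w0))// tw tw0.
apply: le_measure; rewrite ?inE.
- apply: measurableI; first exact: measurable_cyl.
  by apply: measurable_shift_preimage => //; exact: (measurable_stay su).
- apply: measurable_forall; first exact: countableP.
  by move=> i; exact: (mW hW i (if (i <= l)%N then [set c i] else I1 w)).
- move=> y [cy sy] i; case: ifPn => [il|]; first exact: cy.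
  by rewrite -ltnNge => li; have := sy (i - l)%N; rewrite /shift subnKC// ltnW.
Qed.

(** Let M be the supremum of the probabilities of B. A path in B violates the window at some finite
    time, which has probability at most 1 - c, and after that time B again has probability at most
    M. Hence M <= (1 - c) M. *)
Lemma zero_one (c : R) (B : set PS) : (0 < c)%R -> measurable B ->
  (forall x n, B x -> B (shift n x)) ->
  (forall x, exists2 G : nat -> set W, c%:E <= Lam x [set y | forall i, G i (y i)] &
    forall y, (forall i, G i (y i)) -> ~ B y) ->
  forall x, Lam x B = 0.
Proof.
move=> c0 mB sB win.
pose M := ereal_sup (range (fun x => Lam x B)).
have LM x : Lam x B <= M by apply: ereal_sup_ubound; exists x.
have M0 : 0 <= M by apply: le_trans (LM 1%g).
have M1 : M <= 1 by apply: ub_ereal_sup => _ [x _ <-]; exact: (Lam_le1 hw).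
have Mf : M \is a fin_num by rewrite ge0_fin_numE// (le_lt_trans M1)// ltry.
suff H x : Lam x B <= (1 - c)%:E * M.
  have : M <= (1 - c)%:E * M by apply: ub_ereal_sup => _ [x _ <-]; exact: H.
  move=> hM x; apply/eqP; rewrite eq_le measure_ge0 andbT; apply: (le_trans (LM x)).
  rewrite -(fineK Mf) -EFinM !lee_fin in hM M0 *; nra.
have [G hG nG] := win x.
pose D n : set PS := [set y | forall i, (i <= n)%N -> G i (y i)].
have Dl n a b : (forall i, (i <= n)%N -> a i = b i) -> D n a -> D n b.
  by move=> ab h i ni; rewrite -ab//; exact: h.
have mD n : measurable (D n) by exact: (measurable_coords cW (Dl n)).
have mDC n := measurableC (mD n).
have h1 n : Lam x B <= Lam x (B `&` D n) + (1 - c)%:E * M.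
  have -> : Lam x B = Lam x (B `&` D n) + Lam x (B `\` D n).
    by rewrite (measureDI (Lam x) mB (mD n)) addeC.
  rewrite leeD2l//; apply: (@le_trans _ _ (Lam x (~` D n `&` shift n @^-1` B))).
    apply: le_measure; rewrite ?inE; first exact: measurableD.
      by apply: measurableI => //; exact: measurable_shift_preimage.
    by move=> y [By nD]; split=> //; exact: sB.
  rewrite (Lam_markov_sum hW hw)//; last first.
    by move=> a b ab nD /(Dl n b a) h; apply: nD; apply: h => i ni; rewrite ab.
  apply: (@le_trans _ _ (\esum_(y in [set: W]) (M * Lam x (~` D n `&` [set z | z n = y])))).
    by apply: le_esum => y _; rewrite muleC lee_pmul.
  rewrite -(fineK Mf) esumZl ?fine_ge0// (fineK Mf).
  rewrite -(measure_partition cW (Lam x) (fun v => measurable_coord cW n [set v]) (mDC n)).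
  rewrite muleC lee_wpmul2r// (LamC hw)// EFinB leeB//; apply: (le_trans hG).
  apply: le_measure; rewrite ?inE//.
    apply: measurable_forall; first exact: countableP.
    by move=> i; exact: (mW hW i (G i)).
  by move=> y hy i _; exact: hy.
have cv : Lam x (B `&` D n) @[n --> \oo] --> 0.
  have -> : 0 = Lam x (\bigcap_n (B `&` D n)).
    rewrite [X in Lam x X](_ : _ = set0) ?measure0//; apply/seteqP; split=> // y hy.
    have [By _] := hy 0%N Logic.I; apply: (nG y) => // i.
    by have [_ h] := hy i Logic.I; exact: h.
  apply: nonincreasing_cvg_mu.
  - by rewrite (@le_lt_trans _ _ 1)// ?ltry// (Lam_le1 hw)//; exact: measurableI.
  - by move=> n; exact: measurableI.
  - by apply: bigcapT_measurable => n; exact: measurableI.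
  - move=> m n mn; apply/subsetPset => y [By Dy]; split=> // i im.
    by apply: Dy; exact: leq_trans mn.
suff : Lam x B - (1 - c)%:E * M <= 0 by rewrite leeBlDr ?fin_numM// add0e.
rewrite -(cvg_lim _ cv)//.
apply: lime_ge; first by apply/cvg_ex; exists 0.
by apply: nearW => n; rewrite leeBlDr ?fin_numM.
Qed.

Lemma hits_io x0 : {ae Lam x0, forall x, forall n, exists2 m, (n <= m)%N & hit m x}.
Proof.
pose B : set PS := [set x | forall m, ~ hit m x].
have mB : measurable B.
  apply: measurable_forall; first exact: countableP.
  by move=> m; apply: measurableC; exact: measurable_hit.
have [J _ [c c0 win]] := hit_window.
have B0 : forall x, Lam x B = 0.
  apply: (zero_one c0) => //.
    by move=> x n Bx m /hit_shift; exact: Bx.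
  move=> x; have [G h1 h2] := win x; exists G => // y /h2[m _ hm] /(_ m); exact.
have H : {ae Lam x0, forall x, forall n, ~ B (shift n x)}.
  apply: ae_foralln => n; apply: ae_measure0; first exact: measurable_shift_preimage.
  rewrite -[X in Lam _ X]setTI (Lam_markov_sum hW hw)//.
  by apply: esum1 => y _; rewrite B0 mule0.
apply: ae_mono H => x h n; apply: contrapT => no; apply: (h n) => m /hit_shift hm.
by apply: no; exists (n + m)%N => //; exact: leq_addr.
Qed.

End Hits.

(** * A law of large numbers for stationary kernels *)

Lemma measureI_full d (X : measurableType d) (R : realType)
    (mu : {measure set X -> \bar R}) (S B : set X) : measurable S ->
  measurable B -> mu (~` S) = 0%E -> mu (B `&` S) = mu B.
Proof.
move=> mS mB z; have h : mu (B `\` S) = 0%E.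
  apply/eqP; rewrite eq_le measure_ge0 andbT -z; apply: le_measure; rewrite ?inE.
  - exact: measurableD.
  - exact: measurableC.
  - by move=> x [].
apply/esym; apply: etrans (measureDI mu mB mS) _.
apply: (@etrans _ _ (0 + mu (B `&` S))%E); last exact: add0e.
by congr (_ + _)%E.
Qed.

Section CountableIntegral.
Context d (X : measurableType d) (R : realType) (I : choiceType).
Hypothesis cI : countable [set: I].
Variables (f : X -> I) (mf : forall i, measurable (f @^-1` [set i])).
Local Open Scope ereal_scope.

Lemma measurable_fiber (P : set I) : measurable (f @^-1` P).
Proof.
have -> : f @^-1` P = [set x | exists i, (P i /\ f x = i)].
  by apply/seteqP; split=> x /= => [Px|[i [Pi e]]]; [exists (f x)|rewrite e].
apply: measurable_exists => // i; have [Pi|nP] := pselect (P i); last first.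
  by rewrite (_ : (fun _ => _) = set0)//; apply/seteqP; split=> // x [].
rewrite (_ : (fun _ => _) = f @^-1` [set i])//.
by apply/seteqP; split=> x //= [].
Qed.

Lemma measurable_countable_comp d2 (Y : measurableType d2) (D : set X) (G : I -> Y) :
  measurable D -> measurable_fun D (G \o f).
Proof.
move=> mD _ B mB; apply: measurableI => //; rewrite comp_preimage.
exact: measurable_fiber.
Qed.

Lemma integral_countable (mu : {measure set X -> \bar R}) (D : set X)
    (G : I -> \bar R) : measurable D -> (forall i, 0 <= G i) ->
  \int[mu]_(x in D) G (f x) = \esum_(i in [set: I]) (G i * mu (D `&` f @^-1` [set i])).
Proof.
move=> mD G0; have /countable_injP[g injg] := cI.
pose F k := D `&` [set x | g (f x) = k].
have FE i : F (g i) = D `&` f @^-1` [set i].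
  apply/seteqP; split=> x [Dx /= gx]; split => //=; last by rewrite gx.
  by apply: injg gx; rewrite inE.
have F0 k : ~ (g @` [set: I]) k -> F k = set0.
  move=> nk; apply/seteqP; split=> x //= [_ gx]; apply: nk.
  by exists (f x).
have mF k : measurable (F k).
  have [[i _ <-]|/F0 ->//] := pselect ((g @` [set: I]) k).
  by rewrite FE; exact: measurableI.
have tF : trivIset setT F by move=> i j _ _ [x [[_ /= <-] [_ /= <-]]].
have DE : D = \bigcup_k F k.
  apply/seteqP; split=> [x Ax|x [k _ []]//].
  by exists (g (f x)).
have mG : measurable_fun D (fun x => G (f x) : \bar R) := measurable_countable_comp G mD.
rewrite DE in mG.
rewrite [in LHS]DE (ge0_integral_bigcup mu mF mG)//.
rewrite nneseries_esumT; last by move=> n; exact: integral_ge0.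
rewrite [LHS](_ : _ = \esum_(k in g @` [set: I]) \int[mu]_(x in F k) G (f x)); last first.
  rewrite [RHS]esum_mkcond; apply: eq_esum => k _.
  have [kr|nk] := pselect ((g @` [set: I]) k); first by rewrite mem_set.
  by rewrite memNset// F0// integral_set0.
rewrite esum_image; last by move=> i j _ _; apply: injg; rewrite inE.
apply: eq_esum => i _; rewrite -FE -integral_cst//.
apply: eq_integral => x; rewrite inE FE => -[_ /= ->]; by [].
Qed.

End CountableIntegral.

Section MarkovLLN.
Variables (R : realType) (T : choiceType) (t0 : T) (cT : countable [set: T]).
Local Notation PS := (path_space t0).
Variables (kap : T -> T -> R) (Law : T -> {measure set PS -> \bar R}).
Hypothesis Law1 : forall x, Law x setT = 1%E.
Hypothesis kap0 : forall x y, 0 <= kap x y.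
Hypothesis LawE : forall x n (y : nat -> T),
  Law x (cyl n y) = ((y 0%N == x)%:R * \prod_(i < n) kap (y i) (y i.+1))%:E.
Variables (pi : T -> R) (pi0 : forall x, 0 <= pi x).
Local Open Scope ereal_scope.
Hypothesis pi1 : \esum_(t in [set: T]) (pi t)%:E = 1.
Hypothesis pi_inv : forall t', \esum_(t in [set: T]) (pi t * kap t t')%:E = (pi t')%:E.

Let mc n (P : set T) : measurable ([set z | P (z n)] : set PS).
Proof. exact: (measurable_coord cT n P). Qed.

Let Law_le1 x (B : set PS) : measurable B -> Law x B <= 1.
Proof. by move=> mB; rewrite -(Law1 x); apply: le_measure; rewrite ?inE. Qed.

Let Law_fin x (B : set PS) : measurable B -> Law x B \is a fin_num.
Proof.
by move=> mB; rewrite ge0_fin_numE// (@le_lt_trans _ _ 1)// ?ltry// Law_le1.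
Qed.

Let Law_start x y : Law x [set z | z 0%N = y] = (y == x)%:R%:E.
Proof.
have -> : [set z : PS | z 0%N = y] = cyl 0 (fun=> y).
  by apply/seteqP; split=> z /= => [e i|]; [rewrite leqn0 => /eqP->|exact].
by rewrite LawE big_ord0 mulr1.
Qed.

Let Law_step x y : Law x [set z | z 1%N = y] = (kap x y)%:E.
Proof.
rewrite (measure_partition cT (Law x) (fun v => measurable_coord cT 0 [set v]) (mc 1 [set y])).
have h v : [set z : PS | z 1%N = y] `&` (fun z : PS => z 0%N) @^-1` [set v] =
    cyl 1 (fun i => if i is 0%N then v else y).
  apply/seteqP; split=> z /=; first by move=> [z0 z1] [|[|i]].
  by move=> c; split; [exact: (c 1%N)|exact: (c 0%N)].
rewrite (eq_esum (b := fun v => if v \in [set x] then (kap x y)%:E else 0)).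
  by rewrite -esum_mkcond esum_set1// lee_fin.
move=> v _; rewrite [LHS](congr1 (Law x) (h v)) LawE big_ord1.
have [->|nv] := eqVneq v x; first by rewrite mem_set// mul1r.
by rewrite memNset ?mul0r//= => e; rewrite e eqxx in nv.
Qed.

Let shiftE x (B : set PS) : measurable B ->
  Law x (shift 1 @^-1` B) = \esum_(y in [set: T]) ((kap x y)%:E * Law y B).
Proof.
move=> mB; rewrite -[X in Law x X]setTI (Lam_shift cT Law1 kap0 LawE)//.
by apply: eq_esum => y _; rewrite setTI Law_step.
Qed.

Definition Qlaw (B : set PS) : \bar R := \esum_(t in [set: T]) ((pi t)%:E * Law t B).

Let pL0 t B : 0 <= (pi t)%:E * Law t B.
Proof. by rewrite mule_ge0 ?lee_fin. Qed.

Let Qlaw0 : Qlaw set0 = 0.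
Proof. by apply: esum1 => t _; rewrite measure0 mule0. Qed.

Let Qlaw_ge0 B : 0 <= Qlaw B.
Proof. by apply: esum_ge0 => t _. Qed.

Let Qlaw_sigma : semi_sigma_additive Qlaw.
Proof.
move=> F mF tF mUF.
have -> : Qlaw (\bigcup_n F n) = \sum_(0 <= n <oo) Qlaw (F n).
  rewrite nneseries_esumT; last by move=> n; exact: Qlaw_ge0.
  rewrite /Qlaw esum_exchange; last by move=> n t; exact: pL0.
  apply: eq_esum => t _; rewrite esumZl//; congr (_ * _).
  by rewrite measure_bigcup// -nneseries_esumT// ; apply: eq_eseriesl => i; rewrite in_setT.
by apply: is_cvg_nneseries => n _ _.
Qed.

HB.instance Definition _ := isMeasure.Build _ _ _ Qlaw Qlaw0 Qlaw_ge0 Qlaw_sigma.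

Let Q : {measure set PS -> \bar R} := [the measure _ _ of Qlaw].

Let QT : Q setT = 1.
Proof. by rewrite /Q /= /Qlaw -pi1; apply: eq_esum => t _; rewrite Law1 mule1. Qed.

Let Q_shift (B : set PS) : measurable B -> Q (shift 1 @^-1` B) = Q B.
Proof.
move=> mB; rewrite /Q /= /Qlaw.
rewrite (eq_esum (b := fun t => \esum_(y in [set: T])
    ((pi t)%:E * ((kap t y)%:E * Law y B)))); last first.
  by move=> t _; rewrite shiftE// esumZl// => y; rewrite mule_ge0 ?lee_fin.
rewrite esum_exchange; last by move=> t t'; rewrite mule_ge0 ?mule_ge0 ?lee_fin.
apply: eq_esum => t' _; rewrite -pi_inv.
under eq_esum do rewrite muleA -EFinM muleC.
rewrite -(fineK (Law_fin t' mB)) esumZl//; last first.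
  by move=> t; rewrite lee_fin mulr_ge0.
by rewrite muleC.
Qed.

Let Q_coord0 (P : set T) : Q [set z | P (z 0%N)] = \esum_(t in P) (pi t)%:E.
Proof.
rewrite /Q /= /Qlaw [RHS]esum_mkcond; apply: eq_esum => t _.
rewrite (measure_partition cT (Law t) (fun v => measurable_coord cT 0 [set v]) (mc 0 P)).
have [Pt|nP] := pselect (P t).
  rewrite mem_set// (eq_esum (b := fun v => if v \in [set t] then 1 else 0)).
    by rewrite -esum_mkcond esum_set1 ?mule1.
  move=> v _; have [->|nv] := eqVneq v t.
    rewrite mem_set//; transitivity (Law t [set z | z 0%N = t]); last by rewrite Law_start eqxx.
    by congr (Law t _); apply/seteqP; split=> z /= => [[]//|e]; rewrite e.
  rewrite memNset; last by move=> /= e; rewrite e eqxx in nv.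
  apply/eqP; rewrite eq_le measure_ge0 andbT.
  have <- : Law t [set z | z 0%N = v] = 0 by rewrite Law_start (negbTE nv).
  apply: le_measure; rewrite ?inE; [|exact: (mc 0 [set v])|by move=> z []].
  by apply: measurableI; [exact: (mc 0 P)|exact: (mc 0 [set v])].
rewrite memNset// esum1 ?mule0// => v _.
have [Pv|nPv] := pselect (P v); last first.
  apply: etrans (measure0 (Law t)); congr (Law t _).
  by apply/seteqP; split=> // z [/= + zv]; rewrite zv.
have nv : v != t by apply/eqP => e; apply: nP; rewrite -e.
apply/eqP; rewrite eq_le measure_ge0 andbT.
have <- : Law t [set z | z 0%N = v] = 0 by rewrite Law_start (negbTE nv).
apply: le_measure; rewrite ?inE; [|exact: (mc 0 [set v])|by move=> z []].
by apply: measurableI; [exact: (mc 0 P)|exact: (mc 0 [set v])].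
Qed.

Let Q_coord n (P : set T) : Q [set z | P (z n)] = \esum_(t in P) (pi t)%:E.
Proof.
elim: n => [|n IH]; first exact: Q_coord0.
rewrite -IH -(Q_shift (mc n P)); congr (Q _).
Qed.

(** [B] plays the role of one recurrent state: the next step has the same law from all its points.
    In the application it fixes the state and leaves the gap component free. *)
Variable B : set T.
Hypothesis kapB : forall b b' t, B b -> B b' -> kap b t = kap b' t.
Hypothesis hitB : forall t, (0 < pi t)%R -> Law t (~` [set z | exists n, B (z n)]) = 0.

Let mhit : measurable ([set z | exists n, B (z n)] : set PS).
Proof. by apply: measurable_exists; [exact: countableP|move=> n; exact: mc]. Qed.

Lemma stationary_hit_pos : 0 < \esum_(t in B) (pi t)%:E.
Proof.
rewrite lt0e esum_ge0 ?andbT; last by move=> t _; rewrite lee_fin.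
apply/eqP => z.
pose S : set PS := [set z | exists n, B (z n)].
have Q0 : Q (~` S) = 0.
  rewrite /Q /= /Qlaw; apply: esum1 => t _; have [pt|] := ltrP 0%R (pi t).
    by rewrite hitB// mule0.
  by move=> pt; have -> : pi t = 0%R by [apply/eqP; rewrite eq_le pt pi0]; rewrite mul0e.
have Q1 : Q S = 0.
  apply/eqP; rewrite eq_le measure_ge0 andbT.
  have -> : S = \bigcup_n [set z | B (z n)].
    by apply/seteqP; split=> x [n] => [h|_ h]; exists n.
  have mU n : measurable ([set z | B (z n)] : set PS) by exact: mc.
  have h : Q (\bigcup_n [set z | B (z n)]) <= \sum_(0 <= n <oo) Q [set z | B (z n)].
    apply: measure_sigma_subadditive => //; exact: bigcup_measurable.
  apply: (le_trans h); rewrite eseries0// => n _ _; rewrite -[RHS]z; exact: Q_coord.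
have : Q setT = 0.
  by rewrite -(measureI_full (mu := Q) mhit measurableT Q0) setTI.
by rewrite QT => /eqP; rewrite eqe oner_eq0.
Qed.

(** * A maximal ergodic inequality *)

Section Reward.
Variables (p m : T -> R) (p0 : forall t, (0 <= p t)%R) (m0 : forall t, (0 <= m t)%R).
Hypothesis pm : \esum_(t in [set: T]) (pi t * p t)%:E < \esum_(t in [set: T]) (pi t * m t)%:E.

(** The maximum of 0 and the partial sums of p - m up to n, in the recursive form of Garsia's proof
    of the maximal ergodic theorem. *)
Fixpoint maxsum (n : nat) (z : nat -> T) : R :=
  if n is n'.+1 then (Num.max 0 (p (z 0%N) - m (z 0%N) + maxsum n' (shift 1 z)))%R else 0%R.

Let maxsum_ge0 n z : (0 <= maxsum n z)%R.
Proof. by case: n => //= n; rewrite le_max lexx. Qed.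

Let maxsum_local n (z z' : nat -> T) : (forall i, (i <= n)%N -> z i = z' i) ->
  maxsum n z = maxsum n z'.
Proof.
elim: n z z' => //= n IH z z' h; rewrite h//; congr (Num.max _ (_ + _)%R).
by apply: IH => i ni; rewrite /shift h.
Qed.

Let maxsum_step n z : (maxsum n z <= maxsum n.+1 z)%R.
Proof.
elim: n z => [|n IH] z; first exact: (maxsum_ge0 1).
rewrite [leRHS]/= [leLHS]/= ge_max le_max lexx/= le_max lerD2l.
by have := IH (shift 1 z); rewrite /= => ->; rewrite orbT.
Qed.

Let maxsum_mono a b z : (a <= b)%N -> (maxsum a z <= maxsum b z)%R.
Proof.
move=> /subnK <-; elim: (b - a)%N => [|n IH] //.
by rewrite addSn; apply: le_trans IH _; exact: maxsum_step.
Qed.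

Lemma sum_le_maxsum n z : (\sum_(0 <= i < n) (p (z i) - m (z i)) <= maxsum n z)%R.
Proof.
elim: n z => [|n IH] z; first by rewrite big_geq.
rewrite big_nat_recl//= le_max; apply/orP; right; rewrite lerD2l.
by apply: le_trans (IH (shift 1 z)).
Qed.

Definition unbounded : set PS := [set z | forall b : nat, exists n, (b%:R <= maxsum n z)%R].

Let munb : measurable unbounded.
Proof.
apply: measurable_forall; first exact: countableP.
move=> b; apply: measurable_exists; first exact: countableP.
move=> n; apply: (measurable_coords cT (n := n)) => x y xy /=.
by rewrite (maxsum_local xy).
Qed.

Let unb_shift z : unbounded (shift 1 z) <-> unbounded z.
Proof.
split=> h b.
  have [n hn] := h (b + (Num.Def.truncn (m (z 0%N))).+1)%N.
  exists n.+1 => /=; rewrite le_max; apply/orP; right.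
  have := truncnS_gt (m (z 0%N)); have := p0 (z 0%N); rewrite natrD in hn; lra.
have [n hn] := h (b + (Num.Def.truncn (p (z 0%N))).+1)%N; exists n.
have h2 := le_trans hn (maxsum_step n z); move: h2 => /=.
have pt := truncnS_gt (p (z 0%N)); have mz := m0 (z 0%N).
have b0 : (0 <= b%:R :> R)%R by [].
rewrite natrD le_max => /orP[h2|h2]; [have := p0 (z 0%N)|]; lra.
Qed.

Let unb_shiftn n z : unbounded (shift n z) <-> unbounded z.
Proof.
elim: n z => [|n IH] z; first by have -> : shift 0 z = z by apply/funext => i.
by rewrite -[n.+1]addn1 -shiftD unb_shift.
Qed.

Let hB b b' : B b -> B b' -> Law b unbounded = Law b' unbounded.
Proof.
move=> Bb Bb'; have e : unbounded = shift 1 @^-1` unbounded.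
  by apply/seteqP; split=> z hz; [exact: (iffRL (unb_shift z) hz)|exact: (iffLR (unb_shift z) hz)].
rewrite e !shiftE//; apply: eq_esum => t _; by rewrite (kapB t Bb Bb').
Qed.

Let h (t : T) : R := fine (Law t unbounded).

Let hE t : (h t)%:E = Law t unbounded. Proof. by rewrite fineK// Law_fin. Qed.

(** Decomposition by the first time in [B]: the event is invariant under shifts, and its probability
    is the same from every point of [B]. *)
Let unb_hit b t : B b -> Law t (~` [set z | exists n, B (z n)]) = 0 ->
  Law t unbounded = (h b)%:E.
Proof.
move=> Bb hitt.
pose tau n : set PS := [set z | B (z n) /\ forall i, (i < n)%N -> ~ B (z i)].
have tl n x y : (forall i, (i <= n)%N -> x i = y i) -> tau n x -> tau n y.
  move=> xy [Bx nx]; split; first by rewrite -xy.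
  by move=> i ni; rewrite -xy ?(ltnW ni)//; exact: nx.
have mt n : measurable (tau n) by exact: (measurable_coords cT (@tl n)).
have tt : trivIset setT tau.
  apply/trivIsetP => i j _ _ ij; apply/seteqP; split=> // z [[Bi ni] [Bj nj]].
  by have [ij'|ji|e] := ltngtP i j; [exact: (nj i)|exact: (ni j)|rewrite e eqxx in ij].
have tU : \bigcup_n tau n = [set z | exists n, B (z n)].
  apply/seteqP; split=> z; first by move=> [n _ []]; exists n.
  move=> hz; have [n Bn] := hz; have [h1 h2] := @least_spec [set n | B (z n)] n Bn.
  by exists (least [set n | B (z n)]) => //; split=> // i; rewrite ltnNge => /negP hi /h2.
have one : \sum_(0 <= n <oo) Law t (tau n) = 1.
  have e : Law t (\bigcup_n tau n) = 1.
    rewrite tU -(Law1 t) -[X in _ = Law t X](setvU [set z : PS | exists n, B (z n)]).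
    rewrite measureU ?setICl//; last exact: measurableC.
    by rewrite [X in _ = X + _]hitt add0e.
  rewrite -e measure_bigcup//.
  by apply: eq_eseriesl => i; rewrite in_setT.
have each n : Law t (unbounded `&` tau n) = (h b)%:E * Law t (tau n).
  have -> : unbounded `&` tau n = tau n `&` shift n @^-1` unbounded.
    by apply/seteqP; split=> z [z1 z2]; split=> //; apply/unb_shiftn.
  rewrite (Lam_shift cT Law1 kap0 LawE t (@tl n) munb).
  rewrite (measure_partition cT (Law t) (fun v => measurable_coord cT n [set v]) (mt n)).
  rewrite -esumZl ?fine_ge0//; apply: eq_esum => y _; rewrite muleC.
  have [By|nBy] := pselect (B y); first by rewrite (hB By Bb) hE.
  rewrite (_ : tau n `&` _ = set0) ?measure0 ?mule0//.
  by apply/seteqP; split=> // z [[Bz _] /= zn]; apply: nBy; rewrite -zn.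
have full : Law t unbounded = Law t (\bigcup_n (unbounded `&` tau n)).
  by rewrite -setI_bigcupr tU (measureI_full mhit munb hitt).
rewrite full measure_bigcup//; last 2 first.
- by move=> n _; exact: measurableI.
- move=> i j _ _ [z [[_ z1] [_ z2]]]; apply: (tt i j) => //; by exists z.
rewrite (eq_eseriesr (g := fun n => (h b)%:E * Law t (tau n))); last by move=> n _; exact: each.
rewrite nneseriesZl//.
rewrite [X in _ * X = _](_ : _ = 1) ?mule1// -one.
by apply: eq_eseriesl => i; rewrite in_setT.
Qed.

Let hit_B t : Law t (~` [set z | exists n, B (z n)]) = 0 -> exists b, B b.
Proof.
move=> hitt; apply: contrapT => nB; move: hitt.
have -> : ~` [set z : PS | exists n, B (z n)] = setT.
  by apply/seteqP; split=> // z _ [n Bz]; apply: nB; exists (z n).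
by rewrite Law1 => /eqP; rewrite eqe oner_eq0.
Qed.

Let unb_const : exists2 c : R, (0 <= c)%R & forall t, (0 < pi t)%R -> Law t unbounded = c%:E.
Proof.
have [[b Bb]|nB] := pselect (exists b, B b).
  by exists (h b) => [|t /hitB]; [rewrite fine_ge0|exact: unb_hit].
by exists 0%R => // t /hitB /hit_B.
Qed.

Let posT : exists t, (0 < pi t)%R.
Proof.
apply: contrapT => no; have : \esum_(t in [set: T]) (pi t)%:E = 0.
  apply: esum1 => t _; congr (_%:E); apply/eqP; rewrite eq_le pi0 andbT leNgt.
  by apply/negP => pt; apply: no; exists t.
by rewrite pi1 => /eqP; rewrite eqe oner_eq0.
Qed.

(** The event is invariant under shifts and has the same probability c from every charged state. So
    its intersection with a cylinder has c times the probability of the cylinder, and the event is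
    independent of itself. *)
Let unb_zero_one : exists2 c : R, (c == 0%R) || (c == 1%R) &
  forall t, (0 < pi t)%R -> Law t unbounded = c%:E.
Proof.
have [c c0 hc] := unb_const; exists c => //; have [t pt] := posT.
have cylE n y : Law t (unbounded `&` cyl n y) = c%:E * Law t (cyl n y).
  have -> : unbounded `&` cyl n y = cyl n y `&` shift n @^-1` unbounded.
    by apply/seteqP; split=> z [z1 z2]; split=> //; apply/unb_shiftn.
  rewrite (Lam_cyl_shift cT Law1 kap0 LawE t n y munb) muleC.
  have mcyl : measurable (cyl n y : set PS) by exact: measurable_cyl.
  have [z|nz] := eqVneq (Law t (cyl n y)) 0; first by rewrite z !mule0.
  rewrite hc// -lte_fin.
  have <- : Q [set z | z n = y n] = (pi (y n))%:E.
    by rewrite (@Q_coord n [set y n]) esum_set1// lee_fin.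
  apply: (@lt_le_trans _ _ ((pi t)%:E * Law t [set z | z n = y n])).
    apply: mule_gt0; rewrite ?lte_fin//; apply: (@lt_le_trans _ _ (Law t (cyl n y))).
      by rewrite lt0e nz measure_ge0.
    apply: le_measure; rewrite ?inE//; first exact: (mc n [set y n]).
    by move=> z; apply.
  by apply: esum_ge; exists [set t] => //; rewrite fsbig_set1.
have mid : measurable_fun setT (@id PS) by exact: measurable_id.
pose m1 := [the measure _ _ of law_on (Law t) munb mid].
pose m2 := mscale (NngNum c0) (Law t).
have := @path_measure_unique T t0 R m1 m2 _ _ _ unbounded munb.
rewrite /m1 /m2 /= /law_on /mscale /= !preimage_id setIid setIT (hc t pt) Law1 mule1.
have fin : (c%:E : \bar R) < +oo by exact: ltry.
move=> /(_ fin erefl (fun n y => etrans (f_equal _ (erefl _)) (cylE n y))) e.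
have {}e : (c = c * c)%R by apply: EFin_inj; rewrite EFinM.
have : (c * (c - 1) = 0)%R by rewrite mulrBr mulr1 -e subrr.
by move=> /eqP; rewrite mulf_eq0 subr_eq0.
Qed.

Let mlocal (F : (nat -> T) -> R) n : (forall z z', (forall i, (i <= n)%N -> z i = z' i) ->
  F z = F z') -> forall D : set PS, measurable D -> measurable_fun D ((fun z => (F z)%:E) : PS -> \bar R).
Proof.
move=> Fl D mD _ Y mY; apply: measurableI => //.
apply: (measurable_coords cT (n := n)) => x y xy /=; by rewrite (Fl x y).
Qed.

Let int0 (g : T -> R) (D : set PS) : (forall t, (0 <= g t)%R) -> measurable D -> Q (~` D) = 0 ->
  \int[Q]_(z in D) (g (z 0%N))%:E = \esum_(t in [set: T]) (pi t * g t)%:E.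
Proof.
move=> g0 mD D0.
rewrite (integral_countable cT (f := fun z : PS => z 0%N) (fun v => measurable_coord cT 0 [set v]) Q mD
  (G := fun t => (g t)%:E)); last by move=> t; rewrite lee_fin.
apply: eq_esum => t _; rewrite setIC (measureI_full mD _ D0); last exact: (mc 0 [set t]).
have -> : Q ((fun z : PS => z 0%N) @^-1` [set t]) = (pi t)%:E.
  by apply: etrans (@Q_coord 0 [set t]) _; rewrite esum_set1// lee_fin.
by rewrite -EFinM mulrC.
Qed.

Let QC0 : Q (~` setT) = 0. Proof. by rewrite setCT measure0. Qed.

(** Otherwise the event has full measure. The truncation [g n] of m satisfies maxsum (n+1) + g n = p
    + maxsum n of the shifted path, so its mean is at most that of p, while [g n] increases to m on
    the event. No means are subtracted, so m may have infinite mean. *)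
Lemma garsia t : (0 < pi t)%R -> Law t unbounded = 0.
Proof.
move=> pt; have [c /orP[/eqP c0|/eqP c1] hc] := unb_zero_one; first by rewrite hc// c0.
exfalso; have Qunb : Q (~` unbounded) = 0.
  rewrite /Q /= /Qlaw; apply: esum1 => t' _; have [pt'|pt'] := ltrP 0%R (pi t').
    suff -> : Law t' (~` unbounded) = 0 by rewrite mule0.
    have mC := measurableC munb.
    have h1 : Law t' setT = Law t' (~` unbounded) + Law t' unbounded.
      by rewrite -[X in Law t' X = _](setvU unbounded) measureU ?setICl.
    have h2 := hc _ pt'; rewrite Law1 h2 c1 -(fineK (Law_fin t' mC)) -EFinD in h1.
    rewrite -(fineK (Law_fin t' mC)); congr (_%:E).
    have h3 : (1 = fine (Law t' (~` unbounded)) + 1)%R by apply: EFin_inj; exact: h1.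
    lra.
  by have -> : pi t' = 0%R by [apply/eqP; rewrite eq_le pt' pi0]; rewrite mul0e.
pose I n := \int[Q]_z (maxsum n z)%:E.
pose Ip := \esum_(t in [set: T]) (pi t * p t)%:E.
pose g n (z : PS) : \bar R := (Num.min (m (z 0%N)) (p (z 0%N) + maxsum n (shift 1 z)))%:E.
have mM n : measurable_fun setT ((fun z => (maxsum n z)%:E) : PS -> \bar R).
  by apply: (mlocal (n := n)) => // *; exact: maxsum_local.
have shl n (x y : nat -> T) : (forall i, (i <= n.+1)%N -> x i = y i) ->
    maxsum n (shift 1 x) = maxsum n (shift 1 y).
  by move=> xy; apply: maxsum_local => i ni; rewrite /shift xy.
have mg n (D : set PS) : measurable D -> measurable_fun D (g n).
  by apply: (mlocal (n := n.+1)) => x y xy; rewrite (shl _ _ _ xy) xy.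
have g0 n z : 0 <= g n z by rewrite lee_fin le_min m0 addr_ge0.
have Ip0 : \int[Q]_z (p (z 0%N))%:E = Ip by rewrite int0.
have Ifin n : \int[Q]_z (maxsum n (shift 1 z))%:E = I n.
  have ms := measurable_shift cT 1 (t := t0).
  rewrite -[LHS](@ge0_integral_pushforward _ _ PS PS R (shift 1) ms Q setT
    (fun z => (maxsum n z)%:E))//; last by move=> z _; rewrite lee_fin.
  by apply: eq_measure_integral => S mS _; exact: Q_shift.
have step n : I n.+1 + \int[Q]_z g n z = Ip + I n.
  have m1 : measurable_fun setT ((fun z => (p (z 0%N))%:E) : PS -> \bar R).
    by apply: (mlocal (F := fun z => p (z 0%N)) (n := 0)) => // x y ->.
  have m2 : measurable_fun setT ((fun z => (maxsum n (shift 1 z))%:E) : PS -> \bar R).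
    apply: (mlocal (F := fun z => maxsum n (shift 1 z)) (n := n.+1)) => //; exact: shl.
  have e1 : \int[Q]_z ((p (z 0%N))%:E + (maxsum n (shift 1 z))%:E) = Ip + I n.
    rewrite (ge0_integralD Q measurableT _ m1 _ m2) ?Ip0 ?Ifin// => z _; by rewrite lee_fin.
  have e2 : \int[Q]_z ((maxsum n.+1 z)%:E + g n z) = I n.+1 + \int[Q]_z g n z.
    rewrite (ge0_integralD Q measurableT _ (mM n.+1) _ (mg n _ measurableT))// => z _.
    by rewrite lee_fin.
  rewrite -e1 -e2.
  apply: eq_integral => z _; rewrite -!EFinD; congr (_%:E) => /=.
  by rewrite /Num.min /Num.max; case: ltP => h1; case: ltP => h2; lra.
have If n : I n < +oo.
  elim: n => [|n IH]; first by rewrite /I /= integral0.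
  have : I n.+1 <= Ip + I n by rewrite -step leeDl// integral_ge0.
  move=> /le_lt_trans; apply; apply: lte_add_pinfty => //.
  by apply: lt_le_trans pm _; exact: leey.
have I0 n : 0 <= I n by apply: integral_ge0 => z _; rewrite lee_fin.
have le n : \int[Q]_(z in unbounded) g n z <= Ip.
  apply: (@le_trans _ _ (\int[Q]_z g n z)).
    by apply: ge0_subset_integral => //; exact: mg.
  have h1 : I n <= I n.+1.
    apply: ge0_le_integral => // z _; rewrite lee_fin//; exact: maxsum_step.
  have h2 : I n + \int[Q]_z g n z <= I n + Ip.
    by rewrite [leRHS]addeC -step leeD2r.
  by rewrite leeD2lE// ge0_fin_numE in h2.
have := @cvg_monotone_convergence _ PS R Q unbounded munb g (fun n => mg n _ munb)
  (fun n z _ => g0 n z).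
have gnd z : unbounded z -> {homo g ^~ z : a b / (a <= b)%N >-> a <= b}.
  move=> _ a b ab; rewrite lee_fin le_min ge_min lexx/= ge_min lerD2l.
  by rewrite maxsum_mono// orbT.
move=> /(_ gnd) cv.
have lim : \int[Q]_(z in unbounded) limn (g ^~ z) = \esum_(t in [set: T]) (pi t * m t)%:E.
  rewrite -(int0 m0 munb Qunb); apply: eq_integral => z; rewrite inE => uz.
  apply: lim_near_cst => //.
  have [n hn] := (iffRL (unb_shift z) uz) (Num.Def.truncn (m (z 0%N))).+1.
  exists n => // k /= nk; congr (_%:E); apply/min_idPl.
  have := maxsum_mono (shift 1 z) nk; have := truncnS_gt (m (z 0%N)).
  have := p0 (z 0%N); lra.
rewrite lim in cv.
have : \esum_(t in [set: T]) (pi t * m t)%:E <= Ip.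
  rewrite -(cvg_lim _ cv)//; apply: lime_le; first by apply/cvg_ex; eexists; exact: cv.
  by apply: nearW => n; exact: le.
by rewrite leNgt pm.
Qed.

Lemma garsia_hit t : Law t (~` [set z | exists n, B (z n)]) = 0 -> Law t unbounded = 0.
Proof.
move=> hitt; have [b Bb] := hit_B hitt; have [t1 pt1] := posT.
by rewrite (unb_hit Bb hitt) -(unb_hit Bb (hitB pt1)) garsia.
Qed.

Lemma sums_bounded t : Law t (~` [set z | exists n, B (z n)]) = 0 ->
  {ae Law t, forall z, exists b : nat, forall n,
    (\sum_(0 <= i < n) (p (z i) - m (z i)) <= b%:R)%R}.
Proof.
move=> pt; have H := ae_measure0 munb (garsia_hit pt).
apply: ae_mono H => z nz; apply: contrapT => no; apply: nz => b.
apply: contrapT => nb; apply: no; exists b => n; apply: (le_trans (sum_le_maxsum n z)).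
by rewrite leNgt; apply/negP => bn; apply: nb; exists n; exact: ltW.
Qed.

End Reward.

Let esum_piZ (c : R) : (0 <= c)%R -> \esum_(t in [set: T]) (pi t * c)%:E = c%:E.
Proof.
move=> c0; under eq_esum do rewrite mulrC EFinM.
by rewrite esumZl ?pi1 ?mule1// => t; rewrite lee_fin.
Qed.

Lemma lln_upper (f : T -> R) (mu e : R) : (forall t, 0 <= f t)%R -> (0 < e)%R ->
  \esum_(t in [set: T]) (pi t * f t)%:E = mu%:E ->
  forall t, Law t (~` [set z | exists n, B (z n)]) = 0 -> {ae Law t, forall z, exists b : nat, forall n,
    (\sum_(0 <= i < n) f (z i) <= n%:R * (mu + e) + b%:R)%R}.
Proof.
move=> f0 e0 fE t pt.
have mu0 : (0 <= mu)%R.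
  by rewrite -lee_fin -fE; apply: esum_ge0 => t' _; rewrite lee_fin mulr_ge0.
have c0 : (0 <= mu + e)%R by rewrite addr_ge0// ltW.
have := @sums_bounded f (fun=> (mu + e)%R) f0 (fun=> c0) _ t pt.
rewrite fE esum_piZ// lte_fin ltrDl => /(_ e0); apply: ae_mono => z [b hb].
exists b => n; have := hb n; rewrite sumrB big_const_nat iter_addr_0 subn0 -mulr_natl; lra.
Qed.

(** The constant c takes the place of p and f that of m, so the mean of f may be infinite; this
    serves to refute an infinite mean gap later. *)
Lemma lln_lower (f : T -> R) (c : R) : (forall t, 0 <= f t)%R -> (0 <= c)%R ->
  c%:E < \esum_(t in [set: T]) (pi t * f t)%:E ->
  forall t, Law t (~` [set z | exists n, B (z n)]) = 0 -> {ae Law t, forall z, exists b : nat, forall n,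
    (n%:R * c <= \sum_(0 <= i < n) f (z i) + b%:R)%R}.
Proof.
move=> f0 c0 fc t pt.
have := @sums_bounded (fun=> c) f (fun=> c0) f0 _ t pt.
rewrite esum_piZ// => /(_ fc); apply: ae_mono => z [b hb].
exists b => n; have := hb n; rewrite sumrB big_const_nat iter_addr_0 subn0 -mulr_natl; lra.
Qed.

End MarkovLLN.

(** * Renewal structure of the last entry times *)

Section Entrances.
Variables (R : realType) (N : nat) (k : 'I_N -> nat) (W : groupType).
Variables (s : 'I_N -> W) (pb : W -> W -> R) (mass : W -> R).
Local Notation PS := (path_space (1%g : W)).
Variables (Lam : W -> {measure set PS -> \bar R}) (L0 : nat) (eps Q : R).
Variables (A : labelled_graph N) (K : nat) (div : nat -> R) (L1 : R).
Variables (Cov : vertex A -> set W).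
Hypothesis su : setup k s pb mass Lam L0 eps Q K div L1 Cov.
Let hW := su_W su.
Let hw := su_w su.
Let hA := su_A su.
Let cW := countable_W hW.
Local Notation len := (len s).
Local Notation dist := (dist s).
Local Notation C := (cone s A).
Local Notation T := (cone_type s A).
Local Notation I1 w := (inner s L1 (cone s A w)).
Local Notation I3 w := (inner s (3%:R * L1) (cone s A w)).
Local Notation pv := (path_value s (A := A)).

Local Notation stay := (stay s A L1).
Local Notation cov_level := (cov_level s Cov K).
Local Notation le k x := (last_entry s L1 Cov K x k).
Local Notation ec k x := (entry_cone s L1 Cov K x k).

Definition enter w m (x : nat -> W) : Prop :=
  I3 w (x m) /\ forall n, (m <= n)%N -> I1 w (x n).

Definition first_enter w m (x : nat -> W) : Prop :=
  I3 w (x m) /\ forall m', (m' < m)%N -> I3 w (x m') ->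
    exists2 j, (m' <= j < m)%N & ~ I1 w (x j).

(** Being the last entry time is split into a condition on the path up to m and one on the path from
    m on, as the Markov property requires. *)
Definition Ent w m : set PS := [set x | first_enter w m x /\ stay w (shift m x)].

Lemma first_enter_local w m x y : (forall i, (i <= m)%N -> x i = y i) ->
  first_enter w m x -> first_enter w m y.
Proof.
move=> xy [h1 h2]; split; first by have := h1; rewrite xy.
move=> m' mm; rewrite -xy ?(ltnW mm)// => /(h2 m' mm)[j /andP[j1 j2] nj].
by exists j; [rewrite j1|rewrite -xy// ltnW].
Qed.

Lemma measurable_Ent w m : measurable (Ent w m).
Proof.
apply: measurableI; first exact: (measurable_coords cW (@first_enter_local w m)).
by apply: measurable_shift_preimage => //; exact: (measurable_stay su).
Qed.

Lemma stay_from w m n x : stay w (shift m x) -> (m <= n)%N -> I1 w (x n).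
Proof. by move=> h mn; have := h (n - m)%N; rewrite /shift subnKC. Qed.

Lemma Ent_enter w m x : Ent w m x -> enter w m x.
Proof. by move=> [[h1 _] h]; split=> // n mn; exact: stay_from h mn. Qed.

Lemma enter_Ent w m x : enter w m x -> exists2 m0, (m0 <= m)%N & Ent w m0 x.
Proof.
move=> h; have [h1 h2] := @least_spec [set m | enter w m x] m h.
set m0 := least _ in h1 h2; exists m0; first exact: h2.
have [i3 i1] := h1; split; last by move=> n; apply: i1; rewrite leq_addr.
split=> // m' mm Im; apply: contrapT => no; suff /h2 : enter w m' x by lia.
split=> // n mn; apply: contrapT => nI; apply: no.
have [m0n|nm0] := leqP m0 n; first by case: nI; exact: i1.
by exists n; rewrite ?mn.
Qed.

Lemma level_disjoint n w w' z : cov_level n w -> cov_level n w' -> C w z -> C w' z -> w = w'.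
Proof.
have far a : (cball s K.+1 1%g `\` cball s K 1%g) a -> len a = K.+1.
  by rewrite /cball /= => -[]; rewrite /= dist1; lia.
elim: n w w' z => [|n IH] _ _ z /= [a ha [v vc <-]] [b hb [v' vc' <-]] az bz.
  have la := far a ha; have lb := far b hb.
  have ra : recurrent (T a) by apply: (recurrent_far su); rewrite la.
  have rb : recurrent (T b) by apply: (recurrent_far su); rewrite lb.
  have [i1 _ _] := cov_mem su ra vc; have [i2 _ _] := cov_mem su rb vc'.
  have ab : a = b.
    have h1 := cone_trans (I3C i1) az; have h2 := cone_trans (I3C i2) bz.
    by apply: (cone_len_eq hA (cone_total hA h1 h2 _)); rewrite la lb.
  rewrite -ab in vc' bz *; congr (_ * _)%g.
  by apply: (cov_disjoint (su_Cov su ra) (erefl (T a)) vc vc'); exists z.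
have ra : recurrent (T a) by apply: (recurrent_far su); have := level_far su ha; lia.
have rb : recurrent (T b) by apply: (recurrent_far su); have := level_far su hb; lia.
have [i1 _ _] := cov_mem su ra vc; have [i2 _ _] := cov_mem su rb vc'.
have ab : a = b.
  by apply: (IH _ _ z ha hb); [exact: cone_trans (I3C i1) _ az|exact: cone_trans (I3C i2) _ bz].
rewrite -ab in vc' bz *; congr (_ * _)%g.
by apply: (cov_disjoint (su_Cov su ra) (erefl (T a)) vc vc'); exists z.
Qed.

Lemma level_recurrent n w : cov_level n w -> recurrent (T w).
Proof. by move=> /(level_far su) h; apply: (recurrent_far su); lia. Qed.

Lemma level_len n w : cov_level n w -> (n < len w)%N.
Proof.
elim: n w => [|n IH] w; first by move=> /(level_far su); lia.
move=> [a ha [v vc <-]]; have := IH _ ha; have := cov_len su (level_recurrent ha) vc; lia.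
Qed.

(** An earlier candidate time would concern a cone of the same level containing x m, hence w itself,
    and [first_enter] provides an exit from its interior after that time. *)
Lemma at_last n w m x : cov_level n w -> Ent w m x -> le n x = m /\ ec n x = w.
Proof.
move=> lw E; have [i3 i1] := Ent_enter E.
pose S := [set m | exists2 w, cov_level n w & enter w m x].
have [h1 h2] := @least_spec S m (ex_intro2 _ _ w lw (conj i3 i1)).
have leE : le n x = least S by [].
have lm : least S = m.
  have am := h2 m (ex_intro2 _ _ w lw (conj i3 i1)).
  move: am; rewrite leq_eqVlt => /orP[/eqP//|am].
  have [w' lw' [i3' i1']] := h1.
  have ww : w' = w.
    by apply: (level_disjoint lw' lw (I1C (i1' m (ltnW am))) (I3C i3)).
  rewrite ww in i3' i1'; have [[_ fe] _] := E.
  by have [j /andP[j1 j2] nj] := fe _ am i3'; case: nj; exact: i1'.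
split; first by rewrite leE.
rewrite /entry_cone leE lm.
have [l1 l2] := @xgetPex _ 1%g [set w | cov_level n w /\ C w (x m)]
  (ex_intro _ w (conj lw (I3C i3))).
exact: (level_disjoint l1 lw l2 (I3C i3)).
Qed.

Definition entered n x := exists w m, cov_level n w /\ Ent w m x.
Definition good (x : nat -> W) := forall n, entered n x.

Lemma entered_at n x : entered n x -> cov_level n (ec n x) /\ Ent (ec n x) (le n x) x.
Proof. by move=> [w [m [lw E]]]; have [-> ->] := at_last lw E. Qed.

Lemma Ent_child w v m x : recurrent (T w) -> Cov (T w) v -> Ent (w * v)%g m x ->
  enter w m x.
Proof.
move=> rw wv /Ent_enter[i3 i1]; have [j3 j1 _] := cov_mem su rw wv; split.
  by apply: inner_sub i3 => z /j1 /I1C.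
by move=> n /i1 /I1C; exact: j1.
Qed.

Lemma entered_nest n x : entered n.+1 x -> [/\ entered n x,
  Cov (T (ec n x)) ((ec n x)^-1 * ec n.+1 x)%g & (le n x <= le n.+1 x)%N].
Proof.
move=> /[dup] /entered_at[+ E] _ => -[a la [v vc av]]; rewrite -av in E.
have [m0 m0m E0] := enter_Ent (Ent_child (level_recurrent la) vc E).
have [l0 e0] := at_last la E0.
by rewrite l0 e0 -av mulKg; split=> //; exists a, m0.
Qed.

Lemma good_le_mono x n n' : good x -> (n <= n')%N -> (le n x <= le n' x)%N.
Proof.
move=> gx /subnK <-; elim: (n' - n)%N => [|j IH] //.
by rewrite addSn; apply: leq_trans IH _; have [] := entered_nest (gx (j + n).+1).
Qed.

Lemma good_le_lower x n : good x -> x 0%N = 1%g ->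
  (forall n, (dist (x n) (x n.+1) <= L0)%N) -> (n <= L0 * le n x)%N.
Proof.
move=> gx x0 st; have [lw E] := entered_at (gx n).
have h1 := level_len lw; have [i3 _] := Ent_enter E.
have h2 := cone_len hA (I3C i3); have h3 := len_traj hW (isT : (0 < 1)%N) st (le n x).
by rewrite x0 len1 in h3; lia.
Qed.

Local Open Scope ereal_scope.

Section Measurability.

Lemma measurable_enter w m : measurable ([set x | enter w m x] : set PS).
Proof.
have -> : [set x | enter w m x] = [set x : PS | I3 w (x m)] `&` shift m @^-1` stay w.
  apply/seteqP; split=> x [h1 h2]; split=> //.
    by move=> n; apply: h2; rewrite leq_addr.
  by move=> n; exact: stay_from.
apply: measurableI; first exact: (mW hW m (I3 w)).
by apply: measurable_shift_preimage => //; exact: (measurable_stay su).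
Qed.

Lemma measurable_le n m : measurable ([set x | le n x = m] : set PS).
Proof.
pose S m : set PS := [set x | exists w, (cov_level n w /\ enter w m x)].
have mS m' : measurable (S m').
  apply: measurable_exists => // w; have [lw|nl] := pselect (cov_level n w).
    rewrite (_ : (fun _ => _) = [set x | enter w m' x]); first exact: measurable_enter.
    by apply/seteqP; split=> x // [].
  by rewrite (_ : (fun _ => _) = set0)//; apply/seteqP; split=> // x [].
pose U m' x := exists2 w, cov_level n w & enter w m' x.
have SU m' x : S m' x <-> U m' x by split=> [[w [h1 h2]]|[w h1 h2]]; exists w.
(* The second set accounts for the value 0 that [least] returns when there is no entry. *)
have -> : [set x | le n x = m] =
    (S m `&` [set x : PS | forall i, ((i < m)%N -> ~ S i x)]) `|`
    (if m == 0%N then [set x : PS | forall i, ~ S i x] else set0).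
  apply/seteqP; split=> x /=.
    move=> lm; have [[i Si]|no] := pselect (exists i, S i x).
      left; have [h1 h2] := @least_spec [set m | U m x] i (iffLR (SU _ _) Si).
      have e : least [set m | U m x] = m by exact: lm.
      rewrite e in h1 h2; split; first exact/SU.
      by move=> j jm Sj; have := h2 j (iffLR (SU _ _) Sj); lia.
    right; have e : m = 0%N.
      rewrite -lm /last_entry /least; apply: xgetPN => j [[w lw E] _].
      by apply: no; exists j, w.
    by rewrite e eqxx => i Si; apply: no; exists i.
  case=> [[Sm nS]|].
    have [h1 h2] := @least_spec [set m | U m x] m (iffLR (SU _ _) Sm).
    have -> : le n x = least [set m | U m x] by [].
    have := h2 m (iffLR (SU _ _) Sm); rewrite leq_eqVlt => /orP[/eqP//|am].
    by case: (nS _ am); exact/SU.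
  case: eqP => // -> nS; rewrite /last_entry /least; apply: xgetPN => j [[w lw E] _].
  by apply: (nS j); exists w.
apply: measurableU; last first.
  case: eqP => // _; apply: measurable_forall; first exact: countableP.
  by move=> i; exact: measurableC.
apply: measurableI => //; apply: measurable_forall; first exact: countableP.
move=> i; have [im|_] := boolP (i < m)%N; last first.
  by rewrite (_ : (fun _ => _) = setT)//; apply/seteqP; split.
rewrite (_ : (fun _ => _) = ~` S i); first exact: measurableC.
by apply/seteqP; split=> x /= h; [exact: h|move=> _].
Qed.

Lemma measurable_le2 (P : nat -> W -> nat -> W -> Prop) n n' :
  measurable ([set x | P (le n x) (x (le n x)) (le n' x) (x (le n' x))] : set PS).
Proof.
have -> : [set x : PS | P (le n x) (x (le n x)) (le n' x) (x (le n' x))] =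
    [set x | exists m, exists m', (le n x = m /\ le n' x = m') /\ P m (x m) m' (x m')].
  apply/seteqP; split=> x /=; first by move=> h; exists (le n x), (le n' x).
  by move=> [m [m' [[-> ->]]]].
apply: measurable_exists; first exact: countableP.
move=> m; apply: measurable_exists; first exact: countableP.
move=> m'; rewrite (_ : (fun _ => _) = ([set x : PS | le n x = m] `&` [set x | le n' x = m'])
    `&` [set x : PS | P m (x m) m' (x m')]).
  apply: measurableI; first by apply: measurableI; exact: measurable_le.
  apply: (measurable_coords cW (n := maxn m m')) => x y xy.
  by rewrite /= !xy// leq_max leqnn ?orbT.
by apply/seteqP; split.
Qed.

End Measurability.

Section Renewal.

Definition local_set (m : nat) (F : set PS) : Prop :=
  forall x y : nat -> W, (forall i, (i <= m)%N -> x i = y i) -> F x -> F y.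

Lemma measurable_local m F : local_set m F -> measurable F.
Proof. by move=> h; exact: (measurable_coords cW h). Qed.

(** Events after which the process starts afresh, conditioned on staying in the cone: a condition on
    the past up to a last entry, followed by staying. *)
Definition renewal w m (F : set PS) : Prop :=
  (exists2 F', local_set m F' & F = F' `&` shift m @^-1` stay w) /\ F `<=` Ent w m.

Lemma renewal_measurable w m F : renewal w m F -> measurable F.
Proof.
move=> [[F' lF' ->] _]; apply: measurableI; first exact: measurable_local lF'.
by apply: measurable_shift_preimage => //; exact: (measurable_stay su).
Qed.

Variables (w v : W) (rw : recurrent (T w)) (wv : Cov (T w) v).

(** The path before m does not interfere: an earlier deep visit to the child is one to w, and it is
    followed before time m by an exit from the interior of w, hence from that of the child. *)
Lemma Ent_shift m d x : Ent w m x ->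
  Ent (w * v)%g (m + d) x <-> Ent (w * v)%g d (shift m x).
Proof.
have [_ j1 _] := cov_mem su rw wv.
have I11 z : I1 (w * v)%g z -> I1 w z by move=> /I1C /j1.
have I33 z : I3 (w * v)%g z -> I3 w z by apply: inner_sub => z' /j1 /I1C.
move=> [[_ fe] _]; rewrite /Ent /= shiftD; split=> -[[h1 h2] h3]; split=> //; split=> //.
  move=> m' md Im; have [|j /andP[j1' j2] nj] := h2 (m + m')%N _ Im; first by lia.
  by exists (j - m)%N; rewrite /shift; [lia|rewrite subnKC//; lia].
move=> m' md Im; have [mm|mm] := leqP m m'.
  have [||j /andP[j1' j2] nj] := h2 (m' - m)%N; first by lia.
    by rewrite /shift subnKC.
  by exists (m + j)%N => //; lia.
have [j /andP[j1' j2] nj] := fe m' mm (I33 _ Im).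
by exists j; [lia|move=> /I11].
Qed.

Definition next_entry d v' : set PS := [set x | Ent (w * v)%g d x /\ x d = (w * v * v')%g].

Lemma measurable_next d v' : measurable (next_entry d v').
Proof. by apply: measurableI; [exact: measurable_Ent|exact: (mW hW d [set (w * v * v')%g])]. Qed.

Lemma renewal_next m d v' F : renewal w m F ->
  F `&` next_entry (m + d) v' = F `&` shift m @^-1` next_entry d v'.
Proof.
move=> [_ FE]; apply/seteqP; split=> x [Fx [E xd]]; split=> //; split=> //.
  exact/(Ent_shift d (FE _ Fx)).
exact/(Ent_shift d (FE _ Fx)).
Qed.

(** Written as a product because the probability of staying, by which one would divide, may vanish
    at the given point. *)
Lemma renewal_prob x0 m d v0 v' F : renewal w m F ->
  F `<=` [set x | x m = (w * v0)%g] ->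
  Lam x0 (F `&` next_entry (m + d) v') * Lam (w * v0)%g (stay w) =
  Lam x0 F * Lam (w * v0)%g (stay w `&` next_entry d v').
Proof.
move=> ren Fm; have ms := measurable_stay su w.
have [[F' lF' FE] _] := ren.
rewrite (renewal_next d v' ren).
have FE2 : F = F' `&` [set x | x m = (w * v0)%g] `&` shift m @^-1` stay w.
  apply/seteqP; split=> x; last by rewrite FE => -[[]].
  by move=> Fx; have := Fx; rewrite {1}FE => -[F'x sx]; split=> //; split=> //; exact: Fm.
have e1 : Lam x0 F = Lam x0 (F' `&` [set x | x m = (w * v0)%g]) * Lam (w * v0)%g (stay w).
  by rewrite {1}FE2; exact: (Lam_markov_at hW hw).
have e2 : Lam x0 (F `&` shift m @^-1` next_entry d v') =
    Lam x0 (F' `&` [set x | x m = (w * v0)%g]) * Lam (w * v0)%g (stay w `&` next_entry d v').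
  rewrite FE2 -setIA -preimage_setI; apply: (Lam_markov_at hW hw) => //.
  by apply: measurableI => //; exact: measurable_next.
by rewrite e1 e2 -!muleA; congr (_ * _); rewrite muleC.
Qed.

End Renewal.

Section States.
Variables (t : vertex A) (u : W) (r : seq (edge A)).
Hypothesis tr : trap s Lam L1 Cov t u r.

Lemma hit_state m x : hit s K L1 Cov t u r m x -> exists n, [/\ entered n.+1 x,
  procW s L1 Cov K x n.+1 = (t, u, pv r) & le n.+1 x = m].
Proof.
move=> [w [mw [e1 e2 e3] sw]]; have tw := marked_type tr mw.
have E : Ent w m x.
  split=> //; split=> //; rewrite e1; exact: trap_I3 tr _ tw.
have [n [w2 [lw tw2 we]]] := mw.
have uc : Cov (T w2) u by rewrite tw2; exact: trap_cov tr.
have lw' : cov_level n.+1 w by rewrite we; exact: level_child.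
have [l1 c1] := at_last lw' E; exists n; split=> //; first by exists w, m.
have en : entered n.+1 x by exists w, m.
rewrite /procW /= c1 l1 tw e1 mulKg; congr (_, _, _).
have E2 := E; rewrite we in E2.
have [m0 _ E0] := enter_Ent (Ent_child (level_recurrent lw) uc E2).
by have [_ ->] := at_last lw E0; rewrite we mulKg.
Qed.

Lemma entered_le_nest n n' x : (n <= n')%N -> entered n' x -> entered n x.
Proof.
by move=> /subnK <-; elim: (n' - n)%N => [|j IH] // /entered_nest[+ _ _].
Qed.

(** Every hit is a last entry at some level. If level n were never entered, all hits would belong to
    levels at most n, hence occur at finitely many times. *)
Lemma good_hits x : (forall n, exists2 m, (n <= m)%N & hit s K L1 Cov t u r m x) -> good x.
Proof.
move=> io n; apply: contrapT => nn.
have [m hm hx] := io (\sum_(i < n.+1) le i x).+1.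
have [j [ej _ lj]] := hit_state hx.
have jn : (j.+1 < n.+1)%N.
  rewrite ltnS ltnNge; apply/negP => nj; apply: nn; exact: (entered_le_nest (leqW nj) ej).
move: hm; rewrite -lj ltnNge => /negP; apply.
by rewrite (bigD1 (Ordinal jn))//= leq_addr.
Qed.

Lemma good_ae x0 : {ae Lam x0, forall x, good x}.
Proof. by apply: ae_mono (hits_io su tr x0) => x; exact: good_hits. Qed.

End States.
End Entrances.

(** * The Markov chain of entry data *)

Section RenewalChain.
Variables (R : realType) (N : nat) (k : 'I_N -> nat) (W : groupType).
Variables (s : 'I_N -> W) (pb : W -> W -> R) (mass : W -> R).
Local Notation PS := (path_space (1%g : W)).
Variables (Lam : W -> {measure set PS -> \bar R}) (L0 : nat) (eps Q : R).
Variables (A : labelled_graph N) (K : nat) (div : nat -> R) (L1 : R).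
Variables (Cov : vertex A -> set W).
Hypothesis su : setup k s pb mass Lam L0 eps Q K div L1 Cov.
Let hW := su_W su.
Let hw := su_w su.
Let hA := su_A su.
Let cW := countable_W hW.
Local Notation C := (cone s A).
Local Notation T := (cone_type s A).
Local Notation I1 w := (inner s L1 (cone s A w)).
Local Notation I3 w := (inner s (3%:R * L1) (cone s A w)).

Local Notation stay := (stay s A L1).
Local Notation cov_level := (cov_level s Cov K).
Local Notation le k x := (last_entry s L1 Cov K x k).
Local Notation ec k x := (entry_cone s L1 Cov K x k).
Local Notation pw k x := (procW s L1 Cov K x k).
Local Notation Ent := (Ent s A L1).
Local Notation entered := (entered s K L1 Cov).
Local Notation next_entry := (next_entry s A L1).
Local Notation renewal := (renewal s A L1).
Local Notation ST := (vertex A * W * W)%type.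
Local Notation ZT := (vertex A * W * W * nat)%type.
Local Open Scope ereal_scope.

Definition renewal_pair n (x : nat -> W) : ZT := (pw n.+1 x, (le n.+1 x - le n x)%N).

Definition type_rep (t : vertex A) : W := xget 1%g [set w | T w = t].

(** The conditional probability of the next state and gap given a, computed in a representative cone
    of the type of a; it involves only the type and the relative entry point in a. Inadmissible
    increments get 0. *)
Definition renewal_kernel (a : ST) (z : ZT) : R :=
  let t := a.1.1 in let v := a.2 in
  let u' := z.1.1.2 in
  if `[< [/\ recurrent t, Cov t u' & T (type_rep t * u')%g = z.1.1.1] >] then
    (fine (Lam (type_rep t * v)%g (stay (type_rep t) `&` next_entry (type_rep t) u' z.2 z.1.2)) /
     fine (Lam (type_rep t * v)%g (stay (type_rep t))))%R
  else 0%R.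

Lemma renewal_kernel_ge0 a z : (0 <= renewal_kernel a z)%R.
Proof. by rewrite /renewal_kernel; case: asboolP => // _; rewrite divr_ge0// fine_ge0. Qed.

Lemma type_repP t : recurrent t -> T (type_rep t) = t.
Proof. by move=> /(recurrent_rep hA)[w tw]; exact: (@xgetPex _ 1%g [set w | T w = t] (ex_intro _ w tw)). Qed.

Lemma measurable_hist2 (Q' : nat -> W -> W -> nat -> W -> W -> Prop) n n' :
  measurable ([set x | Q' (le n x) (ec n x) (x (le n x)) (le n' x) (ec n' x) (x (le n' x))] : set PS).
Proof.
pose f n p := xget 1%g [set w | cov_level n w /\ C w p].
exact: (measurable_le2 su (fun m p m' p' => Q' m (f n p) p m' (f n' p') p') n n').
Qed.

Lemma measurable_pw n (P : set ST) : measurable ([set x | P (pw n.+1 x)] : set PS).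
Proof.
exact: (measurable_hist2 (fun _ w p _ w' _ => P (T w, (w'^-1 * w)%g, (w^-1 * p)%g)) n.+1 n).
Qed.

Lemma measurable_Z n (P : set ZT) : measurable ([set x | P (renewal_pair n x)] : set PS).
Proof.
exact: (measurable_hist2 (fun m w p m' w' _ => P (T w, (w'^-1 * w)%g, (w^-1 * p)%g, (m - m')%N)) n.+1 n).
Qed.

Lemma measurable_entered n : measurable ([set x | entered n x] : set PS).
Proof.
apply: measurable_exists => // w; apply: measurable_exists; first exact: countableP.
move=> m; have [lw|nl] := pselect (cov_level n w).
  rewrite (_ : (fun _ => _) = Ent w m); first exact: (measurable_Ent su).
  by apply/seteqP; split=> x // [].
by rewrite (_ : (fun _ => _) = set0)//; apply/seteqP; split=> // x [].
Qed.

Lemma entered_chain j n x : (j <= n)%N -> entered n x ->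
  (le j x <= le n x)%N /\ (forall z, I1 (ec n x) z -> I1 (ec j x) z).
Proof.
move=> /subnK <-; elim: (n - j)%N => [|i IH] //.
rewrite addSn => /(entered_nest su)[en cv lm]; have [l1 i1] := IH en.
have [lw _] := entered_at su en.
have [_ j1 _] := cov_mem su (level_recurrent su lw) cv; rewrite mulgA mulgV mul1g in j1.
split; first exact: leq_trans l1 lm.
by move=> z /I1C /j1; exact: i1.
Qed.

Definition hist_ext n (Phi : (nat -> W) -> Prop) : Prop := forall x y,
  (forall j, (j <= n)%N -> [/\ le j x = le j y, ec j x = ec j y & x (le j x) = y (le j y)]) ->
  Phi x -> Phi y.

(** Changing the path after m inside the interior of the current cone keeps it inside all earlier
    cones, so earlier entries are unaffected. The event is therefore its projection to the past,
    intersected with staying. *)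
Lemma renewal_hist n w m Phi : hist_ext n Phi ->
  renewal w m [set x | [/\ cov_level n w, Ent w m x & Phi x]].
Proof.
move=> hP; split; last by move=> x [].
set F := [set x | _].
exists [set z | exists2 x, F x & forall i, (i <= m)%N -> x i = z i].
  move=> z z' zz [x Fx xz]; exists x => // i im; by rewrite xz// zz.
apply/seteqP; split=> [x Fx|z [[x [lw E Px] xz] sz]].
  by split; [exists x|have [_ [_ ]] := Fx].
have en : entered n x by exists w, m.
have [ln en'] := at_last su lw E.
have Ez : Ent w m z by split=> //; case: E => + _; apply: first_enter_local.
split=> //; apply: hP Px => j jn.
have ej := entered_le_nest su jn en; have [lj Ej] := entered_at su ej.
have [l1 i1] := entered_chain jn en; rewrite ln en' in l1 i1.
have [fj sj] := Ej.
have Ezj : Ent (ec j x) (le j x) z.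
  split; first by apply: first_enter_local fj => i ij; apply: xz; exact: leq_trans l1.
  move=> i; rewrite /shift; have [im|mi] := leqP (le j x + i) m.
    by rewrite -xz//; apply: sj.
  by apply: i1; apply: (stay_from sz); exact: ltnW.
have [-> ->] := at_last su lj Ezj; split=> //; exact: xz.
Qed.

Lemma Ent_tr w w' m x : T w = T w' ->
  Ent w m x <-> Ent w' m (fun n => w' * (w^-1 * x n))%g.
Proof.
move=> tw; have E3 z : I3 w z <-> I3 w' (w' * (w^-1 * z))%g.
  have {1}-> : z = (w * (w^-1 * z))%g by rewrite mulgA mulgV mul1g.
  by split; [exact: (inner_tr hA tw)|exact: (inner_tr hA (esym tw))].
have E1 z : I1 w z <-> I1 w' (w' * (w^-1 * z))%g.
  have {1}-> : z = (w * (w^-1 * z))%g by rewrite mulgA mulgV mul1g.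
  by split; [exact: (inner_tr hA tw)|exact: (inner_tr hA (esym tw))].
split=> -[[h1 h2] h3]; split; try (by move=> n; apply/E1; exact: (h3 n)); split; try exact/E3.
  by move=> m' mm /E3 /(h2 m' mm)[j jj nj]; exists j => // /E1.
by move=> m' mm /E3 /(h2 m' mm)[j jj nj]; exists j => // /E1.
Qed.

Lemma next_tr w w' v u' d v' : T w = T w' -> C w (w * u')%g ->
  Lam (w * v)%g (stay w `&` next_entry w u' d v') =
  Lam (w' * v)%g (stay w' `&` next_entry w' u' d v').
Proof.
move=> tw cu; pose B := relative w^-1%g @^-1` next_entry w u' d v'.
have mB : measurable B.
  apply: (measurable_relative_preimage su); exact: (measurable_next su).
have tu : T (w * u')%g = T (w' * u')%g by rewrite (type_tr hA tw).
have := stay_relative su tw v mB.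
have e0 (x : PS) : relative w^-1%g (relative w x) = x.
  by apply/funext => n; rewrite /relative invgK mulgA mulgV mul1g.
have -> : relative w @^-1` B = next_entry w u' d v'.
  by apply/seteqP; split=> x; rewrite /B /preimage /= e0.
have -> // : stay w' `&` relative w' @^-1` B = stay w' `&` next_entry w' u' d v'.
have e (x : nat -> W) : (fun n => (w * u') * ((w' * u')^-1 * x n))%g =
    (fun n => (w^-1)^-1 * (w'^-1 * x n))%g.
  by apply/funext => n; rewrite invgK invgM !mulgA mulgK.
apply/seteqP; split=> x [sx]; rewrite /B /relative /Submission.next_entry /= => -[h1 h2]; split=> //; split.
- by apply/(Ent_tr _ _ (esym tu)); rewrite e.
- apply: (mulgI w'^-1%g); apply: (mulgI w^-1^-1%g); rewrite h2 invgK -!mulgA.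
  by rewrite mulKg.
- by rewrite -e; apply/(Ent_tr _ _ (esym tu)).
- by rewrite h2 invgK -!mulgA mulKg.
Qed.

Lemma renewal_null x0 w m v F : renewal w m F -> F `<=` [set x | x m = (w * v)%g] ->
  Lam (w * v)%g (stay w) = 0 -> Lam x0 F = 0.
Proof.
move=> [[F' lF' FE] _] Fm z.
have -> : F = F' `&` [set x | x m = (w * v)%g] `&` shift m @^-1` stay w.
  apply/seteqP; split=> x; last by rewrite FE => -[[]].
  by move=> Fx; have := Fx; rewrite {1}FE => -[F'x sx]; split=> //; split=> //; exact: Fm.
rewrite (Lam_markov_at hW hw _ _ lF'); last exact: (measurable_stay su).
by rewrite z mule0.
Qed.

(** The event is split by the current cone and entry time. On each piece the history is a renewal
    event, [renewal_prob] gives the conditional probability, and [next_tr] moves it to the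
    representative cone. *)
Lemma markov_step x0 n (Phi : (nat -> W) -> Prop) (a : ST) z : hist_ext n Phi ->
  (forall x, entered n x -> Phi x -> T (ec n x) = a.1.1 /\ ((ec n x)^-1 * x (le n x))%g = a.2) ->
  Lam x0 [set x | [/\ entered n x, Phi x, entered n.+1 x & renewal_pair n x = z]] =
  Lam x0 [set x | entered n x /\ Phi x] * (renewal_kernel a z)%:E.
Proof.
case: a => [[t u0] v]; case: z => [[[t' u'] v'] d'] hP Pa /=.
pose F w m := [set x | [/\ cov_level n w, Ent w m x & Phi x]] : set PS.
have ren w m : renewal w m (F w m) by exact: renewal_hist.
have mF w m : measurable (F w m) by exact: (renewal_measurable su (ren w m)).
pose D : set PS := [set x | entered n x /\ Phi x].
have DE : D = [set x | exists w, exists m, F w m x].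
  apply/seteqP; split=> x.
    by move=> [[w [m [lw E]]] Px]; exists w, m.
  by move=> [w [m [lw E Px]]]; split=> //; exists w, m.
have mD : measurable D.
  rewrite DE; apply: measurable_exists => // w.
  by apply: measurable_exists; [exact: countableP|move=> m; exact: mF].
pose G : set PS := [set x | [/\ entered n x, Phi x, entered n.+1 x & renewal_pair n x = (t', u', v', d')]].
have GE : G = D `&` [set x | entered n.+1 x] `&` [set x | renewal_pair n x = (t', u', v', d')].
  by apply/seteqP; split=> x; [move=> []|move=> [[[]]]].
have mG : measurable G.
  rewrite GE; apply: measurableI; last exact: (measurable_Z n [set (t', u', v', d')]).
  by apply: measurableI => //; exact: measurable_entered.
pose f (x : PS) := (ec n x, le n x).
have cWn : countable [set: W * nat] by exact: (countable_prodT cW (countableP _)).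
have mf i : measurable (f @^-1` [set i]).
  exact: (measurable_hist2 (fun m w _ _ _ _ => (w, m) = i) n n).
have DF w m : D `&` f @^-1` [set (w, m)] = F w m.
  apply/seteqP; split=> x.
    move=> [[en Px] [e1 e2]]; have [lw E] := entered_at su en.
    by rewrite /F /= -e1 -e2.
  move=> [lw E Px]; have [e1 e2] := at_last su lw E.
  by split; [split=> //; exists w, m|rewrite /f /= e1 e2].
rewrite -/D -/G (measure_partition cWn (Lam x0) mf mG) (measure_partition cWn (Lam x0) mf mD).
rewrite muleC -esumZl ?renewal_kernel_ge0//; apply: eq_esum => -[w m] _.
rewrite DF muleC.
have [[x1 [lw E1 P1]]|nF] := pselect (exists x, F w m x); last first.
  have F0 : F w m = set0 by apply/seteqP; split=> // x Fx; apply: nF; exists x.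
  rewrite F0 measure0 mul0e; apply: etrans (measure0 (Lam x0)); congr (Lam x0 _).
  apply/seteqP; split=> // x [[en Px _ _] fx]; apply: nF; exists x.
  by rewrite -DF; split.
have rw := level_recurrent su lw.
have tw : T w = t.
  have [e1 e2] := at_last su lw E1; have en : entered n x1 by exists w, m.
  by have [+ _] := Pa _ en P1; rewrite e2.
have Fv : F w m `<=` [set x | x m = (w * v)%g].
  move=> x [_ E Px]; have [e1 e2] := at_last su lw E.
  have en : entered n x by exists w, m.
  have [_ ] := Pa _ en Px; rewrite e1 e2 /= => <-; by rewrite mulgA mulgV mul1g.
have GF : G `&` f @^-1` [set (w, m)] `<=` F w m `&` next_entry w u' (m + d') v' /\
    (G `&` f @^-1` [set (w, m)] !=set0 -> Cov t u' /\ T (w * u')%g = t').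
  have H x : (G `&` f @^-1` [set (w, m)]) x -> [/\ F w m x, next_entry w u' (m + d') v' x,
      Cov t u' & T (w * u')%g = t'].
    move=> [[en Px en1 zx] [e1 e2]].
    have [_ cv lm] := entered_nest su en1; have [lw1 E] := entered_at su en1.
    move: zx; rewrite /renewal_pair /procW /= => -[z1 z2 z3 z4].
    have ec1 : ec n.+1 x = (w * u')%g by rewrite -z2 e1 mulgA mulgV mul1g.
    have le1 : le n.+1 x = (m + d')%N by rewrite -z4 -e2 subnKC.
    split.
    - by rewrite -DF; split=> //; rewrite /f /= e1 e2.
    - split; first by rewrite -ec1 -le1.
      by rewrite -le1 -z3 -ec1 mulgA mulgV mul1g.
    - by rewrite -z2 -tw -{1}e1.
    - by rewrite -ec1.
  by split=> [x /H[]|[x /H[]]].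
rewrite /renewal_kernel /= -/T; case: asboolP => [[rt cu tu]|nc]; last first.
  rewrite mule0; apply: etrans (measure0 (Lam x0)); congr (Lam x0 _).
  apply/seteqP; split=> // x Gx; have [_ /(_ (ex_intro _ x Gx))[cu tu]] := GF.
  apply: nc; split=> //; first by rewrite -tw.
  have wv : Cov (T w) u' by rewrite tw.
  have [i3 _ _] := cov_mem su rw wv; rewrite -tu.
  have twr : T w = T (type_rep t) by rewrite type_repP// -tw.
  exact: (type_tr hA twr (I3C i3)).
have wv : Cov (T w) u' by rewrite tw.
have [i3 _ _] := cov_mem su rw wv; have cwu := I3C i3.
have twr : T w = T (type_rep t) by rewrite type_repP.
have tu' : T (w * u')%g = t' by rewrite -tu; apply/esym/(type_tr hA) => //; rewrite -?twr.
have -> : G `&` f @^-1` [set (w, m)] = F w m `&` next_entry w u' (m + d') v'.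
  apply/seteqP; split; first by have [] := GF.
  move=> x [Fx [E xd]]; have [_ E0 Px] := Fx; have [e1 e2] := at_last su lw E0.
  have lw' : cov_level n.+1 (w * u')%g by exact: level_child.
  have [e3 e4] := at_last su lw' E.
  have [[en _] fx] : (D `&` f @^-1` [set (w, m)]) x by rewrite DF.
  split=> //; split=> //; first by exists (w * u')%g, (m + d')%N.
  rewrite /renewal_pair /procW /= e1 e2 e3 e4 tu' mulKg xd addKn; congr (_, _, _, _).
  by rewrite mulKg.
have hp := renewal_prob su rw wv x0 d' v' (ren w m) Fv.
rewrite (stay_tr su twr) (next_tr v d' v' twr cwu) in hp.
have ms := measurable_stay su (type_rep t).
have mn := measurableI _ _ ms (measurable_next su (type_rep t) u' d' v').
have mFn : measurable (F w m `&` next_entry w u' (m + d') v').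
  by apply: measurableI => //; exact: (measurable_next su).
(* If staying has probability 0 the history itself is null, so the value of the kernel at a
   vanishing denominator does no harm. *)
have z0 : Lam (type_rep t * v)%g (stay (type_rep t)) = 0 ->
    Lam x0 (F w m `&` next_entry w u' (m + d') v') = 0 /\ Lam x0 (F w m) = 0.
  move=> z; have z1 : Lam x0 (F w m) = 0.
    by apply: renewal_null (ren w m) Fv _; rewrite (stay_tr su twr).
  split=> //; apply/eqP; rewrite eq_le measure_ge0 andbT -z1.
  by apply: le_measure; rewrite ?inE// => x [].
have [z|nz] := eqVneq (Lam (type_rep t * v)%g (stay (type_rep t))) 0.
  by have [-> ->] := z0 z; rewrite mul0e.
move: hp nz; rewrite -(fineK (Lam_fin hw x0 mFn)) -(fineK (Lam_fin hw x0 (mF w m))).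
rewrite -(fineK (Lam_fin hw (type_rep t * v)%g ms)) -(fineK (Lam_fin hw (type_rep t * v)%g mn)) /=.
rewrite -!EFinM eqe => hp nz; have e := EFin_inj hp; congr (_%:E).
by rewrite mulrA -e mulfK.
Qed.

End RenewalChain.

(** * Frequencies and mean gaps *)

Section RenewalLaws.
Variables (R : realType) (N : nat) (k : 'I_N -> nat) (W : groupType).
Variables (s : 'I_N -> W) (pb : W -> W -> R) (mass : W -> R).
Local Notation PS := (path_space (1%g : W)).
Variables (Lam : W -> {measure set PS -> \bar R}) (L0 : nat) (eps Q : R).
Variables (A : labelled_graph N) (K : nat) (div : nat -> R) (L1 : R).
Variables (Cov : vertex A -> set W).
Hypothesis su : setup k s pb mass Lam L0 eps Q K div L1 Cov.
Let hW := su_W su.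
Let hw := su_w su.
Let hA := su_A su.
Let cW := countable_W hW.
Local Notation T := (cone_type s A).
Local Notation pv := (path_value s (A := A)).

Variables (t : vertex A) (u : W) (r : seq (edge A)).
Hypothesis tr : trap s Lam L1 Cov t u r.
Local Notation le k x := (last_entry s L1 Cov K x k).
Local Notation ec k x := (entry_cone s L1 Cov K x k).
Local Notation pw k x := (procW s L1 Cov K x k).
Local Notation entered := (entered s K L1 Cov).
Local Notation good := (good s K L1 Cov).
Local Notation renewal_pair := (renewal_pair s K L1 Cov).
Local Notation renewal_kernel := (renewal_kernel s Lam L1 Cov).
Local Notation hist_ext := (hist_ext s K L1 Cov).
Local Notation ST := (vertex A * W * W)%type.
Local Notation ZT := (vertex A * W * W * nat)%type.
Local Notation z0 := ((start A, 1%g, 1%g, 0%N) : ZT).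
Local Notation PZ := (path_space z0).
Local Notation st0 := ((t, u, pv r) : ST).
Local Open Scope ereal_scope.

Lemma countable_ST : countable [set: ST].
Proof. by apply: countable_prodT cW; apply: countable_prodT cW; exact: countableP. Qed.

Lemma countable_ZT : countable [set: ZT].
Proof. by apply: countable_prodT countable_ST _; exact: countableP. Qed.
Let cZ := countable_ZT.

Lemma ae_null (B : set PS) x0 : measurable B -> {ae Lam x0, forall x, ~ B x} -> Lam x0 B = 0.
Proof.
move=> mB [S [mS S0 nS]]; apply/eqP; rewrite eq_le measure_ge0 andbT -S0.
by apply: le_measure; rewrite ?inE// => x Bx; apply: nS => /=; exact.
Qed.

Lemma entered_full n : Lam 1%g (~` [set x | entered n x]) = 0.
Proof.
apply: ae_null; first by apply: measurableC; exact: (measurable_entered su).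
by apply: ae_mono (good_ae su tr 1%g) => x gx; apply; exact: gx.
Qed.

Definition attained (a : ST) : Prop := exists n, 0 < Lam 1%g [set x | pw n.+1 x = a].

(** States that are never attained are made absorbing, so that a path law exists from every starting
    point. *)
Definition pair_kernel (z z' : ZT) : R :=
  if `[< attained z.1 >] then renewal_kernel z.1 z' else (z' == z)%:R.

Lemma pair_kernel_ge0 z z' : (0 <= pair_kernel z z')%R.
Proof. by rewrite /pair_kernel; case: asboolP => // _; exact: renewal_kernel_ge0. Qed.

Lemma hist_ext_pw n a : hist_ext n.+1 (fun x => pw n.+1 x = a).
Proof.
move=> x y h; have [e1 e2 e3] := h n.+1 (leqnn _); have [e4 e5 e6] := h n (leqnSn _).
by rewrite /procW /= e2 e3 e5.
Qed.

Lemma hist_ext_Z n m a : (n < m)%N -> hist_ext m (fun x => renewal_pair n x = a).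
Proof.
move=> nm x y h; have [e1 e2 e3] := h n.+1 nm; have [e4 e5 e6] := h n (ltnW nm).
by rewrite /Submission.renewal_pair /procW /= e2 e3 e5 e1 e4.
Qed.

Section Chain.
Variables (n : nat) (Phi : (nat -> W) -> Prop) (y : nat -> ZT).
Hypothesis hPhi : hist_ext n.+1 Phi.
Hypothesis mPhi : measurable ([set x | Phi x] : set PS).
Hypothesis Phi0 : forall x, Phi x -> pw n.+1 x = (y 0%N).1.

Let H m : set PS := [set x | Phi x /\ forall i, (0 < i <= m)%N -> renewal_pair (n + i) x = y i].

Let mH m : measurable (H m).
Proof.
apply: measurableI => //; apply: measurable_forall; first exact: countableP.
move=> i; have [im|im] := boolP (0 < i <= m)%N; last first.
  by rewrite (_ : (fun _ => _) = setT)//; apply/seteqP; split.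
rewrite (_ : (fun _ => _) = [set x | renewal_pair (n + i) x = y i]).
  exact: (measurable_Z su (n + i) [set y i]).
by apply/seteqP; split=> x /= h; [exact: h|].
Qed.

Lemma chain_prob m : Lam 1%g [set x | Phi x /\ forall i, (0 < i <= m)%N -> renewal_pair (n + i) x = y i] =
  Lam 1%g [set x | Phi x] * (\prod_(i < m) pair_kernel (y i) (y i.+1))%:E.
Proof.
rewrite -/(H m); elim: m => [|m IH].
  rewrite big_ord0 mule1; congr (Lam 1%g _); apply/seteqP; split=> x; first by case.
  by move=> Px; split=> // i /andP[i0 i1]; lia.
rewrite big_ord_recr /= EFinM muleA -IH.
pose k' := (n + m.+1)%N.
have kE : k' = (n + m).+1 by rewrite /k' addnS.
have last x : H m x -> pw k' x = (y m).1.
  rewrite kE => -[Px hx]; case: (posnP m) => [m0|m0].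
    by rewrite m0 addn0; exact: Phi0.
  by have := hx m; rewrite m0 leqnn => /(_ isT) <-.
have mS j : measurable ([set x | entered j x] : set PS) by exact: (measurable_entered su).
(* A state that is never attained gives probability 0 on both sides, so the absorbing convention
   does not interfere. *)
have [at_|nat_] := pselect (attained (y m).1); last first.
  have Hm0 : Lam 1%g (H m) = 0.
    apply/eqP; rewrite eq_le measure_ge0 andbT leNgt; apply/negP => h; apply: nat_.
    exists (n + m)%N; apply: (lt_le_trans h); apply: le_measure; rewrite ?inE//.
      exact: (measurable_pw su (n + m) [set (y m).1]).
    by move=> x Hx; have := last x Hx; rewrite kE.
  rewrite Hm0 mul0e; apply/eqP; rewrite eq_le measure_ge0 andbT -Hm0.
  apply: le_measure; rewrite ?inE//.
  by move=> x [Px hx]; split=> // i /andP[i0 im]; apply: hx; rewrite i0 leqW.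
rewrite /pair_kernel; case: asboolP => // _.
have hm : hist_ext k' (H m).
  move=> a b ab [Pa ha]; split.
    by apply: hPhi Pa => j jn; apply: ab; rewrite kE; apply: leq_trans jn _; rewrite ltnS leq_addr.
  move=> i /andP[i0 im]; apply: (hist_ext_Z (m := k') _ ab); last by apply: ha; rewrite i0.
  by rewrite kE ltnS leq_add2l.
have pt x : entered k' x -> H m x -> T (ec k' x) = (y m).1.1.1 /\
    ((ec k' x)^-1 * x (le k' x))%g = (y m).1.2.
  by move=> _ /last; case: (y m) => [[[a b] c] e] /= [-> _ ->].
have := markov_step su 1%g (y m.+1) hm pt.
have -> : Lam 1%g [set x | entered k' x /\ H m x] = Lam 1%g (H m).
  rewrite -(measureI_full (mS k') (mH m) (entered_full k')).
  by congr (Lam 1%g _); apply/seteqP; split=> x [].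
move=> <-; rewrite -(measureI_full (mS k'.+1) (mH m.+1) (entered_full k'.+1)).
congr (Lam 1%g _); apply/seteqP; split=> x.
  move=> [[Px hx] en]; have [en' _ _] := entered_nest su en; split=> //.
    by split=> // i /andP[i0 im]; apply: hx; rewrite i0 leqW.
  by apply: hx; rewrite ltnS leqnn.
move=> [en [Px hx] en1 zx]; split=> //; split=> // i /andP[i0].
rewrite leq_eqVlt => /orP[/eqP->//|im]; by apply: hx; rewrite i0.
Qed.

End Chain.

Definition zpath n (x : PS) : PZ := fun i => renewal_pair (n + i) x.

Lemma measurable_zpath n : measurable_fun setT (zpath n).
Proof. by apply: measurable_to_paths => i a; exact: (measurable_Z su (n + i) [set a]). Qed.

(** For an attained state the path law is read off the process itself, conditioned on that state at
    some time; the first coordinate is replaced by a, since the gap component of a need not occur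
    there. *)
Lemma law_exists (a : ZT) : exists mu : {measure set PZ -> \bar R},
  mu setT = 1 /\ forall m y, mu (cyl m y) =
    ((y 0%N == a)%:R * \prod_(i < m) pair_kernel (y i) (y i.+1))%:E.
Proof.
have [at_|nat_] := pselect (attained a.1); last first.
  exists [the measure _ _ of dirac ((fun=> a) : PZ)]; split.
    by rewrite /= diracE in_setT.
  move=> m y; rewrite /= diracE; have [ya|ya] := eqVneq (y 0%N) a; last first.
    rewrite mul0r memNset// => h; move: ya; rewrite -(h 0%N)// eqxx //.
  rewrite mul1r; elim: m => [|m IH].
    by rewrite big_ord0 mem_set// => i; rewrite leqn0 => /eqP->.
  rewrite big_ord_recr /= EFinM -IH.
  have [h|nh] := pselect ((cyl m y : set PZ) (fun=> a)); last first.
    rewrite [in RHS]memNset// mul0e memNset// => h; apply: nh => i im; apply: h; exact: leqW.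
  rewrite [in RHS]mem_set// mul1e /pair_kernel -(h m)//; case: asboolP => // _.
  have [yb|yb] := eqVneq (y m.+1) a.
    rewrite mem_set// => i; rewrite leq_eqVlt => /orP[/eqP->//|]; exact: h.
  by rewrite memNset// => h'; move: yb; rewrite -(h' m.+1)// eqxx.
have [n pn] := at_.
have mD : measurable ([set x | pw n.+1 x = a.1] : set PS).
  exact: (measurable_pw su n [set a.1]).
pose f (x : PS) : PZ := fun i => if i is j.+1 then renewal_pair (n + j.+1) x else a.
have mf : measurable_fun setT f.
  apply: measurable_to_paths => -[|i] b.
    have [ab|ab] := eqVneq a b.
      by rewrite (_ : _ @^-1` _ = setT)//; apply/seteqP; split.
    rewrite (_ : _ @^-1` _ = set0)//; apply/seteqP; split=> // x /= e; by rewrite e eqxx in ab.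
  exact: (measurable_Z su (n + i.+1) [set b]).
pose p0 := fine (Lam 1%g [set x | pw n.+1 x = a.1]).
have pE : p0%:E = Lam 1%g [set x | pw n.+1 x = a.1] by rewrite fineK// (Lam_fin hw).
have p00 : (0 < p0)%R by rewrite -lte_fin pE.
have pV : (0 <= p0^-1)%R by rewrite invr_ge0 ltW.
exists [the measure _ _ of mscale (NngNum pV) [the measure _ _ of law_on (Lam 1%g) mD mf]].
have unit : p0^-1%:E * Lam 1%g [set x | pw n.+1 x = a.1] = 1.
  by rewrite -pE -EFinM mulVf// gt_eqF.
split; first by rewrite /= /mscale /= /law_on preimage_setT setIT.
move=> m y; rewrite /= /mscale /= /law_on.
have [ya|ya] := eqVneq (y 0%N) a; last first.
  rewrite mul0r (_ : _ `&` _ = set0) ?measure0 ?mule0//.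
  by apply/seteqP; split=> // x [_ /(_ 0%N isT)] /= e; rewrite e eqxx in ya.
rewrite mul1r; have e : [set x | pw n.+1 x = a.1] `&` f @^-1` cyl m y =
    [set x | pw n.+1 x = a.1 /\ forall i, (0 < i <= m)%N -> renewal_pair (n + i) x = y i].
  apply/seteqP; split=> x [Dx h]; split=> //.
    by move=> [//|i] /= im; have := h i.+1 im.
  move=> [|i] im; first by rewrite ya.
  exact: (h i.+1).
rewrite e (@chain_prob n (fun x => pw n.+1 x = a.1) y (@hist_ext_pw n a.1) mD _ m).
  by rewrite muleA unit mul1e.
by move=> x /= ->; rewrite ya.
Qed.

Lemma laws : exists Law : ZT -> {measure set PZ -> \bar R},
  [/\ forall a, Law a setT = 1,
      forall a m y, Law a (cyl m y) =
        ((y 0%N == a)%:R * \prod_(i < m) pair_kernel (y i) (y i.+1))%:E &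
      forall n a (B : set PZ), measurable B ->
        Lam 1%g ([set x | renewal_pair n x = a] `&` zpath n @^-1` B) =
        Lam 1%g [set x | renewal_pair n x = a] * Law a B].
Proof.
have [Law hL] := choice law_exists; exists Law; split; try by move=> a; have [] := hL a.
move=> n a B mB; have [LT LE] := hL a.
have mD : measurable ([set x | renewal_pair n x = a] : set PS) by exact: (measurable_Z su n [set a]).
pose p0 := fine (Lam 1%g [set x | renewal_pair n x = a]).
have pE : p0%:E = Lam 1%g [set x | renewal_pair n x = a] by rewrite fineK// (Lam_fin hw).
have p00 : (0 <= p0)%R by rewrite fine_ge0.
pose m1 := [the measure _ _ of law_on (Lam 1%g) mD (measurable_zpath n)].
pose m2 := [the measure _ _ of mscale (NngNum p00) (Law a)].
rewrite -pE -[LHS]/(m1 B) -[RHS]/(m2 B).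
apply: (@path_measure_unique ZT z0 R m1 m2) => //.
- by rewrite /= /law_on preimage_setT setIT -pE ltry.
- by rewrite /= /law_on /mscale /= preimage_setT setIT LT mule1 pE.
move=> m y; rewrite /= /law_on /mscale /= LE pE.
have [ya|ya] := eqVneq (y 0%N) a; last first.
  rewrite mul0r mule0; apply: etrans (measure0 (Lam 1%g)); congr (Lam 1%g _).
  apply/seteqP; split=> // x [/= xa /(_ 0%N isT)]; rewrite /zpath addn0 xa => e.
  by rewrite e eqxx in ya.
rewrite mul1r -(@chain_prob n (fun x => renewal_pair n x = a) y (@hist_ext_Z n n.+1 a (ltnSn n)) mD).
  congr (Lam 1%g _); apply/seteqP; split=> x [Dx h]; split=> //.
    by move=> i /andP[_ im]; exact: h.
  move=> [|i] im; first by rewrite /zpath addn0 Dx ya.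
  exact: (h i.+1).
by move=> x /= xa; rewrite ya -xa.
Qed.

Lemma states_io : {ae Lam 1%g, forall x, forall n, exists2 j, (n <= j)%N & pw j.+1 x = st0}.
Proof.
apply: ae_mono (ae_conj (hits_io su tr 1%g) (good_ae su tr 1%g)) => x [io gx] n.
have [m nm hm] := io (le n.+1 x).+1.
have [j [ej pj lj]] := hit_state su tr hm; exists j => //.
rewrite leqNgt; apply/negP => jn.
by have := good_le_mono su gx (leqW jn); rewrite lj; lia.
Qed.

Section Stationary.
Variables (nu : ST -> R).
Hypothesis nu0 : forall a, (0 <= nu a)%R.
Hypothesis nuA : forall a, ~ attained a -> nu a = 0%R.
Hypothesis nu1 : \esum_(a in [set: ST]) (nu a)%:E = 1.
Hypothesis nu_inv : forall a', \esum_(a in [set: ST]) \esum_(d in [set: nat])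
  (nu a * renewal_kernel a (a', d))%:E = (nu a')%:E.

(** The stationary law of the pairs: one step of the kernel started from [nu]. *)
Definition pair_law (z : ZT) : R := fine (\esum_(a in [set: ST]) (nu a * renewal_kernel a z)%:E).

Let nk0 a z : (0 <= nu a * renewal_kernel a z)%R.
Proof. by rewrite mulr_ge0// renewal_kernel_ge0. Qed.

Let pi0 z : (0 <= pair_law z)%R.
Proof. by apply: fine_ge0; apply: esum_ge0 => a _; rewrite lee_fin. Qed.

Let inv' a' : \esum_(d in [set: nat]) \esum_(a in [set: ST]) (nu a * renewal_kernel a (a', d))%:E = (nu a')%:E.
Proof. by rewrite esum_exchange// => d a; rewrite lee_fin. Qed.

Lemma pair_lawE z : (pair_law z)%:E = \esum_(a in [set: ST]) (nu a * renewal_kernel a z)%:E.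
Proof.
have z1 : 0 <= \esum_(a in [set: ST]) (nu a * renewal_kernel a z)%:E.
  by apply: esum_ge0 => a _; rewrite lee_fin.
rewrite fineK// ge0_fin_numE//; case: z z1 => a' d z1.
apply: (@le_lt_trans _ _ (nu a')%:E); last exact: ltry.
rewrite -inv'; apply: esum_ge; exists [set d] => //.
by rewrite fsbig_set1.
Qed.

Let sum_d a' : \esum_(d in [set: nat]) (pair_law (a', d))%:E = (nu a')%:E.
Proof. by rewrite -inv'; apply: eq_esum => d _; rewrite pair_lawE. Qed.

Let esum_pair (F : ZT -> \bar R) : (forall z, 0 <= F z) ->
  \esum_(z in [set: ZT]) F z = \esum_(a in [set: ST]) \esum_(d in [set: nat]) F (a, d).
Proof.
move=> F0; rewrite esum_esum//.
rewrite (_ : [set: ST] `*`` (fun=> [set: nat]) = [set: ZT]); last by apply/seteqP; split.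
by apply: eq_esum => -[].
Qed.

Let pi1 : \esum_(z in [set: ZT]) (pair_law z)%:E = 1.
Proof.
rewrite esum_pair; last by move=> z; rewrite lee_fin.
by rewrite -nu1; apply: eq_esum => a _; exact: sum_d.
Qed.

Let pi_inv z' : \esum_(z in [set: ZT]) (pair_law z * pair_kernel z z')%:E = (pair_law z')%:E.
Proof.
rewrite esum_pair; last by move=> z; rewrite lee_fin mulr_ge0// pair_kernel_ge0.
rewrite pair_lawE; apply: eq_esum => a _; rewrite /pair_kernel /=.
case: asboolP => [at_|nat_].
  under eq_esum do rewrite mulrC EFinM.
  by rewrite esumZl ?renewal_kernel_ge0 ?sum_d// ?EFinM 1?muleC// => d; rewrite lee_fin.
rewrite (nuA nat_) mul0r; apply: esum1 => d _.
suff -> : pair_law (a, d) = 0%R by rewrite mul0r.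
apply: EFin_inj; rewrite pair_lawE; apply/eqP; rewrite eq_le esum_ge0 ?andbT; last first.
  by move=> b _; rewrite lee_fin.
rewrite -[leRHS](_ : (nu a)%:E = 0); last by rewrite (nuA nat_).
by rewrite -pair_lawE -sum_d; apply: esum_ge; exists [set d]; rewrite ?fsbig_set1.
Qed.

Let B : set ZT := [set z | z.1 = st0].

Let att0 : attained st0.
Proof.
apply: contrapT => nat_.
have H : {ae Lam 1%g, forall x, forall n, ~ (pw n.+1 x = st0)}.
  apply: ae_foralln => n; apply: ae_measure0; first exact: (measurable_pw su n [set st0]).
  apply/eqP; rewrite eq_le measure_ge0 andbT leNgt; apply/negP => h; apply: nat_.
  by exists n.
have F : {ae Lam 1%g, forall x, ~ [set: PS] x}.
  by apply: ae_mono (ae_conj H states_io) => x [h /(_ 0%N)[j _ /h]].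
have := ae_null measurableT F; rewrite (iw_LamT hw) => /eqP; by rewrite eqe oner_eq0.
Qed.

Let kapB b b' z : B b -> B b' -> pair_kernel b z = pair_kernel b' z.
Proof. by rewrite /B /pair_kernel /= => -> ->; case: asboolP. Qed.

Section WithLaws.
Variable Law : ZT -> {measure set PZ -> \bar R}.
Hypothesis LawT : forall a, Law a setT = 1.
Hypothesis LawE : forall a m y, Law a (cyl m y) =
  ((y 0%N == a)%:R * \prod_(i < m) pair_kernel (y i) (y i.+1))%:E.
Hypothesis LawP : forall n a (D : set PZ), measurable D ->
  Lam 1%g ([set x | renewal_pair n x = a] `&` zpath n @^-1` D) =
  Lam 1%g [set x | renewal_pair n x = a] * Law a D.

Let mhit : measurable ([set z | exists n, B (z n)] : set PZ).
Proof.
apply: measurable_exists; first exact: countableP.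
by move=> n; exact: (measurable_coord cZ n B).
Qed.

Let hit_null n a : 0 < Lam 1%g [set x | renewal_pair n x = a] ->
  Law a (~` [set z | exists n, B (z n)]) = 0.
Proof.
move=> pa; have mC := measurableC mhit; have := LawP n a mC.
have -> : Lam 1%g ([set x | renewal_pair n x = a] `&` zpath n @^-1` (~` [set z : PZ | exists n0, B (z n0)])) = 0.
  apply: ae_null.
    apply: measurableI; first exact: (measurable_Z su n [set a]).
    by rewrite -[X in measurable X]setTI; exact: measurable_zpath.
  apply: ae_mono states_io => x /(_ n)[j nj pj] [_]; apply.
  by exists (j - n)%N; rewrite /B /zpath /= subnKC.
move=> /esym/eqP; rewrite mule_eq0 => /orP[/eqP e|/eqP//]; by rewrite e ltxx in pa.
Qed.

(** A pair charged by the stationary law follows an attained state with positive probability, so it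
    really occurs along the walk, and then [st0] is visited because the walk visits it infinitely
    often. *)
Let hitB a : (0 < pair_law a)%R -> Law a (~` [set z | exists n, B (z n)]) = 0.
Proof.
move=> pa; have [b nb] : exists b, (0 < nu b * renewal_kernel b a)%R.
  apply: contrapT => no; move: pa; rewrite -lte_fin pair_lawE esum1 ?ltxx// => b _.
  congr (_%:E); apply/eqP; rewrite eq_le nk0 andbT leNgt; apply/negP => h; apply: no.
  by exists b.
have at_ : attained b by apply: contrapT => /nuA e; rewrite e mul0r ltxx in nb.
have [n pn] := at_; apply: (@hit_null n.+1).
pose y i : ZT := if i is 0%N then (b, 0%N) else a.
have mD : measurable ([set x | pw n.+1 x = b] : set PS) by exact: (measurable_pw su n [set b]).
have := @chain_prob n (fun x => pw n.+1 x = b) y (@hist_ext_pw n b) mD (fun x h => h) 1.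
rewrite big_ord1 /pair_kernel /= asboolT// => e.
have kb : (0 < renewal_kernel b a)%R.
  by rewrite lt0r renewal_kernel_ge0 andbT; apply/eqP => e0; rewrite e0 mulr0 ltxx in nb.
apply: (@lt_le_trans _ _ (Lam 1%g [set x | pw n.+1 x = b /\
    forall i, (0 < i <= 1)%N -> renewal_pair (n + i) x = y i])).
  by rewrite e mule_gt0.
apply: le_measure; rewrite ?inE.
- apply: measurableI => //; apply: measurable_forall; first exact: countableP.
  move=> i; have [im|im] := boolP (0 < i <= 1)%N; last first.
    by rewrite (_ : (fun _ => _) = setT)//; apply/seteqP; split.
  rewrite (_ : (fun _ => _) = [set x | renewal_pair (n + i) x = y i]).
    exact: (measurable_Z su (n + i) [set y i]).
  by apply/seteqP; split=> x /= h; [exact: h|].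
- exact: (measurable_Z su n.+1 [set a]).
- by move=> x [_ /(_ 1%N isT)]; rewrite addn1.
Qed.

(** The process is disintegrated over its first pair. A first pair of positive probability leads to
    [st0] almost surely, so what holds from all such starting points carries over to the walk. *)
Let transfer (P : (nat -> ZT) -> Prop) :
  (forall a, Law a (~` [set z | exists n, B (z n)]) = 0 -> {ae Law a, forall z, P z}) ->
  {ae Lam 1%g, forall x, P (renewal_pair ^~ x)}.
Proof.
move=> hP; have H a : {ae Lam 1%g, forall x, renewal_pair 0 x = a -> P (renewal_pair ^~ x)}.
  have mD : measurable ([set x | renewal_pair 0 x = a] : set PS) by exact: (measurable_Z su 0 [set a]).
  have [z|nz] := eqVneq (Lam 1%g [set x | renewal_pair 0 x = a]) 0.
    by apply: ae_mono (ae_measure0 mD z) => x nx xa.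
  have pa : 0 < Lam 1%g [set x | renewal_pair 0 x = a] by rewrite lt0e nz measure_ge0.
  have [N0 [mN N00 nN]] := hP a (hit_null pa).
  have := LawP 0 a mN; rewrite N00 mule0 => z.
  have mS : measurable (([set x | renewal_pair 0 x = a] `&` zpath 0 @^-1` N0) : set PS).
    by apply: measurableI => //; rewrite -[X in measurable X]setTI; exact: measurable_zpath.
  apply: ae_mono (ae_measure0 mS z) => x nx xa; apply: contrapT => nP; apply: nx.
  by split=> //; apply: nN.
by apply: ae_mono (ae_forall cZ H) => x; apply.
Qed.

Lemma nu_pos_laws : (0 < nu st0)%R.
Proof.
have := stationary_hit_pos cZ LawT pair_kernel_ge0 LawE pi0 pi1 pi_inv hitB.
suff -> : \esum_(z in B) (pair_law z)%:E = (nu st0)%:E by rewrite lte_fin.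
rewrite esum_mkcond esum_pair; last by move=> z; case: ifP; rewrite ?lee_fin.
rewrite (esumID [set st0])//; last by move=> a _; apply: esum_ge0 => d _; case: ifP; rewrite ?lee_fin.
rewrite !setTI esum_set1; last by apply: esum_ge0 => d _; case: ifP; rewrite ?lee_fin.
rewrite [X in _ + X]esum1 ?adde0; last first.
  by move=> a /= na; apply: esum1 => d _; rewrite memNset.
by rewrite -sum_d; apply: eq_esum => d _; rewrite mem_set.
Qed.

Lemma lln_Z_lower_laws (f : ZT -> R) (c : R) : (forall z, 0 <= f z)%R -> (0 <= c)%R ->
  c%:E < \esum_(z in [set: ZT]) (pair_law z * f z)%:E ->
  {ae Lam 1%g, forall x, exists b : nat, forall n,
    (n%:R * c <= \sum_(0 <= i < n) f (renewal_pair i x) + b%:R)%R}.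
Proof.
move=> f0 c0 fc; apply: (transfer (P := fun z => exists b : nat, forall n,
    (n%:R * c <= \sum_(0 <= i < n) f (z i) + b%:R)%R)) => a.
exact: (lln_lower cZ LawT pair_kernel_ge0 LawE pi0 pi1 pi_inv kapB hitB f0 c0 fc).
Qed.

Lemma lln_Z_upper_laws (f : ZT -> R) (mu e : R) : (forall z, 0 <= f z)%R -> (0 < e)%R ->
  \esum_(z in [set: ZT]) (pair_law z * f z)%:E = mu%:E ->
  {ae Lam 1%g, forall x, exists b : nat, forall n,
    (\sum_(0 <= i < n) f (renewal_pair i x) <= n%:R * (mu + e) + b%:R)%R}.
Proof.
move=> f0 e0 fE; apply: (transfer (P := fun z => exists b : nat, forall n,
    (\sum_(0 <= i < n) f (z i) <= n%:R * (mu + e) + b%:R)%R)) => a.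
exact: (lln_upper cZ LawT pair_kernel_ge0 LawE pi0 pi1 pi_inv kapB hitB f0 e0 fE).
Qed.

End WithLaws.

Lemma nu_pos : (0 < nu st0)%R.
Proof. by have [Law [h1 h2 h3]] := laws; exact: nu_pos_laws h1 h2 h3. Qed.

Lemma lln_Z_lower (f : ZT -> R) (c : R) : (forall z, 0 <= f z)%R -> (0 <= c)%R ->
  c%:E < \esum_(z in [set: ZT]) (pair_law z * f z)%:E ->
  {ae Lam 1%g, forall x, exists b : nat, forall n,
    (n%:R * c <= \sum_(0 <= i < n) f (renewal_pair i x) + b%:R)%R}.
Proof.
by move=> f0 c0 fc; have [Law [h1 h2 h3]] := laws; exact: (lln_Z_lower_laws h1 h2 h3 f0 c0 fc).
Qed.

Lemma lln_Z_upper (f : ZT -> R) (mu e : R) : (forall z, 0 <= f z)%R -> (0 < e)%R ->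
  \esum_(z in [set: ZT]) (pair_law z * f z)%:E = mu%:E ->
  {ae Lam 1%g, forall x, exists b : nat, forall n,
    (\sum_(0 <= i < n) f (renewal_pair i x) <= n%:R * (mu + e) + b%:R)%R}.
Proof.
by move=> f0 e0 fE; have [Law [h1 h2 h3]] := laws; exact: (lln_Z_upper_laws h1 h2 h3 f0 e0 fE).
Qed.

Definition mean_gap : \bar R := \esum_(z in [set: ZT]) (pair_law z * z.2%:R)%:E.

Let sum_gap x n : good x ->
  (\sum_(0 <= i < n) (renewal_pair i x).2%:R = (le n x)%:R - (le 0 x)%:R :> R)%R.
Proof.
move=> gx; elim: n => [|n IH]; first by rewrite big_geq// subrr.
rewrite big_nat_recr//= IH natrB; last by apply: (good_le_mono su gx).
by ring.
Qed.

Lemma gap_lower (c : R) : (0 <= c)%R -> c%:E < mean_gap ->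
  {ae Lam 1%g, forall x, exists b : nat, forall n, (n%:R * c <= (le n x)%:R + b%:R)%R}.
Proof.
move=> c0 hc; have H := lln_Z_lower (fun z => ler0n R z.2) c0 hc.
apply: ae_mono (ae_conj H (good_ae su tr 1%g)) => x [[b hb] gx]; exists b => n.
by have := hb n; rewrite sum_gap//; have : (0 <= (le 0 x)%:R :> R)%R by []; lra.
Qed.

Lemma gap_upper (mu e : R) : (0 < e)%R -> mean_gap = mu%:E ->
  {ae Lam 1%g, forall x, exists b : nat, forall n, ((le n x)%:R <= n%:R * (mu + e) + b%:R)%R}.
Proof.
move=> e0 hmu; have H := lln_Z_upper (fun z => ler0n R z.2) e0 hmu.
apply: ae_mono (ae_conj H (good_ae su tr 1%g)) => x [[b hb] gx]; exists (b + le 0 x)%N => n.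
by have := hb n; rewrite sum_gap// natrD; lra.
Qed.

Let freq_mean : \esum_(z in [set: ZT]) (pair_law z * (z.1 == st0)%:R)%:E = (nu st0)%:E.
Proof.
rewrite esum_pair; last by move=> z; rewrite lee_fin mulr_ge0.
rewrite (esumID [set st0])//; last by move=> a _; apply: esum_ge0 => d _; rewrite lee_fin mulr_ge0.
rewrite !setTI esum_set1; last by apply: esum_ge0 => d _; rewrite lee_fin mulr_ge0.
rewrite [X in _ + X]esum1 ?adde0; last first.
  move=> a /= na; apply: esum1 => d _; case: eqP => [e|_]; last by rewrite mulr0.
  by case: na.
by rewrite -sum_d; apply: eq_esum => d _ /=; rewrite eqxx mulr1.
Qed.

Lemma freq_lower (c : R) : (0 <= c)%R -> (c < nu st0)%R ->
  {ae Lam 1%g, forall x, exists b : nat, forall n,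
    (n%:R * c <= \sum_(0 <= i < n) (pw i.+1 x == st0)%:R + b%:R)%R}.
Proof.
move=> c0 hc; apply: (lln_Z_lower (f := fun z => (z.1 == st0)%:R)) => //.
by rewrite freq_mean lte_fin.
Qed.

Lemma freq_upper (e : R) : (0 < e)%R ->
  {ae Lam 1%g, forall x, exists b : nat, forall n,
    (\sum_(0 <= i < n) (pw i.+1 x == st0)%:R <= n%:R * (nu st0 + e) + b%:R)%R}.
Proof.
move=> e0; apply: (lln_Z_upper (f := fun z => (z.1 == st0)%:R)) => //.
Qed.

End Stationary.
End RenewalLaws.

(** * The mean gap is finite and positive *)

Section MeanGap.
Variables (R : realType) (N : nat) (k : 'I_N -> nat) (W : groupType).
Variables (s : 'I_N -> W) (pb : W -> W -> R) (mass : W -> R).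
Local Notation PS := (path_space (1%g : W)).
Variables (Lam : W -> {measure set PS -> \bar R}) (L0 : nat) (eps Q : R).
Variables (A : labelled_graph N) (K : nat) (div : nat -> R) (L1 : R).
Variables (Cov : vertex A -> set W).
Hypothesis su : setup k s pb mass Lam L0 eps Q K div L1 Cov.
Let hW := su_W su.
Let hw := su_w su.
Let hA := su_A su.
Let cW := countable_W hW.

Variables (t : vertex A) (u : W) (r : seq (edge A)).
Hypothesis tr : trap s Lam L1 Cov t u r.
Local Notation le k x := (last_entry s L1 Cov K x k).
Local Notation hit := (hit s K L1 Cov t u r).
Local Notation ST := (vertex A * W * W)%type.
Local Open Scope ereal_scope.
Let eps0 : (0 < eps)%R. Proof. by case/andP: (iw_eps hw). Qed.

Lemma block_hits : exists J, exists2 c : R, (0 < c)%R & forall i,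
  c%:E <= Lam 1%g [set x | exists2 m, (i * J.+1 <= m < i.+1 * J.+1)%N & hit m x].
Proof.
have [J _ [c c0 win]] := hit_window su tr; exists J, c => // i.
pose B : set PS := [set x | exists m, ((m <= J)%N /\ hit m x)].
have mB : measurable B.
  apply: measurable_exists; first exact: countableP.
  move=> m; have [mJ|mJ] := boolP (m <= J)%N.
    rewrite (_ : (fun _ => _) = hit m); first exact: (measurable_hit su).
    by apply/seteqP; split=> x // [].
  by rewrite (_ : (fun _ => _) = set0)//; apply/seteqP; split=> // x [].
have hB y : c%:E <= Lam y B.
  have [G h1 h2] := win y; apply: (le_trans h1); apply: le_measure; rewrite ?inE//.
    apply: measurable_forall; first exact: countableP.
    by move=> j; exact: (mW hW j (G j)).
  by move=> x /h2[m mJ hm]; exists m.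
set n := (i * J.+1)%N.
apply: (@le_trans _ _ (Lam 1%g (setT `&` shift n @^-1` B))).
  rewrite (Lam_markov_sum hW hw)//.
  apply: (@le_trans _ _ (\esum_(y in [set: W]) (c%:E * Lam 1%g (setT `&` [set z | z n = y])))).
    rewrite esumZl ?(ltW c0)//.
    rewrite -(measure_partition cW (Lam 1%g) (fun v => measurable_coord cW n [set v]) measurableT).
    by rewrite (iw_LamT hw) mule1.
  by apply: le_esum => y _; rewrite muleC lee_pmul// lee_fin ltW.
apply: le_measure; rewrite ?inE.
- by rewrite setTI; exact: measurable_shift_preimage.
- rewrite (_ : [set x | _] = [set x : PS | exists m, ((n <= m < i.+1 * J.+1)%N /\ hit m x)]); last first.
    by apply/seteqP; split=> x [m h1]; [move=> h2; exists m|case: h1 => h1 h2; exists m].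
  apply: measurable_exists; first exact: countableP.
  move=> m; have [mJ|mJ] := boolP (n <= m < i.+1 * J.+1)%N.
    rewrite (_ : (fun _ => _) = hit m); first exact: (measurable_hit su).
    by apply/seteqP; split=> x // [].
  by rewrite (_ : (fun _ => _) = set0)//; apply/seteqP; split=> // x [].
- move=> x [_ [m [mJ hm]]]; exists (n + m)%N.
    by rewrite leq_addr/= mulSn addnC ltn_add2r ltnS.
  exact: (hit_shift su hm).
Qed.

Section Gaps.
Variables (nu : ST -> R).
Hypothesis nu0 : forall a, (0 <= nu a)%R.
Hypothesis nuA : forall a, ~ attained s Lam K L1 Cov a -> nu a = 0%R.
Hypothesis nu1 : \esum_(a in [set: ST]) (nu a)%:E = 1.
Hypothesis nu_inv : forall a', \esum_(a in [set: ST]) \esum_(d in [set: nat])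
  (nu a * renewal_kernel s Lam L1 Cov a (a', d))%:E = (nu a')%:E.
Local Notation mean_gap := (mean_gap s Lam L1 Cov nu).

Lemma mean_gap_ge0 : 0 <= mean_gap.
Proof.
apply: esum_ge0 => z _; rewrite lee_fin mulr_ge0//; apply: fine_ge0.
by apply: esum_ge0 => a _; rewrite lee_fin mulr_ge0// renewal_kernel_ge0.
Qed.

Lemma ae_witness (P : PS -> Prop) : {ae Lam 1%g, forall x, P x} -> exists x, P x.
Proof.
move=> hP; apply: contrapT => no.
have F : {ae Lam 1%g, forall x, ~ [set: PS] x}.
  by apply: ae_mono hP => x Px; case: no; exists x.
have [S [mS S0 nS]] := F; have : Lam 1%g setT <= 0.
  by rewrite -S0; apply: le_measure; rewrite ?inE// => x _; apply: nS => /=; exact.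
by rewrite (iw_LamT hw) lee_fin ler10.
Qed.

(** With infinite mean the n-th entry time would be at least n c' - b for a large slope c', outside
    an event of probability c/4, so few entries would fall into the first n blocks of length J+1.
    But by [block_hits] each block contains one with probability at least c. *)
Lemma mean_gap_lt : mean_gap < +oo.
Proof.
rewrite ltey; apply/eqP => inf.
have [J [c c0 hb]] := block_hits.
(* With this slope only about n c / 4 entries fit into n blocks, whereas on average at least n c
   blocks contain one. *)
pose c' : R := (4 * J.+1%:R / c)%R.
have c'0 : (0 < c')%R by rewrite divr_gt0// mulr_gt0// ltr0n.
have H := gap_lower su tr nu0 nuA nu1 nu_inv (ltW c'0) (_ : c'%:E < mean_gap).
have {}H := H (eq_ind_r (fun z => c'%:E < z) (ltry c') inf).
pose Ab b : set PS := [set x | forall n, (n%:R * c' <= (le n x)%:R + b%:R)%R].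
have mA b : measurable (Ab b).
  apply: measurable_forall; first exact: countableP.
  move=> n; exact: (measurable_le2 su (fun m _ _ _ => (n%:R * c' <= m%:R + b%:R)%R) n n).
have Anull : Lam 1%g (\bigcap_b (~` Ab b)) = 0.
  apply: ae_null; first by apply: bigcapT_measurable => b; exact: measurableC.
  by apply: ae_mono H => x [b hx] /(_ b Logic.I); apply.
have cv : Lam 1%g (~` Ab n) @[n --> \oo] --> 0.
  rewrite -Anull; apply: nonincreasing_cvg_mu.
  - by rewrite (@le_lt_trans _ _ 1)// ?ltry// (Lam_le1 hw)//; exact: measurableC.
  - by move=> n; exact: measurableC.
  - by apply: bigcapT_measurable => b; exact: measurableC.
  - move=> m n mn; apply/subsetPset => x nx Ax; apply: nx => i.
    apply: (le_trans (Ax i)); by rewrite lerD2l ler_nat.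
have [b hbad] : exists b, Lam 1%g (~` Ab b) <= (c / 4)%:E.
  apply: contrapT => no; have : (c / 4)%:E <= 0.
    rewrite -(cvg_lim _ cv)//; apply: lime_ge; first by apply/cvg_ex; exists 0.
    by apply: nearW => n; rewrite leNgt; apply/negP => h; apply: no; exists n; exact: ltW.
  by rewrite lee_fin leNgt divr_gt0.
pose E i : set PS := [set x | exists2 m, (i * J.+1 <= m < i.+1 * J.+1)%N & hit m x].
pose V i j : set PS := [set x | (i * J.+1 <= le j.+1 x < i.+1 * J.+1)%N].
have mV i j : measurable (V i j).
  exact: (measurable_le2 su (fun m _ _ _ => (i * J.+1 <= m < i.+1 * J.+1)%N) j.+1 j.+1).
have mE i : measurable (E i).
  rewrite (_ : E i = [set x : PS | exists m, ((i * J.+1 <= m < i.+1 * J.+1)%N /\ hit m x)]); last first.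
    by apply/seteqP; split=> x [m h1]; [move=> h2; exists m|case: h1 => h1 h2; exists m].
  apply: measurable_exists; first exact: countableP.
  move=> m; have [mJ|mJ] := boolP (i * J.+1 <= m < i.+1 * J.+1)%N.
    rewrite (_ : (fun _ => _) = hit m); first exact: (measurable_hit su).
    by apply/seteqP; split=> x // [].
  by rewrite (_ : (fun _ => _) = set0)//; apply/seteqP; split=> // x [].
(* The expected number of blocks containing an entry is counted by entries: only indices below q
   reach the first n blocks, each falls into at most one block, and the exceptional event costs c/4
   per block. *)
have bound n (q : nat) : ((n * J.+1)%:R + b%:R <= q%:R * c')%R -> (n%:R * c <= q%:R + n%:R * (c / 4))%R.
  move=> hq; pose v i j := fine (Lam 1%g (V i j)).
  have vE i j : (v i j)%:E = Lam 1%g (V i j) by rewrite fineK// (Lam_fin hw).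
  have each i : (i < n)%N -> (c <= \sum_(0 <= j < q) v i j + c / 4)%R.
    move=> im; rewrite -lee_fin EFinD; apply: (le_trans (hb i)).
    apply: (@le_trans _ _ (Lam 1%g ((\big[setU/set0]_(j < q) V i j) `|` ~` Ab b))).
      apply: le_measure; rewrite ?inE; first exact: mE.
        by apply: measurableU; [exact: bigsetU_measurable|exact: measurableC].
      move=> x Ex; have [Ax|nA] := pselect (Ab b x); last by right.
      left; have [m mi hm] := Ex; have [j [_ _ lj]] := hit_state su tr hm.
      rewrite -bigcup_mkord; exists j; last by rewrite /V /= lj.
      rewrite /= -(ltr_nat R) -(ltr_pM2r c'0).
      have := Ax j.+1; rewrite lj -natr1 mulrDl mul1r => h1.
      have mn : (m%:R <= (n * J.+1)%:R :> R)%R.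
        by rewrite ler_nat; case/andP: mi => _ /ltnW h; apply: (leq_trans h); rewrite leq_mul2r im orbT.
      lra.
    apply: (le_trans (measureU2 _ _ _)); [exact: bigsetU_measurable|exact: measurableC|].
    have bo : Lam 1%g (\big[setU/set0]_(j < q) V i j) <= \sum_(j < q) Lam 1%g (V i j).
      by apply: (@Boole_inequality _ _ _ (Lam 1%g) (V i) q) => j _; exact: mV.
    rewrite leeD//; apply: (le_trans bo).
    by rewrite -sumEFin big_mkord; apply: lee_sum => j _; rewrite vE.
  have tot j : (\sum_(0 <= i < n) v i j <= 1)%R.
    rewrite -lee_fin -sumEFin; under eq_bigr do rewrite vE.
    apply: (@le_trans _ _ (Lam 1%g (\big[setU/set0]_(i < n) V i j))).
      rewrite big_mkord (measure_bigsetU (Lam 1%g) (F := fun i => V i j))//.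
      apply/trivIsetP => i1 i2 _ _ ii; apply/seteqP; split=> // x [/andP[a1 a2] /andP[a3 a4]].
      case/negP: ii; apply/eqP.
      have h1 : (i1 * J.+1 < i2.+1 * J.+1)%N by exact: leq_ltn_trans a1 a4.
      have h2 : (i2 * J.+1 < i1.+1 * J.+1)%N by exact: leq_ltn_trans a3 a2.
      rewrite !ltn_mul2r /= !ltnS in h1 h2; lia.
    by apply: (Lam_le1 hw); exact: bigsetU_measurable.
  have S1 : (\sum_(0 <= i < n) c <= \sum_(0 <= i < n) (\sum_(0 <= j < q) v i j + c / 4))%R.
    by rewrite big_nat [leRHS]big_nat; apply: ler_sum => i /andP[_ im]; exact: each.
  rewrite big_split/= exchange_big/= !big_const_nat !iter_addr_0 !subn0 in S1.
  have S2 : (\sum_(0 <= j < q) \sum_(0 <= i < n) v i j <= \sum_(0 <= j < q) 1)%R.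
    by apply: ler_sum => j _; exact: tot.
  rewrite big_const_nat iter_addr_0 subn0 in S2.
  rewrite -[(c *+ n)%R]mulr_natl -[(c / 4 *+ n)%R]mulr_natl in S1.
  exact: (le_trans S1 (lerD S2 (lexx _))).
pose n := (Num.Def.truncn ((b%:R / c' + 2) * 4 / c)).+1.
pose q := (Num.Def.truncn (((n * J.+1)%:R + b%:R) / c')).+1.
have hq : ((n * J.+1)%:R + b%:R <= q%:R * c')%R.
  by rewrite -ler_pdivrMr// ltW// truncnS_gt.
have q2 : (q%:R <= ((n * J.+1)%:R + b%:R) / c' + 1)%R.
  rewrite /q -natr1 lerD2r truncn_le// divr_ge0 ?(ltW c'0)// addr_ge0//.
have := bound n q hq.
have e1 : ((n * J.+1)%:R / c' = n%:R * (c / 4) :> R)%R.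
  have cn : (c != 0)%R by rewrite gt_eqF.
  apply: (canLR (mulfK (lt0r_neq0 c'0))); rewrite /c' natrM.
  set j := (J.+1%:R)%R.
  have -> : (n%:R * (c / 4) * (4 * j / c) = n%:R * j * (c * c^-1) * (4 / 4))%R by ring.
  by rewrite !divff ?mulr1.
rewrite mulrDl e1 in q2.
have hn : ((b%:R / c' + 2) * 4 / c < n%:R)%R by exact: truncnS_gt.
rewrite ltr_pdivrMr// in hn.
have bc : (0 <= b%:R / c')%R by rewrite divr_ge0// (ltW c'0).
lra.
Qed.

(** Cones of level n have length above n and steps have length at most [L0], so the n-th entry time
    is at least n / L0. *)
Lemma mean_gap_gt0 : 0 < mean_gap.
Proof.
rewrite lt0e mean_gap_ge0 andbT; apply/eqP => z.
pose e : R := (L0%:R * 2)^-1%R.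
have L1' : (1 <= L0%:R :> R)%R by rewrite ler1n; exact: (L0_gt0 hW hw).
have e0 : (0 < e)%R by rewrite invr_gt0; lra.
have H := gap_upper su tr nu0 nuA nu1 nu_inv e0 z.
have x0ae : {ae Lam 1%g, forall x : PS, x 0%N = 1%g}.
  have m0 := measurableC (mW hW 0 [set 1%g]).
  apply: ae_mono (ae_measure0 m0 _) => [x /contrapT//|].
  by rewrite (LamC hw) ?(Lam_start hw) ?subee//; exact: (mW hW 0 [set 1%g]).
have [x [[[[b hx] gx] st] x0]] := ae_witness (ae_conj (ae_conj (ae_conj H (good_ae su tr 1%g))
  (bounded_steps hW hw 1%g)) x0ae).
pose n := (2 * L0 * b).+1.
have h1 := good_le_lower su n gx x0 st; have := hx n.
have {}h1 : (n%:R <= L0%:R * (le n x)%:R :> R)%R by rewrite -natrM ler_nat.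
have e2 : (L0%:R * e = 2^-1 :> R)%R by rewrite /e; field; apply/eqP; lra.
move=> h2; have h3 : (L0%:R * (le n x)%:R <= L0%:R * (n%:R * (0 + e) + b%:R))%R.
  by rewrite ler_wpM2l.
have e3 : (L0%:R * (n%:R * (0 + e) + b%:R) = n%:R * (L0%:R * e) + L0%:R * b%:R)%R by ring.
rewrite e3 e2 in h3; have : (n%:R = 2 * (L0%:R * b%:R) + 1 :> R)%R.
  by rewrite /n -natr1 !natrM; ring.
lra.
Qed.

End Gaps.

End MeanGap.

(** * Probabilities of entry cones *)

Section TrappingEstimates.
Variables (R : realType) (N : nat) (k : 'I_N -> nat) (W : groupType).
Variables (s : 'I_N -> W) (pb : W -> W -> R) (mass : W -> R).
Local Notation PS := (path_space (1%g : W)).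
Variables (Lam : W -> {measure set PS -> \bar R}) (L0 : nat) (eps Q : R).
Variables (A : labelled_graph N) (K : nat) (div : nat -> R) (L1 : R).
Variables (Cov : vertex A -> set W).
Hypothesis su : setup k s pb mass Lam L0 eps Q K div L1 Cov.
Let hW := su_W su.
Let hw := su_w su.
Let hA := su_A su.
Let cW := countable_W hW.
Local Notation T := (cone_type s A).
Local Notation pv := (path_value s (A := A)).

Variables (t : vertex A) (u : W) (r : seq (edge A)).
Hypothesis tr : trap s Lam L1 Cov t u r.
Local Notation le k x := (last_entry s L1 Cov K x k).
Local Notation ec k x := (entry_cone s L1 Cov K x k).
Local Notation pw k x := (procW s L1 Cov K x k).
Local Notation stay := (stay s A L1).
Local Notation Ent := (Ent s A L1).
Local Notation entrance := (entrance s L1 r).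
Local Notation ST := (vertex A * W * W)%type.
Local Notation st0 := ((t, u, pv r) : ST).
Local Open Scope ereal_scope.
Let eps0 : (0 < eps)%R. Proof. by case/andP: (iw_eps hw). Qed.

Lemma measurable_ec n w : measurable ([set x | ec n x = w] : set PS).
Proof. exact: (measurable_hist2 su (fun _ v _ _ _ _ => v = w) n n). Qed.

Definition cone_prob n w : R := fine (Lam 1%g [set x | ec n x = w]).
(** The part of [cone_prob n w] in which the cone is entered through the trap state. *)
Definition exit_prob n w : R := fine (Lam 1%g [set x | ec n x = w /\ pw n x = st0]).

Lemma measurable_exit n w : measurable ([set x | ec n.+1 x = w /\ pw n.+1 x = st0] : set PS).
Proof. by apply: measurableI; [exact: measurable_ec|exact: (measurable_pw su n [set st0])]. Qed.

Lemma cone_probE n w : (cone_prob n w)%:E = Lam 1%g [set x | ec n x = w].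
Proof. by rewrite fineK// (Lam_fin hw)//; exact: measurable_ec. Qed.

Lemma exit_probE n w : (exit_prob n.+1 w)%:E = Lam 1%g [set x | ec n.+1 x = w /\ pw n.+1 x = st0].
Proof. by rewrite fineK// (Lam_fin hw)//; exact: measurable_exit. Qed.

Lemma cone_prob_ge0 n w : (0 <= cone_prob n w)%R. Proof. exact: fine_ge0. Qed.
Lemma exit_prob_ge0 n w : (0 <= exit_prob n w)%R. Proof. exact: fine_ge0. Qed.

Lemma cone_prob_le1 n w : (cone_prob n w <= 1)%R.
Proof. by rewrite -lee_fin cone_probE (Lam_le1 hw)//; exact: measurable_ec. Qed.

Lemma exit_prob_le_cone_prob n w : (exit_prob n.+1 w <= cone_prob n.+1 w)%R.
Proof.
rewrite -lee_fin cone_probE exit_probE; apply: le_measure; rewrite ?inE; last by move=> x [].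
  exact: measurable_exit.
exact: measurable_ec.
Qed.

Local Notation green_value := (green_value pb).

(** On this event the walk visits the entry point of the trap; the union bound over the time of the
    visit gives the Green function. *)
Lemma exit_prob_le_green n w : (exit_prob n.+1 w <= green_value (w * pv r)%g)%R.
Proof.
rewrite -lee_fin exit_probE (green_valueE hW hw hA (su_K su)).
under eq_eseriesr do rewrite (transE hW hw).
have mx m : measurable ([set x : PS | x m = (w * pv r)%g]) by exact: (mW hW m [set (w * pv r)%g]).
have h : Lam 1%g [set x | ec n.+1 x = w /\ pw n.+1 x = st0] <=
    \sum_(0 <= m <oo) Lam 1%g [set x : PS | x m = (w * pv r)%g].
  apply: measure_sigma_subadditive => //; first exact: measurable_exit.
  move=> x [ex]; rewrite /procW /= ex => -[_ _ px]; exists (le n.+1 x) => //=.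
  by rewrite -px mulgA mulgV mul1g.
exact: h.
Qed.

Let sg := fine (Lam (type_rep s t * pv r)%g (stay (type_rep s t))).

Let rept : T (type_rep s t) = t. Proof. exact: (type_repP su (trap_rec tr)). Qed.

Let sgE w : T w = t -> Lam (w * pv r)%g (stay w) = sg%:E.
Proof.
move=> tw; rewrite (stay_tr su (w' := type_rep s t)) ?tw ?rept//.
by rewrite fineK// (Lam_fin hw)//; exact: (measurable_stay su).
Qed.

Let sg0 : (0 < sg)%R.
Proof. by rewrite -lte_fin -(sgE rept); exact: trap_stay tr _ rept. Qed.

Lemma sg_gt0 : (0 < sg)%R. Proof. exact: sg0. Qed.

Lemma entrance_Ent w l m x : T w = t -> entrance w l (shift m x) ->
  stay w (shift (m + l) x) -> Ent w (m + l) x.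
Proof.
move=> tw [e1 [i il e2] e3] sx; split=> //; split.
  by have := e1; rewrite /shift => ->; exact: trap_I3 tr _ tw.
move=> m' ml Im; have [mm|mm] := leqP m m'.
  have [||j /andP[j1 j2] nj] := e3 (m' - m)%N; first by lia.
    by rewrite /shift subnKC.
  by exists (m + j)%N; [lia|exact: nj].
by exists (m + i)%N; [lia|exact: e2].
Qed.

(** Visiting [c 0] at time m, following c and then staying makes m + l the last entry time into w.
    For different m these events are disjoint, so their probabilities add up, and the visits sum to
    the Green function. *)
Lemma trapped_prob w l c : T w = t -> (forall i, (i < l)%N -> adj s (c i) (c i.+1)) ->
  entrance w l c ->
  (eps ^+ l * sg * green_value (c 0%N))%:E <= Lam 1%g [set x | exists m, Ent w m x].
Proof.
move=> tw ca ce; have [cl _ _] := ce.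
pose D : set PS := @cyl W 1%g l c `&` shift l @^-1` stay w.
have mD : measurable D.
  apply: measurableI; first exact: measurable_cyl.
  by apply: measurable_shift_preimage => //; exact: (measurable_stay su).
pose B (m : nat) : set PS := [set x | x m = c 0%N] `&` shift m @^-1` D.
have mB m : measurable (B m).
  by apply: measurableI; [exact: (mW hW m [set c 0%N])|exact: measurable_shift_preimage].
have BE (m : nat) (x : PS) : B m x -> Ent w (m + l) x.
  move=> [_ [cx sx]]; apply: entrance_Ent => //.
    by apply: entrance_local ce => i il; rewrite cx.
  by rewrite -shiftD.
have tB : trivIset setT B.
  have cross a b (y : PS) : (a < b)%N -> B a y -> B b y -> False.
    move=> ab /BE E1 /BE[[_ fe] _]; have [j1 j2] := Ent_enter E1.
    have [|n /andP[n1 n2] nn] := fe (a + l)%N _ j1; first by lia.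
    by apply: nn; apply: j2.
  apply/trivIsetP => i j _ _ ij; rewrite -subset0 => y [Bi Bj].
  have [h|h] := ltnP i j; first exact: (cross i j y h Bi Bj).
  by apply: (cross j i y _ Bj Bi); rewrite ltn_neqAle eq_sym ij.
have LB m : Lam 1%g (B m) = (fine (Lam (c 0%N) (cyl l c)) * sg)%:E * (trans Lam m 1%g (c 0%N))%:E.
  have mk : Lam 1%g (setT `&` [set z : PS | z m = c 0%N] `&` shift m @^-1` D) =
      Lam 1%g (setT `&` [set z : PS | z m = c 0%N]) * Lam (c 0%N) D.
    exact: (Lam_markov_at hW hw).
  rewrite setTI in mk; rewrite mk (transE hW hw) muleC; congr (_ * _).
  have h2 : Lam (c 0%N) D = Lam (c 0%N) (cyl l c) * Lam (c l) (stay w).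
    exact: (Lam_cyl_shift cW (iw_LamT hw) (iw_ge0 hw) (iw_cyl hw) _ _ _ (measurable_stay su w)).
  by rewrite h2 cl sgE// -(fineK (_ : Lam (c 0%N) (cyl l c) \is a fin_num))// (Lam_fin hw)//; exact: measurable_cyl.
have fp := follow_path su ca.
have mEx : measurable ([set x : PS | exists m, Ent w m x]).
  by apply: measurable_exists; [exact: countableP|move=> m; exact: (measurable_Ent su)].
apply: (@le_trans _ _ (Lam 1%g (\bigcup_m B m))); last first.
  apply: le_measure; rewrite ?inE//; first exact: bigcup_measurable.
  by move=> x [m _ /BE h]; exists (m + l)%N.
have -> : Lam 1%g (\bigcup_m B m) = \sum_(0 <= m <oo) Lam 1%g (B m).
  by rewrite measure_bigcup//; apply: eq_eseriesl => m; rewrite in_setT.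
under eq_eseriesr do rewrite LB.
have cf : (Lam (c 0%N) (cyl l c)) \is a fin_num by rewrite (Lam_fin hw)//; exact: measurable_cyl.
rewrite nneseriesZl//; last by move=> m _; rewrite lee_fin (trans_ge0 Lam).
rewrite -(green_valueE hW hw hA (su_K su) (c 0%N)) -EFinM lee_fin.
apply: ler_wpM2r; first exact: (ltW (green_value_gt0 hW hw hA (su_K su) _)).
by apply: ler_wpM2r; [exact: (ltW sg0)|rewrite -lee_fin fineK].
Qed.

End TrappingEstimates.

(** * Detours and lower bounds for entry probabilities *)

Section Siblings.
Variables (R : realType) (N : nat) (k : 'I_N -> nat) (W : groupType).
Variables (s : 'I_N -> W) (pb : W -> W -> R) (mass : W -> R).
Local Notation PS := (path_space (1%g : W)).
Variables (Lam : W -> {measure set PS -> \bar R}) (L0 : nat) (eps Q : R).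
Variables (A : labelled_graph N) (K : nat) (div : nat -> R) (L1 : R).
Variables (Cov : vertex A -> set W).
Hypothesis su : setup k s pb mass Lam L0 eps Q K div L1 Cov.
Let hW := su_W su.
Let hw := su_w su.
Let hA := su_A su.
Let cW := countable_W hW.
Local Notation len := (len s).
Local Notation C := (cone s A).
Local Notation T := (cone_type s A).
Local Notation pre := (pre s A).
Local Notation pv := (path_value s (A := A)).

Variables (t : vertex A) (u : W) (r : seq (edge A)).
Hypothesis tr : trap s Lam L1 Cov t u r.
Local Notation ec k x := (entry_cone s L1 Cov K x k).
Local Notation entered := (entered s K L1 Cov).
Local Notation cov_level := (cov_level s Cov K).
Local Notation stay := (stay s A L1).
Local Notation Ent := (Ent s A L1).
Local Notation entrance := (entrance s L1 r).
Local Open Scope ereal_scope.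
Let eps0 : (0 < eps)%R. Proof. by case/andP: (iw_eps hw). Qed.

Local Notation cone_prob := (cone_prob s Lam K L1 Cov).
Local Notation green_value := (green_value pb).
Let mE n w : measurable ([set x | ec n x = w] : set PS). Proof. exact: (measurable_ec su). Qed.

(** The path descends to the common vertex at level k0 and climbs to the entry point of w. The
    turning point is outside [C w] because k0 < len w, and it supplies the exit demanded by
    [entrance]. *)
Lemma down_up x0 w k0 : T w = t -> (k0 < len w)%N -> (k0 <= len x0)%N ->
  pre x0 k0 = pre w k0 -> let l := (len x0 - k0 + (len w + size r - k0))%N in
  exists c : nat -> W, [/\ c 0%N = x0,
    forall i, (i < l)%N -> adj s (c i) (c i.+1) & entrance w l c].
Proof.
move=> tw kw kx pe l; set z := (w * pv r)%g.
have pr : is_path (T w) r by rewrite tw; exact: trap_path tr.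
have zc : C w z by exact: (cone_extend hA pr).
have lz : len z = (len w + size r)%N.
  by rewrite -(size_gamma hA) (gamma_extend hA pr) size_cat (size_gamma hA).
have pz : pre z k0 = pre x0 k0.
  by rewrite pe -(pre_pre hA z (ltnW kw)) (cone_preE hA zc).
set d := (len x0 - k0)%N.
pose c i := if (i <= d)%N then pre x0 (len x0 - i) else pre z (k0 + (i - d)).
have lE : l = (d + (len z - k0))%N by rewrite lz.
have cD i : (d <= i)%N -> c i = pre z (k0 + (i - d)).
  rewrite /c leq_eqVlt => /orP[/eqP<-|di]; last by rewrite leqNgt di.
  by rewrite leqnn subnn addn0 pz /d subKn.
exists c; split.
- by rewrite /c leq0n subn0 (pre_len hA).
- move=> i il; have [id|di] := ltnP i d; last first.
    rewrite !cD ?leqW// subSn// addnS; apply: (pre_adj hW hA); lia.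
  rewrite /c (ltnW id) id (adjC hW).
  have -> : (len x0 - i = (len x0 - i.+1).+1)%N by move: id; rewrite /d; lia.
  by apply: (pre_adj hW hA); move: id; rewrite /d; lia.
- have cd : ~ C w (c d).
    rewrite (cD d (leqnn d)) subnn addn0 pz => /(cone_len hA).
    by rewrite (len_pre hA)//; lia.
  have dl : (d < l)%N by rewrite lE; lia.
  split.
  + rewrite cD ?(ltnW dl)// lE; rewrite (_ : k0 + _ = len z)%N ?(pre_len hA)//; lia.
  + by exists d => // /I1C.
  + move=> m ml Im; have [md|dm] := leqP m d.
      by exists d; [rewrite md|move=> /I1C].
    rewrite (cD m (ltnW dm)) in Im; have wc := cone_len hA (I3C Im).
    rewrite (len_pre hA) in wc; last by lia.
    set i := (k0 + (m - d) - len w)%N.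
    have iE : (k0 + (m - d) = len w + i)%N by rewrite /i; lia.
    rewrite iE (pre_extend su _ pr) in Im.
    have [|j /andP[ij jr] nj] := trap_first tr tw _ Im; first by lia.
    exists (j + m - i)%N; first by lia.
    rewrite cD; last by lia.
    rewrite (_ : k0 + _ = len w + j)%N; last by lia.
    by rewrite (pre_extend su _ pr).
Qed.

Let sg := fine (Lam (type_rep s t * pv r)%g (stay (type_rep s t))).

Lemma trapped_low w x0 k0 : T w = t -> (k0 < len w)%N -> (k0 <= len x0)%N ->
  pre x0 k0 = pre w k0 ->
  (eps ^+ (len x0 - k0 + (len w + size r - k0)) * sg * green_value x0)%:E
    <= Lam 1%g [set x | exists m, Ent w m x].
Proof.
move=> tw h1 h2 h3; have [c [c0 ca ce]] := down_up tw h1 h2 h3.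
by have := trapped_prob su tr tw ca ce; rewrite c0.
Qed.

Let mX w : measurable ([set x : PS | exists m, Ent w m x]).
Proof. by apply: measurable_exists; [exact: countableP|move=> m; exact: (measurable_Ent su)]. Qed.

Let len_trap w : T w = t -> len (w * pv r)%g = (len w + size r)%N.
Proof.
move=> tw; have pr : is_path (T w) r by rewrite tw; exact: trap_path tr.
by rewrite -(size_gamma hA) (gamma_extend hA pr) size_cat (size_gamma hA).
Qed.

(** From the entry point, a detour of 2 (size r + 1) steps leads just outside the cone and back; its
    length does not depend on w. *)
Lemma cone_prob_low : exists2 c : R, (0 < c)%R & forall n w, cov_level n w -> T w = t ->
  (c * green_value (w * pv r)%g <= cone_prob n w)%R.
Proof.
exists (eps ^+ ((size r).+1 + (size r).+1) * sg)%R.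
  by rewrite mulr_gt0 ?exprn_gt0//; exact: (sg_gt0 su tr).
move=> n w lw tw; have lw0 := level_len su lw.
have pr : is_path (T w) r by rewrite tw; exact: trap_path tr.
have pe : pre (w * pv r)%g (len w).-1 = pre w (len w).-1.
  by rewrite -(pre_pre hA _ (leq_pred (len w))) (cone_preE hA (cone_extend hA pr)).
have := trapped_low tw (_ : (len w).-1 < len w)%N _ pe.
rewrite len_trap// => /(_ _ _); rewrite (_ : (len w + size r - (len w).-1 = (size r).+1)%N); last by lia.
move=> h; rewrite -lee_fin (cone_probE su); apply: le_trans (h _ _) _; [lia|lia|].
apply: le_measure; rewrite ?inE; [exact: mX|exact: mE|].
by move=> x [m /(at_last su lw)[]].
Qed.

(** If u were the only possible child, the linear growth of the covering would fail. *)
Lemma other_child t' : recurrent t' -> exists2 v, Cov t' v & v <> u.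
Proof.
move=> rt; apply: contrapT => no.
have [a [b [a0 [n0 _ hn]]]] := cov_linear (su_Cov su rt).
pose n := (n0 + (Num.Def.truncn (1 / a)).+1)%N.
have /andP[h _] := hn n (leq_addr _ _).
have sub : (Cov t' `&` cball s n 1%g) `<=` [set u].
  by move=> v [vc _]; apply: contrapT => vu; apply: no; exists v.
have h1 : (size (finmap.enum_fset (fset_set (Cov t' `&` cball s n 1%g))) <= 1)%N.
  rewrite -(finmap.cardfs1 u) -fset_set1; apply: finmap.fsubset_leq_card.
  by rewrite -fset_set_sub//; exact: sub_finite_set sub (finite_set1 u).
have h2 : (1 / a < n%:R)%R.
  by apply: (lt_le_trans (truncnS_gt _)); rewrite ler_nat leq_addl.
rewrite ltr_pdivrMr// in h2.
have h3 : ((size (finmap.enum_fset (fset_set (Cov t' `&` cball s n 1%g))))%:R <= 1 :> R)%R by rewrite (ler_nat R _ 1).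
by move: h h2 h3; rewrite mulrC; lra.
Qed.

Lemma cone_prob_full n w : (cone_prob n w)%:E = Lam 1%g (entered n `&` [set x | ec n x = w]).
Proof.
rewrite (cone_probE su) setIC; apply/esym; apply: (measureI_full _ (mE n w)).
  exact: (measurable_entered su).
exact: (entered_full su tr).
Qed.

Lemma cone_prob_child n w v : cov_level n w -> Cov (T w) v ->
  (cone_prob n.+1 (w * v)%g <= cone_prob n w)%R.
Proof.
move=> lw wv; rewrite -lee_fin cone_prob_full (cone_probE su); apply: le_measure; rewrite ?inE.
- by apply: measurableI; [exact: (measurable_entered su)|exact: mE].
- exact: mE.
move=> x [ex exw]; have [_ E] := entered_at su ex; rewrite exw in E.
have [m0 _ E0] := enter_Ent su (Ent_child su (level_recurrent su lw) wv E).
by have [] := at_last su lw E0.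
Qed.

Lemma cone_prob_sibling_type t' : recurrent t' -> exists2 c : R, (0 < c)%R &
  forall n w, cov_level n w -> T w = t' -> Cov t' u -> T (w * u)%g = t ->
  (cone_prob n.+1 (w * u)%g + c * green_value (w * u * pv r)%g <= cone_prob n w)%R.
Proof.
move=> rt; have [v vc vu] := other_child rt; have [w0 tw0] := recurrent_rep hA rt.
have rv w : T w = t' -> recurrent (T (w * v)%g).
  by move=> tw; rewrite -tw in rt vc; have [] := cov_mem su rt vc.
have [u1 u1c u1t] := cov_type su (rv _ tw0) (trap_rec tr).
have tv w : T w = t' -> T (w * v)%g = T (w0 * v)%g.
  move=> tw; have rt' := rt; have vc' := vc; rewrite -tw0 in rt' vc'.
  have [/I3C h _ _] := cov_mem su rt' vc'.
  by apply: (type_tr hA _ h); rewrite tw0 tw.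
pose l := (len (u * pv r)%g + (len (v * u1 * u)%g + size r))%N.
exists (eps ^+ l * sg)%R; first by rewrite mulr_gt0 ?exprn_gt0//; exact: (sg_gt0 su tr).
move=> n w lw tw uc tu; pose w1 := (w * v)%g; pose w2 := (w1 * u1)%g; pose w3 := (w2 * u)%g.
have rw : recurrent (T w) by rewrite tw.
have vcw : Cov (T w) v by rewrite tw.
have ucw : Cov (T w) u by rewrite tw.
have rw1 : recurrent (T w1) by exact: rv.
have u1w : Cov (T w1) u1 by rewrite /w1 tv.
have tw2 : T w2 = t by apply: u1t; rewrite tv.
have rw2 : recurrent (T w2) by rewrite tw2; exact: trap_rec tr.
have uw2 : Cov (T w2) u by rewrite tw2; exact: trap_cov tr.
have tw3 : T w3 = t by exact: trap_type tr _ tw2.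
have C1 : C w w1 by have [h _ _] := cov_mem su rw vcw; exact: (I3C h).
have C2 : C w1 w2 by have [h _ _] := cov_mem su rw1 u1w; exact: (I3C h).
have C3 : C w2 w3 by have [h _ _] := cov_mem su rw2 uw2; exact: (I3C h).
have Cu : C w (w * u)%g by have [h _ _] := cov_mem su rw ucw; exact: (I3C h).
pose x0 := (w * u * pv r)%g.
have pr : is_path (T (w * u)%g) r by rewrite tu; exact: trap_path tr.
have Cx : C w x0 by apply: (cone_trans Cu); exact: (cone_extend hA pr).
have Cw3 : C w w3 by apply: (cone_trans C1); apply: (cone_trans C2).
have lw3 : (len w < len w3)%N.
  by have := cov_len su rw vcw; have := cone_len hA C2; have := cone_len hA C3; rewrite -/w1; lia.
have h := trapped_low tw3 lw3 (cone_len hA Cx) _.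
have {h} := h (etrans (cone_preE hA Cx) (esym (cone_preE hA Cw3))).
have e1 : (len x0 - len w = len (u * pv r)%g)%N.
  by rewrite (len_cone hW hA Cx) /x0 -mulgA dist_mul addKn.
have e2 : (len w3 + size r - len w = len (v * u1 * u)%g + size r)%N.
  by rewrite (len_cone hW hA Cw3) /w3 /w2 /w1 -!mulgA dist_mul -addnA addKn.
rewrite e1 e2 -/l => h.
rewrite -lee_fin EFinD; apply: (le_trans (leeD (lexx _) h)).
rewrite cone_prob_full (cone_probE su).
have mA : measurable (entered n.+1 `&` [set x | ec n.+1 x = (w * u)%g] : set PS).
  by apply: measurableI; [exact: (measurable_entered su)|exact: mE].
have entw x m : Ent w3 m x -> ec n.+1 x = w1 /\ ec n x = w.
  move=> E; have [m0 _ E0] := enter_Ent su (Ent_child su rw2 uw2 E).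
  have [m1 _ E1] := enter_Ent su (Ent_child su rw1 u1w E0).
  have [m2 _ E2] := enter_Ent su (Ent_child su rw vcw E1).
  by have [_ ->] := at_last su (level_child lw vcw) E1; have [_ ->] := at_last su lw E2.
have dis : (entered n.+1 `&` [set x | ec n.+1 x = (w * u)%g] : set PS) `&`
    [set x : PS | exists m, Ent w3 m x] = set0.
  apply/seteqP; split=> // x [[_ h1] [m /entw[h2 _]]]; apply: vu.
  by have := h1; rewrite /= h2 => /mulgI.
have mU := measureU (Lam 1%g) mA (mX w3) dis.
rewrite -mU; apply: le_measure; rewrite ?inE; [exact: measurableU|exact: mE|].
move=> x [[ex exw]|[m /entw[]]//]; have [_ E] := entered_at su ex; rewrite exw in E.
have [m0 _ E0] := enter_Ent su (Ent_child su rw ucw E).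
by have [] := at_last su lw E0.
Qed.

Lemma cone_prob_sibling : exists2 c : R, (0 < c)%R & forall n w, cov_level n w ->
  Cov (T w) u -> T (w * u)%g = t ->
  (cone_prob n.+1 (w * u)%g + c * green_value (w * u * pv r)%g <= cone_prob n w)%R.
Proof.
have h t' : exists c : R, (0 < c)%R /\ forall n w, cov_level n w -> T w = t' ->
    Cov t' u -> T (w * u)%g = t ->
    (cone_prob n.+1 (w * u)%g + c * green_value (w * u * pv r)%g <= cone_prob n w)%R.
  have [rt|nr] := pselect (recurrent t').
    by have [c c0 hc] := cone_prob_sibling_type rt; exists c.
  by exists 1%R; split=> // n w lw tw; case: nr; rewrite -tw; exact: (level_recurrent su lw).
have [f hf] := boolp.choice h.
(* A positive constant below every [f t'], available because there are finitely many types. *)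
pose c := (\sum_t' (f t')^-1)^-1%R.
have f0 t' : (0 < f t')%R by have [] := hf t'.
have s0 t' : ((f t')^-1 <= \sum_t' (f t')^-1)%R.
  by rewrite (bigD1 t')//= lerDl sumr_ge0// => i _; rewrite invr_ge0 ltW.
have s1 : (0 < \sum_t' (f t')^-1)%R by apply: lt_le_trans (s0 t); rewrite invr_gt0.
exists c; first by rewrite invr_gt0.
move=> n w lw uw tu; have [_ h'] := hf (T w); apply: le_trans (h' n w lw erefl uw tu).
rewrite lerD2l ler_wpM2r ?(ltW (green_value_gt0 hW hw hA (su_K su) _))//.
by rewrite -[f _]invrK lef_pV2 ?posrE ?invr_gt0.
Qed.

End Siblings.

(** * Entry probabilities compared with the Green function *)

Section Sandwich.
Variables (R : realType) (N : nat) (k : 'I_N -> nat) (W : groupType).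
Variables (s : 'I_N -> W) (pb : W -> W -> R) (mass : W -> R).
Local Notation PS := (path_space (1%g : W)).
Variables (Lam : W -> {measure set PS -> \bar R}) (L0 : nat) (eps Q : R).
Variables (A : labelled_graph N) (K : nat) (div : nat -> R) (L1 : R).
Variables (Cov : vertex A -> set W).
Hypothesis su : setup k s pb mass Lam L0 eps Q K div L1 Cov.
Let hW := su_W su.
Let hw := su_w su.
Let hA := su_A su.
Let cW := countable_W hW.
Local Notation C := (cone s A).
Local Notation T := (cone_type s A).
Local Notation pv := (path_value s (A := A)).

Variables (t : vertex A) (u : W) (r : seq (edge A)).
Hypothesis tr : trap s Lam L1 Cov t u r.
Local Notation le k x := (last_entry s L1 Cov K x k).
Local Notation ec k x := (entry_cone s L1 Cov K x k).
Local Notation pw k x := (procW s L1 Cov K x k).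
Local Notation entered := (entered s K L1 Cov).
Local Notation good := (good s K L1 Cov).
Local Notation cov_level := (cov_level s Cov K).
Local Notation ST := (vertex A * W * W)%type.
Local Notation st0 := ((t, u, pv r) : ST).
Local Open Scope ereal_scope.
Let eps0 : (0 < eps)%R. Proof. by case/andP: (iw_eps hw). Qed.

Local Notation cone_prob := (cone_prob s Lam K L1 Cov).
Local Notation exit_prob := (exit_prob s Lam K L1 Cov t u r).
Local Notation green_value := (green_value pb).
Let mE n w : measurable ([set x | ec n x = w] : set PS). Proof. exact: (measurable_ec su). Qed.

Local Notation green_len := (green_len pb).
Let gr0 w : (0 < green_value w)%R. Proof. exact: (green_value_gt0 hW hw hA (su_K su)). Qed.

Lemma esum_cone_prob n : \esum_(w in [set: W]) (cone_prob n w)%:E = 1.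
Proof.
rewrite -[RHS](iw_LamT hw 1%g) (measure_partition cW (Lam 1%g) (f := fun x => ec n x) (mE n) measurableT).
by apply: eq_esum => w _; rewrite (cone_probE su) setTI.
Qed.

(** Given an exceptional cone, the trap state has conditional probability below b^n. Summing over
    cones, the exceptional event has probability at most b^n, and Borel-Cantelli applies. *)
Lemma exit_prob_large (b : R) : (0 < b < 1)%R -> {ae Lam 1%g, forall x, exists n0, forall n,
  (n0 <= n)%N -> pw n.+1 x = st0 ->
  (b ^+ n * cone_prob n.+1 (ec n.+1 x) <= exit_prob n.+1 (ec n.+1 x))%R}.
Proof.
move=> /andP[b0 b1].
pose V n : set W := [set w | (exit_prob n.+1 w < b ^+ n * cone_prob n.+1 w)%R].
pose F n : set PS := [set x | pw n.+1 x = st0] `&` [set x | V n (ec n.+1 x)].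
have mF n : measurable (F n).
  apply: measurableI; first exact: (measurable_pw su n [set st0]).
  exact: (measurable_hist2 su (fun _ v _ _ _ _ => V n v) n.+1 n.+1).
have LF n : Lam 1%g (F n) <= (b ^+ n)%:E.
  rewrite (measure_partition cW (Lam 1%g) (f := fun x => ec n.+1 x) (mE n.+1) (mF n)).
  rewrite -[leRHS]mule1 -(esum_cone_prob n.+1) -esumZl ?exprn_ge0 ?(ltW b0)//; last by move=> w; exact: cone_prob_ge0.
  apply: le_esum => w _; have [Vw|nV] := pselect (V n w); last first.
    have h0 : 0 <= (b ^+ n)%:E * (cone_prob n.+1 w)%:E.
      by rewrite mule_ge0// lee_fin ?exprn_ge0 ?(ltW b0)//; exact: cone_prob_ge0.
    rewrite (_ : _ `&` _ = set0) ?measure0//.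
    by rewrite -subset0 => x [[_ Vx] /= ex]; apply: nV; rewrite -ex.
  apply: (@le_trans _ _ (exit_prob n.+1 w)%:E); last by rewrite lee_fin; exact: ltW.
  rewrite (exit_probE su); apply: le_measure; rewrite ?inE.
  - by apply: measurableI => //; exact: mE.
  - exact: (measurable_exit su).
  - by move=> x [[h _] e].
have sF : \sum_(0 <= n <oo) Lam 1%g (F n) < +oo.
  apply: (le_summable (b := fun n => (b ^+ n)%:E)) => //.
  by apply: geometric_summable; rewrite (ltW b0).
apply: ae_mono (ae_eventually_not mF sF) => x [n0 hx]; exists n0 => n /hx nF px.
by rewrite leNgt; apply/negP => h; apply: nF.
Qed.

Lemma cone_prob_pos_ae : {ae Lam 1%g, forall x, forall n, (0 < cone_prob n (ec n x))%R}.
Proof.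
apply: ae_foralln => n.
have h w : {ae Lam 1%g, forall x, ec n x = w -> (0 < cone_prob n w)%R}.
  have [a0|a0] := ltP 0%R (cone_prob n w); first by apply: aeW => x _.
  have z : Lam 1%g [set x | ec n x = w] = 0.
    by rewrite -(cone_probE su); congr (_%:E); apply/le_anti; rewrite a0 cone_prob_ge0.
  exists [set x | ec n x = w]; split; [exact: mE|exact: z|].
  by move=> x; apply: contra_notP => /= nx ex; case: nx.
by apply: ae_mono (ae_forall cW h) => x hx; exact: hx erefl.
Qed.

Lemma st0_entered n x : entered n.+1 x -> pw n.+1 x = st0 ->
  [/\ cov_level n (ec n x), cov_level n.+1 (ec n.+1 x) /\ T (ec n.+1 x) = t,
      x (le n.+1 x) = (ec n.+1 x * pv r)%g,
      Cov (T (ec n x)) u & ec n.+1 x = (ec n x * u)%g].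
Proof.
move=> ex; have [ex' cv _] := entered_nest su ex; have [l1 _] := entered_at su ex.
have [l0 _] := entered_at su ex'; rewrite /procW /= => -[tt uu xx].
by rewrite -uu in cv *; split=> //; rewrite -?xx mulgA mulgV mul1g.
Qed.

Lemma sandwich : exists c : R, forall n x, entered n.+1 x -> pw n.+1 x = st0 ->
  (- ln (cone_prob n.+1 (ec n.+1 x)) <= green_len (x (le n.+1 x)) + c)%R /\
  forall b : R, (0 < b)%R -> (b ^+ n * cone_prob n.+1 (ec n.+1 x) <= exit_prob n.+1 (ec n.+1 x))%R ->
  (green_len (x (le n.+1 x)) + n%:R * ln b - c <= - ln (cone_prob n.+1 (ec n.+1 x)))%R.
Proof.
have [c0 c00 hc] := cone_prob_low su tr; have g1 := gr0 1%g.
exists (`|ln c0| + `|ln (green_value 1%g)|)%R => n x ex px.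
have [l0 [l1 tw] xw uc _] := st0_entered ex px; rewrite xw.
set w := ec n.+1 x in l1 tw *; have h := hc _ _ l1 tw; have g0 := gr0 (w * pv r)%g.
have a0 : (0 < cone_prob n.+1 w)%R by apply: lt_le_trans h; rewrite mulr_gt0.
have n1 := ler_norm (- ln c0)%R; have n2 := ler_norm (- ln (green_value 1%g))%R.
have n3 := ler_norm (ln (green_value 1%g)); have n4 := normr_ge0 (ln c0).
rewrite !normrN in n1 n2; rewrite /green_len ln_div ?posrE//; split.
  have : (ln (c0 * green_value (w * pv r)%g) <= ln (cone_prob n.+1 w))%R by rewrite ler_ln ?posrE ?mulr_gt0.
  by rewrite lnM ?posrE//; lra.
move=> b b0 hb; have h2 := le_trans hb (exit_prob_le_green su t u r n w).
have : (ln (b ^+ n * cone_prob n.+1 w) <= ln (green_value (w * pv r)%g))%R.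
  by rewrite ler_ln ?posrE ?mulr_gt0 ?exprn_gt0.
by rewrite lnM ?posrE ?exprn_gt0// lnXn// -mulr_natl; lra.
Qed.

(** If the trap state has positive probability at the new cone w, a path realising it shows that w
    is the child by u of the preceding cone, so the sibling estimate applies and [exit_prob] is
    bounded by the Green function. Otherwise monotonicity suffices. *)
Lemma cone_prob_decrease : exists2 c : R, (0 < c)%R & forall n x, entered n.+1 x ->
  (cone_prob n.+1 (ec n.+1 x) + c * exit_prob n.+1 (ec n.+1 x) <= cone_prob n (ec n x))%R.
Proof.
have [c c0 hc] := cone_prob_sibling su tr; exists c => // n x ex.
have [ex' cv _] := entered_nest su ex; have [l1 E1] := entered_at su ex.
have [l0 E0] := entered_at su ex'; set w := ec n.+1 x in l1 cv E1 *.
have we : w = (ec n x * ((ec n x)^-1 * w))%g by rewrite mulgA mulgV mul1g.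
have low : (cone_prob n.+1 w <= cone_prob n (ec n x))%R by rewrite [in leLHS]we; exact: (cone_prob_child su tr).
have [d0|d0] := leP (exit_prob n.+1 w) 0%R.
  by apply: le_trans low; rewrite gerDl pmulr_rle0.
have [y [[ey yw] py]] : exists y : PS, (entered n.+1 y /\ ec n.+1 y = w) /\ pw n.+1 y = st0.
  apply: contrapT => no; have z : Lam 1%g ([set x | ec n.+1 x = w /\ pw n.+1 x = st0] `&`
      [set x | entered n.+1 x]) = Lam 1%g [set x | ec n.+1 x = w /\ pw n.+1 x = st0].
    apply: measureI_full; [exact: (measurable_entered su)|exact: (measurable_exit su)|].
    exact: (entered_full su tr).
  rewrite (_ : _ `&` _ = set0) ?measure0 in z.
    by rewrite -(exit_probE su) in z; move: d0; rewrite -lte_fin -z ltxx.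
  by rewrite -subset0 => y [[yw py] ey]; apply: no; exists y.
have [k0 [k1 tw] _ uc wu] := st0_entered ey py; rewrite yw in tw wu k1.
have rw0 := level_recurrent su k0.
have Cw : C (ec n y) w by rewrite wu; have [h _ _] := cov_mem su rw0 uc; exact: (I3C h).
have Cx : C (ec n x) w.
  by rewrite we; have [h _ _] := cov_mem su (level_recurrent su l0) cv; exact: (I3C h).
have xy := level_disjoint su l0 k0 Cx Cw; rewrite xy wu.
rewrite wu in tw; apply: le_trans (hc n _ k0 uc tw); rewrite lerD2l ler_wpM2l ?(ltW c0)//.
exact: (exit_prob_le_green su t u r).
Qed.

Definition exit_ratio n w : R := (exit_prob n.+1 w / cone_prob n.+1 w)%R.

Lemma exit_ratio_ge0 n w : (0 <= exit_ratio n w)%R.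
Proof. by rewrite divr_ge0//; [exact: exit_prob_ge0|exact: cone_prob_ge0]. Qed.

Lemma exit_ratio_le1 n w : (exit_ratio n w <= 1)%R.
Proof.
have [a0|a0] := ltP 0%R (cone_prob n.+1 w); first by rewrite ler_pdivrMr// mul1r; exact: (exit_prob_le_cone_prob su).
have -> : exit_ratio n w = 0%R; last exact: ler01.
rewrite /exit_ratio (_ : cone_prob n.+1 w = 0%R) ?invr0 ?mulr0//.
by apply/le_anti; rewrite a0 cone_prob_ge0.
Qed.

(** Each level multiplies the probability by at most 1 / (1 + c q), with q the exit ratio, and ln (1
    + c q) >= c q / (1 + c q) >= c q / (1 + c). *)
Lemma entropy_low : exists2 c : R, (0 < c)%R & forall x, good x ->
  (forall n, 0 < cone_prob n (ec n x))%R -> forall n,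
  (c * \sum_(0 <= i < n) exit_ratio i (ec i.+1 x) <= - ln (cone_prob n (ec n x)))%R.
Proof.
have [c c0 hc] := cone_prob_decrease; exists (c / (1 + c))%R; first by rewrite divr_gt0// addr_gt0.
move=> x gx ax; elim=> [|n IH].
  by rewrite big_geq// mulr0 oppr_ge0 ln_le0//; exact: (cone_prob_le1 su).
rewrite big_nat_recr//= mulrDr.
set q := exit_ratio n _; have q0 : (0 <= q)%R by exact: exit_ratio_ge0.
have q1 : (q <= 1)%R by exact: exit_ratio_le1.
have y0 : (0 < 1 + c * q)%R by rewrite ltr_pwDl// mulr_ge0// (ltW c0).
have h : (cone_prob n.+1 (ec n.+1 x) * (1 + c * q) <= cone_prob n (ec n x))%R.
  apply: le_trans (hc n x (gx n.+1)); rewrite mulrDr mulr1 lerD2l mulrCA.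
  have e : (cone_prob n.+1 (ec n.+1 x) * q = exit_prob n.+1 (ec n.+1 x))%R.
    by rewrite /q /exit_ratio mulrCA divff ?mulr1// gt_eqF.
  by rewrite e.
have h1 : (ln (cone_prob n.+1 (ec n.+1 x)) + ln (1 + c * q) <= ln (cone_prob n (ec n x)))%R.
  by rewrite -lnM ?posrE// ler_ln ?posrE ?mulr_gt0.
have h2 : (c / (1 + c) * q <= ln (1 + c * q))%R.
  have e : (1 + - (c * q / (1 + c * q)) = (1 + c * q)^-1)%R by field; rewrite gt_eqF.
  have h3 : (-1 < - (c * q / (1 + c * q)))%R.
    by rewrite ltrN2 ltr_pdivrMr// mul1r ltrDr.
  have := le_ln1Dx h3; rewrite e lnV ?posrE// lerN2; apply: le_trans.
  have cq : (0 <= c * q)%R by rewrite mulr_ge0// (ltW c0).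
  rewrite [leLHS]mulrAC; apply: ler_wpM2l => //.
  have c1 : (0 < 1 + c)%R by rewrite addr_gt0.
  rewrite lef_pV2 ?posrE// lerD2l -[leRHS]mulr1.
  by apply: ler_wpM2l => //; exact: ltW.
lra.
Qed.

End Sandwich.

(** * Sampling along a sparse subsequence *)

Section SparseSampling.
Variables (R : realType) (g : nat -> R) (l : nat -> nat) (S : nat -> bool).
Variables (h mu f D : R).
Hypotheses (mu0 : 0 < mu) (f0 : 0 < f) (D0 : 0 <= D).
Hypothesis g_lip : forall m m', `|g m - g m'| <= D * `|m%:R - m'%:R|.
Hypothesis l_lln : forall e, 0 < e -> exists b : R, forall n, `|(l n)%:R - n%:R * mu| <= e * n%:R + b.
Hypothesis S_freq : forall e, 0 < e -> exists b : R, forall n,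
  `|\sum_(0 <= i < n) (S i)%:R - n%:R * f| <= e * n%:R + b.
Hypothesis g_at : forall e, 0 < e -> exists b : R, forall n, S n ->
  `|g (l n.+1) - n.+1%:R * h| <= e * n.+1%:R + b.

Lemma sublinear_cvg (a : nat -> R) (c : R) :
  (forall e, 0 < e -> exists b : R, forall m, `|a m - m%:R * c| <= e * m%:R + b) ->
  a n / n%:R @[n --> \oo] --> c.
Proof.
move=> H; apply/cvgrPdist_le => e e0.
have [b hb] := H (e / 2) (divr_gt0 e0 (ltr0n _ 2)).
pose n0 := (Num.Def.truncn (`|b| * 2 / e)).+1.
exists n0 => // n /= nn; have n0' : (0 : R) < n%:R.
  by apply: (lt_le_trans _ (_ : n0%:R <= n%:R)); rewrite ?ltr0n ?ler_nat.
have bn : `|b| * 2 / e < n%:R.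
  by apply: (lt_le_trans (truncnS_gt _)); rewrite ler_nat.
rewrite ltr_pdivrMr// in bn.
have -> : c - a n / n%:R = - ((a n - n%:R * c) / n%:R) by field; rewrite gt_eqF.
rewrite normrN normrM normfV (gtr0_norm n0') ler_pdivrMr//.
by apply: (le_trans (hb n)); have := ler_norm b; lra.
Qed.

(** Without an index of S between k and x the counts up to k and up to x would agree, although S has
    density f up to an error e. This forces x - k to be of order e k / f plus a constant. *)
Lemma sample_near e : 0 < e -> e <= f / 4 -> exists2 c : R, 0 <= c & forall k : nat,
  exists q, [/\ S q, (k <= q)%N & q%:R <= k%:R + 4 * e / f * k%:R + c].
Proof.
move=> e0 ef; have [b hb] := S_freq e0.
pose c := 4 * (`|b| + 1) / f.
have c0 : 0 <= c by rewrite divr_ge0 ?(ltW f0)// mulr_ge0// addr_ge0.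
exists c => // k; set x := k%:R + 4 * e / f * k%:R + c.
have ef0 : 0 <= 4 * e / f by rewrite divr_ge0 ?(ltW f0)// mulr_ge0 ?(ltW e0).
have x0 : 0 <= x by rewrite !addr_ge0// mulr_ge0.
pose n := (Num.Def.truncn x).+1.
have xn : x < n%:R by exact: truncnS_gt.
suff [q [kq qn Sq]] : exists q, [/\ (k <= q)%N, (q < n)%N & S q].
  exists q; split=> //; apply: (@le_trans _ _ (Num.Def.truncn x)%:R).
    by rewrite ler_nat -ltnS.
  by rewrite truncn_le.
apply: contrapT => no.
have kn : (k <= n)%N.
  rewrite -(ler_nat R); apply: le_trans (ltW xn).
  by rewrite /x -addrA lerDl addr_ge0// mulr_ge0.
have cnt : \sum_(0 <= i < n) (S i)%:R = \sum_(0 <= i < k) (S i)%:R :> R.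
  rewrite (big_cat_nat (leq0n k) kn)//= [X in _ + X](_ : _ = 0) ?addr0//.
  rewrite big_nat_cond big1// => i.
  rewrite andbT => /andP[ki i_n]; case E : (S i) => //; case: no.
  by exists i.
have h1 := hb n; have h2 := hb k; rewrite cnt in h1.
have b1 := ler_norm b.
have h3 : n%:R * (f - e) <= k%:R * (f + e) + 2 * `|b|.
  by move: h1 h2; rewrite !ler_distl => /andP[a1 a2] /andP[a3 a4]; lra.
have fe : 0 < f - e by lra.
have h4 : x * (f - e) < n%:R * (f - e) by rewrite ltr_pM2r.
have k0 : (0 : R) <= k%:R by [].
have i1 : 4 * e / f * (f - e) = 4 * e - (e / f) * (4 * e) by field; rewrite gt_eqF.
have i2 : e / f <= 4^-1 by rewrite ler_pdivrMr//; lra.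
have i3 : (e / f) * (4 * e) <= 4^-1 * (4 * e) by rewrite ler_wpM2r// mulr_ge0 ?(ltW e0).
have i4 : k%:R * (f + e) <= (k%:R + 4 * e / f * k%:R) * (f - e).
  have -> : (k%:R + 4 * e / f * k%:R) * (f - e) = k%:R * (f - e + 4 * e / f * (f - e)) by ring.
  by rewrite ler_wpM2l// i1; lra.
have i5 : 2 * (`|b| + 1) <= c * (f - e).
  have -> : 2 * (`|b| + 1) = c * (f / 2) by rewrite /c; field; rewrite gt_eqF.
  by rewrite ler_wpM2l//; lra.
have i6 : x * (f - e) = (k%:R + 4 * e / f * k%:R) * (f - e) + c * (f - e) by rewrite mulrDl.
lra.
Qed.

(** For given m, take k near m / mu and the next index q of S. Then l (q+1) differs from m by a
    small multiple of m plus a constant; g is controlled there, and the Lipschitz bound covers the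
    rest. *)
Lemma sparse_limit : g m / m%:R @[m --> \oo] --> h / mu.
Proof.
apply: sublinear_cvg => d d0.
pose F := 4 / (f * mu); have F0 : 0 < F by rewrite divr_gt0 ?mulr_gt0.
(* [M] collects the coefficients of e m in the four error terms, see the identity [t4]. *)
pose M := (D + 1) * (mu^-1 + F) + (D * mu + `|h|) * F.
have M0 : 0 <= M.
  have m0 : 0 <= mu^-1 by rewrite invr_ge0 ltW.
  have F1 := ltW F0; have m1 := ltW mu0.
  by apply: addr_ge0; apply: mulr_ge0 => //; apply: addr_ge0 => //; apply: mulr_ge0.
pose e := Num.min (Num.min 1 (f / 4)) (d / (M + 1)).
have M1 : 0 < M + 1 by lra.
have e0 : 0 < e by rewrite !lt_min ltr01 !divr_gt0.
have e1 : e <= 1 by rewrite /e !ge_min lexx.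
have e2 : e <= f / 4 by rewrite /e !ge_min lexx orbT.
have e3 : e * M <= d.
  have : e <= d / (M + 1) by rewrite /e ge_min lexx orbT.
  by rewrite ler_pdivlMr//; move: e0; lra.
have [b1 h1] := l_lln e0; have [b3 h3] := g_at e0; have [c c0 hc] := sample_near e0 e2.
exists (D * (e * (c + 2) + b1 + mu * (c + 2)) + (e * (c + 2) + b3) + `|h| * (c + 2)) => m.
set y := m%:R / mu; have y0 : 0 <= y by rewrite divr_ge0 ?(ltW mu0).
pose k := Num.Def.truncn y; have ky : k%:R <= y by rewrite truncn_le.
have yk : y < k%:R + 1 by rewrite natr1; exact: truncnS_gt.
have [q [Sq kq qk]] := hc k; set x : R := q.+1%:R.
have kq' : (k%:R : R) <= q%:R by rewrite ler_nat.
have Fm : 4 * e / f * y = e * F * m%:R by rewrite /y /F; field; rewrite !gt_eqF.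
have xy : `|x - y| <= e * F * m%:R + (c + 2).
  have i1 : 4 * e / f * k%:R <= 4 * e / f * y.
    by rewrite ler_wpM2l// divr_ge0 ?(ltW f0)// mulr_ge0 ?(ltW e0).
  have i2 : 0 <= e * F * m%:R by rewrite mulr_ge0//; exact: mulr_ge0 (ltW e0) (ltW F0).
  by rewrite /x -natr1 ler_distl; apply/andP; split; lra.
have x1 : x <= y + (e * F * m%:R + (c + 2)).
  by move: xy; rewrite ler_distl => /andP[_]; lra.
have eF : e * F * m%:R <= F * m%:R.
  by rewrite ler_wpM2r// -[leRHS]mul1r ler_wpM2r// ltW.
have yE : y = mu^-1 * m%:R by rewrite mulrC.
have ex : e * x <= e * ((mu^-1 + F) * m%:R) + e * (c + 2).
  rewrite -mulrDr ler_wpM2l ?(ltW e0)//; rewrite mulrDl -yE; lra.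
have lx : `|m%:R - (l q.+1)%:R| <= e * x + b1 + mu * (e * F * m%:R + (c + 2)).
  have j1 := h1 q.+1; rewrite -/x in j1.
  have j2 : `|x * mu - m%:R| <= mu * (e * F * m%:R + (c + 2)).
    have -> : x * mu - m%:R = mu * (x - y) by rewrite /y; field; rewrite gt_eqF.
    by rewrite normrM (gtr0_norm mu0) ler_wpM2l ?(ltW mu0).
  rewrite distrC; apply: le_trans (ler_distD (x * mu) _ _) _; lra.
have gx : `|g m - g (l q.+1)| <= D * (e * x + b1 + mu * (e * F * m%:R + (c + 2))).
  by apply: le_trans (g_lip _ _) _; rewrite ler_wpM2l.
have hx : `|x * h - m%:R * (h / mu)| <= `|h| * (e * F * m%:R + (c + 2)).
  have -> : x * h - m%:R * (h / mu) = h * (x - y) by rewrite /y; field; rewrite gt_eqF.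
  by rewrite normrM ler_wpM2l.
have g3 := h3 q Sq; rewrite -/x in g3.
apply: le_trans (ler_distD (g (l q.+1)) _ _) _.
have t1 : `|g (l q.+1) - m%:R * (h / mu)| <= e * x + b3 + `|h| * (e * F * m%:R + (c + 2)).
  by apply: le_trans (ler_distD (x * h) _ _) _; lra.
apply: le_trans (lerD gx t1) _.
have t2 : D * (e * x) <= D * (e * ((mu^-1 + F) * m%:R) + e * (c + 2)) by rewrite ler_wpM2l.
have t3 : e * M * m%:R <= d * m%:R by rewrite ler_wpM2r.
have t4 : e * M * m%:R = D * (e * ((mu^-1 + F) * m%:R)) + e * ((mu^-1 + F) * m%:R) +
  D * (mu * (e * F * m%:R)) + `|h| * (e * F * m%:R) by rewrite /M; ring.
rewrite !mulrDr in t2 *; rewrite !mulrDr in ex; lra.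
Qed.

End SparseSampling.

(** * Bounds on the entropy *)

Lemma ae_all_eps (R : realType) d (X : measurableType d) (mu : {measure set X -> \bar R})
    (Q : R -> X -> Prop) : (forall e e' x, e <= e' -> Q e x -> Q e' x) ->
  (forall e, 0 < e -> {ae mu, forall x, Q e x}) ->
  {ae mu, forall x, forall e, 0 < e -> Q e x}.
Proof.
move=> Qm Qe.
have h : {ae mu, forall x, forall i : nat, Q i.+1%:R^-1 x}.
  by apply: ae_foralln => i; apply: Qe; rewrite invr_gt0 ltr0n.
apply: ae_mono h => x hx e e0; apply: Qm (hx (Num.Def.truncn e^-1)).
by rewrite -[leRHS]invrK lef_pV2 ?posrE ?invr_gt0// ltW// truncnS_gt.
Qed.

Lemma eventual_bound (R : realType) (a : nat -> R) (e b0 : R) (S : nat -> Prop) n0 : 0 <= e ->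
  (forall n, (n0 <= n)%N -> S n -> a n <= e * n%:R + b0) ->
  exists b, forall n, S n -> a n <= e * n%:R + b.
Proof.
move=> e0 h; exists (`|b0| + \sum_(0 <= i < n0) `|a i|) => n Sn.
have s0 : 0 <= \sum_(0 <= i < n0) `|a i| by exact: sumr_ge0.
have [nn|nn] := leqP n0 n; first by have := h n nn Sn; have := ler_norm b0; lra.
have : a n <= \sum_(0 <= i < n0) `|a i|.
  rewrite (big_cat_nat (leq0n n) (ltnW nn))/= [X in _ + X]big_ltn//.
  have s1 : 0 <= \sum_(0 <= i < n) `|a i| by exact: sumr_ge0.
  have s2 : 0 <= \sum_(n.+1 <= i < n0) `|a i| by exact: sumr_ge0.
  by have := ler_norm (a n); lra.
have := normr_ge0 b0; have : 0 <= e * n%:R by rewrite mulr_ge0.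
lra.
Qed.

Lemma esum_eqE (R : realType) (T : choiceType) (z0 : T) (f : T -> \bar R) :
  (forall z, 0 <= f z)%E ->
  (\esum_(z in [set: T]) (((z == z0)%:R : R)%:E * f z) = f z0)%E.
Proof.
move=> f0; rewrite (esumID [set z0]); last by move=> z _; rewrite mule_ge0// lee_fin.
have -> : (\esum_(z in [set: T] `&` [set z0]) (((z == z0)%:R : R)%:E * f z) = f z0)%E.
  by rewrite setTI esum_set1 ?eqxx ?mul1e.
by rewrite esum1 ?adde0// => z [_ /eqP/negPf->]; rewrite mul0e.
Qed.

Lemma ae_nonempty (R : realType) d (Omega : measurableType d)
    (P : probability Omega R) (A : Omega -> Prop) :
  {ae P, forall a, A a} -> exists a, A a.
Proof.
move=> hA; apply: contrapT => no.
have [S [mS S0 nS]] := hA; have : (P setT <= 0)%E.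
  by rewrite -S0; apply: le_measure; rewrite ?inE// => a _; apply: nS => Aa; apply: no; exists a.
by rewrite probability_setT lee_fin ler10.
Qed.

Lemma ae_mean_limit (R : realType) d (Omega : measurableType d)
    (P : probability Omega R) (F : nat -> Omega -> R) (c : R) :
  (forall n, measurable_fun setT (fun a => (F n a)%:E)) -> (forall n a, 0 <= F n a <= 1) ->
  {ae P, forall a, F n a @[n --> \oo] --> c} ->
  ((\int[P]_(a in setT) (F n a)%:E) @[n --> \oo] --> c%:E)%E.
Proof.
move=> mF F01 Fc.
have mc : measurable_fun [set: Omega] (fun=> c%:E) by exact: measurable_cst.
have ig : P.-integrable [set: Omega] (EFin \o cst (1 : R)) by exact: finite_measure_integrable_cst.
have ac : {ae P, forall a, [set: Omega] a -> (F n a)%:E @[n --> \oo] --> (fun=> c%:E) a}.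
  by apply: ae_mono Fc => a Fa _; apply: cvg_EFin => //; exact: nearW.
have ab : {ae P, forall a n, [set: Omega] a -> (`|(F n a)%:E| <= (EFin \o cst (1%R : R)) a)%E}.
  by apply: aeW => a n _; have /andP[f0 f1] := F01 n a; rewrite /= lee_fin ger0_norm.
have [_ _ h] := dominated_convergence measurableT mF mc ac ig ab.
by rewrite (integral_cst P measurableT c%:E)/= probability_setT mule1 in h.
Qed.

(** * The entropy is finite and positive, and it gives the growth of the Green length *)

Section EntropyBounds.
Variables (R : realType) (N : nat) (k : 'I_N -> nat) (W : groupType).
Variables (s : 'I_N -> W) (pb : W -> W -> R) (mass : W -> R).
Local Notation PS := (path_space (1%g : W)).
Variables (Lam : W -> {measure set PS -> \bar R}) (L0 : nat) (eps Q : R).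
Variables (A : labelled_graph N) (K : nat) (div : nat -> R) (L1 : R).
Variables (Cov : vertex A -> set W).
Hypothesis su : setup k s pb mass Lam L0 eps Q K div L1 Cov.
Let hW := su_W su.
Let hw := su_w su.
Let hA := su_A su.
Let cW := countable_W hW.
Local Notation dist := (dist s).
Local Notation pv := (path_value s (A := A)).

Variables (t : vertex A) (u : W) (r : seq (edge A)).
Hypothesis tr : trap s Lam L1 Cov t u r.
Local Notation le k x := (last_entry s L1 Cov K x k).
Local Notation ec k x := (entry_cone s L1 Cov K x k).
Local Notation pw k x := (procW s L1 Cov K x k).
Local Notation ST := (vertex A * W * W)%type.
Local Notation st0 := ((t, u, pv r) : ST).
Local Open Scope ereal_scope.
Let eps0 : (0 < eps)%R. Proof. by case/andP: (iw_eps hw). Qed.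

Local Notation cone_prob := (cone_prob s Lam K L1 Cov).
Local Notation exit_prob := (exit_prob s Lam K L1 Cov t u r).
Local Notation green_value := (green_value pb).

Local Notation green_len := (green_len pb).

Local Notation exit_ratio := (exit_ratio s Lam K L1 Cov t u r).
Variables (nu : ST -> R).
Hypothesis nu0 : forall a, (0 <= nu a)%R.
Hypothesis nuA : forall a, ~ attained s Lam K L1 Cov a -> nu a = 0%R.
Hypothesis nu1 : \esum_(a in [set: ST]) (nu a)%:E = 1.
Hypothesis nu_inv : forall a', \esum_(a in [set: ST]) \esum_(d in [set: nat])
  (nu a * renewal_kernel s Lam L1 Cov a (a', d))%:E = (nu a')%:E.
Variable mu : R.
Hypothesis mean_mu : mean_gap s Lam L1 Cov nu = mu%:E.

Lemma freq_ae : {ae Lam 1%g, forall x, forall e, (0 < e)%R -> exists b : R, forall n : nat,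
  (`|\sum_(0 <= i < n) (pw i.+1 x == st0)%:R - n%:R * nu st0| <= e * n%:R + b)%R}.
Proof.
apply: ae_all_eps => [e e' x ee [b hb]|e e0].
  by exists b => n; apply: (le_trans (hb n)); rewrite lerD2r ler_wpM2r.
pose c := Num.max 0%R (nu st0 - e)%R; have n0 := nu_pos su tr nu0 nuA nu1 nu_inv.
have c0 : (0 <= c)%R by rewrite le_max lexx.
have cn : (c < nu st0)%R by rewrite gt_max n0 ltrBlDr ltrDl.
apply: ae_mono (ae_conj (freq_lower su tr nu0 nuA nu1 nu_inv c0 cn)
  (freq_upper su tr nu0 nuA nu1 nu_inv e0)) => x [[b hb] [b' hb']].
exists (b%:R + b'%:R)%R => n; rewrite ler_distl.
have h1 := hb n; have h2 := hb' n.
have h3 : (n%:R * (nu st0 - e) <= n%:R * c)%R by rewrite ler_wpM2l// le_max lexx orbT.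
have b0 : (0 <= b%:R :> R)%R by []; have b0' : (0 <= b'%:R :> R)%R by [].
by apply/andP; split; lra.
Qed.

Lemma gap_ae : {ae Lam 1%g, forall x, forall e, (0 < e)%R -> exists b : R, forall n : nat,
  (`|(le n x)%:R - n%:R * mu| <= e * n%:R + b)%R}.
Proof.
apply: ae_all_eps => [e e' x ee [b hb]|e e0].
  by exists b => n; apply: (le_trans (hb n)); rewrite lerD2r ler_wpM2r.
have mu0 : (0 < mu)%R.
  by rewrite -lte_fin -mean_mu; exact: (mean_gap_gt0 su tr nu0 nuA nu1 nu_inv).
pose c := Num.max 0%R (mu - e)%R.
have c0 : (0 <= c)%R by rewrite le_max lexx.
have cn : c%:E < mean_gap s Lam L1 Cov nu.
  by rewrite mean_mu lte_fin gt_max mu0 ltrBlDr ltrDl.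
apply: ae_mono (ae_conj (gap_lower su tr nu0 nuA nu1 nu_inv c0 cn)
  (gap_upper su tr nu0 nuA nu1 nu_inv e0 mean_mu)) => x [[b hb] [b' hb']].
exists (b%:R + b'%:R)%R => n; rewrite ler_distl.
have h1 := hb n; have h2 := hb' n.
have h3 : (n%:R * (mu - e) <= n%:R * c)%R by rewrite ler_wpM2l// le_max lexx orbT.
have b0 : (0 <= b%:R :> R)%R by []; have b0' : (0 <= b'%:R :> R)%R by [].
by apply/andP; split; lra.
Qed.

Lemma exit_prob_ae : {ae Lam 1%g, forall x, forall e, (0 < e)%R -> exists n0, forall n,
  (n0 <= n)%N -> pw n.+1 x = st0 ->
  (expR (- e) ^+ n * cone_prob n.+1 (ec n.+1 x) <= exit_prob n.+1 (ec n.+1 x))%R}.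
Proof.
apply: ae_all_eps => [e e' x ee [n0 hn]|e e0]; last first.
  by apply: (exit_prob_large su t u r); rewrite expR_gt0 expR_lt1 oppr_lt0.
exists n0 => n nn px; apply: le_trans (hn n nn px); rewrite ler_wpM2r ?cone_prob_ge0//.
by rewrite lerXn2r ?nnegrE ?expR_ge0// ler_expR lerN2.
Qed.

Lemma traj_dist x m j : (forall n, (dist (x n) (x n.+1) <= L0)%N) ->
  (dist (x m) (x (m + j)%N) <= L0 * j)%N.
Proof.
move=> st; elim: j => [|j IH]; first by rewrite addn0 distxx.
rewrite addnS mulnS; apply: (leq_trans (dist_triangle hW (x (m + j)%N) _ _)).
by have := st (m + j)%N; lia.
Qed.

Variables (d : measure_display) (Omega : measurableType d) (P : probability Omega R).
Variable Xb : Omega -> PS.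
Hypothesis mXb : forall B, measurable B -> measurable (Xb @^-1` B).
Hypothesis XbE : forall B, measurable B -> P (Xb @^-1` B) = Lam 1%g B.
Variable H : \bar R.
Local Notation ent n a := (- (n%:R^-1 * ln (cone_prob n (ec n (Xb a)))))%R.
Hypothesis hH : {ae P, forall a, (ent n a)%:E @[n --> \oo] --> H}.

Lemma ae_pull (B : PS -> Prop) : {ae Lam 1%g, forall x, B x} -> {ae P, forall a, B (Xb a)}.
Proof.
move=> [S [mS S0 nS]]; exists (Xb @^-1` S); split; first exact: mXb.
  by rewrite XbE.
by move=> a /= nB; apply: nS.
Qed.

Let x0ae : {ae Lam 1%g, forall x : PS, x 0%N = 1%g}.
Proof.
have m0 := measurableC (mW hW 0 [set 1%g]).
apply: ae_mono (ae_measure0 m0 _) => [x /contrapT//|].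
by rewrite (LamC hw) ?(Lam_start hw) ?subee//; exact: (mW hW 0 [set 1%g]).
Qed.

Lemma entropy_ge0 : 0 <= H.
Proof.
have [a ha] := ae_nonempty hH; rewrite -(cvg_lim _ ha)//.
apply: lime_ge; first by apply/cvg_ex; exists H.
apply: nearW => n; rewrite lee_fin oppr_ge0 mulr_ge0_le0 ?invr_ge0//.
by rewrite ln_le0//; exact: (cone_prob_le1 su).
Qed.

(** At visits to the trap state, minus the logarithm of the cone probability is at most the Green
    length plus a constant, hence linear in the entry time, and entry times are linear in the index
    because the mean gap is finite. *)
Lemma entropy_lt : H < +oo.
Proof.
rewrite ltey; apply/eqP => inf; have hH' := hH; rewrite inf in hH'.
have hx := ae_conj (ae_conj (ae_conj (good_ae su tr 1%g) (bounded_steps hW hw 1%g))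
  (ae_conj x0ae (states_io su tr))) (gap_upper su tr nu0 nuA nu1 nu_inv ltr01 mean_mu).
have [a [ha [[[gx st] [x0 io]] [b hb]]]] := ae_nonempty (ae_conj hH' (ae_pull hx)).
set x := Xb a in ha gx st x0 io hb.
have [c hc] := sandwich su tr.
move/cvgeryP/cvgryPge : ha => ha.
pose D := `|ln eps|%R.
pose B := (D * (L0%:R * (mu + 1 + b%:R)) + `|green_len 1%g| + `|c|)%R.
have [n0 _ hn] := ha (B + 1)%R.
have [j nj pj] := io n0; have := hn j.+1 (leqW nj); apply/negP; rewrite -ltNge.
have [h _] := hc j x (gx j.+1) pj.
set L := le j.+1 x in h.
have D0 : (0 <= D)%R by exact: normr_ge0.
have h1 : (green_len (x L) <= green_len 1%g + D * (L0%:R * L%:R))%R.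
  apply: (le_trans (green_len_lip hW hw hA (su_K su) 1%g (x L))); rewrite lerD2l -mulNr.
  apply: (@le_trans _ _ (D * (dist 1%g (x L))%:R)%R).
    by rewrite ler_wpM2r// /D -normrN ler_norm.
  rewrite ler_wpM2l// dist1 -natrM ler_nat.
  by have := len_traj hW (isT : (0 < 1)%N) st L; rewrite x0 len1.
have mu00 : (0 <= mu)%R by rewrite -lee_fin -mean_mu; exact: (mean_gap_ge0 s Lam L1 Cov nu0).
have n1 : (1 <= j.+1%:R :> R)%R by rewrite ler1n.
have h2 : (L%:R <= j.+1%:R * (mu + 1 + b%:R))%R.
  apply: (le_trans (hb j.+1)); rewrite [leRHS]mulrDr lerD2l.
  by rewrite -[leLHS]mul1r ler_wpM2r.
have h3 : (D * (L0%:R * L%:R) <= D * (L0%:R * (j.+1%:R * (mu + 1 + b%:R))))%R.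
  by do 2 rewrite ler_wpM2l//.
have h4 : (`|green_len 1%g| <= j.+1%:R * `|green_len 1%g|)%R by rewrite -[leLHS]mul1r ler_wpM2r.
have h5 : (`|c| <= j.+1%:R * `|c|)%R by rewrite -[leLHS]mul1r ler_wpM2r.
have g1 := ler_norm (green_len 1%g); have c1 := ler_norm c.
apply: (@le_lt_trans _ _ B); last by rewrite ltrDl.
rewrite -mulrN ler_pdivrMl ?ltr0n// /B.
move: h h1 h3; set G := (- ln _)%R; rewrite !mulrDr => h h1 h3; lra.
Qed.

Let qF n (a : Omega) : R := (n%:R^-1 * \sum_(0 <= i < n) exit_ratio i (ec i.+1 (Xb a)))%R.
Let pF n (a : Omega) : R := (n%:R^-1 * \sum_(0 <= i < n) (pw i.+1 (Xb a) == st0)%:R)%R.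

Let mq i : measurable_fun setT (fun a => (exit_ratio i (ec i.+1 (Xb a)))%:E).
Proof.
apply: (measurable_countable_comp cW (f := fun a => ec i.+1 (Xb a)) _
  (fun w => (exit_ratio i w)%:E)) => // w; apply: (mXb (B := [set x | ec i.+1 x = w])).
exact: (measurable_ec su).
Qed.

Let mp i : measurable_fun setT (fun a => ((pw i.+1 (Xb a) == st0)%:R : R)%:E).
Proof.
apply: (measurable_countable_comp (countable_ST su) (f := fun a => pw i.+1 (Xb a)) _
  (fun z => ((z == st0)%:R : R)%:E)) => // z; apply: (mXb (B := [set x | pw i.+1 x = z])).
exact: (measurable_pw su i [set z]).
Qed.

(** The exit ratio is the conditional expectation of the indicator of the trap state given the entry
    cone. *)
Let int_qp i : \int[P]_(a in setT) (exit_ratio i (ec i.+1 (Xb a)))%:E =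
  \int[P]_(a in setT) ((pw i.+1 (Xb a) == st0)%:R : R)%:E.
Proof.
rewrite (integral_countable cW (f := fun a => ec i.+1 (Xb a)) _ P
  (G := fun w => (exit_ratio i w)%:E))//; last 2 first.
- by move=> w; apply: (mXb (B := [set x | ec i.+1 x = w])); exact: (measurable_ec su).
- by move=> w; rewrite lee_fin exit_ratio_ge0.
rewrite (integral_countable (countable_ST su) (f := fun a => pw i.+1 (Xb a)) _ P
  (G := fun z => ((z == st0)%:R : R)%:E))//; last first.
  by move=> z; apply: (mXb (B := [set x | pw i.+1 x = z])); exact: (measurable_pw su i [set z]).
rewrite [RHS](esum_eqE st0 (f := fun z => P ([set: Omega] `&` (fun a => pw i.+1 (Xb a)) @^-1` [set z])))//.
rewrite setTI.
have mp0 : measurable ([set x | pw i.+1 x = st0] : set PS) by exact: (measurable_pw su i [set st0]).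
have -> : P ((fun a => pw i.+1 (Xb a)) @^-1` [set st0]) = Lam 1%g [set x | pw i.+1 x = st0].
  exact: (XbE mp0).
rewrite (measure_partition cW (Lam 1%g) (f := fun x => ec i.+1 x) (fun w => measurable_ec su i.+1 w) mp0).
apply: eq_esum => w _; transitivity ((exit_ratio i w)%:E * (cone_prob i.+1 w)%:E).
  congr (_ * _); rewrite setTI (cone_probE su); exact: (XbE (measurable_ec su i.+1 w)).
have -> : Lam 1%g ([set x | pw i.+1 x = st0] `&` (fun x => ec i.+1 x) @^-1` [set w]) = (exit_prob i.+1 w)%:E.
  by rewrite (exit_probE su) setIC.
rewrite -EFinM /Submission.exit_ratio; congr (_%:E); have [a0|a0] := eqVneq (cone_prob i.+1 w) 0%R; last by rewrite divfK.
rewrite a0 mulr0; apply/esym/le_anti; rewrite exit_prob_ge0 andbT.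
by rewrite -a0; exact: (exit_prob_le_cone_prob su).
Qed.

Let qF01 n a : (0 <= qF n a <= 1)%R.
Proof.
rewrite /qF mulr_ge0 ?invr_ge0 ?sumr_ge0//=; last by move=> i _; exact: exit_ratio_ge0.
case: n => [|n]; first by rewrite big_geq// mulr0 ler01.
rewrite ler_pdivrMl ?ltr0n// mulr1.
apply: (@le_trans _ _ (\sum_(0 <= i < n.+1) 1)%R); last by rewrite sumr_const_nat subn0.
by apply: ler_sum => i _; exact: (exit_ratio_le1 su).
Qed.

Let pF01 n a : (0 <= pF n a <= 1)%R.
Proof.
rewrite /pF mulr_ge0 ?invr_ge0 ?sumr_ge0//=.
case: n => [|n]; first by rewrite big_geq// mulr0 ler01.
rewrite ler_pdivrMl ?ltr0n// mulr1.
apply: (@le_trans _ _ (\sum_(0 <= i < n.+1) 1)%R); last by rewrite sumr_const_nat subn0.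
by apply: ler_sum => i _; rewrite lern1; case: eqP.
Qed.

Let mean_int (f : nat -> Omega -> R) n : (forall i, measurable_fun setT (fun a => (f i a)%:E)) ->
  (forall i a, 0 <= f i a)%R ->
  measurable_fun setT (fun a => (n%:R^-1 * \sum_(0 <= i < n) f i a)%:E) /\
  \int[P]_(a in setT) (n%:R^-1 * \sum_(0 <= i < n) f i a)%:E =
  (n%:R^-1)%:E * \sum_(0 <= i < n) \int[P]_(a in setT) (f i a)%:E.
Proof.
move=> mf f0.
have E a : (n%:R^-1 * \sum_(0 <= i < n) f i a)%:E = (n%:R^-1)%:E * \sum_(0 <= i < n) (f i a)%:E.
  by rewrite EFinM sumEFin.
have mS : measurable_fun setT (fun a => \sum_(0 <= i < n) (f i a)%:E).
  by apply: emeasurable_sum.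
split; first by rewrite (_ : (fun _ => _) = (fun a => (n%:R^-1)%:E * \sum_(0 <= i < n) (f i a)%:E));
  [exact: measurable_funeM|apply/funext => a; exact: E].
under eq_integral do rewrite E.
rewrite ge0_integralZl//; last by move=> a _; apply: sume_ge0 => i _; rewrite lee_fin.
by congr (_ * _); rewrite ge0_integral_sum// => i a _; rewrite lee_fin.
Qed.

Let int_means n : \int[P]_(a in setT) (qF n a)%:E = \int[P]_(a in setT) (pF n a)%:E.
Proof.
have [_ ->] := mean_int n mq (fun i a => exit_ratio_ge0 s Lam K L1 Cov t u r i (ec i.+1 (Xb a))).
have [_ ->] := mean_int n mp (fun i a => ler0n R _).
by congr (_ * _); apply: eq_bigr => i _; exact: int_qp.
Qed.

Let pF_cvg : {ae P, forall a, pF n a @[n --> \oo] --> nu st0}.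
Proof.
apply: ae_mono (ae_pull freq_ae) => a ha.
by under eq_fun do rewrite /pF mulrC; apply: sublinear_cvg.
Qed.

(** If H were 0, [entropy_low] would force the averages of the exit ratios to tend to 0 almost
    surely, and in mean since they are bounded. But they have the same means as the visit
    frequencies of the trap state, which tend to a positive limit. *)
Lemma entropy_gt0 : 0 < H.
Proof.
rewrite lt0e entropy_ge0 andbT; apply/eqP => H0.
have hH' := hH; rewrite H0 in hH'.
have [c c0 hc] := entropy_low su tr.
have qF_cvg : {ae P, forall a, qF n a @[n --> \oo] --> (0%R : R)}.
  have hx := ae_pull (ae_conj (good_ae su tr 1%g) (cone_prob_pos_ae su)).
  apply: ae_mono (ae_conj hH' hx) => a [ha [gx ax]].
  have e1 : ent n a @[n --> \oo] --> (0%R : R) by have /fine_cvgP[_] := ha.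
  have e2 : (c^-1 * ent n a)%R @[n --> \oo] --> (0%R : R).
    by rewrite -(mulr0 (c^-1)%R); apply: cvgM => //; exact: cvg_cst.
  apply: squeeze_cvgr (cvg_cst 0%R) e2; apply: nearW => n.
  have /andP[-> _] /= := qF01 n a.
  rewrite -mulrN ler_pdivlMl// mulrCA ler_wpM2l ?invr_ge0//.
  exact: hc.
have q1 := ae_mean_limit (fun n => (mean_int n mq (fun i a => exit_ratio_ge0 s Lam K L1 Cov t u r i (ec i.+1 (Xb a)))).1)
  qF01 qF_cvg.
have p1 := ae_mean_limit (fun n => (mean_int n mp (fun i a => ler0n R _)).1) pF01 pF_cvg.
have e : 0%:E = (nu st0)%:E :> \bar R.
  have p2 : \int[P]_(a in setT) (pF n a)%:E @[n --> \oo] --> 0%:E.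
    by under eq_fun do rewrite -int_means; exact: q1.
  by rewrite -(cvg_lim _ p2)// (cvg_lim _ p1).
have := nu_pos su tr nu0 nuA nu1 nu_inv; have <- := EFin_inj e.
by rewrite ltxx.
Qed.

Lemma green_limit h : H = h%:E ->
  {ae P, forall a, (green_len (Xb a n) / n%:R)%R @[n --> \oo] --> (h / mu)%R}.
Proof.
move=> Hh; have mu0 : (0 < mu)%R.
  by rewrite -lte_fin -mean_mu; exact: (mean_gap_gt0 su tr nu0 nuA nu1 nu_inv).
have [c hc] := sandwich su tr.
have hx := ae_conj (ae_conj (ae_conj (good_ae su tr 1%g) (bounded_steps hW hw 1%g))
  (ae_conj gap_ae freq_ae)) exit_prob_ae.
have hH' := hH; rewrite Hh in hH'.
apply: ae_mono (ae_conj hH' (ae_pull hx)) => a [ha [[[gx st] [gap freq]] dwx]].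
set x := Xb a in ha gx st gap freq dwx *.
apply: (sparse_limit (g := fun m => green_len (x m)) (l := fun n => le n x)
  (S := fun n => pw n.+1 x == st0) (f := nu st0) (D := (`|ln eps| * L0%:R)%R)) => //.
- exact: (nu_pos su tr nu0 nuA nu1 nu_inv).
- have one m j : (`|green_len (x m) - green_len (x (m + j)%N)| <= `|ln eps| * L0%:R * j%:R)%R.
    have l1 := green_len_lip hW hw hA (su_K su) (x m) (x (m + j)%N).
    have l2 := green_len_lip hW hw hA (su_K su) (x (m + j)%N) (x m); rewrite (distC hW) in l2.
    have l3 : (- ln eps * (dist (x m) (x (m + j)%N))%:R <= `|ln eps| * L0%:R * j%:R)%R.
      apply: (@le_trans _ _ (`|ln eps| * (dist (x m) (x (m + j)%N))%:R)%R).
        by rewrite ler_wpM2r// -normrN ler_norm.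
      by rewrite -mulrA ler_wpM2l// -natrM ler_nat traj_dist.
    by rewrite ler_distl; apply/andP; split; lra.
  have two m m' : (m <= m')%N ->
      (`|green_len (x m) - green_len (x m')| <= `|ln eps| * L0%:R * `|m%:R - m'%:R|)%R.
    move=> mm; rewrite [X in (_ <= _ * X)%R]distrC.
    by rewrite [X in (_ <= _ * X)%R]ger0_norm ?subr_ge0 ?ler_nat// -natrB//; have := one m (m' - m)%N; rewrite subnKC.
  move=> m m'; have [mm|mm] := leqP m m'; first exact: two.
  by rewrite distrC [X in (_ <= _ * X)%R]distrC; exact/two/ltnW.
(* Half of e pays for the factor between exit and cone probabilities, the other half for the
   convergence of the entropy. *)
- move=> e e0; have e20 : (0 < e / 2)%R by rewrite divr_gt0.
  have [n0 hn0] := dwx _ e20.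
  have /fine_cvgP[_ /cvgrPdist_le /(_ _ e20) [n1 _ hn1]] := ha.
  have [b hb] : exists b, forall n, pw n.+1 x = st0 ->
      (`|green_len (x (le n.+1 x)) - n.+1%:R * h| <= e * n%:R + b)%R.
    apply: (eventual_bound (b0 := (`|c| + e)%R) (n0 := (n0 + n1)%N)); first exact: ltW.
    move=> n nn px; have [s1 s2] := hc n x (gx n.+1) px.
    have {}s2 := s2 _ (expR_gt0 _) (hn0 n (leq_trans (leq_addr _ _) nn) px).
    rewrite expRK in s2.
    have v := hn1 n.+1 (leq_trans (leq_addl _ _) (leqW nn)).
    set y := ln _ in s1 s2 v.
    have {}v : (`|n.+1%:R * h + y| <= e / 2 * n.+1%:R)%R.
      have -> : (n.+1%:R * h + y = n.+1%:R * (h - - (n.+1%:R^-1 * y)))%R.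
        by rewrite opprK mulrDr mulVKf.
      by rewrite normrM gtr0_norm ?ltr0n// mulrC ler_wpM2r.
    rewrite ler_distl; move: v; rewrite ler_norml => /andP[v1 v2].
    by have := ler_norm c; rewrite -[(n.+1%:R)%R]natr1 in v1 v2 *; move=> cc; apply/andP; split; lra.
  exists b => n /eqP px; apply: (le_trans (hb n px)).
  by rewrite lerD2r ler_wpM2l ?(ltW e0)// ler_nat.
Qed.

End EntropyBounds.

(** * Identification with the quantities of the statement *)

Section Transfer.
Variables (R : realType) (N : nat) (k : 'I_N -> nat) (W : groupType).
Variables (s : 'I_N -> W) (pb : W -> W -> R) (mass : W -> R).
Local Notation PS := (path_space (1%g : W)).
Variables (Lam : W -> {measure set PS -> \bar R}) (L0 : nat) (eps Q : R).
Variables (A : labelled_graph N) (K : nat) (div : nat -> R) (L1 : R).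
Variables (Cov : vertex A -> set W).
Hypothesis su : setup k s pb mass Lam L0 eps Q K div L1 Cov.
Let hW := su_W su.
Let hw := su_w su.
Let hA := su_A su.
Let cW := countable_W hW.
Local Notation C := (cone s A).
Local Notation T := (cone_type s A).

Variables (t : vertex A) (u : W) (r : seq (edge A)).
Hypothesis tr : trap s Lam L1 Cov t u r.
Local Notation le k x := (last_entry s L1 Cov K x k).
Local Notation ec k x := (entry_cone s L1 Cov K x k).
Local Notation pw k x := (procW s L1 Cov K x k).
Local Notation entered := (entered s K L1 Cov).
Local Notation ST := (vertex A * W * W)%type.
Local Open Scope ereal_scope.
Let eps0 : (0 < eps)%R. Proof. by case/andP: (iw_eps hw). Qed.

Local Notation cone_prob := (cone_prob s Lam K L1 Cov).
Local Notation green_value := (green_value pb).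

Section CylinderProbability.

(** A cone of level n has a single ancestor in each lower level, because cones of one level are
    disjoint. *)
Lemma entry_eq n x y : entered n x -> entered n y -> ec n x = ec n y ->
  forall i, (i <= n)%N -> ec i x = ec i y.
Proof.
move=> ex ey exy i /subnK; move: (n - i)%N => j; elim: j i n ex ey exy => [|j IH] i n ex ey exy.
  by rewrite add0n => ->.
case: n ex ey exy => [|n] ex ey exy; first by move=> e; exfalso; lia.
rewrite addSn => -[e]; have [ex' cx _] := entered_nest su ex; have [ey' cy _] := entered_nest su ey.
apply: (IH i n ex' ey' _ e).
have [lx _] := entered_at su ex'; have [ly _] := entered_at su ey'.
have h w v : recurrent (T w) -> Cov (T w) (w^-1 * v)%g -> C w v.
  by move=> rw wv; have [i3 _ _] := cov_mem su rw wv; rewrite mulgA mulgV mul1g in i3; exact: (I3C i3).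
apply: (level_disjoint su lx ly (h _ _ (level_recurrent su lx) cx)).
by rewrite exy; exact: h (level_recurrent su ly) cy.
Qed.

Local Notation py i x := (procY s L1 Cov K x i).

Lemma measurable_procY i v : measurable ([set x | py i x = v] : set PS).
Proof.
case: i => [|i].
  exact: (measurable_hist2 su (fun _ w _ _ _ _ => inl w = v :> (W + vertex A * vertex A * W)%type) 0 0).
exact: (measurable_hist2 su (fun _ w _ _ w' _ =>
  inr (T w', T w, (w'^-1 * w)%g) = v :> (W + vertex A * vertex A * W)%type) i.+1 i).
Qed.

Lemma measurable_cylY n (v : nat -> W + vertex A * vertex A * W) :
  measurable ([set x | forall i, (i <= n)%N -> py i x = v i] : set PS).
Proof.
apply: measurable_forall; first exact: countableP.
move=> i; have [ni|ni] := boolP (i <= n)%N.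
  rewrite (_ : (fun _ => _) = [set x | py i x = v i]); first exact: measurable_procY.
  by apply/seteqP; split=> x; [apply|move=> /= ? _].
by rewrite (_ : (fun _ => _) = setT); [|apply/seteqP; split].
Qed.

(** The values of Y up to n amount to the entry cones of levels 0 to n, and these are determined by
    the last of them. *)
Lemma cylY_prob n x : entered n x ->
  Lam 1%g [set y | forall i, (i <= n)%N -> py i y = py i x] = (cone_prob n (ec n x))%:E.
Proof.
move=> ex; rewrite (cone_probE su).
have mC := measurable_cylY n (fun i => py i x).
have mS := measurable_entered su n.
have full := entered_full su tr n.
have h1 : Lam 1%g ([set y | forall i, (i <= n)%N -> py i y = py i x] `&` [set y | entered n y]) =
    Lam 1%g [set y | forall i, (i <= n)%N -> py i y = py i x].
  exact: (measureI_full mS mC full).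
have h2 : Lam 1%g ([set y | ec n y = ec n x] `&` [set y | entered n y]) =
    Lam 1%g [set y | ec n y = ec n x].
  exact: (measureI_full mS (measurable_ec su n (ec n x)) full).
rewrite -h1 -h2; congr (Lam 1%g _); apply/seteqP; split=> y [h ey]; split=> //.
  move: h => /= h; have {}h : forall i, (i <= n)%N -> ec i y = ec i x.
    elim=> [|i IH] ni; first by have /= := h 0%N ni; case.
    have := h i.+1 ni; rewrite /= => -[_ _ e]; have e' := IH (ltnW ni).
    by apply: (mulgI (ec i y)^-1%g); rewrite e e'.
  exact: h.
move=> i ni; have E := entry_eq ey ex h.
by case: i ni => [|i] ni /=; rewrite ?E// ltnW.
Qed.

End CylinderProbability.

Section Law.
Variables (d : measure_display) (Omega : measurableType d) (P : probability Omega R).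
Variable Xb : Omega -> PS.
Hypothesis mXb : forall B, measurable B -> measurable (Xb @^-1` B).
Hypothesis XbE : forall B, measurable B -> P (Xb @^-1` B) = Lam 1%g B.
Local Notation ZT := (vertex A * W * W * nat)%type.
Local Notation renewal_pair := (renewal_pair s K L1 Cov).
Local Notation renewal_kernel := (renewal_kernel s Lam L1 Cov).
Let bW n a := pw n (Xb a).
Let e n a := le n (Xb a).

Lemma step_prob n (a : ST) (z : ZT) :
  Lam 1%g [set x | pw n.+1 x = a /\ renewal_pair n.+1 x = z] = Lam 1%g [set x | pw n.+1 x = a] * (renewal_kernel a z)%:E.
Proof.
have hP : hist_ext s K L1 Cov n.+1 (fun x => pw n.+1 x = a).
  move=> x y xy <-; have [_ e1 x1] := xy n.+1 (leqnn _); have [_ e2 _] := xy n (leqnSn _).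
  by rewrite /procW /= e1 e2 x1.
have Pa x : entered n.+1 x -> pw n.+1 x = a ->
    T (ec n.+1 x) = a.1.1 /\ ((ec n.+1 x)^-1 * x (le n.+1 x))%g = a.2.
  by move=> _ <-.
have h := markov_step su 1%g z hP Pa.
have m1 := measurable_pw su n [set a].
have m2 : measurable ([set x | pw n.+1 x = a /\ renewal_pair n.+1 x = z] : set PS).
  by apply: measurableI => //; exact: (measurable_Z su n.+1 [set z]).
have h1 : Lam 1%g ([set x | pw n.+1 x = a] `&` [set x | entered n.+1 x]) =
    Lam 1%g [set x | pw n.+1 x = a].
  exact: (measureI_full (measurable_entered su n.+1) m1 (entered_full su tr n.+1)).
have h2 : Lam 1%g ([set x | pw n.+1 x = a /\ renewal_pair n.+1 x = z] `&` [set x | entered n.+2 x]) =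
    Lam 1%g [set x | pw n.+1 x = a /\ renewal_pair n.+1 x = z].
  exact: (measureI_full (measurable_entered su n.+2) m2 (entered_full su tr n.+2)).
rewrite -h1 -h2.
rewrite (_ : _ `&` [set x | entered n.+2 x] = [set x | [/\ entered n.+1 x, pw n.+1 x = a,
  entered n.+2 x & renewal_pair n.+1 x = z]]); last first.
  apply/seteqP; split=> x; last by move=> [].
  by move=> [[h3 h4] h5]; split=> //; have [] := entered_nest su h5.
rewrite setIC; exact: h.
Qed.

Lemma bW_prob n a : P (bW n.+1 @^-1` [set a]) = Lam 1%g [set x | pw n.+1 x = a].
Proof. exact: (XbE (measurable_pw su n [set a])). Qed.

Lemma attainable_attained a : attainable P bW a <-> attained s Lam K L1 Cov a.
Proof.
split; first by move=> [[//|n] _]; rewrite bW_prob; exists n.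
by move=> [n]; rewrite -bW_prob; exists n.+1.
Qed.

Lemma some_timeP a : attained s Lam K L1 Cov a -> exists n, some_time P bW a = n.+1 /\
  0 < Lam 1%g [set x | pw n.+1 x = a].
Proof.
move=> /attainable_attained[k' k1 kp].
have [] := @xgetPex _ 1%N [set k | (1 <= k)%N /\ 0 < P (bW k @^-1` [set a])]
  (ex_intro _ k' (conj k1 kp)).
rewrite -/(some_time P bW a); case: (some_time P bW a) => // n _.
by rewrite bW_prob; exists n.
Qed.

Let divK (m : \bar R) (S : \bar R) : 0 < m -> m \is a fin_num -> m * S / m = S.
Proof.
move=> m0 mf; rewrite -(fineK mf) in m0 *; set c := fine m in m0 *.
rewrite lte_fin in m0; rewrite inver gt_eqF// muleAC -EFinM divff ?mul1e//.
by rewrite gt_eqF.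
Qed.

Let mpos n a : Lam 1%g [set x | pw n.+1 x = a] \is a fin_num.
Proof. by rewrite (Lam_fin hw)//; exact: (measurable_pw su n [set a]). Qed.

Lemma transition_renewal_kernel a a' : attained s Lam K L1 Cov a ->
  transition P bW a a' = \esum_(j in [set: nat]) (renewal_kernel a (a', j))%:E.
Proof.
move=> /some_timeP[n [en n0]]; rewrite /transition en bW_prob.
have m2 : measurable ([set x | pw n.+1 x = a /\ pw n.+2 x = a'] : set PS).
  apply: measurableI; first exact: (measurable_pw su n [set a]).
  exact: (measurable_pw su n.+1 [set a']).
have -> : P (bW n.+1 @^-1` [set a] `&` bW n.+2 @^-1` [set a']) =
    Lam 1%g [set x | pw n.+1 x = a /\ pw n.+2 x = a'] by exact: (XbE m2).
rewrite (measure_partition (countableP _) (Lam 1%g) (f := fun x => (renewal_pair n.+1 x).2)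
  (fun j => measurable_Z su n.+1 (fun z => z.2 = j)) m2).
rewrite -[RHS](divK _ n0 (mpos n a)); congr (_ / _).
rewrite -(fineK (mpos n a)) -esumZl; last 2 first.
- exact: fine_ge0.
- by move=> j; rewrite lee_fin renewal_kernel_ge0.
rewrite (fineK (mpos n a)); apply: eq_esum => j _; rewrite -step_prob.
congr (Lam 1%g _); apply/seteqP; split=> x.
  move=> [[h0 h1] h2]; split; first exact: h0.
  by rewrite [LHS]surjective_pairing; congr pair; [exact: h1|exact: h2].
by move=> [h0 h]; split; [split; [exact: h0|exact: (congr1 fst h)]|exact: (congr1 snd h)].
Qed.

Variables (nu : ST -> R).
Hypothesis st_nu : stationary_distribution P bW nu.

Lemma stat_nu0 a : (0 <= nu a)%R. Proof. exact: stat_ge0 st_nu a. Qed.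

Lemma stat_nuA a : ~ attained s Lam K L1 Cov a -> nu a = 0%R.
Proof. by move=> na; apply: (stat_support st_nu) => /attainable_attained. Qed.

Lemma esum_attainable (F : ST -> \bar R) : (forall a, nu a = 0%R -> F a = 0) ->
  \esum_(a in attainable P bW) F a = \esum_(a in [set: ST]) F a.
Proof.
move=> F0; rewrite esum_mkcond; apply: eq_esum => a _; case: ifPn => // /negP na.
by rewrite F0//; apply: (stat_support st_nu); move=> h; apply: na; rewrite inE.
Qed.

Lemma stat_nu1 : \esum_(a in [set: ST]) (nu a)%:E = 1.
Proof. by rewrite -(stat_mass st_nu) esum_attainable// => a ->. Qed.

(** The invariance in [stationary_distribution] concerns attainable states. For the others both
    sides vanish, since an attained state leads only to attained states. *)
Lemma stat_nu_inv a' : \esum_(a in [set: ST]) \esum_(j in [set: nat])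
  (nu a * renewal_kernel a (a', j))%:E = (nu a')%:E.
Proof.
have k0 a j : 0 <= (nu a * renewal_kernel a (a', j))%:E by rewrite lee_fin mulr_ge0 ?stat_nu0 ?renewal_kernel_ge0.
have [at'|nat'] := pselect (attained s Lam K L1 Cov a'); last first.
  rewrite (stat_nuA nat'); apply: esum1 => a _; apply: esum1 => j _.
  have [at_|na] := pselect (attained s Lam K L1 Cov a); last by rewrite (stat_nuA na) mul0r.
  have [n n0] := at_; have h := step_prob n a (a', j).
  have z : Lam 1%g [set x | pw n.+1 x = a /\ renewal_pair n.+1 x = (a', j)] = 0.
    apply/le_anti/andP; split; last exact: measure_ge0.
    rewrite leNgt; apply/negP => pos; apply: nat'; exists n.+1; apply: (lt_le_trans pos).
    apply: le_measure; rewrite ?inE.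
    - apply: measurableI; first exact: (measurable_pw su n [set a]).
      exact: (measurable_Z su n.+1 [set (a', j)]).
    - exact: (measurable_pw su n.+1 [set a']).
    - by move=> x [_ /(congr1 fst)].
  rewrite z -(fineK (mpos n a)) -EFinM in h; have {h} := EFin_inj h.
  move=> /esym/eqP; rewrite mulf_eq0 => /orP[/eqP f0|/eqP ->]; last by rewrite mulr0.
  by move: n0; rewrite -(fineK (mpos n a)) f0 ltxx.
have atP := (attainable_attained a').2 at'.
rewrite (stat_invariant st_nu atP) esum_attainable; last by move=> a ->; rewrite mul0e.
apply: eq_esum => a _; have [at_|na] := pselect (attained s Lam K L1 Cov a).
  rewrite transition_renewal_kernel// -esumZl ?stat_nu0//; last by move=> j; rewrite lee_fin renewal_kernel_ge0.
rewrite (stat_nuA na) mul0e; apply: esum1 => j _; by rewrite mul0r.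
Qed.

Lemma mean_increment a : attained s Lam K L1 Cov a -> let k0 := some_time P bW a in
  (\int[P]_(b in bW k0 @^-1` [set a]) ((e k0.+1 b)%:R - (e k0 b)%:R)%:E) / P (bW k0 @^-1` [set a])
  = \esum_(z in [set: ZT]) (renewal_kernel a z * z.2%:R)%:E.
Proof.
move=> /some_timeP[n [en n0]] /=; rewrite en.
have mD : measurable (bW n.+1 @^-1` [set a]) by exact: (mXb (measurable_pw su n [set a])).
have mZ z : measurable ((fun b => renewal_pair n.+1 (Xb b)) @^-1` [set z]).
  exact: (mXb (measurable_Z su n.+1 [set z])).
have me z : measurable ((fun b => (e n.+2 b, e n.+1 b)) @^-1` [set z]).
  exact: (mXb (measurable_le2 su (fun m _ m' _ => (m, m') = z) n.+2 n.+1)).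
have mf : measurable_fun (bW n.+1 @^-1` [set a]) (fun b => ((e n.+2 b)%:R - (e n.+1 b)%:R : R)%:E).
  exact: (measurable_countable_comp (countableP _) me (fun z : nat * nat => (z.1%:R - z.2%:R : R)%:E) mD).
have mg : measurable_fun (bW n.+1 @^-1` [set a]) (fun b => ((renewal_pair n.+1 (Xb b)).2%:R : R)%:E).
  exact: (measurable_countable_comp (countable_ZT su) mZ (fun z : ZT => (z.2%:R : R)%:E) mD).
have eqi : \int[P]_(b in bW n.+1 @^-1` [set a]) ((e n.+2 b)%:R - (e n.+1 b)%:R)%:E =
    \int[P]_(b in bW n.+1 @^-1` [set a]) ((renewal_pair n.+1 (Xb b)).2%:R : R)%:E.
  (* On good paths the entry times do not decrease, so the truncated difference in the pair is the
     real difference. *)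
  apply: ae_eq_integral => //.
  apply: ae_mono (ae_pull mXb XbE (good_ae su tr 1%g)) => b gb _; congr (_%:E).
  by rewrite /Submission.renewal_pair /= natrB//; exact: (good_le_mono su gb).
rewrite eqi bW_prob (integral_countable (countable_ZT su) mZ P (G := fun z => (z.2%:R : R)%:E))//.
rewrite -[RHS](divK _ n0 (mpos n a)); congr (_ / _).
have kz z : 0 <= (renewal_kernel a z * z.2%:R)%:E by rewrite lee_fin mulr_ge0// renewal_kernel_ge0.
rewrite -(fineK (mpos n a)) -esumZl; last 2 first.
- exact: fine_ge0.
- exact: kz.
rewrite (fineK (mpos n a)); apply: eq_esum => z _.
have m2 : measurable ([set x | pw n.+1 x = a /\ renewal_pair n.+1 x = z] : set PS).
  by apply: measurableI; [exact: (measurable_pw su n [set a])|exact: (measurable_Z su n.+1 [set z])].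
transitivity ((z.2%:R : R)%:E * Lam 1%g [set x | pw n.+1 x = a /\ renewal_pair n.+1 x = z]).
  by congr (_ * _); exact: (XbE m2).
by rewrite step_prob [LHS]muleC -muleA -EFinM.
Qed.

Lemma increment_mean_gap : stationary_increment P bW nu e = mean_gap s Lam L1 Cov nu.
Proof.
rewrite /stationary_increment /mean_gap.
rewrite esum_attainable; last by move=> a ->; rewrite mul0e.
have k0 a z : 0 <= (nu a * renewal_kernel a z * z.2%:R)%:E.
  by rewrite lee_fin !mulr_ge0 ?stat_nu0 ?renewal_kernel_ge0.
transitivity (\esum_(a in [set: ST]) \esum_(z in [set: ZT]) (nu a * renewal_kernel a z * z.2%:R)%:E).
  apply: eq_esum => a _; have [at_|na] := pselect (attained s Lam K L1 Cov a).
    rewrite mean_increment// -esumZl ?stat_nu0//.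
      by apply: eq_esum => z _; rewrite -EFinM mulrA.
    by move=> z; rewrite lee_fin mulr_ge0// renewal_kernel_ge0.
  by rewrite (stat_nuA na) mul0e; apply/esym/esum1 => z _; rewrite !mul0r.
rewrite esum_exchange//; apply: eq_esum => z _.
rewrite EFinM (pair_lawE stat_nu0 stat_nu_inv) muleC -esumZl//.
  by apply: eq_esum => a _; rewrite -EFinM mulrC.
by move=> a; rewrite lee_fin mulr_ge0 ?stat_nu0 ?renewal_kernel_ge0.
Qed.

End Law.

End Transfer.

(** * Transfer to the building *)

Section BuildingSetup.
Variables (R : realType) (N : nat) (k : 'I_N -> nat) (W : groupType).
Variables (s : 'I_N -> W) (hW : fuchsian_coxeter_system k s).
Variables (Delta : choiceType) (delta : Delta -> Delta -> W) (q : 'I_N -> nat).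
Hypotheses (hD : building s delta) (hq : regular_building s delta q).
Hypothesis hthick : thick q.
Variables (o : Delta) (p : Delta -> Delta -> R) (hp : stochastic p).
Hypothesis hiso : isotropic delta p.
Variables (L0 : nat) (hL0 : walk_range s delta p L0).
Hypothesis hpS : forall x y i, delta x y = s i -> 0 < p x y.
Variables (d : measure_display) (Omega : measurableType d).
Variables (P : probability Omega R) (X : nat -> Omega -> Delta).
Hypothesis hX : markov_chain P p o X.
Local Notation pb := (retracted_kernel delta p o).
Local Notation Lam := (Lam hW hD hq hX).

Lemma retracted_isotropic_walk : exists2 eps : R, True &
  isotropic_walk s pb (mass R s q) Lam L0 eps (\sum_i (q i)%:R).
Proof.
have [eps e01 he] := eps_ex hW hD hiso o hpS; exists eps => //; split.
- exact: e01.
- exact: (pb_ge0 hW hD hq hthick hp hiso hL0 o).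
- move=> u v; exact: (pb_range hW hD hq hthick hp hiso hL0).
- exact: (pb_sum hW hD hq hthick hp hiso hL0 o).
- move=> u u'; exact: (pb_loc hW hD hq hthick hp hiso hL0 o).
- move=> u i; exact: (pb_step hW hD hq hthick hp hiso hL0 u i he).
- move=> u; exact: (pb_stay hW hD hq hthick hp hiso hL0 he).
- exact: (mass_ge1 R hW hD hq hthick o).
- exact: (mass1 R hW hD hq o).
- move=> u i lu; have m1 := mass_ge1 R hW hD hq hthick o u.
  rewrite (mass_asc R hW hD hq o lu); have m0 : 0 <= mass R s q u by exact: le_trans m1.
  rewrite !ler_wpM2r//; first by rewrite (bigD1 i)//= lerDl sumr_ge0.
  by rewrite (ler_nat R 2); exact: hthick.
- exact: (mass_invariant hW hD hq hthick hp hiso hL0 o).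
- exact: (LamT hW hD hq hX).
- exact: (Lam_cyl hW hD hq hthick hp hiso hL0 hX).
- move=> i n U; apply: (le_trans (base_change hW hD hq hthick hp hiso hL0 hX i n U)).
  apply: lee_wpmul2r; first exact: measure_ge0.
  by rewrite lee_fin (bigD1 i)//= lerDl sumr_ge0.
Qed.

Let delta_refl : delta o o = 1%g. Proof. exact/(building_eq hD). Qed.

Lemma measurable_retracted (B : set (path_space (1%g : W))) : measurable B ->
  measurable (retraction_path delta X o @^-1` B).
Proof.
move=> mB; rewrite -[X in measurable X]setTI.
exact: (measurable_retraction_path hW hD hq hX o measurableT mB).
Qed.

Lemma retracted_law (B : set (path_space (1%g : W))) : measurable B ->
  P (retraction_path delta X o @^-1` B) = Lam 1%g B.
Proof.
move=> mB; have h := walk_lawE hW hD hq hthick hp hiso hL0 hX o mB.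
rewrite delta_refl in h; rewrite -h /walk_law.
by rewrite -[X in P X = _]setTI.
Qed.

End BuildingSetup.

Theorem theorem3p14 (R : realType)
  (N : nat) (k : 'I_N -> nat) (W : groupType) (s : 'I_N -> W)
  (hW : fuchsian_coxeter_system k s) (hirr : irreducible_coxeter s)
  (Delta : choiceType) (delta : Delta -> Delta -> W) (q : 'I_N -> nat)
  (hDelta : building s delta) (hq : regular_building s delta q)
  (hthick : thick q) (o : Delta)
  (p : Delta -> Delta -> R) (hp : stochastic p) (hpirr : irreducible_kernel p)
  (hiso : isotropic delta p) (L0 : nat) (hL0 : walk_range s delta p L0)
  (hpS : forall x y i, delta x y = s i -> 0 < p x y)
  (d : measure_display) (Omega : measurableType d) (P : probability Omega R)
  (X : nat -> Omega -> Delta) (hX : markov_chain P p o X)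
  (A : labelled_graph N) (hA : strongly_automatic s A)
  (hAR : recurrent_transitive A)
  (K : nat) (hK : recurrent_outside s A K)
  (dhyp : R) (hdhyp : thin_triangles s dhyp)
  (div : nat -> R) (hdiv : divergence_function s div)
  (hdivexp : exponential_growth div)
  (Cov : vertex A -> set W) :
  let L1 : R := Num.max (div 0%N) (Num.max L0%:R dhyp) + 1 in
  (forall t, recurrent t -> covering s L1 t (Cov t)) ->
  let Xbar n a : W := delta o (X n a) in
  let e n a : nat := last_entry s L1 Cov K (Xbar^~ a) n in
  let bW n a := procW s L1 Cov K (Xbar^~ a) n in
  let bY n a := procY s L1 Cov K (Xbar^~ a) n in
  forall nu : vertex A * W * W -> R, stationary_distribution P bW nu ->
  forall H : \bar R, path_entropy P bY H ->
  exists hG : R,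
    [/\ hG%:E = (H / stationary_increment P bW nu e)%E, 0 < hG &
      {ae P, forall a,
        green_length delta p o (Xbar n a) / n%:R @[n --> \oo] --> hG}].
Proof.
move=> L1 hCov Xbar e bW bY nu hnu H hH.
have [eps _ hw] := retracted_isotropic_walk hW hDelta hq hthick hp hiso hL0 hpS hX.
have su : setup k s (retracted_kernel delta p o) (mass R s q) (Lam hW hDelta hq hX) L0 eps
    (\sum_i (q i)%:R) K div L1 Cov.
  split=> //; rewrite /L1 ?lerD2r !le_max lexx ?orbT//.
have [t [u [r tr]]] := trap_data su.
pose Xb := retraction_path delta X o.
have mXb := measurable_retracted hW hDelta hq hX.
have XbE := retracted_law hW hDelta hq hthick hp hiso hL0 hX.
have nu0 := stat_nu0 hnu.
have nuA := stat_nuA su XbE hnu.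
have nu1 := stat_nu1 hnu.
have nu_inv := stat_nu_inv su tr XbE hnu.
have inc : stationary_increment P bW nu e = mean_gap s (Lam hW hDelta hq hX) L1 Cov nu.
  exact: (increment_mean_gap su tr mXb XbE hnu).
have m0 := mean_gap_gt0 su tr nu0 nuA nu1 nu_inv.
have mlt := mean_gap_lt su tr nu0 nuA nu1 nu_inv.
have mf : mean_gap s (Lam hW hDelta hq hX) L1 Cov nu \is a fin_num.
  by rewrite ge0_fin_numE// ltW.
set mu := fine (mean_gap s (Lam hW hDelta hq hX) L1 Cov nu).
have mu_mean : mean_gap s (Lam hW hDelta hq hX) L1 Cov nu = mu%:E by rewrite fineK.
have mu0 : 0 < mu by rewrite -lte_fin -mu_mean.
(* [path_entropy] speaks of cylinders of Y; on good paths their probability is that of the last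
   entry cone. *)
have hent : {ae P, forall a, (- (n%:R^-1 *
    ln (Submission.cone_prob s (Lam hW hDelta hq hX) K L1 Cov n (entry_cone s L1 Cov K (Xb a) n))))%:E
      @[n --> \oo] --> H}.
  apply: ae_mono (ae_conj hH (ae_pull mXb XbE (good_ae su tr 1%g))) => a [ha ga].
  have E n : fine (P [set b | forall i, (i <= n)%N -> bY i b = bY i a]) =
      Submission.cone_prob s (Lam hW hDelta hq hX) K L1 Cov n (entry_cone s L1 Cov K (Xb a) n).
    have c := cylY_prob su tr (ga n).
    have -> : P [set b | forall i, (i <= n)%N -> bY i b = bY i a] =
        Lam hW hDelta hq hX 1%g [set y | forall i, (i <= n)%N ->
          procY s L1 Cov K y i = procY s L1 Cov K (Xb a) i].
      exact: (XbE _ (measurable_cylY su n (fun i => procY s L1 Cov K (Xb a) i))).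
    by rewrite c.
  by under eq_fun do rewrite -E.
have H0 := entropy_gt0 su tr nu0 nuA nu1 nu_inv mXb XbE hent.
have Hlt := entropy_lt su tr nu0 nuA nu1 nu_inv mu_mean mXb XbE hent.
have Hf : H \is a fin_num by rewrite ge0_fin_numE// ltW.
have Hh : H = (fine H)%:E by rewrite fineK.
exists (fine H / mu); split.
- by rewrite inc mu_mean Hh inver gt_eqF// EFinM.
- by rewrite divr_gt0// -lte_fin -Hh.
- exact: (green_limit su tr nu0 nuA nu1 nu_inv mu_mean mXb XbE hent Hh).
Qed.
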